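(* Let $\Omega\subset\mathbb{R}^n$ be a smooth bounded domain, $1<p<\infty$, let $a\in C^2_{\rm loc}(\mathbb{R})$ be such that $a(s)\ge\eta$ for all $s\ge 0$ and some constant $\eta>0$, and let $f:[0,\infty)\to\mathbb{R}$ be locally Lipschitz continuous. Assume that $f(s)>0$ for all $s\in(0,\infty)$ and that $\Omega$ is strictly convex with respect to the $x_1$-direction and symmetric with respect to the hyperplane $\{x_1=0\}$. Let $u\in C^{1,\alpha}(\overline\Omega)$ be a weak solution of $$-\mathrm{div}(a(u)|\nabla u|^{p-2}\nabla u)+\frac{a'(u)}{p}|\nabla u|^p=f(u)\ \text{in }\Omega,\qquad u>0\ \text{in }\Omega,\qquad u=0\ \text{on }\partial\Omega .$$ Then $u\in\mathcal{S}_{x_1}$, i.e. $u$ is symmetric with respect to $\{x_1=0\}$, non-decreasing in the $x_1$-direction for $x_1<0$ and non-increasing in the $x_1$-direction for $x_1>0$. In addition, if $\Omega$ is a ball, then $u\in\mathcal{R}$, i.e. $u$ is radially symmetric (about the center of the ball) and radially decreasing.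
   Context: A weak $C^{1,\alpha}(\overline\Omega)$ solution is a function $u\in C^{1,\alpha}(\overline\Omega)$ (for some $\alpha\in(0,1)$) with $u>0$ in $\Omega$, $u=0$ on $\partial\Omega$ and $$\int_\Omega a(u)|\nabla u|^{p-2}\nabla u\cdot\nabla\varphi\,dx+\frac1p\int_\Omega a'(u)|\nabla u|^p\varphi\,dx=\int_\Omega f(u)\varphi\,dx\qquad\forall\varphi\in C_c^\infty(\Omega).$$ $\mathcal{S}_{x_1}$ is the set of nontrivial weak $C^{1,\alpha}(\overline\Omega)$ solutions of this problem that are symmetric with respect to $\{x_1=0\}$, non-decreasing in $x_1$ for $x_1<0$ and non-increasing in $x_1$ for $x_1>0$. $\mathcal{R}$ is the set of nontrivial weak $C^{1,\alpha}(\overline\Omega)$ solutions that are radially symmetric and radially decreasing. ''Strictly convex with respect to the $x_1$-direction'' means: whenever two distinct points of $\overline\Omega$ differ by a multiple of $e_1$, the open segment joining them lies in $\Omega$. *)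

(* Defs.v *)
From HB Require Import structures.
From mathcomp Require Import all_boot all_order all_algebra.
From mathcomp Require Import all_classical all_reals all_analysis.
Set Implicit Arguments.
Unset Strict Implicit.
Unset Printing Implicit Defensive.
Import Order.TTheory GRing.Theory Num.Theory.
Import numFieldNormedType.Exports.
Local Open Scope classical_set_scope.
Local Open Scope ring_scope.

(* Lebesgue measure on R^n, carried by n.-tuple R with the product Borel
   sigma-algebra: the image of lambda \x lambda_n under (x, t) |-> x :: t. *)
Section lebesgue_Rn.
Context {R : realType}.
Local Open Scope ereal_scope.

Definition tuple_cons n (z : measurableTypeR R * n.-tuple R) : n.+1.-tuple R :=
  [tuple of z.1 :: z.2].

Lemma measurable_tuple_cons n : measurable_fun setT (@tuple_cons n).
Proof. exact: measurable_cons. Qed.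

Section step.
Context n (m : {sigma_finite_measure set (n.-tuple R) -> \bar R}).

Definition lebesgue_step : set (n.+1.-tuple R) -> \bar R :=
  pushforward (lebesgue_measure \x m) (@tuple_cons n).

Let mpre A : measurable A -> measurable (@tuple_cons n @^-1` A).
Proof.
by move=> mA; rewrite -[X in measurable X]setTI; exact: measurable_tuple_cons.
Qed.

Let lebesgue_step0 : lebesgue_step set0 = 0.
Proof. by rewrite /lebesgue_step /pushforward preimage_set0 measure0. Qed.

Let lebesgue_step_ge0 A : 0 <= lebesgue_step A.
Proof. by rewrite /lebesgue_step /pushforward measure_ge0. Qed.

Let lebesgue_step_sigma_additive : semi_sigma_additive lebesgue_step.
Proof.
move=> F mF tF mUF; rewrite /lebesgue_step /pushforward preimage_bigcup.
apply: measure_semi_sigma_additive.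
- by move=> k; exact: mpre.
- apply/trivIsetP => /= i j _ _ ij; rewrite -preimage_setI.
  by move/trivIsetP : tF => /(_ _ _ _ _ ij) ->//; rewrite preimage_set0.
- by rewrite -preimage_bigcup; exact: mpre.
Qed.

HB.instance Definition _ := isMeasure.Build _ _ _ lebesgue_step
  lebesgue_step0 lebesgue_step_ge0 lebesgue_step_sigma_additive.

Let lebesgue_step_sigma_finite : sigma_finite setT lebesgue_step.
Proof.
have /sigma_finiteP[F [TF ndF Foo]] := sigma_finiteT (@lebesgue_measure R).
have /sigma_finiteP[G [TG ndG Goo]] := sigma_finiteT m.
pose unc (t : n.+1.-tuple R) : measurableTypeR R * n.-tuple R := (thead t, [tuple of behead t]).
have munc : measurable_fun setT unc.
  by apply: measurable_fun_pair; [exact: measurable_tnth|exact: measurable_behead].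
exists (fun k => unc @^-1` (F k `*` G k)).
  rewrite -preimage_bigcup (_ : \bigcup_k _ = setT) ?preimage_setT//.
  rewrite -subTset => -[x t] _.
  have [[i _ Fx] [j _ Gt]] : (\bigcup_k F k) x /\ (\bigcup_k G k) t.
    by rewrite -TF -TG.
  exists (maxn i j) => //; split=> /=.
  - by move: x Fx; exact/subsetPset/ndF/leq_maxl.
  - by move: t Gt; exact/subsetPset/ndG/leq_maxr.
move=> k; have [mF Fk] := Foo k; have [mG Gk] := Goo k; split.
  by rewrite -[X in measurable X]setTI; apply: munc => //; exact: measurableX.
rewrite /lebesgue_step /pushforward -comp_preimage.
rewrite (_ : unc \o @tuple_cons n = id).
  by rewrite preimage_id product_measure1E// lte_mul_pinfty// ge0_fin_numE.
apply/funext => -[x t]; rewrite /unc /tuple_cons /=; congr pair.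
exact/val_inj.
Qed.

HB.instance Definition _ := Measure_isSigmaFinite.Build _ _ _ lebesgue_step
  lebesgue_step_sigma_finite.

End step.

Fixpoint lebesgue_Rn n : {sigma_finite_measure set (n.-tuple R) -> \bar R} :=
  match n with
  | 0 => \d_([tuple] : 0.-tuple R)
  | k.+1 => lebesgue_step (lebesgue_Rn k)
  end.

Lemma lebesgue_Rn_box n (A : 'I_n -> set R) : (forall i, measurable (A i)) ->
  lebesgue_Rn n [set t | forall i, A i (tnth t i)] =
  \prod_(i < n) lebesgue_measure (A i).
Proof.
elim: n A => [|n IH] A mA /=.
  by rewrite big_ord0 diracE mem_set// => -[].
rewrite big_ord_recl -IH//.
rewrite /lebesgue_step /pushforward.
rewrite (_ : _ @^-1` _ =
    A ord0 `*` [set t | forall i, A (lift ord0 i) (tnth t i)]); last first.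
  apply/seteqP; split=> -[x t] /=.
    move=> h; split; first exact: (h ord0).
    by move=> i; have := h (lift ord0 i); rewrite tnthS.
  move=> [h0 h1] i; case: (unliftP ord0 i) => [j ->|->//].
  by rewrite tnthS; exact: h1.
have mB : measurable [set t : n.-tuple R | forall i, A (lift ord0 i) (tnth t i)].
  rewrite [X in measurable X](_ : _ =
      \bigcap_(i in setT) ((@tnth _ R ^~ i) @^-1` A (lift ord0 i))).
    apply: fin_bigcap_measurable; first exact: finite_finset.
    by move=> i _; rewrite -[X in measurable X]setTI; exact: measurable_tnth.
  by apply/seteqP; split=> t /= h i => [_|]; exact: h.
by rewrite product_measure1E//; exact: (mA ord0).
Qed.

End lebesgue_Rn.

Definition boundary (T : topologicalType) (A : set T) : set T :=
  closure A `\` A°.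

Section calculus_Rn.
Context {R : realType} {n : nat}.
Implicit Types (x y : 'rV[R]_n) (D : set 'rV[R]_n) (g : 'rV[R]_n -> R).

Definition dotp x y : R := \sum_(i < n) x 0 i * y 0 i.
(* Euclidean: the library norm `|x| on 'rV is the sup norm. *)
Definition enorm x : R := Num.sqrt (dotp x x).
Definition eball (c : 'rV[R]_n) (r : R) : set 'rV[R]_n :=
  [set x | enorm (x - c) < r].

Definition partial (i : 'I_n) g x : R := 'D_(delta_mx 0 i) g x.
Definition grad g x : 'rV[R]_n := \row_i partial i g x.

(* g is of class C^k on the open set D *)
Fixpoint class_C (k : nat) D g : Prop :=
  (forall x, D x -> {for x, continuous g}) /\
  match k with
  | 0 => True
  | l.+1 => (forall i x, D x -> derivable g x (delta_mx 0 i)) /\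
            (forall i, class_C l D (partial i g))
  end.

Definition smooth D g : Prop := forall k, class_C k D g.

(* C_c^oo(D), functions being extended by zero outside D *)
Definition test_function D g : Prop :=
  [/\ smooth setT g, compact (closure [set x | g x != 0]) &
      closure [set x | g x != 0] `<=` D].

(* u in C^{1,alpha}(closure D): u and its gradient extend continuously to
   closure D and the extension of the gradient is alpha-Hoelder there. *)
Definition class_C1alpha (alpha : R) D g : Prop :=
  [/\ {within closure D, continuous g}, class_C 1 D g &
      exists G : 'rV[R]_n -> 'rV[R]_n,
        [/\ {within closure D, continuous G},
            forall x, D x -> G x = grad g x &
            exists C : R, forall x y, closure D x -> closure D y ->
              enorm (G x - G y) <= C * enorm (x - y) `^ alpha]].

Definition rV_of_tuple (t : n.-tuple R) : 'rV[R]_n := \row_i tnth t i.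

Definition integral_Rn D g : R :=
  (\int[lebesgue_Rn n]_(t in rV_of_tuple @^-1` D) g (rV_of_tuple t))%R.

End calculus_Rn.

Definition class_C2 (R : realType) (a : R -> R) : Prop :=
  [/\ forall s, derivable a s 1, forall s, derivable (derive1 a) s 1 &
      continuous (derive1n 2 a)].

Section domains.
Context {R : realType} {n : nat}.
Implicit Types (Omega : set 'rV[R]_n.+1).

(* Near each boundary point, Omega is, up to relabelling and reorienting the
   coordinate axes, the region above the graph of a smooth function of the
   other coordinates. *)
Definition smooth_boundary Omega : Prop :=
  forall x0, boundary Omega x0 ->
    exists (i : 'I_n.+1) (b : bool) (gamma : 'rV[R]_n -> R),
      smooth setT gamma /\
      \forall x \near x0, Omega x <-> gamma (col' i x) < (-1) ^+ b * x 0 i.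

Definition smooth_bounded_domain Omega : Prop :=
  [/\ open Omega, connected Omega, Omega !=set0, bounded_set Omega &
      smooth_boundary Omega].

Definition e1 : 'rV[R]_n.+1 := delta_mx 0 ord0.

Definition reflect1 (x : 'rV[R]_n.+1) : 'rV[R]_n.+1 :=
  \row_i (if i == ord0 then - x 0 i else x 0 i).

Definition symmetric_x1 Omega : Prop :=
  forall x, Omega x <-> Omega (reflect1 x).

Definition strictly_convex_x1 Omega : Prop :=
  forall x t, t != 0 -> closure Omega x -> closure Omega (x + t *: e1) ->
    forall s, 0 < s < 1 -> Omega (x + (s * t) *: e1).

End domains.

Section solutions.
Context {R : realType} {n : nat}.
Variables (Omega : set 'rV[R]_n.+1) (p : R) (a f : R -> R).
Implicit Type u : 'rV[R]_n.+1 -> R.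

(* f only matters on [0, +oo[, since u >= 0.  At the critical points of u the
   vector |grad u|^{p-2} grad u evaluates to 0 for every p. *)
Definition weak_solution u : Prop :=
  [/\ exists alpha : R, 0 < alpha < 1 /\ class_C1alpha alpha Omega u,
      forall x, Omega x -> 0 < u x,
      forall x, boundary Omega x -> u x = 0 &
      forall phi, test_function Omega phi ->
        integral_Rn Omega (fun x =>
          a (u x) * enorm (grad u x) `^ (p - 2) * dotp (grad u x) (grad phi x))
        + p^-1 * integral_Rn Omega (fun x =>
            derive1 a (u x) * enorm (grad u x) `^ p * phi x)
        = integral_Rn Omega (fun x => f (u x) * phi x)].

Definition nontrivial u : Prop := exists2 x, Omega x & u x != 0.

Definition solutions_x1 : set ('rV[R]_n.+1 -> R) := [set u |
  [/\ weak_solution u /\ nontrivial u,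
      forall x, closure Omega x -> u (reflect1 x) = u x,
      forall x t, 0 <= t -> closure Omega x -> closure Omega (x + t *: e1) ->
        (x + t *: e1) 0 ord0 < 0 -> u x <= u (x + t *: e1) &
      forall x t, 0 <= t -> closure Omega x -> closure Omega (x + t *: e1) ->
        0 < x 0 ord0 -> u (x + t *: e1) <= u x]].

(* Meant for Omega a ball with center c; "radially decreasing" is strict. *)
Definition solutions_radial (c : 'rV[R]_n.+1) : set ('rV[R]_n.+1 -> R) := [set u |
  [/\ weak_solution u /\ nontrivial u,
      forall x y, closure Omega x -> closure Omega y ->
        enorm (x - c) = enorm (y - c) -> u x = u y &
      forall x y, closure Omega x -> closure Omega y ->
        enorm (x - c) < enorm (y - c) -> u y < u x]].

End solutions.

(* Main.v *)
(* With v the integral of a^(1/p) from 0 to u, testing the equation with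
   a(u)^(-1/p) psi cancels the terms in a' and leaves the p-Laplace equation
   - div (|grad v|^(p-2) grad v) = h(v), where h is locally Lipschitz and
   positive on ]0, +oo[.

   The planes {x_1 = l} are moved from the left, comparing v with its reflection
   v_l.  A weak comparison principle holds as soon as the set where v > v_l and
   |grad v| >= d has small measure: where |grad v| < d the lower bound on h(v)
   replaces the missing ellipticity, and Hopf's lemma keeps grad v away from 0 on
   the boundary.  If the planes stopped at l < 0, then v = v_l would hold on a set
   of positive measure of noncritical points.  At a density point of that set
   grad v = grad v_l, and a logarithmic energy estimate combined with a Poincare
   inequality makes v = v_l in a neighbourhood.  The noncritical points near which
   v = v_l then form an open set whose closure lies in Omega and whose boundary
   points are critical: the flux through the boundary vanishes although its
   divergence - h(v) is negative, which is absurd.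

   In a ball the argument applies in every direction, and v cannot be constant on
   an annulus since h(v) > 0. *)
Require Import Defs.
From HB Require Import structures.
From mathcomp Require Import all_boot all_order all_algebra.
From mathcomp Require Import all_classical all_reals all_analysis.
From mathcomp Require Import ring lra.
From mathcomp Require Import measurable_realfun.
Set Implicit Arguments.
Unset Strict Implicit.
Unset Printing Implicit Defensive.
Import Order.TTheory GRing.Theory Num.Theory.
Import numFieldNormedType.Exports.
Local Open Scope classical_set_scope.
Local Open Scope ring_scope.

Local Notation pushforward_measure :=
  measure_function_pushforward__canonical__measure_function_Measure.

(** * Lebesgue measure on R^n *)

Section translation_invariance.
Context {R : realType}.

(** The obstacle is the degeneracy of the operator. Solutions are only C^1, there is no linearised
    equation at critical points, and no Harnack inequality is at hand. Two choices answer this.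
    Failure of the moving planes is measured rather than located: a plane can only be stuck if the
    coincidence set contains noncritical points in positive measure, and then a strong comparison
    principle that assumes zeros of positive measure suffices; the logarithm of v - v_l together
    with a Poincare inequality gives it. And test functions stay C^1: the weak formulation is
    extended from smooth to C^1 functions by mollification, truncations occur squared or cubed, and
    in the flux argument the second derivatives of v are replaced by difference quotients, whose
    increment cancels from the final bound.

    Of measure theory two invariances are needed. Translation invariance of the integral yields
    integration by parts, and orthogonal invariance yields the equations of the reflected and
    rotated solutions. *)

Lemma lebesgue_measure_shift (a : R) (A : set (measurableTypeR R)) :
  measurable A -> lebesgue_measure ((fun x => x + a) @^-1` A) = lebesgue_measure A.
Proof.
move=> mA; pose sh (x : measurableTypeR R) : measurableTypeR R := x + a.
have ms : measurable_fun setT sh by exact: measurable_funD.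
pose mu := pushforward_measure lebesgue_measure ms.
rewrite [RHS](@lebesgue_measure_unique R mu)//= => X [[x y] _ <-] /=.
rewrite /mu /= /pushforward /= (_ : _ @^-1` _ = `](x - a), (y - a)]%classic).
  rewrite !lebesgue_measure_itv /= !lte_fin ltrD2r -!EFinD.
  by rewrite (_ : y - a - (x - a) = y - x)//; ring.
by apply/seteqP; split=> t /=; rewrite !in_itv /= ltrBlDr lerBrDr.
Qed.

Definition shift_tuple N (a t : N.-tuple R) : N.-tuple R :=
  [tuple tnth t i + tnth a i | i < N].

Lemma measurable_shift_tuple N (a : N.-tuple R) :
  measurable_fun setT (shift_tuple a).
Proof.
apply/measurable_fun_tnthP => i.
rewrite (_ : _ \o _ = fun t => tnth t i + tnth a i); last first.
  by apply/funext => t /=; rewrite tnth_mktuple.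
by apply: measurable_funD => //; exact: measurable_tnth.
Qed.

(** Induction on the dimension: through [tuple_cons] the translation splits into one on the line and
    one in N variables, and a product measure is determined by its values on rectangles. *)
Lemma lebesgue_Rn_shift N (a : N.-tuple R) (A : set (N.-tuple R)) :
  measurable A -> lebesgue_Rn N (shift_tuple a @^-1` A) = lebesgue_Rn N A.
Proof.
elim: N a A => [|N IH] a A mA.
  rewrite (_ : shift_tuple a = id) ?preimage_id//.
  by apply/funext => t; apply/eq_from_tnth => -[].
rewrite /= /lebesgue_step /pushforward.
set B := (@tuple_cons R N) @^-1` A.
have mB : measurable B.
  by rewrite -[X in measurable X]setTI; exact: (@measurable_tuple_cons R N).
pose sh (z : measurableTypeR R * N.-tuple R) : measurableTypeR R * N.-tuple R :=
  (z.1 + tnth a ord0, shift_tuple [tuple of behead a] z.2).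
have msh : measurable_fun setT sh.
  apply: measurable_fun_pair => /=.
    by apply: measurable_funD.
  exact: (measurableT_comp (measurable_shift_tuple _) measurable_snd).
rewrite (_ : _ @^-1` _ = sh @^-1` B); last first.
  apply/funext => -[x t]; rewrite /B /sh /preimage /mkset /=; congr (A _).
  apply/eq_from_tnth => i; rewrite /tuple_cons /= tnth_mktuple.
  case: (unliftP ord0 i) => [j ->|->]; last by rewrite !tnth0.
  rewrite !tnthS tnth_mktuple; congr (_ + _).
  by rewrite [in LHS](tuple_eta a) tnthS.
pose mu := pushforward_measure (lebesgue_measure \x lebesgue_Rn N)%E msh.
rewrite [RHS](@product_measure_unique _ _ _ _ _ _ _ mu)// => X Y mX mY.
rewrite /mu /= /pushforward /=.
rewrite (_ : _ @^-1` _ = ((fun x => x + tnth a ord0) @^-1` X) `*`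
   (shift_tuple [tuple of behead a] @^-1` Y)); last first.
  by apply/seteqP; split => -[x t].
rewrite product_measure1E//; last 2 first.
- by rewrite -[X in measurable X]setTI; apply: (measurable_funD _ _) => //.
- by rewrite -[X in measurable X]setTI; exact: measurable_shift_tuple.
by congr (_ * _)%E; [exact: lebesgue_measure_shift|exact: IH].
Qed.

End translation_invariance.

(** * Measurable sets and functions of row vectors *)

Section measurability_rV.
Context {R : realType} {N : nat}.
Implicit Types (x : 'rV[R]_N) (g h : 'rV[R]_N -> R) (A : set 'rV[R]_N).

Definition tuple_of_rV x : N.-tuple R := [tuple x 0 i | i < N].

Lemma tuple_of_rVK : cancel tuple_of_rV (@rV_of_tuple R N).
Proof. by move=> x; apply/rowP => i; rewrite mxE tnth_mktuple. Qed.

Lemma rV_normP x (r : R) : 0 <= r -> `|x| <= r <-> forall i, `|x 0 i| <= r.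
Proof.
move=> r0; rewrite /Num.norm /= mx_normrE; split.
  by move=> /bigmax_leP[_ h] i; exact: (h (0, i)).
move=> h; apply/bigmax_leP; split=> // -[i j] _ /=; rewrite (ord1 i); exact: h.
Qed.

Lemma rV_coord_le x i : `|x 0 i| <= `|x|.
Proof. exact: (proj1 (rV_normP _ (normr_ge0 x)) (lexx _)). Qed.

Lemma rV_norm_ltP x (r : R) : 0 < r -> `|x| < r <-> forall i, `|x 0 i| < r.
Proof.
move=> r0; split; first by move=> h i; exact: le_lt_trans (rV_coord_le x i) h.
rewrite /Num.norm /= mx_normrE => h; apply/bigmax_ltP; split => // -[i j] _ /=.
by rewrite (ord1 i); exact: h.
Qed.

Definition mset A := measurable ((@rV_of_tuple R N) @^-1` A).

Definition mfun g := measurable_fun setT (fun t => g (rV_of_tuple t)).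

Lemma mfun_coord i : mfun (fun x => x 0 i).
Proof.
rewrite /mfun (_ : (fun t => _) = (@tnth _ R ^~ i)); first exact: measurable_tnth.
by apply/funext => t; rewrite mxE.
Qed.

(** The sigma-algebra is the product one, so an open set is written as the countable union of the
    boxes with rational centre and radius 1/(k+1) that it contains; [F] replaces every other box by
    the empty set. *)
Lemma open_mset A : open A -> mset A.
Proof.
move=> oA; pose box (qk : 'rV[rat]_N * nat) : set 'rV[R]_N :=
  [set x | forall i, `|x 0 i - ratr (qk.1 0 i)| < (qk.2.+1%:R)^-1].
pose F qk := if asbool (box qk `<=` A) then box qk else set0.
have -> : A = \bigcup_qk F qk.
  apply/seteqP; split => x; last first.
    by move=> [qk _]; rewrite /F; case: asboolP => // h; exact: h.
  move=> Ax; have /nbhs_ballP[e /= e0 eA] : nbhs x A by exact: open_nbhs_nbhs.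
  have [k ke] : exists k, (k.+1%:R)^-1 < e / 2.
    have e20 : 0 < e / 2 by rewrite divr_gt0.
    have [k _ /(_ k (leqnn _)) hk] := near_infty_natSinv_lt (PosNum e20).
    by exists k.
  have k0 : 0 < (k.+1%:R)^-1 :> R by rewrite invr_gt0.
  have /choice[q hq] : forall i, exists q : rat, `|x 0 i - ratr q| < (k.+1%:R)^-1.
    move=> i; have /rat_in_itvoo[q] : x 0 i - (k.+1%:R)^-1 < x 0 i + (k.+1%:R)^-1.
      by rewrite ltrD2l gtrN.
    rewrite in_itv /= => /andP[h1 h2]; exists q.
    by rewrite ltr_distlC h1 h2.
  exists (\row_i q i, k) => //; rewrite /F; case: asboolP => [_ /= i|].
    by rewrite mxE; exact: hq.
  case => y /= hy; apply: eA; rewrite -ball_normE /=.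
  apply/rV_norm_ltP => // i; rewrite !mxE.
  have := hq i; have := hy i; rewrite mxE distrC /= => h1 h2.
  rewrite (_ : x 0 i - y 0 i = (x 0 i - ratr (q i)) + (ratr (q i) - y 0 i)); last by ring.
  rewrite [e]splitr; apply: le_lt_trans (ler_normD _ _) _.
  by apply: ltrD; [exact: lt_trans h2 ke|exact: lt_trans h1 ke].
rewrite /mset preimage_bigcup; apply: countable_bigcupT_measurable.
  exact: countableP.
move=> qk; rewrite /F; case: asboolP => _; last by rewrite preimage_set0.
rewrite (_ : _ @^-1` _ = \bigcap_(i in setT)
   ((fun t => `|rV_of_tuple t 0 i - ratr (qk.1 0 i)|) @^-1` `]-oo, (qk.2.+1%:R)^-1[)).
  apply: fin_bigcap_measurable; first exact: finite_finset.
  move=> i _; rewrite -[X in measurable X]setTI.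
  have : measurable_fun setT (fun t : N.-tuple R => `|rV_of_tuple t 0 i - ratr (qk.1 0 i)|).
    apply: measurableT_comp => //; apply: measurable_funB => //; exact: mfun_coord.
  by apply.
apply/seteqP; split => t h i => [_|].
  by rewrite /preimage /= in_itv /=; exact: h.
by have := h i I; rewrite /preimage /= in_itv.
Qed.

Lemma closed_mset A : closed A -> mset A.
Proof.
move=> cA; rewrite /mset -[A]setCK preimage_setC; apply: measurableC.
by apply: (@open_mset (~` A)); exact: closed_openC.
Qed.

Lemma mfun_cont g : continuous g -> mfun g.
Proof.
move=> /continuousP cg.
apply: (measurability _ (RGenOpens.measurableE R)).
move=> _ [_ [a [b ->] <-]]; rewrite setTI.
rewrite (_ : _ @^-1` _ = rV_of_tuple @^-1` (g @^-1` `]a, b[)) //.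
by apply: open_mset; apply: cg; exact: interval_open.
Qed.

Lemma mset_comp (D : set R) g : mfun g -> measurable D -> mset (g @^-1` D).
Proof. by move=> mg mD; have := mg measurableT _ mD; rewrite setTI. Qed.

Lemma mfun_indic A : mset A -> mfun \1_A.
Proof.
move=> mA; rewrite /mfun (_ : (fun t => _) = \1_((@rV_of_tuple R N) @^-1` A)).
  exact: measurable_indic.
by apply/funext => t; rewrite !indicE; congr ((_ : bool)%:R); apply/idP/idP; rewrite !inE.
Qed.

Lemma mfunD g h : mfun g -> mfun h -> mfun (fun x => g x + h x).
Proof. by move=> mg mh; apply: measurable_funD. Qed.

Lemma mfunM g h : mfun g -> mfun h -> mfun (fun x => g x * h x).
Proof. by move=> mg mh; apply: measurable_funM. Qed.

Lemma mfun_cst c : mfun (fun=> c).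
Proof. exact: measurable_cst. Qed.

Lemma mfun_norm g : mfun g -> mfun (fun x => `|g x|).
Proof. by move=> mg; apply: measurableT_comp. Qed.

(** Bounded measurable functions with bounded support, one [M] serving for both bounds. All
    integrands of the proof are of this kind, so that integrability reduces to the stability
    properties of this class. *)
Definition BM g := mfun g /\
  exists M : R, forall x, `|g x| <= M /\ (g x != 0 -> `|x| <= M).

Lemma BM_mfun g : BM g -> mfun g. Proof. by case. Qed.

Lemma BMD g h : BM g -> BM h -> BM (fun x => g x + h x).
Proof.
move=> [mg [M HM]] [mh [K HK]]; split; first exact: mfunD.
exists (Num.max (M + K) (Num.max M K)) => x; have [M1 M2] := HM x; have [K1 K2] := HK x.
split.
  rewrite le_max; apply/orP; left.
  by apply: le_trans (ler_normD _ _) _; exact: lerD.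
move=> gh; rewrite !le_max; apply/orP; right; apply/orP.
have [g0|/M2] := eqVneq (g x) 0; last by left.
by right; apply: K2; move: gh; rewrite g0 add0r.
Qed.

Lemma BMMl g h : BM g -> mfun h -> (exists M : R, forall x, g x != 0 -> `|h x| <= M) ->
  BM (fun x => h x * g x).
Proof.
move=> [mg [M HM]] mh [K HK]; split; first exact: mfunM.
exists (Num.max (K * M) M) => x; have [M1 M2] := HM x.
have M0 : 0 <= M by apply: le_trans M1.
have [->|g0] := eqVneq (g x) 0.
  rewrite mulr0 normr0; split; last by rewrite eqxx.
  by rewrite le_max M0 orbT.
split; first by rewrite normrM le_max; apply/orP; left; apply: ler_pM => //; exact: HK.
by move=> _; rewrite le_max M2// orbT.
Qed.

Lemma BM_scale c g : BM g -> BM (fun x => c * g x).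
Proof. by move=> bg; apply: BMMl => //; [exact: mfun_cst|exists `|c|]. Qed.

Lemma BMN g : BM g -> BM (fun x => - g x).
Proof.
move=> bg; rewrite (_ : (fun x => _) = (fun x => -1 * g x)); first exact: BM_scale.
by apply/funext => x; rewrite mulN1r.
Qed.

Lemma BMB g h : BM g -> BM h -> BM (fun x => g x - h x).
Proof. by move=> bg bh; apply: BMD => //; exact: BMN. Qed.

Lemma BM_bounded g : BM g -> exists M : R, forall x, `|g x| <= M.
Proof. by move=> [_ [M h]]; exists M => x; case: (h x). Qed.

Lemma BMM g h : BM g -> BM h -> BM (fun x => g x * h x).
Proof.
move=> bg bh; apply: BMMl => //; first exact: BM_mfun.
by have [M h'] := BM_bounded bg; exists M => x _.
Qed.

Lemma BM_indic A g : mset A -> BM g -> BM (fun x => \1_A x * g x).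
Proof.
move=> mA bg; apply: BMMl => //; first exact: mfun_indic.
by exists 1 => x _; rewrite indicE; case: (_ \in _); rewrite ?normr1 ?normr0.
Qed.

Lemma BM_norm g : BM g -> BM (fun x => `|g x|).
Proof.
move=> [mg [M HM]]; split; first exact: mfun_norm.
by exists M => x; rewrite normr_id normr_eq0.
Qed.

Lemma BM_set A : mset A -> (exists M : R, forall x, A x -> `|x| <= M) -> BM \1_A.
Proof.
move=> mA [M HM]; split; first exact: mfun_indic.
exists (Num.max M 1) => x; rewrite indicE.
case: (boolP (x \in A)) => [/set_mem /HM Ax|_] /=.
  by rewrite normr1 !le_max lexx Ax orbT.
by rewrite normr0 eqxx le_max ler01 orbT.
Qed.

Lemma BM0 : BM (fun=> 0).
Proof. by split; [exact: mfun_cst|exists 0 => x; rewrite normr0 eqxx]. Qed.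

Lemma BM_sum (I : Type) (s : seq I) (F : I -> 'rV[R]_N -> R) :
  (forall i, BM (F i)) -> BM (fun x => \sum_(i <- s) F i x).
Proof.
move=> bF; elim: s => [|i s IH].
  by under eq_fun do rewrite big_nil; exact: BM0.
by under eq_fun do rewrite big_cons; exact: BMD.
Qed.

End measurability_rV.
Arguments closed_mset {R N A} _.
Arguments open_mset {R N A} _.
Arguments mfun_cont {R N g} _.
Arguments mfun_cst {R N} c.
Arguments mfun_coord {R N} i.
Arguments BM_mfun {R N g} _.

(** * The integral of bounded functions with bounded support *)

Section integral_functional.
Context {R : realType} {N : nat}.
Implicit Types (x a : 'rV[R]_N) (g h : 'rV[R]_N -> R) (A : set 'rV[R]_N).

(** The integral is over the whole space. Domains enter through indicators and supports, so that
    translations and isometries act on the integrand alone. *)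
Definition Int g : R := (\int[lebesgue_Rn N]_t g (rV_of_tuple t))%R.

Definition box (M : R) : set 'rV[R]_N := [set x | `|x| <= M].

Lemma closed_box M : closed (box M).
Proof.
rewrite (_ : box M = (fun x => `|x|) @^-1` [set y | y <= M])//.
apply: closed_comp => [x _|]; [exact: norm_continuous|exact: closed_le].
Qed.

Arguments closed_box : clear implicits.

Lemma BM_box M : BM (\1_(box M) : _ -> R).
Proof.
apply: BM_set; first exact: closed_mset (closed_box _).
by exists M.
Qed.

Lemma lebesgue_box (M : R) : 0 <= M ->
  lebesgue_Rn N (@rV_of_tuple R N @^-1` box M) = ((2 * M) ^+ N)%:E.
Proof.
move=> M0; rewrite (_ : _ @^-1` _ = [set t | forall i, `[- M, M]%classic (tnth t i)]).
  rewrite (@lebesgue_Rn_box _ _ (fun=> `[- M, M]%classic))//.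
  rewrite (eq_bigr (fun=> (2 * M)%:E)).
    by rewrite big_const_ord; elim: N => [|n IH] //=; rewrite IH exprS EFinM.
  move=> i _; rewrite lebesgue_measure_itv /= lte_fin.
  case: ltgtP => [h|h|h]; first by rewrite -EFinB; congr EFin; ring.
    by exfalso; lra.
  by congr EFin; lra.
apply/seteqP; split => t /=.
  by move=> /rV_normP h i; rewrite in_itv /= -ler_norml; have := h M0 i; rewrite mxE.
move=> h; apply/rV_normP => // i; rewrite mxE.
by have := h i; rewrite in_itv /= -ler_norml.
Qed.

Lemma BM_integrable g : BM g ->
  (lebesgue_Rn N).-integrable setT (EFin \o (fun t => g (rV_of_tuple t))).
Proof.
move=> [mg [M HM]]; set B := @rV_of_tuple R N @^-1` box `|M|.
have mB : measurable B by exact: closed_mset (closed_box _).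
rewrite (_ : _ \o _ = (EFin \o (fun t => g (rV_of_tuple t))) \_ B).
  apply/(integrable_mkcond _ mB).
  apply: measurable_bounded_integrable => //.
  - exact: (eq_ind_r (fun e => (e < +oo)%E) (ltry _) (lebesgue_box (normr_ge0 M))).
  - exact: measurable_funS mg.
  - exists `|M|; split; first exact: num_real.
    move=> K MK t _ /=; apply: le_trans (ltW MK).
    by apply: le_trans (ler_norm _); case: (HM (rV_of_tuple t)).
apply/funext => t; rewrite /patch /=; case: ifPn => // tB; congr EFin.
apply/eqP; apply: contraNT tB => /(proj2 (HM _)) h; rewrite inE /B /box /=.
by apply: le_trans h (ler_norm _).
Qed.

Lemma eq_Int g h : g =1 h -> Int g = Int h.
Proof. by move=> gh; congr Int; apply/funext. Qed.

Lemma IntD g h : BM g -> BM h -> Int (fun x => g x + h x) = Int g + Int h.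
Proof. by move=> bg bh; apply: RintegralD => //; exact: BM_integrable. Qed.

Lemma IntB g h : BM g -> BM h -> Int (fun x => g x - h x) = Int g - Int h.
Proof. by move=> bg bh; apply: RintegralB => //; exact: BM_integrable. Qed.

Lemma IntZ c g : BM g -> Int (fun x => c * g x) = c * Int g.
Proof. by move=> bg; apply: RintegralZl => //; exact: BM_integrable. Qed.

Lemma IntZr c g : BM g -> Int (fun x => g x * c) = Int g * c.
Proof. by move=> bg; apply: RintegralZr => //; exact: BM_integrable. Qed.

Lemma IntN g : BM g -> Int (fun x => - g x) = - Int g.
Proof.
move=> bg; rewrite -mulN1r -IntZ//; apply: eq_Int => x; by rewrite mulN1r.
Qed.

Lemma Int_ge0 g : (forall x, 0 <= g x) -> 0 <= Int g.
Proof. by move=> g0; apply: Rintegral_ge0. Qed.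

Lemma le_Int g h : BM g -> BM h -> (forall x, g x <= h x) -> Int g <= Int h.
Proof. by move=> bg bh gh; apply: le_Rintegral => //; exact: BM_integrable. Qed.

Lemma Int0 : Int (fun=> 0) = 0.
Proof.
rewrite -[RHS](mul0r (Int (fun=> 0))) -IntZ; last exact: BM0.
by apply: eq_Int => x; rewrite mul0r.
Qed.

Lemma Int_sum (I : Type) (s : seq I) (F : I -> 'rV[R]_N -> R) :
  (forall i, BM (F i)) -> Int (fun x => \sum_(i <- s) F i x) = \sum_(i <- s) Int (F i).
Proof.
move=> bF; elim: s => [|i s IH].
  by rewrite big_nil -[RHS]Int0; apply: eq_Int => x; rewrite big_nil.
rewrite big_cons -IH -IntD//; last exact: BM_sum.
by apply: eq_Int => x; rewrite big_cons.
Qed.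

Lemma Int_abs g : BM g -> `|Int g| <= Int (fun x => `|g x|).
Proof. by move=> bg; apply: le_normr_Rintegral => //; exact: BM_integrable. Qed.

Lemma Int_box (M : R) : 0 <= M -> Int \1_(box M) = (2 * M) ^+ N.
Proof.
move=> M0; rewrite /Int /Rintegral.
have mB : measurable (@rV_of_tuple R N @^-1` box M) by exact: closed_mset (closed_box _).
rewrite (_ : (fun t => _) = fun t => (\1_(@rV_of_tuple R N @^-1` box M) t)%:E).
  rewrite integral_indic// setIT -[RHS]/(fine ((2 * M) ^+ N)%:E).
  by congr fine; exact: lebesgue_box.
by apply/funext => t; rewrite !indicE; congr (((_ : bool)%:R)%:E).
Qed.

Lemma Int_le_box g (M c : R) : BM g -> 0 <= M -> (forall x, g x <= c) -> 0 <= c ->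
  (forall x, g x != 0 -> `|x| <= M) -> Int g <= c * (2 * M) ^+ N.
Proof.
move=> bg M0 gc c0 gM; rewrite -Int_box// -IntZ; last exact: BM_box.
apply: le_Int => //; first by apply: BM_scale; exact: BM_box.
move=> x; rewrite indicE; case: (boolP (x \in _)) => [_|]; first by rewrite mulr1.
move=> /negP xM; rewrite mulr0; have [->//|/gM h] := eqVneq (g x) 0.
by exfalso; apply: xM; rewrite inE.
Qed.

(** The dominating function is [M] times the indicator of [box M]. The limit inherits the bound and
    the support, so nothing but measurability is asked of [g]. *)
Lemma Int_dct (F : nat -> 'rV[R]_N -> R) g (M : R) :
  (forall k, mfun (F k)) -> mfun g ->
  (forall k x, `|F k x| <= M) -> (forall k x, F k x != 0 -> `|x| <= M) ->
  (forall x, F ^~ x @ \oo --> g x) -> Int \o F @ \oo --> Int g.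
Proof.
move=> mF mg FM Fs Fg.
have M0 : 0 <= M by exact: le_trans (FM 0%N 0).
have bg : BM g.
  split => //; exists M => x; split.
    have /(@cvg_norm _ R^o) /= h := Fg x.
    apply: (closed_cvg _ (@closed_le R M) _ _ h).
    by apply: nearW => k; exact: FM.
  apply: contraNT => xM; apply/eqP.
  have E : F ^~ x = fun=> 0.
    by apply/funext => k; apply/eqP; apply: contraNT xM => /Fs.
  have := Fg x; rewrite E => h.
  exact: (@cvg_unique _ (@norm_hausdorff R R^o) _ _ _ _ h (cvg_cst 0)).
have bd : BM (fun x => M * \1_(box M) x) by apply: BM_scale; exact: BM_box.
have FB k x : `|F k x| <= M * \1_(box M) x.
  rewrite indicE; case: (boolP (x \in _)) => [_|]; first by rewrite mulr1.
  move=> /negP xM; rewrite mulr0; have [->|/Fs h] := eqVneq (F k x) 0.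
    by rewrite normr0.
  by exfalso; apply: xM; rewrite inE.
have [|||||_ _ h] := @dominated_convergence _ _ _ (lebesgue_Rn N) setT measurableT
  (fun k t => (F k (rV_of_tuple t))%:E) (fun t => (g (rV_of_tuple t))%:E)
  (fun t => (M * \1_(box M) (rV_of_tuple t))%:E).
- by move=> k; apply/measurable_EFinP; exact: mF.
- by apply/measurable_EFinP; exact: mg.
- apply: aeW => t _; apply: cvg_EFin; first by apply: nearW.
  exact: Fg.
- exact: BM_integrable bd.
- by apply: aeW => t k _ /=; rewrite lee_fin.
apply: (@cvg_trans _ ((fine \o
  (fun k => (\int[lebesgue_Rn N]_t (F k (rV_of_tuple t))%:E)%E)) @ \oo)) => //.
apply: fine_cvg; rewrite fineK//.
by apply: integrable_fin_num => //; exact: BM_integrable bg.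
Qed.

Lemma mfun_shift a g : mfun g -> mfun (fun x => g (x + a)).
Proof.
move=> mg; rewrite /mfun (_ : (fun t => _) =
  (fun t => g (rV_of_tuple t)) \o shift_tuple (tuple_of_rV a)).
  by apply: (measurableT_comp mg); exact: measurable_shift_tuple.
apply/funext => t /=; congr g; apply/rowP => i.
by rewrite !mxE !tnth_mktuple.
Qed.

Lemma BM_shift a g : BM g -> BM (fun x => g (x + a)).
Proof.
move=> [mg [M HM]]; split; first exact: mfun_shift.
exists (M + `|a|) => x; have [h1 h2] := HM (x + a); split.
  by apply: le_trans h1 _; rewrite lerDl.
move=> /h2 h; rewrite -[x](addrK a); apply: le_trans (ler_normB _ _) _.
by rewrite lerD2r.
Qed.

Lemma Int_shift a g : BM g -> Int (fun x => g (x + a)) = Int g.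
Proof.
move=> bg; rewrite /Int /Rintegral; congr fine.
have ms := @measurable_shift_tuple R N (tuple_of_rV a).
have E : (fun t => (g (rV_of_tuple t + a))%:E) =
  (fun t => (g (rV_of_tuple t))%:E) \o shift_tuple (tuple_of_rV a).
  apply/funext => t /=; congr ((g _)%:E); apply/rowP => i.
  by rewrite !mxE !tnth_mktuple.
have H := @integral_pushforward _ _ _ _ R _ ms (lebesgue_Rn N) setT
  (fun t => (g (rV_of_tuple t))%:E).
rewrite preimage_setT -E in H.
rewrite -H//; last 2 first.
- by apply/measurable_EFinP; exact: BM_mfun.
- exact: BM_integrable (BM_shift a bg).
apply: eq_measure_integral => A mA _; exact: lebesgue_Rn_shift.
Qed.

End integral_functional.
Arguments box {R N} M.
Arguments closed_box {R N} M.

Lemma cvg_sumr (R : realType) (T : Type) (F : set_system T) {FF : Filter F} (I : Type) (s : seq I)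
    (f : I -> T -> R) (l : I -> R) : (forall i, f i @ F --> l i) ->
  (fun x => \sum_(i <- s) f i x) @ F --> \sum_(i <- s) l i.
Proof.
move=> h; elim: s => [|i s IH].
  by under eq_fun do rewrite big_nil; rewrite big_nil; exact: cvg_cst.
by under eq_fun do rewrite big_cons; rewrite big_cons; exact: cvgD.
Qed.

Lemma continuous_sumr (R : realType) (T : topologicalType) (x : T) (I : Type) (s : seq I)
    (f : I -> T -> R) : (forall i, continuous_at x (f i)) ->
  continuous_at x (fun y => \sum_(i <- s) f i y).
Proof. exact: cvg_sumr. Qed.

(** * Fubini's theorem *)

Section fubini_rV.
Context {R : realType} {N : nat}.
Implicit Types (x y a : 'rV[R]_N) (g h : 'rV[R]_N -> R) (F : 'rV[R]_N -> 'rV[R]_N -> R).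

Definition mfun2 F := measurable_fun setT
  (fun z : N.-tuple R * N.-tuple R => F (rV_of_tuple z.1) (rV_of_tuple z.2)).

Lemma mfun2_comp g (f : 'rV[R]_N -> 'rV[R]_N -> 'rV[R]_N) : mfun g ->
  (forall i, mfun2 (fun x y => f x y 0 i)) -> mfun2 (fun x y => g (f x y)).
Proof.
move=> mg mf; rewrite /mfun2 (_ : (fun z => _) = (fun t => g (rV_of_tuple t)) \o
  (fun z => tuple_of_rV (f (rV_of_tuple z.1) (rV_of_tuple z.2)))).
  apply: (measurableT_comp mg); apply/measurable_fun_tnthP => i.
  rewrite (_ : _ \o _ = fun z => f (rV_of_tuple z.1) (rV_of_tuple z.2) 0 i).
    exact: mf.
  by apply/funext => z /=; rewrite tnth_mktuple.
by apply/funext => z /=; rewrite tuple_of_rVK.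
Qed.

Lemma mfun2_fst g : mfun g -> mfun2 (fun x _ => g x).
Proof. by move=> mg; exact: (measurableT_comp mg measurable_fst). Qed.

Lemma mfun2_snd g : mfun g -> mfun2 (fun _ y => g y).
Proof. by move=> mg; exact: (measurableT_comp mg measurable_snd). Qed.

Lemma mfun2D F G : mfun2 F -> mfun2 G -> mfun2 (fun x y => F x y + G x y).
Proof. by move=> mF mG; apply: measurable_funD. Qed.

Lemma mfun2M F G : mfun2 F -> mfun2 G -> mfun2 (fun x y => F x y * G x y).
Proof. by move=> mF mG; apply: measurable_funM. Qed.

Lemma mfun2_sub g : mfun g -> mfun2 (fun x y => g (x - y)).
Proof.
move=> mg; apply: (mfun2_comp mg) => i.
rewrite (_ : (fun x y => _) = fun x y => x 0 i + -1 * y 0 i); last first.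
  by apply/funext => x; apply/funext => y; rewrite !mxE mulN1r.
apply: mfun2D; first exact: (mfun2_fst (mfun_coord i)).
by apply: mfun2M; [exact: (mfun2_fst (mfun_cst _))|exact: (mfun2_snd (mfun_coord i))].
Qed.

Lemma mfun2_add g : mfun g -> mfun2 (fun x y => g (x + y)).
Proof.
move=> mg; apply: (mfun2_comp mg) => i.
rewrite (_ : (fun x y => _) = fun x y => x 0 i + y 0 i); last first.
  by apply/funext => x; apply/funext => y; rewrite !mxE.
by apply: mfun2D; [exact: (mfun2_fst (mfun_coord i))|exact: (mfun2_snd (mfun_coord i))].
Qed.

Definition BM2 F := mfun2 F /\ exists M : R, forall x y,
  `|F x y| <= M /\ (F x y != 0 -> `|x| <= M /\ `|y| <= M).

Lemma BM2_swap F : BM2 F -> BM2 (fun y x => F x y).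
Proof.
move=> [mF [M HM]]; split.
  rewrite /mfun2 (_ : (fun z => _) = (fun z => F (rV_of_tuple z.1) (rV_of_tuple z.2)) \o
    (fun z => (z.2, z.1)))//.
  by apply: (measurableT_comp mF); apply: measurable_fun_pair;
    [exact: measurable_snd|exact: measurable_fst].
by exists M => x y; have [h1 h2] := HM y x; split => // /h2 [].
Qed.

Lemma BM2_section F x : BM2 F -> BM (F x).
Proof.
move=> [mF [M HM]]; split; last first.
  by exists M => y; have [h1 h2] := HM x y; split => // /h2 [].
rewrite /mfun (_ : (fun t => _) = (fun z => F (rV_of_tuple z.1) (rV_of_tuple z.2)) \o
    (fun t => (tuple_of_rV x, t))).
  by apply: (measurableT_comp mF); exact: measurable_fun_pair.
by apply/funext => t /=; rewrite tuple_of_rVK.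
Qed.

Lemma BM2_integrable F : BM2 F -> (lebesgue_Rn N \x lebesgue_Rn N)%E.-integrable setT
  (fun z => (F (rV_of_tuple z.1) (rV_of_tuple z.2))%:E).
Proof.
move=> [mF [M HM]]; set B := @rV_of_tuple R N @^-1` box `|M|.
have mB : measurable B by exact: closed_mset (closed_box _).
set f := fun z => _.
have -> : f = f \_ (B `*` B).
  apply/funext => z; rewrite /patch /f; case: ifPn => // zB; congr EFin.
  apply/eqP; apply: contraNT zB => /(proj2 (HM _ _)) [h1 h2].
  by rewrite inE; split; rewrite /B /box /=; apply: le_trans (ler_norm _).
have mBB : measurable (B `*` B) by exact: measurableX.
apply/(integrable_mkcond _ mBB); apply: measurable_bounded_integrable => //.
- apply: (eq_ind_r (fun e => (e < +oo)%E) _ (product_measure1E _ _ mB mB)).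
  have hB : (lebesgue_Rn N B < +oo)%E.
    exact: (eq_ind_r (fun e => (e < +oo)%E) (ltry _) (lebesgue_box (normr_ge0 M))).
  by apply: lte_mul_pinfty => //; rewrite ge0_fin_numE.
- exact: measurable_funS mF.
- exists `|M|; split; first exact: num_real.
  move=> K MK t _ /=; apply: le_trans (ltW MK).
  by apply: le_trans (ler_norm _); case: (HM (rV_of_tuple t.1) (rV_of_tuple t.2)).
Qed.

Lemma EFin_Int g : BM g ->
  (\int[lebesgue_Rn N]_t (g (rV_of_tuple t))%:E)%E = (Int g)%:E.
Proof.
by move=> bg; rewrite /Int /Rintegral fineK//; apply: integrable_fin_num => //;
  exact: BM_integrable bg.
Qed.

Lemma Int_fubini F : BM2 F -> Int (fun x => Int (F x)) = Int (fun y => Int (F ^~ y)).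
Proof.
move=> bF; have h := Fubini (BM2_integrable bF).
rewrite /Int /Rintegral; congr fine; etransitivity; last etransitivity; [|exact: h|].
  apply: eq_integral => t _ /=; apply/esym.
  exact: (EFin_Int (BM2_section (rV_of_tuple t) bF)).
apply: eq_integral => t _ /=.
exact: (EFin_Int (BM2_section (rV_of_tuple t) (BM2_swap bF))).
Qed.

Lemma BM_Int F : BM2 F -> BM (fun x => Int (F x)).
Proof.
move=> bF; split.
  have := measurable_fubini_F (BM2_integrable bF); rewrite /fubini_F => h.
  by apply: (measurableT_comp _ h).
have [mF [M HM]] := bF.
have M0 : 0 <= M by have [h _] := HM 0 0; exact: le_trans h.
exists (Num.max M (M * (2 * M) ^+ N)) => x; split.
  rewrite le_max; apply/orP; right.
  apply: le_trans (Int_abs (BM2_section _ bF)) _.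
  apply: Int_le_box => //; first exact/BM_norm/BM2_section.
    by move=> y; have [] := HM x y.
  by move=> y; rewrite normr_eq0; have [_ h /h []] := HM x y.
move=> h; rewrite le_max; apply/orP; left; move: h; apply: contraNT => xM.
rewrite (_ : F x = fun=> 0) ?Int0//; apply/funext => y.
by apply/eqP; apply: contraNT xM; have [_ h /h []] := HM x y.
Qed.

End fubini_rV.

(** * Orthogonal invariance of the integral *)

Section orthogonal_invariance.
Context {R : realType} {N : nat}.
Implicit Types (x y : 'rV[R]_N) (g : 'rV[R]_N -> R).

Lemma dotpE x y : dotp x y = (x *m y^T) 0 0.
Proof. by rewrite mxE; apply: eq_bigr => i _; rewrite mxE. Qed.

Lemma dotpNN x y : dotp (- x) (- y) = dotp x y.
Proof. by apply: eq_bigr => i _; rewrite !mxE mulrNN. Qed.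

Lemma rV_mulmx_bound (A : 'M[R]_N) : exists2 C : R, 0 <= C &
  forall x, `|x *m A| <= C * `|x|.
Proof.
exists (\sum_j \sum_i `|A j i|); first by do 2 (apply: sumr_ge0 => ? _).
move=> x; apply/rV_normP => [|i]; first by rewrite mulr_ge0// sumr_ge0// => ? _; rewrite sumr_ge0.
rewrite mxE mulr_suml; apply: le_trans (ler_norm_sum _ _ _) _.
apply: ler_sum => j _; rewrite normrM mulrC; apply: ler_pM => //.
  by rewrite (bigD1 i)//= lerDl sumr_ge0.
exact: rV_coord_le.
Qed.

Lemma mfun_mulmx (A : 'M[R]_N) g : mfun g -> mfun (fun x => g (x *m A)).
Proof.
move=> mg; rewrite /mfun (_ : (fun t => _) = (fun t => g (rV_of_tuple t)) \o
  (fun t => tuple_of_rV (rV_of_tuple t *m A))).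
  apply: (measurableT_comp mg); apply/measurable_fun_tnthP => i.
  rewrite (_ : _ \o _ = fun t => \sum_j rV_of_tuple t 0 j * A j i).
    apply: measurable_sum => j; apply: measurable_funM => //.
    exact: (mfun_coord j).
  by apply/funext => z /=; rewrite tnth_mktuple mxE.
by apply/funext => z /=; rewrite tuple_of_rVK.
Qed.

Lemma BM_mulmx (A B : 'M[R]_N) g : A *m B = 1%:M -> BM g -> BM (fun x => g (x *m A)).
Proof.
move=> AB [mg [M HM]]; split; first exact: mfun_mulmx.
have [C C0 HC] := rV_mulmx_bound B.
exists (Num.max M (C * M)) => x; have [h1 h2] := HM (x *m A).
split; first by rewrite le_max h1.
move=> /h2 h; rewrite le_max; apply/orP; right.
rewrite -[x]mulmx1 -AB mulmxA; apply: le_trans (HC _) _; exact: ler_wpM2l.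
Qed.

Variable Q : 'M[R]_N.
Hypothesis QQT : Q *m Q^T = 1%:M.

Let QTQ : Q^T *m Q = 1%:M. Proof. exact: mulmx1C. Qed.

Lemma dotp_orth x y : dotp (x *m Q) (y *m Q) = dotp x y.
Proof. by rewrite !dotpE trmx_mul mulmxA -(mulmxA x) QQT mulmx1. Qed.

Let E : set 'rV[R]_N := [set x | dotp x x <= 1].

Let dotp_cont : continuous (fun x => dotp x x).
Proof.
move=> x; apply: continuous_sumr => i.
by apply: continuousM; exact: (@coord_continuous R 1 N 0 i x).
Qed.

Let mE : mset E.
Proof.
apply: closed_mset; rewrite (_ : E = (fun x => dotp x x) @^-1` [set r | r <= 1])//.
by apply: closed_comp => [x _|]; [exact: dotp_cont|exact: closed_le].
Qed.

Let Ebox x : E x -> `|x| <= 1.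
Proof.
move=> h; apply/rV_normP => // i.
have : x 0 i * x 0 i <= 1.
  apply: le_trans h; rewrite /dotp (bigD1 i)//= lerDl sumr_ge0// => j _.
  by rewrite -expr2 sqr_ge0.
by rewrite -expr2 -real_normK ?num_real// -[X in _ <= X](expr1n _ 2) ler_pXn2r// nnegrE.
Qed.

Let bE : BM (\1_E : _ -> R).
Proof. by apply: BM_set; [exact: mE|exists 1; exact: Ebox]. Qed.

Let E0 : 0 < Int (\1_E : _ -> R).
Proof.
(* The box of this radius lies in the unit ball, since N r <= 1 and r <= 1 give N r^2 <= 1. *)
pose r : R := (N.+1%:R)^-1; have r0 : 0 < r by rewrite invr_gt0.
apply: (@lt_le_trans _ _ (Int (\1_(box r) : 'rV[R]_N -> R))).
  by rewrite Int_box ?ltW// exprn_gt0// mulr_gt0.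
apply: le_Int; [exact: BM_box|exact: bE|].
move=> x; rewrite !indicE; case: (boolP (x \in box r)) => //=.
rewrite inE => /rV_normP => /(_ (ltW r0)) h.
suff xE : E x by rewrite mem_set.
rewrite /E /=; apply: (@le_trans _ _ (\sum_(i < N) r * r)).
  apply: ler_sum => i _; rewrite -expr2 -real_normK ?num_real// expr2.
  by apply: ler_pM => //.
rewrite sumr_const card_ord -[_ *+ N]mulr_natr.
have h1 : N%:R * r <= 1 by rewrite /r ler_pdivrMr ?ltr0n// mul1r ler_nat.
have h2 : r <= 1 by rewrite /r invf_le1 ?ltr0n// ler1n.
rewrite (_ : r * r * N%:R = N%:R * r * r); last by ring.
by apply: mulr_ile1 => //; rewrite ?mulr_ge0// ltW.
Qed.

(** The uniqueness argument for Haar measure, which needs no determinant: both functionals [Int] and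
    [J] are translation invariant, so Fubini gives Int 1_E * J g = Int g * J 1_E. For the unit ball
    [E], which is invariant under [Q] and has positive measure, [J] and [Int] agree, and the factor
    cancels. *)
Lemma Int_orth g : BM g -> Int (fun x => g (x *m Q)) = Int g.
Proof.
move=> bg; pose J h := Int (fun x => h (x *m Q)).
have JE : J (\1_E) = Int (\1_E).
  by apply: eq_Int => x; rewrite !indicE; congr ((_ : bool)%:R);
    apply/idP/idP; rewrite !inE /E /= dotp_orth.
suff : Int \1_E * J g = Int g * J \1_E.
  by rewrite JE mulrC => h; apply: (mulIf _ h); rewrite gt_eqF ?E0.
have [[mg [M HM]] [C C0 HC]] := (bg, rV_mulmx_bound Q^T).
have M0 : 0 <= M by have [h _] := HM 0; exact: le_trans h.
have mQ i : mfun2 (fun x y : 'rV[R]_N => (y *m Q) 0 i).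
  apply: (mfun2_snd (g := fun y => (y *m Q) 0 i)).
  exact: (mfun_mulmx Q (mfun_coord i)).
(* Both double integrands have bounded support because y is recovered from x and z as (z - x)
   Q^T. *)
have bnd x y z : `|x| <= M + 1 -> `|z| <= M + 1 -> (z = x + y *m Q) ->
   `|y| <= C * (M + 1 + (M + 1)).
  move=> hx hz e; have -> : y = (z - x) *m Q^T.
    by rewrite e addrC addKr -mulmxA QQT mulmx1.
  apply: le_trans (HC _) _; apply: ler_wpM2l => //.
  by apply: le_trans (ler_normB _ _) _; exact: lerD.
pose K := Num.max (M + 1) (C * (M + 1 + (M + 1))).
have b1 : BM2 (fun x y => \1_E x * g (x + y *m Q)).
  split.
    apply: mfun2M; first exact: (mfun2_fst (mfun_indic mE)).
    apply: (mfun2_comp mg) => i.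
    rewrite (_ : (fun x y => _) = fun x y => x 0 i + (y *m Q) 0 i); last first.
      by apply/funext => x; apply/funext => y; rewrite mxE.
    by apply: mfun2D => //; exact: (mfun2_fst (mfun_coord i)).
  exists K => x y; rewrite indicE; case: (boolP (x \in E)) => xE; last first.
    by rewrite mul0r normr0 eqxx; split => //; rewrite le_max addr_ge0.
  rewrite mul1r; have [h1 h2] := HM (x + y *m Q); split.
    by rewrite le_max (le_trans h1)// lerDl.
  move=> /h2 h; have hx : `|x| <= M + 1.
    by apply: le_trans (Ebox (set_mem xE)) _; rewrite lerDr.
  rewrite !le_max hx; split => //; apply/orP; right.
  by apply: (bnd x _ (x + y *m Q)) => //; apply: le_trans h _; rewrite lerDl.
have b2 : BM2 (fun x y => \1_E (x - y *m Q) * g x).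
  split.
    apply: mfun2M; last exact: (mfun2_fst mg).
    apply: (mfun2_comp (mfun_indic mE)) => i.
    rewrite (_ : (fun x y => _) = fun x y => x 0 i + -1 * (y *m Q) 0 i); last first.
      by apply/funext => x; apply/funext => y; rewrite !mxE mulN1r.
    apply: mfun2D => //; first exact: (mfun2_fst (mfun_coord i)).
    by apply: mfun2M => //; exact: (mfun2_fst (mfun_cst _)).
  exists K => x y; rewrite indicE; case: (boolP (_ \in E)) => xE; last first.
    by rewrite mul0r normr0 eqxx; split => //; rewrite le_max addr_ge0.
  rewrite mul1r; have [h1 h2] := HM x; split.
    by rewrite le_max (le_trans h1)// lerDl.
  move=> /h2 h; have hx : `|x - y *m Q| <= M + 1.
    by apply: le_trans (Ebox (set_mem xE)) _; rewrite lerDr.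
  have hx' : `|x| <= M + 1 by apply: le_trans h _; rewrite lerDl.
  rewrite !le_max hx'; split => //; apply/orP; right.
  by apply: (bnd (x - y *m Q) _ x) => //; rewrite subrK.
transitivity (Int (fun x => Int (fun y => \1_E x * g (x + y *m Q)))).
  rewrite -IntZr//; apply: eq_Int => x.
  rewrite IntZ; last first.
    rewrite (_ : (fun y => _) = fun y => (fun z => g (z *m Q)) (y + x *m Q^T)).
      exact: (@BM_shift R N (x *m Q^T) (fun z => g (z *m Q)) (BM_mulmx QQT bg)).
    by apply/funext => y; rewrite mulmxDl -mulmxA QTQ mulmx1 addrC.
  congr (_ * _); rewrite /J -[LHS](Int_shift (x *m Q^T)).
    by apply: eq_Int => y; rewrite mulmxDl -mulmxA QTQ mulmx1 addrC.
  exact: BM_mulmx QQT bg.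
rewrite (Int_fubini b1).
transitivity (Int (fun y => Int (fun x => \1_E (x - y *m Q) * g x))).
  apply: eq_Int => y; rewrite -[RHS](Int_shift (y *m Q)).
    by apply: eq_Int => x; rewrite addrK.
  exact: BM2_section (BM2_swap b2).
rewrite -(Int_fubini b2) -IntZr//; apply: eq_Int => x.
rewrite IntZr; last first.
  have := BM_shift (- (x *m Q^T)) (BM_mulmx QQT bE).
  rewrite (_ : (fun y => _) = fun y => \1_E (x - y *m Q))//; apply/funext => y.
  rewrite mulmxDl mulNmx -mulmxA QTQ mulmx1 -[in LHS]opprB !indicE.
  by congr ((_ : bool)%:R); apply/idP/idP; rewrite !inE /E /= dotpNN.
rewrite mulrC; congr (_ * _).
have := Int_shift (- (x *m Q^T)) (BM_mulmx QQT bE); rewrite -/(J \1_E) => <-.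
apply: eq_Int => y; rewrite mulmxDl mulNmx -mulmxA QTQ mulmx1 -[in LHS]opprB !indicE.
by congr ((_ : bool)%:R); apply/idP/idP; rewrite !inE /E /= dotpNN.
Qed.

End orthogonal_invariance.

Lemma for_cst (T U : topologicalType) (x : T) (c : U) : continuous_at x (fun=> c).
Proof. exact: cvg_cst. Qed.

Lemma for_id (T : topologicalType) (x : T) : continuous_at x (fun y : T => y).
Proof. exact: cvg_id. Qed.

(** * Gradients and test functions *)

Section euclid.
Context {R : realType} {N : nat}.
Implicit Types (x y z d e : 'rV[R]_N).

Lemma dotpC x y : dotp x y = dotp y x.
Proof. by apply: eq_bigr => i _; rewrite mulrC. Qed.

Lemma dotpDl x y z : dotp (x + y) z = dotp x z + dotp y z.
Proof. by rewrite -big_split; apply: eq_bigr => i _; rewrite mxE mulrDl. Qed.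

Lemma dotpDr x y z : dotp z (x + y) = dotp z x + dotp z y.
Proof. by rewrite dotpC dotpDl !(dotpC z). Qed.

Lemma dotpZl c x y : dotp (c *: x) y = c * dotp x y.
Proof. by rewrite mulr_sumr; apply: eq_bigr => i _; rewrite mxE mulrA. Qed.

Lemma dotpZr c x y : dotp x (c *: y) = c * dotp x y.
Proof. by rewrite dotpC dotpZl dotpC. Qed.

Lemma dotpNl x y : dotp (- x) y = - dotp x y.
Proof. by rewrite -scaleN1r dotpZl mulN1r. Qed.

Lemma dotpNr x y : dotp x (- y) = - dotp x y.
Proof. by rewrite dotpC dotpNl dotpC. Qed.

Lemma dotpBl x y z : dotp (x - y) z = dotp x z - dotp y z.
Proof. by rewrite dotpDl dotpNl. Qed.

Lemma dotpBr x y z : dotp z (x - y) = dotp z x - dotp z y.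
Proof. by rewrite dotpDr dotpNr. Qed.

Lemma dotp0l x : dotp 0 x = 0.
Proof. by rewrite -[0](scale0r x) dotpZl mul0r. Qed.

Lemma dotp0r x : dotp x 0 = 0. Proof. by rewrite dotpC dotp0l. Qed.

Lemma dotp_ge0 x : 0 <= dotp x x.
Proof. by apply: sumr_ge0 => i _; rewrite -expr2 sqr_ge0. Qed.

Lemma dotp_delta x i : dotp x (delta_mx 0 i) = x 0 i.
Proof.
rewrite /dotp (bigD1 i)//= mxE !eqxx mulr1 big1 ?addr0// => j ji.
by rewrite mxE (negbTE ji) mulr0.
Qed.

Lemma enorm_ge0 x : 0 <= enorm x. Proof. exact: sqrtr_ge0. Qed.

Lemma enorm_sqr x : enorm x ^+ 2 = dotp x x.
Proof. by rewrite sqr_sqrtr// dotp_ge0. Qed.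

Lemma enorm0 : enorm (0 : 'rV[R]_N) = 0.
Proof. by rewrite /enorm dotp0l sqrtr0. Qed.

Lemma dotp_eq0 x : (dotp x x == 0) = (x == 0).
Proof.
apply/idP/idP => [|/eqP ->]; last by rewrite dotp0l.
rewrite psumr_eq0 => [/allP h|i _]; last by rewrite -expr2 sqr_ge0.
apply/eqP/rowP => i; have := h i (mem_index_enum _).
by rewrite /= -expr2 sqrf_eq0 mxE => /eqP.
Qed.

Lemma enorm_eq0 x : (enorm x == 0) = (x == 0).
Proof. by rewrite -dotp_eq0 -enorm_sqr sqrf_eq0. Qed.

Lemma enorm_gt0 x : (0 < enorm x) = (x != 0).
Proof. by rewrite lt_def enorm_eq0 enorm_ge0 andbT. Qed.

Lemma cauchy_schwarz_sqr x y : dotp x y ^+ 2 <= dotp x x * dotp y y.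
Proof.
have [->|y0] := eqVneq y 0; first by rewrite !dotp0r mulr0 expr0n.
have yy : 0 < dotp y y by rewrite lt_def dotp_eq0 y0 dotp_ge0.
have := dotp_ge0 (dotp y y *: x - dotp x y *: y).
rewrite !(dotpBl, dotpBr, dotpZl, dotpZr) (dotpC y x) => h.
rewrite -subr_ge0 -(pmulr_rge0 _ yy); apply: le_trans h _; rewrite le_eqVlt.
by apply/orP; left; apply/eqP; ring.
Qed.

Lemma cauchy_schwarz x y : `|dotp x y| <= enorm x * enorm y.
Proof.
rewrite -(@ler_pXn2r _ 2)// ?nnegrE ?mulr_ge0 ?enorm_ge0//.
by rewrite exprMn !enorm_sqr real_normK ?num_real// cauchy_schwarz_sqr.
Qed.

Lemma dotp_le x y : dotp x y <= enorm x * enorm y.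
Proof. exact: le_trans (ler_norm _) (cauchy_schwarz _ _). Qed.

Lemma enormZ c x : enorm (c *: x) = `|c| * enorm x.
Proof.
by rewrite /enorm dotpZl dotpZr mulrA sqrtrM ?sqrtr_sqr -?expr2 ?sqr_ge0// sqrtr_sqr.
Qed.

Lemma enormN x : enorm (- x) = enorm x.
Proof. by rewrite /enorm dotpNN. Qed.

Lemma enormB x y : enorm (x - y) = enorm (y - x).
Proof. by rewrite -enormN opprB. Qed.

Lemma enormD x y : enorm (x + y) <= enorm x + enorm y.
Proof.
rewrite -(@ler_pXn2r _ 2)// ?nnegrE ?addr_ge0 ?enorm_ge0//.
rewrite enorm_sqr !(dotpDl, dotpDr) (dotpC y x) -!enorm_sqr sqrrD.
have := dotp_le x y; lra.
Qed.

Lemma ler_enormB x y : `|enorm x - enorm y| <= enorm (x - y).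
Proof.
rewrite ler_norml; apply/andP; split.
  by have := enormD (y - x) x; rewrite subrK enormB; lra.
by have := enormD (x - y) y; rewrite subrK; lra.
Qed.

Lemma coord_le_enorm x i : `|x 0 i| <= enorm x.
Proof.
rewrite -(@ler_pXn2r _ 2)// ?nnegrE ?enorm_ge0// enorm_sqr real_normK ?num_real//.
by rewrite /dotp (bigD1 i)//= -expr2 lerDl sumr_ge0// => j _; rewrite -expr2 sqr_ge0.
Qed.

Lemma norm_le_enorm x : `|x| <= enorm x.
Proof. by apply/rV_normP; [exact: enorm_ge0|exact: coord_le_enorm]. Qed.

Lemma enorm_le_norm x : enorm x <= N%:R * `|x|.
Proof.
have h : 0 <= N%:R * `|x| by rewrite mulr_ge0.
rewrite -(@ler_pXn2r _ 2)// ?nnegrE ?enorm_ge0// enorm_sqr.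
have h1 : dotp x x <= N%:R * `|x| ^+ 2.
  apply: (@le_trans _ _ (\sum_(i < N) `|x| ^+ 2)).
    apply: ler_sum => i _; rewrite -expr2 -real_normK ?num_real//.
    by rewrite ler_pXn2r ?nnegrE// rV_coord_le.
  by rewrite sumr_const card_ord mulr_natl.
apply: le_trans h1 _; rewrite exprMn ler_wpM2r ?sqr_ge0//.
by rewrite -natrX ler_nat; case: (N) => // n; rewrite expnS leq_pmulr.
Qed.

Lemma dotp_norm_le x y : `|dotp x y| <= N%:R ^+ 2 * (`|x| * `|y|).
Proof.
apply: le_trans (cauchy_schwarz _ _) _.
rewrite (_ : _ * _ = (N%:R * `|x|) * (N%:R * `|y|)); last by ring.
by apply: ler_pM; rewrite ?enorm_ge0 ?enorm_le_norm.
Qed.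

Fact dotp_is_linear d : linear (dotp d : 'rV[R]_N -> R^o).
Proof. by move=> c x y; rewrite dotpDr dotpZr. Qed.
HB.instance Definition _ d :=
  GRing.isLinear.Build R 'rV[R]_N R^o _ (dotp d : 'rV[R]_N -> R^o) (dotp_is_linear d).

Lemma rV_continuousP (T : topologicalType) (t : T) (F : T -> 'rV[R]_N) :
  (forall i, continuous_at t (fun s => F s 0 i)) -> continuous_at t F.
Proof.
move=> h; apply/cvgrPdist_lt => e e0.
have : \forall s \near t, forall i, `|F t 0 i - F s 0 i| < e.
  apply: filter_forall => i; have /cvgrPdist_lt := h i; exact.
apply: filterS => s hs; apply/rV_norm_ltP => // i.
by rewrite !mxE; exact: hs.
Qed.

Lemma continuous_coord (T : topologicalType) (t : T) (F : T -> 'rV[R]_N) i :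
  continuous_at t F -> continuous_at t (fun s => F s 0 i).
Proof.
move=> h; apply: (@continuous_comp T 'rV[R]_N R F (fun x : 'rV[R]_N => x 0 i)) => //.
exact: coord_continuous.
Qed.

Lemma continuous_rvD (T : topologicalType) (t : T) (F G : T -> 'rV[R]_N) :
  continuous_at t F -> continuous_at t G -> continuous_at t (fun s => F s + G s).
Proof.
move=> hF hG; apply: rV_continuousP => i.
rewrite (_ : (fun s => _) = fun s => F s 0 i + G s 0 i).
  by apply: continuousD; exact: continuous_coord.
by apply/funext => s; rewrite mxE.
Qed.

Lemma continuous_rvZ (T : topologicalType) (t : T) (a : T -> R) (F : T -> 'rV[R]_N) :
  continuous_at t a -> continuous_at t F -> continuous_at t (fun s => a s *: F s).
Proof.
move=> ha hF; apply: rV_continuousP => i.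
rewrite (_ : (fun s => _) = fun s => a s * F s 0 i).
  by apply: continuousM => //; exact: continuous_coord.
by apply/funext => s; rewrite mxE.
Qed.

Lemma continuous_rvN (T : topologicalType) (t : T) (F : T -> 'rV[R]_N) :
  continuous_at t F -> continuous_at t (fun s => - F s).
Proof.
move=> hF; rewrite (_ : (fun s => _) = fun s => -1 *: F s).
  by apply: continuous_rvZ => //; exact: for_cst.
by apply/funext => s; rewrite scaleN1r.
Qed.

Lemma continuous_rvB (T : topologicalType) (t : T) (F G : T -> 'rV[R]_N) :
  continuous_at t F -> continuous_at t G -> continuous_at t (fun s => F s - G s).
Proof. by move=> hF hG; apply: continuous_rvD => //; exact: continuous_rvN. Qed.

Lemma continuous_dotp (T : topologicalType) (t : T) (F G : T -> 'rV[R]_N) :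
  continuous_at t F -> continuous_at t G ->
  continuous_at t (fun s => dotp (F s) (G s)).
Proof.
move=> hF hG; apply: continuous_sumr => i.
by apply: continuousM; exact: continuous_coord.
Qed.

Lemma continuous_enorm (T : topologicalType) (t : T) (F : T -> 'rV[R]_N) :
  continuous_at t F -> continuous_at t (fun s => enorm (F s)).
Proof.
move=> hF; apply: (@continuous_comp T R R (fun s => dotp (F s) (F s)) Num.sqrt).
  exact: continuous_dotp.
exact: sqrt_continuous.
Qed.

End euclid.

Lemma is_diff_eps (R : realType) (V W : normedModType R) (f : V -> W)
    (df : {linear V -> W}) (x : V) : continuous df ->
  (forall e : R, 0 < e -> \forall h \near (0 : V), `|f (h + x) - (f x + df h)| <= e * `|h|) ->
  is_diff x f df.
Proof.
move=> c H.
have E : f \o shift x = cst (f x) + df +o_ 0 id.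
  apply/eqaddoP => e e0; have := H _ e0; apply: filterS => y hy.
  exact: hy.
have U := diff_unique c E; apply: DiffDef => //.
by apply/diff_locallyP; rewrite U.
Qed.

Section gradient.
Context {R : realType} {N : nat}.
Implicit Types (x y z d e : 'rV[R]_N) (g h : 'rV[R]_N -> R).

(** A relation between the function and its gradient rather than an equation with [grad]: the field
    of gradients of a solution can then be prolonged to the boundary of the domain, where the
    solution itself is not differentiable. *)
Definition is_grad g x d := is_diff x g (dotp d).

Lemma is_gradP g x d : (forall e : R, 0 < e ->
    \forall h \near (0 : 'rV[R]_N), `|g (h + x) - (g x + dotp d h)| <= e * `|h|) -> is_grad g x d.
Proof.
move=> H.
have c : continuous (dotp d).
  by move=> y; apply: (@continuous_dotp _ _ 'rV[R]_N y (fun=> d) id); [exact: for_cst|exact: for_id].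
exact: (@is_diff_eps R 'rV[R]_N R^o g (dotp d) x c H).
Qed.

Lemma is_grad_derive g x d z : is_grad g x d -> is_derive x z g (dotp d z).
Proof.
move=> [dg dE]; apply: DeriveDef; first exact: diff_derivable.
by rewrite deriveE// dE.
Qed.

Lemma is_grad_partial g x d i : is_grad g x d -> partial i g x = d 0 i.
Proof.
by move=> /(is_grad_derive (delta_mx 0 i)) h; rewrite /partial derive_val dotp_delta.
Qed.

Lemma is_grad_grad g x d : is_grad g x d -> grad g x = d.
Proof. by move=> h; apply/rowP => i; rewrite mxE (is_grad_partial i h). Qed.

Lemma is_grad_unique g x d e : is_grad g x d -> is_grad g x e -> d = e.
Proof. by move=> /is_grad_grad <- /is_grad_grad. Qed.

Lemma is_grad_continuous g x d : is_grad g x d -> continuous_at x g.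
Proof. by move=> [dg _]; exact: differentiable_continuous. Qed.

Lemma is_grad_cst c x : is_grad (fun=> c) x 0.
Proof.
apply: (is_diff_eq (is_diff_cst (c : R^o) x)).
by apply/funext => y; rewrite dotp0l.
Qed.

Lemma is_gradD g h x d e : is_grad g x d -> is_grad h x e ->
  is_grad (fun y => g y + h y) x (d + e).
Proof.
move=> dg dh; apply: (is_diff_eq (is_diffD dg dh)).
by apply/funext => y; rewrite dotpDl.
Qed.

Lemma is_gradZ c g x d : is_grad g x d -> is_grad (fun y => c * g y) x (c *: d).
Proof.
move=> dg; apply: (@is_diff_eq _ _ _ _ (c *: dotp d)); first exact: is_diffZ.
by apply/funext => y; rewrite dotpZl.
Qed.

Lemma is_gradN g x d : is_grad g x d -> is_grad (fun y => - g y) x (- d).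
Proof.
move=> dg; rewrite -scaleN1r (_ : (fun y => _) = (fun y => -1 * g y)).
  exact: is_gradZ.
by apply/funext => y; rewrite mulN1r.
Qed.

Lemma is_gradB g h x d e : is_grad g x d -> is_grad h x e ->
  is_grad (fun y => g y - h y) x (d - e).
Proof. by move=> dg dh; apply: is_gradD => //; exact: is_gradN. Qed.

Lemma is_gradM g h x d e : is_grad g x d -> is_grad h x e ->
  is_grad (fun y => g y * h y) x (g x *: e + h x *: d).
Proof.
move=> dg dh; have D := is_diffM dg dh; apply: (is_diff_eq D).
by apply/funext => y; rewrite dotpDl !dotpZl.
Qed.

Lemma is_grad_sum (I : Type) (s : seq I) (F : I -> 'rV[R]_N -> R) x (D : I -> 'rV[R]_N) :
  (forall i, is_grad (F i) x (D i)) ->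
  is_grad (fun y => \sum_(i <- s) F i y) x (\sum_(i <- s) D i).
Proof.
move=> h; elim: s => [|i s IH].
  by rewrite big_nil; under eq_fun do rewrite big_nil; exact: is_grad_cst.
by rewrite big_cons; under eq_fun do rewrite big_cons; exact: is_gradD.
Qed.

Lemma is_grad_comp (f : R -> R) g x d c : is_grad g x d -> is_derive (g x) (1 : R) f c ->
  is_grad (fun y => f (g y)) x (c *: d).
Proof.
move=> dg [df fc]; have dff : is_diff (g x) f ( *:%R^~ c).
  by apply: DiffDef; [exact/derivable1_diffP|rewrite deriv1E// derive1E fc].
apply: (@is_diff_eq _ _ _ _ ( *:%R^~ c \o dotp d)); first exact: is_diff_comp.
by apply/funext => y /=; rewrite dotpZl mulrC.
Qed.

Lemma is_grad_coord i x : is_grad (fun y => y 0 i) x (delta_mx 0 i).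
Proof.
apply: is_gradP => e e0; apply: (@nearW _ (nbhs (0 : 'rV[R]_N))) => y.
by rewrite dotpC dotp_delta mxE addrC subrr normr0 mulr_ge0// ltW.
Qed.

(** Vectors are rows, so the chain rule multiplies the gradient on the right by the transpose. *)
Lemma is_grad_affine g x (A : 'M[R]_N) b d : is_grad g (x *m A + b) d ->
  is_grad (fun y => g (y *m A + b)) x (d *m A^T).
Proof.
move=> dg; have dA : is_diff x (fun y : 'rV[R]_N => y *m A + b) (fun y => y *m A).
  have cA : continuous (fun y : 'rV[R]_N => y *m A).
    move=> y; apply: rV_continuousP => i.
    rewrite (_ : (fun s => _) = fun s : 'rV[R]_N => \sum_j s 0 j * A j i); last first.
      by apply/funext => s; rewrite mxE.
    apply: continuous_sumr => j.
    apply: continuousM; [exact: (@coord_continuous R 1 N 0 j y)|exact: for_cst].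
  apply: (@is_diff_eps R 'rV[R]_N 'rV[R]_N _ (mulmxr A) x cA) => e e0.
  apply: (@nearW _ (nbhs (0 : 'rV[R]_N))) => y /=.
  rewrite mulmxDl (_ : _ - _ = 0) ?normr0 ?mulr_ge0 ?(ltW e0)//.
  by apply/eqP; rewrite subr_eq0 -addrA addrC.
apply: (@is_diff_eq _ _ _ _ (dotp d \o (fun y => y *m A))); first exact: is_diff_comp.
by apply/funext => y /=; rewrite !dotpE !trmx_mul mulmxA.
Qed.

Lemma is_grad_shift g x b d : is_grad g (x + b) d -> is_grad (fun y => g (y + b)) x d.
Proof.
move=> h; have := @is_grad_affine g x 1%:M b d.
rewrite mulmx1 trmx1 mulmx1 => /(_ h).
by congr is_grad; apply/funext => y; rewrite mulmx1.
Qed.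

Lemma is_grad_near g h x d : (\forall y \near x, g y = h y) -> is_grad g x d -> is_grad h x d.
Proof.
move=> gh [dg dE]; apply: is_gradP => e e0.
have ghx : g x = h x by exact: nbhs_singleton gh.
have gh0 : \forall y \near (0 : 'rV[R]_N), g (y + x) = h (y + x).
  by move: gh; rewrite (near_shift 0) subr0; apply: filterS => y /=.
have /diff_locally/eqaddoP/(_ _ e0) := dg; rewrite dE => H.
near=> y; rewrite -ghx.
have <- : g (y + x) = h (y + x) by near: y.
by near: y.
Unshelve. all: by end_near. Qed.

Lemma is_derive_dir g x z t c : is_derive (x + t *: z) z g c ->
  is_derive t (1 : R) (fun s => g (x + s *: z)) c.
Proof.
move=> -[]; rewrite /derivable /derive => h1 h2.
have E : (fun h : R => h^-1 *: (g (x + (h *: (1 : R) + t) *: z) - g (x + t *: z))) =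
   (fun h : R => h^-1 *: (g (h *: z + (x + t *: z)) - g (x + t *: z))).
  apply/funext => s; congr (_ *: (g _ - _)).
  by rewrite [s *: 1]mulr1 scalerDl addrCA.
by apply: DeriveDef; rewrite /derivable /derive /= E.
Qed.

Lemma is_derive_line g x z t d : is_grad g (x + t *: z) d ->
  is_derive t (1 : R) (fun s => g (x + s *: z)) (dotp d z).
Proof. by move=> /(is_grad_derive z); exact: is_derive_dir. Qed.

Lemma mvt_line g (dg : 'rV[R]_N -> 'rV[R]_N) x z :
  (forall t, t \in `]0, 1[ -> is_grad g (x + t *: z) (dg (x + t *: z))) ->
  (forall t, t \in `[0, 1] -> continuous_at (x + t *: z) g) ->
  exists2 t : R, t \in `]0, 1[ & g (x + z) - g x = dotp (dg (x + t *: z)) z.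
Proof.
move=> H C.
have [||t t01] := @MVT R (fun s => g (x + s *: z)) (fun s => dotp (dg (x + s *: z)) z) 0 1 ltr01.
- by move=> t /H; exact: is_derive_line.
- apply: continuous_in_subspaceT => t; rewrite inE /= => /C Ct.
  apply: (@continuous_comp R 'rV[R]_N R (fun s : R => x + s *: z) g) => //.
  apply: continuousD; first exact: cvg_cst.
  exact: scalel_continuous.
by rewrite scale1r scale0r addr0 subr0 mulr1 => ->; exists t.
Qed.

End gradient.

(** * Compactly supported functions and integration by parts *)

Section compact_support.
Context {R : realType} {N : nat}.
Implicit Types (x y z d : 'rV[R]_N) (g h phi : 'rV[R]_N -> R) (K U : set 'rV[R]_N)
  (dphi : 'rV[R]_N -> 'rV[R]_N).

(** The common form of the compactness arguments below: a property that holds around each point of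
    [K] for all small parameters [s] holds on all of [K] below one threshold. Moduli of continuity,
    upper bounds and positive lower bounds are all obtained by a choice of [P]. *)
Lemma compact_unif K (P : R -> 'rV[R]_N -> Prop) : compact K ->
  (forall x, K x -> exists2 r : R, 0 < r &
     forall y, `|x - y| < r -> forall s, 0 < s < r -> P s y) ->
  exists2 r : R, 0 < r & forall s, 0 < s < r -> forall y, K y -> P s y.
Proof.
move=> /compact_near_coveringP cK h.
have := cK R (0 : R)^'+ P _ => /(_ _).
case=> [x Kx|r /= r0 H].
  have [r r0 hr] := h x Kx.
  exists (ball x r, [set s | 0 < s < r]) => /=; last first.
    by move=> [y s] [/= xy sr]; apply: hr => //; move: xy; rewrite -ball_normE.
  split; first exact: nbhsx_ballx.
  by apply: filterS2 (nbhs_right_gt 0) (nbhs_right_lt r0) => s /= -> ->.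
exists r => // s /andP[s0 sr] y Ky.
have := H s; rewrite /= sub0r normrN gtr0_norm//; exact.
Qed.

Lemma compact_fat K U : compact K -> open U -> K `<=` U ->
  exists2 r : R, 0 < r & forall x z, K x -> `|z| < r -> U (x + z).
Proof.
move=> cK oU KU.
have [|r r0 H] := compact_unif (P := fun s y => forall z, `|z| < s -> U (y + z)) cK.
  move=> x Kx; have /nbhs_ballP[e /= e0 eU] : nbhs x U by apply: open_nbhs_nbhs; split => //; exact: KU.
  exists (e / 2); first by rewrite divr_gt0.
  move=> y xy s /andP[s0 se] z zs; apply: eU; rewrite -ball_normE /=.
  rewrite opprD addrA; apply: le_lt_trans (ler_normB _ _) _.
  by rewrite [e]splitr ltrD// (lt_trans zs).
exists (r / 2); first by rewrite divr_gt0.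
move=> x z Kx zr; apply: (H (r / 2)) => //.
by rewrite divr_gt0//= ltr_pdivrMr// ltr_pMr// ltr1n.
Qed.

Lemma compact_bound K : compact K -> exists2 M : R, 0 < M & forall x, K x -> `|x| <= M.
Proof.
move=> /compact_bounded [M [_ HM]]; exists (`|M| + 1); first by rewrite ltr_pwDr.
by move=> x Kx; apply: HM => //; apply: le_lt_trans (ler_norm _) _; rewrite ltrDl.
Qed.

Lemma compact_box (M : R) : compact (box M : set 'rV[R]_N).
Proof.
apply: bounded_closed_compact; last exact: closed_box.
exists `|M|; split; first exact: num_real.
by move=> K MK x Mx; apply: le_trans Mx _; apply: le_trans (ler_norm _) (ltW MK).
Qed.

Lemma compact_closed_bounded K (M : R) : closed K -> (forall x, K x -> `|x| <= M) -> compact K.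
Proof. by move=> cK KM; exact: (subclosed_compact cK (@compact_box M)). Qed.

Lemma compact_closed_rV K : compact K -> closed K.
Proof. exact: compact_closed (@norm_hausdorff R _). Qed.

Lemma nbhs_compactC K x : compact K -> ~ K x -> nbhs x (~` K).
Proof.
move=> cK nK; apply: open_nbhs_nbhs; split => //.
by apply: closed_openC; exact: compact_closed_rV.
Qed.

Definition CC g := continuous g /\ exists M : R, forall x, g x != 0 -> `|x| <= M.

Lemma continuous_bounded g K : compact K -> {within K, continuous g} ->
  exists2 M : R, 0 < M & forall x, K x -> `|g x| <= M.
Proof.
move=> cK cg; have /compact_bounded [M [_ HM]] := continuous_compact cg cK.
exists (`|M| + 1); first by rewrite ltr_pwDr.
move=> x Kx; apply: (HM (`|M| + 1)); last by exists x.
by apply: le_lt_trans (ler_norm _) _; rewrite ltrDl.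
Qed.

Lemma CC_BM g : CC g -> BM g.
Proof.
move=> [cg [M HM]]; split; first exact: mfun_cont.
have [L L0 HL] := continuous_bounded (@compact_box M) (continuous_subspaceT cg).
exists (Num.max L M) => x; rewrite !le_max.
have [->|gx] := eqVneq (g x) 0; first by rewrite normr0 ltW.
by have h := HM _ gx; rewrite HL// h orbT.
Qed.

Lemma CC_on K U g : open U -> compact K -> K `<=` U ->
  (forall x, U x -> continuous_at x g) -> (forall x, ~ K x -> g x = 0) -> CC g.
Proof.
move=> oU cK KU cg g0; split.
  move=> x; have [/KU Kx|nK] := pselect (K x); first exact: cg.
  have h : \forall y \near x, cst 0 y = g y.
    by apply: filterS (nbhs_compactC cK nK) => y /g0 ->.
  rewrite /continuous_at g0//.
  exact: cvg_trans (near_eq_cvg h) (cvg_cst 0).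
have [M M0 HM] := compact_bound cK.
exists M => x gx; apply: HM; apply: contrapT => /g0 /eqP; exact/negP.
Qed.

Lemma CC_unif g : CC g -> forall e : R, 0 < e -> exists2 r : R, 0 < r &
  forall x y, `|x - y| < r -> `|g x - g y| < e.
Proof.
move=> [cg [M HM]] e e0; pose P s x := forall y, `|x - y| < s -> `|g x - g y| < e.
have [x _|r r0 H] := compact_unif (P := P) (@compact_box (`|M| + 1)).
  have e20 : 0 < e / 2 by rewrite divr_gt0.
  have /cvgrPdist_lt /(_ _ e20) /nbhs_ballP[r /= r0 hr] := cg x.
  exists (r / 2); first by rewrite divr_gt0.
  move=> y xy s /andP[s0 sr] z yz.
  rewrite (_ : g y - g z = (g x - g z) - (g x - g y)); last by ring.
  apply: le_lt_trans (ler_normB _ _) _; rewrite [e]splitr; apply: ltrD; apply: hr.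
    rewrite -ball_normE /= (_ : x - z = (x - y) + (y - z)); last by rewrite addrA subrK.
    apply: le_lt_trans (ler_normD _ _) _.
    by rewrite [r]splitr ltrD// (lt_trans yz).
  rewrite -ball_normE /=; apply: lt_trans xy _.
  by rewrite ltr_pdivrMr// ltr_pMr// ltr1n.
exists (Num.min (r / 2) 1); first by rewrite lt_min divr_gt0//=.
move=> x y; rewrite lt_min => /andP[xy xy1].
have [xM|xM] := boolP (`|x| <= `|M| + 1).
  apply: (H (r / 2)) => //.
  by rewrite divr_gt0//= ltr_pdivrMr// ltr_pMr// ltr1n.
have gx : g x = 0.
  apply/eqP; apply: contraNT xM => /HM h; apply: le_trans h _.
  by apply: le_trans (ler_norm _) _; rewrite lerDl.
have gy : g y = 0.
  apply/eqP; apply: contraNT xM => /HM h.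
  rewrite -[x](subrK y); apply: le_trans (ler_normD _ _) _.
  by rewrite addrC lerD ?(ltW xy1)//; apply: le_trans h (ler_norm _).
by rewrite gx gy subrr normr0.
Qed.

(** Test functions of class C^1, carried together with their gradient. The compact set is any set
    off which both vanish, not the support, which saves computing closures. *)
Definition tst U phi dphi := [/\ forall x, is_grad phi x (dphi x), continuous dphi &
  exists2 K, compact K & K `<=` U /\ forall x, ~ K x -> phi x = 0 /\ dphi x = 0].

(** Extension by zero. A function that is C^1 on an open set and vanishes there off a compact set
    becomes C^1 on the whole space; test functions built from a solution are obtained in this
    way. *)
Definition cut K (V : nmodType) (f : 'rV[R]_N -> V) x : V := if asbool (K x) then f x else 0.

Lemma cut_in K (V : nmodType) (f : 'rV[R]_N -> V) x : K x -> cut K f x = f x.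
Proof. by rewrite /cut; case: asboolP. Qed.

Lemma cut_out K (V : nmodType) (f : 'rV[R]_N -> V) x : ~ K x -> cut K f x = 0.
Proof. by rewrite /cut; case: asboolP. Qed.

Lemma cut_eq K U (V : nmodType) (f : 'rV[R]_N -> V) x :
  (forall x, U x -> ~ K x -> f x = 0) -> U x -> cut K f x = f x.
Proof. by move=> f0 Ux; rewrite /cut; case: asboolP => // /(f0 _ Ux) ->. Qed.

Lemma cut_continuous K U (V : normedModType R) (f : 'rV[R]_N -> V) :
  open U -> compact K -> K `<=` U ->
  (forall x, U x -> continuous_at x f) ->
  (forall x, U x -> ~ K x -> f x = 0) -> continuous (cut K f).
Proof.
move=> oU cK KU cf f0 x.
have [/KU Kx|nK] := pselect (K x).
  have h : \forall y \near x, f y = cut K f y.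
    have : nbhs x U by exact: open_nbhs_nbhs.
    by apply: filterS => y Uy; rewrite (cut_eq f0 Uy).
  rewrite /continuous_at (cut_eq f0)//.
  by apply: cvg_trans (near_eq_cvg h) (cf _ Kx).
have h : \forall y \near x, cst 0 y = cut K f y.
  by apply: filterS (nbhs_compactC cK nK) => y Ky; rewrite cut_out.
rewrite /continuous_at cut_out//.
exact: cvg_trans (near_eq_cvg h) (cvg_cst 0).
Qed.

Lemma tst_cut K U phi dphi : open U -> compact K -> K `<=` U ->
  (forall x, U x -> is_grad phi x (dphi x)) ->
  (forall x, U x -> continuous_at x dphi) ->
  (forall x, U x -> ~ K x -> phi x = 0 /\ dphi x = 0) ->
  tst U (cut K phi) (cut K dphi).
Proof.
move=> oU cK KU gphi cphi p0; split; last first.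
- by exists K => //; split => // x nK; rewrite !cut_out.
- by apply: (cut_continuous (U := U)) => // x Ux /(p0 _ Ux) [].
move=> x; have [/KU Kx|nK] := pselect (K x).
  rewrite (cut_eq (U := U))// => [|y Uy /(p0 _ Uy) []//].
  apply: (is_grad_near _ (gphi _ Kx)).
  have : nbhs x U by exact: open_nbhs_nbhs.
  by apply: filterS => y Uy; rewrite (cut_eq (U := U))// => z Uz /(p0 _ Uz) [].
rewrite [cut K dphi x]cut_out//.
apply: (is_grad_near _ (is_grad_cst 0 x)).
by apply: filterS (nbhs_compactC cK nK) => y Ky; rewrite cut_out.
Qed.

Lemma tst_sub U W phi dphi : U `<=` W -> tst U phi dphi -> tst W phi dphi.
Proof.
by move=> UW [h1 h2 [K cK [KU K0]]]; split => //; exists K => //; split => // x /KU /UW.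
Qed.

Lemma tst_CC U phi dphi : tst U phi dphi -> CC phi.
Proof.
move=> [h1 _ [K cK [KU K0]]]; apply: (CC_on (U := setT) (K := K)) => //.
- exact: openT.
- by move=> x _; exact: is_grad_continuous (h1 x).
- by move=> x /K0 [].
Qed.

Lemma tst_CC_dot U phi dphi (F : 'rV[R]_N -> 'rV[R]_N) : open U -> tst U phi dphi ->
  (forall x, U x -> continuous_at x F) -> CC (fun x => dotp (F x) (dphi x)).
Proof.
move=> oU [_ h2 [K cK [KU K0]]] cF; apply: (CC_on (U := U) (K := K)) => //.
  by move=> x Ux; apply: continuous_dotp; [exact: cF|exact: h2].
by move=> x /K0 [_ ->]; rewrite dotp0r.
Qed.

Lemma tst_CC_mul U phi dphi h : open U -> tst U phi dphi ->
  (forall x, U x -> continuous_at x h) -> CC (fun x => h x * phi x).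
Proof.
move=> oU t ch; have [h1 h2 [K cK [KU K0]]] := t.
apply: (CC_on (U := U) (K := K)) => //.
  by move=> x Ux; apply: continuousM; [exact: ch|exact: is_grad_continuous (h1 x)].
by move=> x /K0 [-> _]; rewrite mulr0.
Qed.

Lemma tst_CC_coord U phi dphi i : tst U phi dphi -> CC (fun x => dphi x 0 i).
Proof.
move=> [_ h2 [K cK [KU K0]]]; apply: (CC_on (U := setT) (K := K)) => //.
- exact: openT.
- by move=> x _; apply: continuous_coord; exact: h2.
- by move=> x /K0 [_ ->]; rewrite mxE.
Qed.

(** The difference quotients with increment 1/(k+1) have integral 0 by translation invariance, and
    they converge dominatedly. All integration by parts in the proof goes back to this. *)
Lemma Int_partial0 U phi dphi i : tst U phi dphi -> Int (fun x => dphi x 0 i) = 0.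
Proof.
move=> t; have CCd := tst_CC_coord i t; have CCp := tst_CC t.
have [L HL] := BM_bounded (CC_BM CCd).
have [gphi _ [K cK [KU K0]]] := t.
have [M M0 HM] := compact_bound cK.
pose e : 'rV[R]_N := delta_mx 0 i.
pose s k : R := (k.+1%:R)^-1.
have s0 k : 0 < s k by rewrite invr_gt0.
have s1 k : s k <= 1 by rewrite /s invf_le1 ?ltr0n// ler1n.
pose F k x := (s k)^-1 * (phi (x + s k *: e) - phi x).
have bshift k : BM (fun x => phi (x + s k *: e)) by exact: BM_shift (CC_BM CCp).
have F0 k : Int (F k) = 0.
  by rewrite IntZ ?IntB ?Int_shift ?subrr ?mulr0//; [exact: CC_BM|exact: CC_BM|exact: BMB (CC_BM _)].
have FL k x : `|F k x| <= L.
  have [||c _ hc] := @mvt_line R N phi dphi x (s k *: e).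
  - by move=> r _; exact: gphi.
  - by move=> r _; exact: is_grad_continuous (gphi _).
  rewrite /F hc dotpZr dotp_delta mulrA mulVf ?mul1r ?gt_eqF//; exact: HL.
have ne : `|e| <= 1.
  apply/rV_normP => // j; rewrite mxE; case: (_ && _); rewrite ?normr1 ?normr0//.
have FM k x : F k x != 0 -> `|x| <= M + 1.
  have [Kx _|/K0 [px _]] := pselect (K x).
    by apply: le_trans (HM _ Kx) _; rewrite lerDl.
  have [Kx _|/K0 [px' _]] := pselect (K (x + s k *: e)); last first.
    by rewrite /F px px' subrr mulr0 eqxx.
  rewrite -[x](addrK (s k *: e)); apply: le_trans (ler_normB _ _) _.
  apply: lerD; first exact: HM.
  by rewrite normrZ gtr0_norm//; apply: mulr_ile1 => //; exact: ltW.
have L0 : 0 <= L by exact: le_trans (HL 0).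
have := @Int_dct R N F (fun x => dphi x 0 i) (Num.max L (M + 1)).
have -> : Int \o F = fun=> 0 by apply/funext => k /=; rewrite F0.
move=> H; suff cv : (fun=> 0 : R) @ \oo --> Int (fun x => dphi x 0 i).
  exact: (@cvg_unique _ (@norm_hausdorff R R^o) _ _ _ _ cv (cvg_cst 0)).
apply: H.
- move=> k; apply: BM_mfun; apply: BM_scale.
  exact: (BMB (bshift k) (CC_BM CCp)).
- exact: BM_mfun (CC_BM CCd).
- by move=> k x; rewrite le_max FL.
- by move=> k x /FM h; rewrite le_max h orbT.
move=> x; have [h1 h2] := is_grad_derive e (gphi x).
rewrite dotp_delta in h2.
have h3 : (fun r : R => r^-1 *: ((phi \o shift x) (r *: e) - phi x)) @ 0^' --> dphi x 0 i.
  by rewrite -h2; exact: h1.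
have /cvgr_dnbhsP/(_ s) := h3.
have cs : s @ \oo --> 0 by exact: cvg_harmonic.
move=> /(_ (conj (fun k => lt0r_neq0 (s0 k)) cs)).
rewrite (_ : (fun k => _) = F ^~ x)//; apply/funext => k.
by rewrite /F [x + _]addrC.
Qed.

End compact_support.

Lemma near_forall (T : topologicalType) (I : finType) (x : T) (P : I -> T -> Prop) :
  (forall i, \forall y \near x, P i y) -> \forall y \near x, forall i, P i y.
Proof. by move=> h; apply: filter_forall. Qed.

Lemma continuous_prodr (R : realType) (T : topologicalType) (x : T) (I : Type) (s : seq I)
    (f : I -> T -> R) : (forall i, continuous_at x (f i)) ->
  continuous_at x (fun y => \prod_(i <- s) f i y).
Proof.
move=> h; elim: s => [|i s IH].
  rewrite (_ : (fun y => _) = fun=> 1); first exact: for_cst.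
  by apply/funext => y; rewrite big_nil.
rewrite (_ : (fun y => _) = fun y => f i y * \prod_(j <- s) f j y).
  by apply: continuousM; [exact: h|exact: IH].
by apply/funext => y; rewrite big_cons.
Qed.

(** * Functions of class C^1 and smooth products *)

Section C1_functions.
Context {R : realType} {N : nat}.
Implicit Types (x y z : 'rV[R]_N) (g : 'rV[R]_N -> R) (U : set 'rV[R]_N).

Lemma mvt_delta g x i (c : R) :
  (forall t, `|t| <= `|c| -> derivable g (x + t *: delta_mx 0 i) (delta_mx 0 i)) ->
  exists2 t : R, `|t| <= `|c| &
    g (x + c *: delta_mx 0 i) - g x = partial i g (x + t *: delta_mx 0 i) * c.
Proof.
move=> H; set e : 'rV[R]_N := delta_mx 0 i.
have h t : `|t| <= `|c| -> is_derive t (1 : R) (fun s => g (x + s *: e)) (partial i g (x + t *: e)).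
  by move=> /H /derivableP; exact: is_derive_dir.
have [c0|c0|->] := ltgtP c 0; last first.
- by exists 0; rewrite ?mulr0 ?scale0r ?addr0 ?subrr.
- have [||t t0c] := @MVT R (fun s => g (x + s *: e)) (fun t => partial i g (x + t *: e)) 0 c c0.
  + move=> t; rewrite in_itv /= => /andP[t0 tc]; apply: h.
    by rewrite !gtr0_norm// ltW.
  + apply: derivable_within_continuous => t; rewrite in_itv /= => /andP[t0 tc].
    by apply: (@ex_derive _ _ _ _ _ _ _ (h t _)); rewrite ger0_norm// gtr0_norm.
  move: t0c; rewrite in_itv /= => /andP[t0 tc].
  rewrite scale0r addr0 subr0 => E; exists t => //.
  by rewrite !gtr0_norm// ltW.
- have [||t t0c] := @MVT R (fun s => g (x + s *: e)) (fun t => partial i g (x + t *: e)) c 0 c0.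
  + move=> t; rewrite in_itv /= => /andP[t0 tc]; apply: h.
    by rewrite !ltr0_norm// lerN2 ltW.
  + apply: derivable_within_continuous => t; rewrite in_itv /= => /andP[t0 tc].
    by apply: (@ex_derive _ _ _ _ _ _ _ (h t _)); rewrite ler0_norm// ltr0_norm// lerN2.
  move: t0c; rewrite in_itv /= => /andP[t0 tc].
  rewrite scale0r addr0 sub0r mulrN => E; exists t => //.
    by rewrite !ltr0_norm// lerN2 ltW.
  by rewrite -[LHS]opprB E opprK.
Qed.

(** [class_C] speaks of partial derivatives only; continuity of these makes the function
    differentiable. *)
Lemma partials_grad U g : open U ->
  (forall i x, U x -> derivable g x (delta_mx 0 i)) ->
  (forall i x, U x -> continuous_at x (partial i g)) ->
  forall x, U x -> is_grad g x (grad g x).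
Proof.
move=> oU dg cg x Ux; apply: is_gradP => e e0.
pose e' := e / N.+1%:R; have e'0 : 0 < e' by rewrite divr_gt0.
have [r1 /= r10 HU] : \forall y \near x, U y by exact: open_nbhs_nbhs.
have : \forall y \near x, forall i, `|partial i g x - partial i g y| < e'.
  have F i : \forall y \near x, `|partial i g x - partial i g y| < e'.
    by have /cvgrPdist_lt/(_ _ e'0) := cg i x Ux.
  exact: (near_forall F).
move=> /nbhs_ballP[r2 /= r20 Hc].
have [r1' /= r10' HU'] : exists2 r, 0 < r & ball x r `<=` U by apply/nbhs_ballP; exact: open_nbhs_nbhs.
pose r := Num.min r1' r2; have r0 : 0 < r by rewrite lt_min r10'.
apply/nbhs_ballP; exists r => //= h; rewrite -ball_normE /= sub0r normrN => hr.
(* The path from 0 to [h] that switches on one coordinate at a time, so that each step involves a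
   single partial derivative. *)
pose hk (k : nat) : 'rV[R]_N := \row_i (if (i < k)%N then h 0 i else 0).
have hkS (k : 'I_N) : hk k.+1 = hk k + h 0 k *: delta_mx 0 k.
  apply/rowP => j; rewrite !mxE eqxx /= ltnS.
  have [->|jk] := eqVneq j k; first by rewrite leqnn ltnn mulr1 add0r.
  by rewrite mulr0 addr0 leq_eqVlt -[nat_of_ord j == k]/(j == k) (negbTE jk).
have hk0 : hk 0%N = 0 by apply/rowP => j; rewrite !mxE.
have hkN : hk N = h by apply/rowP => j; rewrite !mxE ltn_ord.
have near_in k (t : R) : `|t| <= `|h 0 k| -> ball x r (x + hk k + t *: delta_mx 0 k).
  move=> th; rewrite -ball_normE /= -addrA opprD addrA subrr sub0r normrN.
  apply/rV_norm_ltP => // j; rewrite !mxE eqxx /=; apply: le_lt_trans hr.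
  have [->|jk] := eqVneq j k; first by rewrite ltnn add0r mulr1 (le_trans th)// rV_coord_le.
  rewrite mulr0 addr0; case: ifP => _; first exact: rV_coord_le.
  by rewrite normr0.
have step (k : 'I_N) : `|g (x + hk k.+1) - g (x + hk k) - partial k g x * h 0 k| <= e' * `|h|.
  have [t th|t th] := @mvt_delta g (x + hk k) k (h 0 k).
    apply: dg; apply: HU'; have := near_in k t th.
    by apply: le_ball; rewrite ge_min lexx.
  rewrite -addrA -hkS => ->; rewrite -mulrBl normrM.
  apply: ler_pM => //; last exact: rV_coord_le.
  rewrite distrC; apply/ltW/Hc; have := near_in k t th.
  by apply: le_ball; rewrite ge_min lexx orbT.
have E : g (h + x) - (g x + dotp (grad g x) h) =
    \sum_(k < N) (g (x + hk k.+1) - g (x + hk k) - partial k g x * h 0 k).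
  rewrite sumrB.
  have -> : \sum_(k < N) (g (x + hk k.+1) - g (x + hk k)) = g (h + x) - g x.
    rewrite -(big_mkord xpredT (fun k => g (x + hk k.+1) - g (x + hk k))).
    by rewrite telescope_sumr// hkN hk0 addr0 (addrC x).
  have -> : \sum_(k < N) partial k g x * h 0 k = dotp (grad g x) h.
    by apply: eq_bigr => k _; rewrite mxE.
  by rewrite opprD addrA.
rewrite E; apply: le_trans (ler_norm_sum _ _ _) _.
apply: (@le_trans _ _ (\sum_(k < N) e' * `|h|)); first exact: ler_sum.
rewrite sumr_const card_ord -[_ *+ N]mulr_natr mulrAC ler_wpM2r//.
rewrite /e' -mulrA ler_piMr ?(ltW e0)//.
by rewrite mulrC ler_pdivrMr ?ltr0n// mul1r ler_nat.
Qed.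

Lemma class_C1_grad U g : open U -> class_C 1 U g ->
  (forall x, U x -> is_grad g x (grad g x)) /\ (forall x, U x -> continuous_at x (grad g)).
Proof.
move=> oU [_ [dg cg]]; split; first by apply: partials_grad => // i x Ux; exact: (cg i).1.
move=> x Ux; apply: rV_continuousP => i.
rewrite (_ : (fun s => _) = partial i g); first exact: (cg i).1.
by apply/funext => s; rewrite mxE.
Qed.

Lemma class_C_continuous k U g : class_C k U g -> forall x, U x -> continuous_at x g.
Proof. by case: k => [|k] []. Qed.

(** The k-th derivative is not asked to be continuous; one more derivative gives that, which
    accounts for [smk k.+1] in [class_C_prod]. *)
Fixpoint smk (k : nat) (f : R -> R) : Prop :=
  if k is l.+1 then exists2 f', (forall t, is_derive t (1 : R) f (f' t)) & smk l f' else True.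

Lemma smk_le k f : smk k.+1 f -> smk k f.
Proof.
elim: k f => //= k IH f [f' df [f'' df' s]]; exists f' => //.
by apply: IH; exists f''.
Qed.

Lemma smkD k f h : smk k f -> smk k h -> smk k (fun t => f t + h t).
Proof.
elim: k f h => //= k IH f h [f' df sf] [h' dh sh].
by exists (fun t => f' t + h' t); [move=> t; exact: is_deriveD|exact: IH].
Qed.

Lemma smkM k f h : smk k f -> smk k h -> smk k (fun t => f t * h t).
Proof.
elim: k f h => //= k IH f h [f' df sf] [h' dh sh].
exists (fun t => f t * h' t + h t * f' t); first by move=> t; exact: is_deriveM.
apply: smkD; apply: IH => //; apply: smk_le.
  by exists f'.
by exists h'.
Qed.

Lemma smk_affine k f (a b : R) : smk k f -> smk k (fun t => f (a * t + b)).
Proof.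
elim: k f => //= k IH f [f' df sf].
exists (fun t => a * f' (a * t + b)).
  move=> t; have h : is_derive t (1 : R) (fun s : R => a * s + b) a.
    have h := is_deriveD (is_deriveZ a (is_derive_id t (1 : R))) (is_derive_cst b t (1 : R)).
    by apply: (is_derive_eq h); rewrite addr0; exact: mulr1.
  have := @is_derive1_comp R f (fun s : R => a * s + b) t (f' (a * t + b)) a (df _) h.
  by rewrite mulrC.
apply: (smkM (f := fun=> a)); last exact: IH.
elim: (k) a {IH sf} => //= m IHm c; exists (fun=> 0) => //.
by move=> t; exact: is_derive_cst.
Qed.

Lemma class_C_prod k (b : 'I_N -> R -> R) : (forall i, smk k.+1 (b i)) ->
  class_C k setT (fun x => \prod_i b i (x 0 i)).
Proof.
(* A product of factors in the other coordinates is constant along the i-th axis, so that no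
   regularity of the factors is needed. *)
have D0 (P : pred 'I_N) (c : 'I_N -> R -> R) x i : ~~ P i ->
    is_derive x (delta_mx 0 i) (fun y : 'rV[R]_N => \prod_(j | P j) c j (y 0 j)) 0.
  move=> Pi; have E : (fun h : R => h^-1 *: (\prod_(j | P j) c j ((h *: delta_mx 0 i + x) 0 j) -
      \prod_(j | P j) c j (x 0 j))) = fun=> 0.
    apply/funext => h; rewrite (eq_bigr (fun j => c j (x 0 j))) ?subrr ?scaler0// => j Pj.
    rewrite !mxE eqxx /= (_ : j == i = false) ?mulr0 ?add0r//.
    by apply/negbTE; apply: contraNneq Pi => <-.
  by apply: DeriveDef; rewrite /derivable /derive /= E; [exact: is_cvg_cst|exact: lim_cst].
elim: k b => [|k IH] b sb.
  split => // x _.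
  have c j : continuous_at x (fun y : 'rV[R]_N => b j (y 0 j)).
    have [b' db _] := sb j.
    apply: (@continuous_comp _ R R (fun y : 'rV[R]_N => y 0 j) (b j)); first exact: coord_continuous.
    by apply: differentiable_continuous; apply/derivable1_diffP; exact: ex_derive.
  exact: continuous_prodr.
have /choice[b' hb'] : forall i, exists b' : R -> R,
    (forall t, is_derive t (1 : R) (b i) (b' t)) /\ smk k.+1 b'.
  by move=> i; have [b' h1 h2] := sb i; exists b'.
have d i x : is_derive x (delta_mx 0 i) (fun y : 'rV[R]_N => \prod_j b j (y 0 j))
    (\prod_j (if j == i then b' j else b j) (x 0 j)).
  have -> : (fun y : 'rV[R]_N => \prod_j b j (y 0 j)) =
      (fun y : 'rV[R]_N => b i (y 0 i)) * (fun y : 'rV[R]_N => \prod_(j | j != i) b j (y 0 j)).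
    by apply/funext => y; rewrite (bigD1 i).
  have h1 : is_derive x (delta_mx 0 i) (fun y : 'rV[R]_N => b i (y 0 i)) (b' i (x 0 i)).
    have := is_grad_derive (delta_mx 0 i) (is_grad_comp (is_grad_coord i x) ((hb' i).1 (x 0 i))).
    by rewrite dotp_delta !mxE !eqxx mulr1.
  have h2 := @D0 (fun j => j != i) b x i; rewrite eqxx in h2.
  have := is_deriveM h1 (h2 isT).
  move=> h; apply: is_derive_eq h _.
  rewrite scaler0 add0r [RHS](bigD1 i)//= eqxx [LHS]mulrC; congr (_ * _).
  by apply: eq_bigr => j /negbTE ->.
have p i : partial i (fun y : 'rV[R]_N => \prod_j b j (y 0 j)) =
    fun x => \prod_j (if j == i then b' j else b j) (x 0 j).
  by apply/funext => x; exact: derive_val.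
split; last split.
- exact: class_C_continuous (IH b (fun i => smk_le (sb i))).
- by move=> i x _; exact: ex_derive.
move=> i; rewrite p; apply: (IH (fun j => if j == i then b' j else b j)) => j.
by case: ifP => _; [exact: (hb' j).2|exact: smk_le].
Qed.

End C1_functions.

(** * A smooth bump and the mollifying kernel *)

Section bump_function.
Context {R : realType}.

Lemma is_derive_small (f : R -> R) (C : R) : 0 <= C ->
  (forall t, `|t| <= 1 -> `|f t| <= C * `|t| ^+ 2) -> is_derive 0 (1 : R) f 0.
Proof.
move=> C0 HC.
have f0 : f 0 = 0.
  by apply/eqP; rewrite -normr_le0; apply: le_trans (HC 0 _) _; rewrite normr0// expr0n mulr0.
have lim0 : (fun h : R => h^-1 *: (f (h *: (1 : R) + 0) - f 0)) @ 0^' --> (0 : R).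
  apply/cvgrPdist_le => e e_gt0; rewrite /=.
  have d0 : 0 < Num.min 1 (e / (C + 1)) by rewrite lt_min ltr01 divr_gt0// ltr_wpDl.
  apply: filterS (dnbhs0_lt d0) => h; rewrite lt_min => /andP[h1 he].
  rewrite sub0r normrN f0 subr0 addr0 [h *: 1]mulr1 normrM normfV.
  have [->|hn0] := eqVneq h 0; first by rewrite normr0 invr0 mul0r ltW.
  rewrite mulrC ler_pdivrMr ?normr_gt0//.
  apply: le_trans (HC _ (ltW h1)) _; rewrite expr2 mulrA ler_pM2r ?normr_gt0//.
  apply: (@le_trans _ _ ((C + 1) * `|h|)); first by rewrite ler_wpM2r// lerDl.
  by rewrite mulrC -ler_pdivlMr ?ltr_wpDl// ltW.
apply: DeriveDef; first by apply/cvg_ex; exists 0.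
exact: cvg_lim.
Qed.

(* P(1/t) exp(-1/t), extended by 0 for t <= 0: this family is closed under differentiation. *)
Definition exp_inv (P : {poly R}) (t : R) : R :=
  if 0 < t then P.[t^-1] * expR (- t^-1) else 0.

Lemma poly_bound (P : {poly R}) : exists2 C : R, 0 <= C &
  forall s : R, 1 <= s -> `|P.[s]| <= C * s ^+ size P.
Proof.
exists (\sum_(i < size P) `|P`_i|); first exact: sumr_ge0.
move=> s s1; rewrite horner_coef mulr_suml; apply: le_trans (ler_norm_sum _ _ _) _.
apply: ler_sum => i _; rewrite normrM ler_wpM2l// ger0_norm ?exprn_ge0 ?(le_trans ler01)//.
by apply: ler_weXn2l => //; exact: ltnW.
Qed.

Lemma exp_inv_small (P : {poly R}) : exists2 C : R, 0 <= C &
  forall t, `|t| <= 1 -> `|exp_inv P t| <= C * `|t| ^+ 2.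
Proof.
have [C C0 HC] := poly_bound P.
(* The exponential beats t^-n with n = [size P] + 2: [size P] powers absorb the polynomial and the
   last two leave the factor |t|^2. *)
have [n nE] := ex_intro (fun n => n = (size P).+2) _ erefl.
exists (C * n`!%:R); first by rewrite mulr_ge0.
move=> t t1; rewrite /exp_inv; case: ifPn => t0; last by rewrite normr0 !mulr_ge0.
rewrite gtr0_norm// in t1 *; have s1 : 1 <= t^-1 by rewrite invf_ge1.
have s0 : 0 < t^-1 by rewrite invr_gt0.
rewrite normrM [`|expR _|]gtr0_norm ?expR_gt0//.
have h : t^-1 ^+ n / n`!%:R <= expR t^-1.
  by rewrite nE; apply: le_trans (expR_ge1Dxn (size P).+1 (ltW s0)); rewrite lerDr.
have h' : expR (- t^-1) <= n`!%:R * t ^+ n.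
  have tn0 : 0 < n`!%:R * t ^+ n by rewrite mulr_gt0 ?exprn_gt0// ltr0n fact_gt0.
  rewrite expRN -[leRHS]invrK lef_pV2 ?posrE ?expR_gt0 ?invr_gt0//.
  by rewrite invfM mulrC -exprVn.
apply: le_trans (ler_pM (normr_ge0 _) (expR_ge0 _) (HC _ s1) h') _.
rewrite le_eqVlt; apply/orP; left; apply/eqP.
rewrite nE -[(size P).+2]addn2 exprD exprVn.
by field; rewrite expf_neq0 ?gt_eqF.
Qed.

(** In the variable s = 1/t the derivation is -s^2 d/ds, and it takes P(s) exp(-s) to s^2 (P -
    P')(s) exp(-s). At 0 the quadratic bound of [exp_inv_small] gives the derivative. *)
Lemma is_derive_exp_inv (P : {poly R}) t :
  is_derive t (1 : R) (exp_inv P) (exp_inv ('X ^+ 2 * (P - P^`())) t).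
Proof.
have [t0|t0|->] := ltgtP t 0.
- rewrite {2}/exp_inv ltNge (ltW t0) /=.
  apply: (near_eq_is_derive _ (is_derive_cst 0 t (1 : R))).
  by apply: filterS (lt_nbhsl t0) => s s0; rewrite /exp_inv ltNge (ltW s0).
- rewrite {2}/exp_inv t0.
  have h1 : is_derive t (1 : R) (fun s : R => s^-1) (- t^-1 ^+ 2).
    apply: is_derive_eq (is_deriveV _ (is_derive_id t (1 : R))) _; first by rewrite gt_eqF.
    by rewrite exprVn; exact: mulr1.
  have h2 : is_derive t (1 : R) (fun s : R => P.[s^-1]) (P^`().[t^-1] * - t^-1 ^+ 2).
    exact: (@is_derive1_comp R (horner P) (fun s => s^-1)).
  have h3 : is_derive t (1 : R) (fun s : R => expR (- s^-1)) (expR (- t^-1) * t^-1 ^+ 2).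
    rewrite -[X in _ * X]opprK.
    exact: (@is_derive1_comp R expR (fun s => - s^-1)).
  have := is_deriveM h2 h3 => h.
  apply: (@near_eq_is_derive R R R ((fun s : R => P.[s^-1]) * (fun s : R => expR (- s^-1)))).
    by apply: filterS (lt_nbhsr t0) => s s0; rewrite /exp_inv s0.
  apply: is_derive_eq h _; rewrite !hornerE /= /GRing.scale /=; ring.
have [C C0 HC] := exp_inv_small P.
rewrite [exp_inv _ 0]/exp_inv ltxx; exact: is_derive_small HC.
Qed.

Lemma smk_exp_inv k (P : {poly R}) : smk k (exp_inv P).
Proof.
elim: k P => //= k IH P; exists (exp_inv ('X ^+ 2 * (P - P^`()))); last exact: IH.
exact: is_derive_exp_inv.
Qed.

(** Positive exactly on ]-1, 1[. The arguments are written in the shape [a * t + b] of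
    [smk_affine]. *)
Definition bump1 (t : R) := exp_inv 1 (1 * t + 1) * exp_inv 1 (-1 * t + 1).

Lemma smk_bump1 k : smk k bump1.
Proof. by apply: smkM; apply: (smk_affine (f := exp_inv 1)); exact: smk_exp_inv. Qed.

Lemma bump1_ge0 t : 0 <= bump1 t.
Proof.
have h P : 0 <= exp_inv 1 P.
  by rewrite /exp_inv; case: ifP => // _; rewrite hornerC mul1r expR_ge0.
by rewrite mulr_ge0.
Qed.

Lemma bump1_gt0 t : `|t| < 1 -> 0 < bump1 t.
Proof.
rewrite ltr_norml => /andP[h1 h2].
have h P : 0 < P -> 0 < exp_inv 1 P.
  by move=> P0; rewrite /exp_inv P0 hornerC mul1r expR_gt0.
by rewrite mulr_gt0// h//; lra.
Qed.

Lemma bump1_out t : 1 <= `|t| -> bump1 t = 0.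
Proof.
rewrite ler_normr /bump1 /exp_inv => /orP[] h.
  by rewrite [X in _ * (if X then _ else _)](_ : _ = false) ?mulr0//; apply/negbTE; rewrite -leNgt; lra.
by rewrite [if _ then _ else _](_ : _ = 0) ?mul0r// ifF//; apply/negbTE; rewrite -leNgt; lra.
Qed.

End bump_function.

Section kernel.
Context {R : realType} {N : nat}.
Implicit Types (x y z : 'rV[R]_N).

(** As a product over the coordinates it lives on the ball of radius [h] of the sup norm, the norm
    underlying the topology of row vectors. It is not normalised to integral 1. *)
Definition bumpN (h : R) x : R := \prod_i bump1 (h^-1 * x 0 i + 0).

Lemma smooth_bumpN_shift (h : R) y : smooth setT (fun x => bumpN h (x - y)).
Proof.
move=> k; rewrite (_ : (fun x => _) =
    fun x => \prod_i (fun t => bump1 (h^-1 * t + - (h^-1 * y 0 i))) (x 0 i)).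
  apply: (class_C_prod (b := fun i t => bump1 (h^-1 * t + - (h^-1 * y 0 i)))) => i.
  by apply: smk_affine; exact: smk_bump1.
by apply/funext => x; apply: eq_bigr => i _; rewrite !mxE addr0 mulrBr.
Qed.

Lemma bumpN_ge0 h x : 0 <= bumpN h x.
Proof. by apply: prodr_ge0 => i _; exact: bump1_ge0. Qed.

Lemma bumpN_out h x : 0 < h -> ~~ (`|x| < h) -> bumpN h x = 0.
Proof.
move=> h0 xh; have [i xi] : exists i, ~ (`|x 0 i| < h).
  by apply/existsNP => /(rV_norm_ltP x h0) xlt; rewrite xlt in xh.
rewrite /bumpN (bigD1 i)//= bump1_out ?mul0r// addr0 normrM gtr0_norm ?invr_gt0//.
by rewrite mulrC ler_pdivlMr// mul1r leNgt; exact/negP.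
Qed.

Lemma bumpN_gt0 h x : 0 < h -> `|x| < h -> 0 < bumpN h x.
Proof.
move=> h0 /rV_norm_ltP => /(_ h0) xh; apply: prodr_gt0 => i _.
apply: bump1_gt0; rewrite addr0 normrM gtr0_norm ?invr_gt0//.
by rewrite mulrC ltr_pdivrMr// mul1r.
Qed.

Lemma tst_bumpN (h : R) : 0 < h -> tst setT (bumpN h) (grad (bumpN h)).
Proof.
move=> h0; have sm := smooth_bumpN_shift h 0.
have bE : (fun x => bumpN h (x - 0)) = bumpN h by apply/funext => x; rewrite subr0.
rewrite bE in sm.
have [g1 g2] := class_C1_grad openT (sm 1%N).
split; [by move=> x; exact: g1|by move=> x; exact: g2|].
exists (box h); first exact: compact_box.
split => // x xh.
have b0 : \forall y \near x, 0 = bumpN h y.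
  have : nbhs x (~` box h) by apply: nbhs_compactC => //; exact: compact_box.
  apply: filterS => y yh; rewrite bumpN_out//; apply/negP => /ltW; exact: yh.
split; first by rewrite -(nbhs_singleton b0).
exact: is_grad_unique (g1 x I) (is_grad_near b0 (is_grad_cst 0 x)).
Qed.

Lemma Int_bumpN_gt0 (h : R) : 0 < h -> 0 < Int (bumpN h).
Proof.
move=> h0; have t := tst_bumpN h0; have [cb _] := tst_CC t.
have b0 : 0 < bumpN h 0 by apply: bumpN_gt0 => //; rewrite normr0.
have [r r0 Hr] : exists2 r : R, 0 < r & forall x, `|x| <= r -> bumpN h 0 / 2 <= bumpN h x.
  have b02 : 0 < bumpN h 0 / 2 by rewrite divr_gt0.
  have /cvgrPdist_lt/(_ _ b02)/nbhs_ballP[r /= r0 H] := cb 0.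
  exists (r / 2); first by rewrite divr_gt0.
  move=> x xr; have := H x; rewrite -ball_normE /= sub0r normrN.
  move=> /(_ (le_lt_trans xr _)); rewrite ltr_pdivrMr// ltr_pMr// ltr1n => /(_ isT).
  by rewrite ltr_norml => /andP[_]; lra.
apply: (@lt_le_trans _ _ (Int (fun x => bumpN h 0 / 2 * \1_(box r) x))).
  rewrite IntZ; last exact: BM_box.
  by rewrite Int_box ?(ltW r0)// mulr_gt0 ?divr_gt0// exprn_gt0// mulr_gt0.
apply: le_Int; [by apply: BM_scale; exact: BM_box|exact: CC_BM (tst_CC t)|].
move=> x; rewrite indicE; case: (boolP (x \in _)) => [|_].
  by rewrite inE mulr1 => /Hr.
by rewrite mulr0 bumpN_ge0.
Qed.

End kernel.

(** * Convolution *)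

Section convolution.
Context {R : realType} {N : nat}.
Implicit Types (x y z : 'rV[R]_N) (g k phi psi : 'rV[R]_N -> R) (U K : set 'rV[R]_N).

Lemma open_preimage U g (D : set R) : open U -> (forall x, U x -> continuous_at x g) ->
  open D -> open (U `&` g @^-1` D).
Proof.
move=> oU cg oD; rewrite openE => x [Ux Dx]; apply: filterI; first exact: open_nbhs_nbhs.
by apply: cg => //; exact: open_nbhs_nbhs.
Qed.

Lemma mfun_on U g : open U -> (forall x, U x -> continuous_at x g) ->
  mfun (fun x => \1_U x * g x).
Proof.
move=> oU cg; apply: (measurability _ (RGenOpens.measurableE R)).
move=> _ [_ [a [b ->] <-]]; rewrite setTI.
have mU := open_mset oU.
have mI : mset (U `&` g @^-1` `]a, b[) by apply: open_mset; apply: open_preimage => //; exact: interval_open.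
have [ab0|ab0] := pselect (`]a, b[%classic (0 : R)).
  rewrite (_ : _ @^-1` _ = @rV_of_tuple R N @^-1` (U `&` g @^-1` `]a, b[) `|` ~` (@rV_of_tuple R N @^-1` U)).
    by apply: measurableU => //; exact: measurableC.
  apply/seteqP; split => t /=; rewrite indicE.
    by case: (boolP (_ \in U)) => [/set_mem Ut|/negP Ut]; rewrite ?mul1r ?mul0r => h;
      [left|right => Ut'; apply: Ut; exact: mem_set].
  by case: (boolP (_ \in U)) => [/set_mem Ut [[]|]//|_ _]; rewrite ?mul1r ?mul0r.
rewrite (_ : _ @^-1` _ = @rV_of_tuple R N @^-1` (U `&` g @^-1` `]a, b[))//.
apply/seteqP; split => t /=; rewrite indicE.
  by case: (boolP (_ \in U)) => [/set_mem Ut|/negP Ut]; rewrite ?mul1r ?mul0r => h.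
by move=> [Ut h]; rewrite mem_set// mul1r.
Qed.

Lemma BM_cut U K g : open U -> compact K -> K `<=` U ->
  (forall x, U x -> continuous_at x g) -> BM (cut K g).
Proof.
move=> oU cK KU cg; split.
  rewrite (_ : cut K g = fun x => \1_K x * (\1_U x * g x)).
    apply: mfunM; last exact: mfun_on.
    by apply: mfun_indic; apply: closed_mset; exact: compact_closed_rV.
  apply/funext => x; rewrite !indicE /cut; case: asboolP => Kx.
    by rewrite !mem_set// ?mul1r//; exact: KU.
  by rewrite memNset// mul0r.
have [M M0 HM] := compact_bound cK.
have cgK : {within K, continuous g}.
  by apply: continuous_in_subspaceT => x /set_mem /KU; exact: cg.
have [L L0 HL] := continuous_bounded cK cgK.
exists (Num.max M L) => x; rewrite !le_max /cut; case: asboolP => Kx.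
  by rewrite HL// HM// orbT.
by rewrite normr0 eqxx ltW.
Qed.

Lemma Int_opp g : BM g -> Int (fun x => g (- x)) = Int g.
Proof.
move=> bg; rewrite -[RHS](@Int_orth R N (- 1%:M))//.
  by apply: eq_Int => x; rewrite mulmxN mulmx1.
by rewrite linearN /= trmx1 mulmxN mulNmx opprK mulmx1.
Qed.

Lemma BM_refl x g : BM g -> BM (fun y => g (x - y)).
Proof.
move=> bg; have h : (- 1%:M : 'M[R]_N) *m (- 1%:M) = 1%:M.
  by rewrite mulmxN mulNmx opprK mulmx1.
have := BM_shift (- x) (BM_mulmx h bg).
by congr BM; apply/funext => y; rewrite mulmxN mulmx1 opprD opprK addrC.
Qed.

Lemma Int_refl x g : BM g -> Int (fun y => g (x - y)) = Int g.
Proof.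
move=> bg; rewrite -[RHS]Int_opp// -[RHS](Int_shift (- x)).
  by apply: eq_Int => y; rewrite opprD opprK addrC.
have := BM_refl 0 bg; congr BM; by apply/funext => y; rewrite sub0r.
Qed.

Lemma BM2_conv g k phi : BM g -> BM k -> BM phi ->
  BM2 (fun x y => g x * (k (x - y) * phi y)).
Proof.
move=> [mg [M HM]] [mk [L HL]] [mp [P HP]]; split.
  apply: mfun2M; first exact: (mfun2_fst mg).
  by apply: mfun2M; [exact: mfun2_sub|exact: (mfun2_snd mp)].
have M0 : 0 <= M by have [h _] := HM 0; exact: le_trans h.
have L0 : 0 <= L by have [h _] := HL 0; exact: le_trans h.
have P0 : 0 <= P by have [h _] := HP 0; exact: le_trans h.
exists (Num.max (M * (L * P)) (Num.max M P)) => x y; rewrite !le_max; split.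
  apply/orP; left; rewrite !normrM; apply: ler_pM => //.
    exact: (HM x).1.
  by apply: ler_pM => //; [exact: (HL _).1|exact: (HP _).1].
rewrite !mulf_eq0 !negb_or => /and3P[gx _ py].
by rewrite (HM x).2// (HP y).2// !orbT.
Qed.

Definition conv k phi x := Int (fun y => k (x - y) * phi y).

Lemma BM_conv k phi : BM k -> BM phi -> BM (conv k phi).
Proof.
move=> [mk [L HL]] [mp [P HP]].
have L0 : 0 <= L by have [h _] := HL 0; exact: le_trans h.
have P0 : 0 <= P by have [h _] := HP 0; exact: le_trans h.
apply: BM_Int; split.
  by apply: mfun2M; [exact: mfun2_sub|exact: (mfun2_snd mp)].
exists (Num.max (L * P) (L + P)) => x y; rewrite !le_max; split.
  apply/orP; left; rewrite normrM; apply: ler_pM => //; [exact: (HL _).1|exact: (HP _).1].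
rewrite mulf_eq0 negb_or => /andP[kx py].
have hy := (HP y).2 py; have hx := (HL _).2 kx; split; apply/orP; right.
  by rewrite -[x](subrK y); apply: le_trans (ler_normD _ _) _; exact: lerD.
by apply: le_trans hy _; rewrite lerDr.
Qed.

Lemma Int_conv g k phi : BM g -> BM k -> BM phi ->
  Int (fun y => Int (fun x => g x * k (x - y)) * phi y) = Int (fun x => g x * conv k phi x).
Proof.
move=> bg bk bp; have b2 := BM2_conv bg bk bp.
transitivity (Int (fun y => Int (fun x => g x * (k (x - y) * phi y)))).
  apply: eq_Int => y; rewrite -IntZr.
    by apply: eq_Int => x; rewrite mulrA.
  exact: BMM (BM_shift (- y) bk).
rewrite -(Int_fubini b2); apply: eq_Int => x.
by rewrite IntZ//; exact: BMM (BM_refl x bk) bp.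
Qed.

(** The kernel is not normalised, so the convolution is close to [Int k * phi x] instead of
    [phi x]. *)
Lemma conv_near (h e : R) k phi x : BM k -> BM phi -> (forall y, 0 <= k y) ->
  (forall y, k y != 0 -> `|y| < h) -> (forall y, `|x - y| < h -> `|phi x - phi y| <= e) ->
  `|Int k * phi x - conv k phi x| <= Int k * e.
Proof.
move=> bk bp k0 kh pe.
have bx := BM_refl x bk.
have bkc c : BM (fun y => k (x - y) * c).
  rewrite (_ : (fun y => _) = fun y => c * k (x - y)); first exact: BM_scale.
  by apply/funext => y; rewrite mulrC.
have bkp : BM (fun y => k (x - y) * phi y) by exact: BMM.
have Ec c : Int (fun y => k (x - y) * c) = Int k * c by rewrite IntZr// Int_refl.
rewrite -!Ec /conv -IntB//; apply: le_trans (Int_abs (BMB (bkc _) bkp)) _.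
apply: le_Int => //; first exact: BM_norm (BMB (bkc _) bkp).
move=> y; rewrite -mulrBr normrM (ger0_norm (k0 _)).
have [->|/kh/pe h'] := eqVneq (k (x - y)) 0; first by rewrite !mul0r.
exact: ler_wpM2l.
Qed.

(** As a function of y, k(x - y) phi(y) is a test function, and the integral of its i-th partial
    derivative vanishes. *)
Lemma Int_parts U V k dk phi dphi x i : tst U k dk -> tst V phi dphi ->
  conv (fun y => dk y 0 i) phi x = conv k (fun y => dphi y 0 i) x.
Proof.
move=> tk tp; have [gk ck [K cK [_ K0]]] := tk; have [gp cp [P cP [_ P0]]] := tp.
have gkx y : is_grad (fun y => k (x - y)) y (- dk (x - y)).
  have := @is_grad_affine R N k y (- 1%:M) x (dk (x - y)).
  rewrite mulmxN mulmx1 linearN /= trmx1 mulmxN mulmx1 addrC => /(_ (gk _)).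
  by congr is_grad; apply/funext => z; rewrite mulmxN mulmx1 addrC.
have t : tst setT (fun y => k (x - y) * phi y) (fun y => k (x - y) *: dphi y + phi y *: - dk (x - y)).
  split.
  - by move=> y; exact: is_gradM.
  - have cx y : continuous_at y (fun z => x - z).
      by apply: continuous_rvB; [exact: for_cst|exact: for_id].
    move=> y; apply: continuous_rvD.
      by apply: continuous_rvZ; [exact: is_grad_continuous (gkx y)|exact: cp].
    apply: continuous_rvZ; first exact: is_grad_continuous (gp y).
    apply: continuous_rvN.
    by apply: (@continuous_comp 'rV[R]_N 'rV[R]_N 'rV[R]_N (fun z => x - z) dk); [exact: cx|exact: ck].
  - exists P => //; split => // y /P0 [-> ->].
    by rewrite mulr0 scaler0 scale0r addr0.
have := Int_partial0 i t.
rewrite (eq_Int (h := fun y => k (x - y) * dphi y 0 i - dk (x - y) 0 i * phi y)); last first.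
  by move=> y; rewrite !mxE mulrN (mulrC (phi y)).
rewrite IntB.
- by move/eqP; rewrite subr_eq0 => /eqP h; apply/esym; exact: h.
- exact: BMM (BM_refl x (CC_BM (tst_CC tk))) (CC_BM (tst_CC_coord i tp)).
- exact: BMM (BM_refl x (CC_BM (tst_CC_coord i tk))) (CC_BM (tst_CC tp)).
Qed.

End convolution.

(** * From smooth to C^1 test functions *)

Section weak_form_C1.
Context {R : realType} {N : nat}.
Variables (U : set 'rV[R]_N) (A : 'rV[R]_N -> 'rV[R]_N) (B : 'rV[R]_N -> R).
Hypotheses (oU : open U) (cA : forall x, U x -> continuous_at x A)
  (cB : forall x, U x -> continuous_at x B).
Hypothesis weakAB : forall phi dphi, tst U phi dphi -> smooth setT phi ->
  Int (fun x => dotp (A x) (dphi x)) = Int (fun x => B x * phi x).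

Lemma Int_dot_coord phi dphi K : tst U phi dphi -> compact K -> K `<=` U ->
  (forall x, ~ K x -> dphi x = 0) ->
  Int (fun x => dotp (A x) (dphi x)) = \sum_i Int (fun x => cut K (fun x => A x 0 i) x * dphi x 0 i).
Proof.
move=> t cK KU K0; rewrite -Int_sum.
  apply: eq_Int => x; have [Kx|/K0 ->] := pselect (K x).
    by apply: eq_bigr => i _; rewrite cut_in.
  by rewrite dotp0r big1// => i _; rewrite mxE mulr0.
move=> i; apply: BMM; last exact: CC_BM (tst_CC_coord i t).
apply: (BM_cut (U := U)) => // x Ux; apply: continuous_coord; exact: cA.
Qed.

(** The translates k(. - y) of a smooth kernel are admissible for y in the support of [phi].
    Averaging their equations against phi(y) gives the equation for the convolution of [k] and
    [phi], which approximates [Int k] times [phi] uniformly together with its gradient. *)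
Lemma weak_form_C1 phi dphi : tst U phi dphi ->
  Int (fun x => dotp (A x) (dphi x)) = Int (fun x => B x * phi x).
Proof.
move=> tp; have [gp cp [K cK [KU K0]]] := tp.
have [r r0 Hr] := compact_fat cK oU KU.
pose r1 := r / 2; have r10 : 0 < r1 by rewrite divr_gt0.
have r1r : r1 < r by rewrite ltr_pdivrMr// ltr_pMr// ltr1n.
(* A compact neighbourhood of [K] inside [U]. It contains the supports of all translated kernels, so
   the coefficients may be cut off outside it and become bounded. *)
pose K' := (fun q : 'rV[R]_N * 'rV[R]_N => q.1 + q.2) @` (K `*` box r1).
have cK' : compact K'.
  apply: continuous_compact; last by apply: compact_setX => //; exact: compact_box.
  apply: continuous_subspaceT; exact: add_continuous.
have K'U : K' `<=` U.
  by move=> _ [[x z] /= [Kx zr] <-]; apply: Hr => //; exact: le_lt_trans zr r1r.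
have KK' : K `<=` K'.
  by move=> x Kx; exists (x, 0); rewrite ?addr0//=; split => //; rewrite /box /= normr0 ltW.
pose cutA i := cut K' (fun x => A x 0 i); pose cutB := cut K' B.
have bA i : BM (cutA i).
  by apply: (BM_cut (U := U)) => // x Ux; apply: continuous_coord; exact: cA.
have bB : BM cutB by exact: (BM_cut (U := U)).
have bp := CC_BM (tst_CC tp); have bdp i := CC_BM (tst_CC_coord i tp).
have E1 : Int (fun x => dotp (A x) (dphi x)) = \sum_i Int (fun x => cutA i x * dphi x 0 i).
  apply: (Int_dot_coord tp cK' K'U) => x xK'; apply: (K0 x _).2 => /KK'; exact: xK'.
have E2 : Int (fun x => B x * phi x) = Int (fun x => cutB x * phi x).
  apply: eq_Int => x; have [/KK' Kx|/K0 [-> _]] := pselect (K x); first by rewrite /cutB cut_in.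
  by rewrite !mulr0.
pose C := \sum_i Int (fun x => `|cutA i x|) + Int (fun x => `|cutB x|).
have C0 : 0 <= C by rewrite addr_ge0 ?sumr_ge0// => *; exact: Int_ge0.
suff S : forall e : R, 0 < e -> `|\sum_i Int (fun x => cutA i x * dphi x 0 i) -
    Int (fun x => cutB x * phi x)| <= e * C.
  rewrite E1 E2; apply/eqP; rewrite -subr_eq0 -normr_le0; apply/ler_addgt0Pl => e e0.
  rewrite addr0; apply: le_trans (S (e / (C + 1)) _) _; first by rewrite divr_gt0// ltr_wpDl.
  rewrite -mulrA ler_piMr ?(ltW e0)// mulrC ler_pdivrMr ?ltr_wpDl//.
  by rewrite mul1r lerDl.
move=> e e0.
have [rp rp0 Hp] := CC_unif (tst_CC tp) e0.
have /choice[rd Hd] : forall i, exists r : R, 0 < r /\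
    forall x y, `|x - y| < r -> `|dphi x 0 i - dphi y 0 i| < e.
  by move=> i; have [s s0 Hs] := CC_unif (tst_CC_coord i tp) e0; exists s.
(* Below the moduli of uniform continuity of [phi] and of all its partial derivatives for the error
   [e], and at most [r1], so that the kernels stay in [K']. *)
pose h := \big[Num.min/Num.min r1 rp]_i rd i.
have h0 : 0 < h.
  rewrite /h; elim/big_ind : _ => [|a b a0 b0|i _]; first by rewrite lt_min r10.
    by rewrite lt_min a0.
  exact: (Hd i).1.
have hr1 : h <= r1.
  by rewrite /h; elim/big_rec : _ => [|i a _ ha]; rewrite ge_min ?lexx// ha orbT.
have hrp : h <= rp.
  by rewrite /h; elim/big_rec : _ => [|i a _ ha]; rewrite ge_min ?lexx ?orbT// ha orbT.
have hrd i : h <= rd i by exact: bigmin_le_cond.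
have tk := tst_bumpN (N := N) h0; set k := bumpN h in tk; set dk := grad k in tk.
have bk := CC_BM (tst_CC tk); have bdk i := CC_BM (tst_CC_coord i tk).
have kout y : ~~ (`|y| < h) -> k y = 0 by move=> ?; exact: bumpN_out.
have dkout y : ~ box h y -> dk y = 0.
  move=> yh; have [gk _ _] := tk.
  have b0 : \forall z \near y, 0 = k z.
    have : nbhs y (~` box h) by apply: nbhs_compactC => //; exact: compact_box.
    by apply: filterS => z zh; rewrite kout//; apply/negP => /ltW; exact: zh.
  exact: is_grad_unique (gk y) (is_grad_near b0 (is_grad_cst 0 y)).
have W y : K y -> \sum_i Int (fun x => cutA i x * dk (x - y) 0 i) = Int (fun x => cutB x * k (x - y)).
  move=> Ky.
  have tky : tst U (fun x => k (x - y)) (fun x => dk (x - y)).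
    have [gk ck _] := tk; split.
    - by move=> x; exact: is_grad_shift.
    - move=> x; apply: (@continuous_comp 'rV[R]_N 'rV[R]_N 'rV[R]_N (fun z => z - y) dk); last exact: ck.
      by apply: continuous_rvB; [exact: for_id|exact: for_cst].
    - exists ((fun q : 'rV[R]_N * 'rV[R]_N => q.1 + q.2) @` ([set y] `*` box h)).
        apply: continuous_compact; first by apply: continuous_subspaceT; exact: add_continuous.
        by apply: compact_setX; [exact: compact_set1|exact: compact_box].
      split.
        move=> _ [[a z] /= [-> zh] <-]; apply: Hr => //.
        by apply: le_lt_trans (le_trans zh hr1) r1r.
      move=> x xn; have xh : ~ box h (x - y).
        by move=> xh; apply: xn; exists (y, x - y) => //=; rewrite addrC subrK.
      split; last exact: dkout.
      by apply: kout; apply/negP => /ltW.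
  have xK' x : ~ K' x -> ~ box h (x - y).
    move=> xn xh; apply: xn; exists (y, x - y); last by rewrite /= addrC subrK.
    by split => //=; exact: le_trans xh hr1.
  have := weakAB tky (smooth_bumpN_shift h y).
  rewrite (Int_dot_coord tky cK' K'U); last by move=> x /xK' /dkout.
  move=> ->; apply: eq_Int => x; rewrite /cutB /cut; case: asboolP => // /xK' xh.
  by rewrite kout ?mulr0//; apply/negP => /ltW.
(* Multiply [W] by phi(y) and integrate in y: Fubini turns the kernels into convolutions, and
   [Int_parts] moves the derivative from [k] to [phi]. *)
have W2 : \sum_i Int (fun x => cutA i x * conv k (fun y => dphi y 0 i) x) =
    Int (fun x => cutB x * conv k phi x).
  rewrite -Int_conv//; transitivity (\sum_i Int (fun y => Int (fun x => cutA i x * dk (x - y) 0 i) * phi y)).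
    apply: eq_bigr => i _; rewrite (Int_conv (bA i) (bdk i) bp).
    by apply: eq_Int => x; rewrite (Int_parts x i tk tp).
  rewrite -Int_sum.
    apply: eq_Int => y; rewrite -mulr_suml.
    have [Ky|/K0 [-> _]] := pselect (K y); first by rewrite W.
    by rewrite !mulr0.
  move=> i; have b2 := BM2_swap (BM2_conv (bA i) (bdk i) bp).
  have := BM_Int b2; congr BM; apply/funext => y.
  rewrite -IntZr; first by apply: eq_Int => x; rewrite mulrA.
  by apply: BMM (bA i) (BM_shift (- y) (bdk i)).
pose c := Int k; have c0 : 0 < c by exact: Int_bumpN_gt0.
have near_dphi i x : `|c * dphi x 0 i - conv k (fun y => dphi y 0 i) x| <= c * e.
  apply: (conv_near (h := h) bk (bdp i)) => [y|y|y xy].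
  - exact: bumpN_ge0.
  - by move=> ky; apply: contraT => /kout ky0; rewrite ky0 eqxx in ky.
  - by apply/ltW/(Hd i).2; exact: lt_le_trans xy (hrd i).
have near_phi x : `|c * phi x - conv k phi x| <= c * e.
  apply: (conv_near (h := h) bk bp) => [y|y|y xy].
  - exact: bumpN_ge0.
  - by move=> ky; apply: contraT => /kout ky0; rewrite ky0 eqxx in ky.
  - by apply/ltW/Hp; exact: lt_le_trans xy hrp.
have term g (psi : 'rV[R]_N -> R) : BM g -> BM psi ->
    (forall x, `|c * psi x - conv k psi x| <= c * e) ->
    `|c * Int (fun x => g x * psi x) - Int (fun x => g x * conv k psi x)| <=
      c * (e * Int (fun x => `|g x|)).
  move=> bg bpsi Hpsi; have bc := BM_conv bk bpsi.
  rewrite -IntZ; last exact: BMM.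
  rewrite -IntB; [|by apply: BM_scale; exact: BMM|exact: BMM].
  have bd : BM (fun x => c * (g x * psi x) - g x * conv k psi x).
    by apply: BMB; [by apply: BM_scale; exact: BMM|exact: BMM].
  apply: le_trans (Int_abs bd) _; rewrite mulrA -IntZ; last exact: BM_norm.
  apply: le_Int; [exact: BM_norm|by apply: BM_scale; exact: BM_norm|] => x.
  rewrite (_ : _ - _ = g x * (c * psi x - conv k psi x)); last by ring.
  by rewrite normrM mulrC ler_wpM2r.
rewrite -(ler_pM2l c0) -{1}[c]gtr0_norm// -normrM mulrBr mulr_sumr.
rewrite -[X in `|X|](subr0) -[X in _ - X](subrr (Int (fun x => cutB x * conv k phi x))) -{1}W2.
rewrite (_ : _ - _ = \sum_i (c * Int (fun x => cutA i x * dphi x 0 i) -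
    Int (fun x => cutA i x * conv k (fun y => dphi y 0 i) x)) -
    (c * Int (fun x => cutB x * phi x) - Int (fun x => cutB x * conv k phi x))); last first.
  by rewrite sumrB; ring.
apply: le_trans (ler_normB _ _) _; rewrite /C !mulrDr; apply: lerD; last exact: term.
apply: le_trans (ler_norm_sum _ _ _) _; rewrite !mulr_sumr; apply: ler_sum => i _.
exact: (term _ _ (bA i) (bdp i) (near_dphi i)).
Qed.

End weak_form_C1.

(** * The p-Laplace operator *)

Section p_field.
Context {R : realType} {N : nat}.
Implicit Types (p m M : R) (xi eta : 'rV[R]_N).

Definition Vf p xi : 'rV[R]_N := enorm xi `^ (p - 2) *: xi.

Lemma powR_sub1 (a s : R) : 0 <= a -> 0 < s -> a `^ (s - 1) * a = a `^ s.
Proof. by move=> a0 s0; rewrite mulrC mulr_powRB1. Qed.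

Lemma powR_sub2 (a p : R) : 0 <= a -> 1 < p -> a `^ (p - 2) * a = a `^ (p - 1).
Proof.
move=> a0 p1; rewrite -(@powR_sub1 _ (p - 1)) ?subr_gt0//.
by congr (_ `^ _ * _); ring.
Qed.

Lemma powR_sub2_sqr (a p : R) : 0 <= a -> 1 < p -> a `^ (p - 2) * a ^+ 2 = a `^ p.
Proof.
move=> a0 p1; rewrite expr2 mulrA powR_sub2// powR_sub1//; exact: lt_trans p1.
Qed.

Lemma Vf0 p : Vf p 0 = 0. Proof. by rewrite /Vf scaler0. Qed.

Lemma enorm_Vf p xi : 1 < p -> enorm (Vf p xi) = enorm xi `^ (p - 1).
Proof.
by move=> p1; rewrite enormZ ger0_norm ?powR_ge0// powR_sub2 ?enorm_ge0.
Qed.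

Lemma dotp_Vf p xi : 1 < p -> dotp (Vf p xi) xi = enorm xi `^ p.
Proof. by move=> p1; rewrite dotpZl -enorm_sqr powR_sub2_sqr ?enorm_ge0. Qed.

Lemma continuous_powR_at (T : topologicalType) (t : T) (f : T -> R) (s : R) :
  0 < f t -> continuous_at t f -> continuous_at t (fun x => f x `^ s).
Proof.
move=> ft cf; apply: (@continuous_comp T R R f (fun x => x `^ s)) => //.
apply: differentiable_continuous; apply/derivable1_diffP.
exact: (@ex_derive _ _ _ _ _ _ _ (is_derive1_powR s ft)).
Qed.

Lemma continuous_Vf p (T : topologicalType) (t : T) (F : T -> 'rV[R]_N) :
  1 < p -> continuous_at t F -> continuous_at t (fun x => Vf p (F x)).
Proof.
move=> p1 cF; have [Ft|Ft] := eqVneq (F t) 0; last first.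
  apply: continuous_rvZ => //; apply: continuous_powR_at; first by rewrite enorm_gt0.
  exact: continuous_enorm.
apply/cvgrPdist_lt => e e0; rewrite Ft Vf0.
have s0 : 0 < p - 1 by rewrite subr_gt0.
have d0 : 0 < e `^ (p - 1)^-1 by rewrite powR_gt0.
have /cvgrPdist_lt/(_ _ d0) := continuous_enorm cF; rewrite Ft enorm0.
apply: filterS => x; rewrite sub0r normrN ger0_norm ?enorm_ge0// => h.
rewrite sub0r normrN; apply: le_lt_trans (norm_le_enorm _) _; rewrite enorm_Vf//.
have -> : e = (e `^ (p - 1)^-1) `^ (p - 1).
  by rewrite -powRrM mulVf ?gt_eqF// powRr1// ltW.
by rewrite gt0_ltr_powR// nnegrE ?enorm_ge0// ltW.
Qed.

(** Polarisation: the pairing is split into a multiple of |xi - eta|^2 and a term in the moduli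
    alone. The sign of the second term is that of p - 2, which is why the cases p >= 2 and p <= 2
    are treated separately. *)
Lemma Vf_mono_expand p xi eta : let A := enorm xi `^ (p - 2) in let B := enorm eta `^ (p - 2) in
  dotp (Vf p xi - Vf p eta) (xi - eta) = 2^-1 * (A + B) * enorm (xi - eta) ^+ 2 +
    2^-1 * (A - B) * (enorm xi ^+ 2 - enorm eta ^+ 2).
Proof.
move=> A B; rewrite /Vf -/A -/B !enorm_sqr !(dotpBl, dotpBr, dotpZl) (dotpC eta xi).
by field.
Qed.

Lemma powR_mono (s a b : R) : 0 <= s -> 0 <= a -> a <= b -> a `^ s <= b `^ s.
Proof. by move=> s0 a0 ab; apply: ge0_ler_powR => //; rewrite nnegrE// (le_trans a0). Qed.

Lemma powR_anti (s a b : R) : s <= 0 -> 0 < a -> a <= b -> b `^ s <= a `^ s.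
Proof.
move=> s0 a0 ab; have b0 : 0 < b by exact: lt_le_trans ab.
rewrite -[s]opprK !(powRN _ (- s)) lef_pV2 ?posrE ?powR_gt0//.
by apply: powR_mono => //; [rewrite oppr_ge0|exact: ltW].
Qed.

Lemma Vf_mono_ge2 p xi eta : 2 <= p ->
  2^-1 * enorm xi `^ (p - 2) * enorm (xi - eta) ^+ 2 <= dotp (Vf p xi - Vf p eta) (xi - eta).
Proof.
move=> p2; rewrite Vf_mono_expand; set A := _ `^ _; set B := _ `^ _.
have h : 0 <= (A - B) * (enorm xi ^+ 2 - enorm eta ^+ 2).
  have s0 : 0 <= p - 2 by rewrite subr_ge0.
  have [ab|ab] := leP (enorm xi) (enorm eta).
    rewrite -mulrNN !opprB mulr_ge0// subr_ge0 ?powR_mono ?enorm_ge0//.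
    by rewrite ler_pXn2r ?nnegrE ?enorm_ge0.
  rewrite mulr_ge0// subr_ge0 ?powR_mono ?enorm_ge0 ?(ltW ab)//.
  by rewrite ler_pXn2r ?nnegrE ?enorm_ge0// ltW.
have h2 : 0 <= B * enorm (xi - eta) ^+ 2 by rewrite mulr_ge0 ?powR_ge0 ?sqr_ge0.
nra.
Qed.

Lemma concave_powR (s a b : R) : 0 < s -> s <= 1 -> 0 < b -> b <= a ->
  s * a `^ (s - 1) * (a - b) <= a `^ s - b `^ s.
Proof.
move=> s0 s1 b0; rewrite le_eqVlt => /predU1P[->|ba]; first by rewrite !subrr mulr0.
have [||c cab ->] := @MVT R (fun x => x `^ s) (fun x => s * x `^ (s - 1)) b a ba.
- by move=> x; rewrite in_itv /= => /andP[bx _]; apply: is_derive1_powR; exact: lt_trans bx.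
- apply: continuous_in_subspaceT => x /set_mem /=; rewrite in_itv /= => /andP[bx _].
  by apply: (@continuous_powR_at R x id s); [exact: lt_le_trans bx|exact: for_id].
move: cab; rewrite in_itv /= => /andP[bc ca].
rewrite ler_pM2r ?subr_gt0// ler_pM2l//; apply: powR_anti; rewrite ?subr_le0//.
  exact: lt_trans bc.
exact: ltW.
Qed.

(** Take |eta| <= |xi| and replace [M] by |xi|. The difference of the two sides is then a sum of two
    nonnegative products: one comes from ||xi| - |eta|| <= |xi - eta|, the other from the concavity
    of t^(p-1). *)
Lemma Vf_mono_le2 p M xi eta : 1 < p -> p <= 2 -> enorm xi <= M -> enorm eta <= M ->
  (p - 1) * M `^ (p - 2) * enorm (xi - eta) ^+ 2 <= dotp (Vf p xi - Vf p eta) (xi - eta).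
Proof.
move=> p1 p2.
wlog ab : xi eta / enorm eta <= enorm xi.
  move=> H xM eM; have [|/ltW] := leP (enorm eta) (enorm xi); first by move/H; exact.
  move=> /H /(_ eM xM).
  by rewrite enormB -[eta - xi]opprB -[Vf p eta - _]opprB dotpNN.
move=> xM eM; have [x0|x0] := eqVneq xi 0.
  have e0 : eta = 0 by apply/eqP; rewrite -enorm_eq0 eq_le enorm_ge0 andbT; move: ab; rewrite x0 enorm0.
  by rewrite x0 e0 subrr enorm0 dotp0r expr0n mulr0.
have a0 : 0 < enorm xi by rewrite enorm_gt0.
have M0 : 0 < M by exact: lt_le_trans xM.
have AM : M `^ (p - 2) <= enorm xi `^ (p - 2) by apply: powR_anti => //; rewrite subr_le0.
have D0 : 0 <= enorm (xi - eta) ^+ 2 by rewrite sqr_ge0.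
have p10 : 0 < p - 1 by rewrite subr_gt0.
apply: (@le_trans _ _ ((p - 1) * enorm xi `^ (p - 2) * enorm (xi - eta) ^+ 2)).
  by rewrite ler_wpM2r// ler_pM2l.
have [->|e0] := eqVneq eta 0.
  rewrite Vf0 !subr0 dotpZl -enorm_sqr -mulrA ler_piMl ?mulr_ge0 ?powR_ge0 ?enorm_ge0//.
  by rewrite lerBlDr.
have b0 : 0 < enorm eta by rewrite enorm_gt0.
have BA : enorm xi `^ (p - 2) <= enorm eta `^ (p - 2) by apply: powR_anti => //; rewrite subr_le0.
have Da : (enorm xi - enorm eta) ^+ 2 <= enorm (xi - eta) ^+ 2.
  by rewrite -real_normK ?num_real// ler_pXn2r ?nnegrE ?enorm_ge0// ler_enormB.
have p1' : p - 1 <= 1 by rewrite lerBlDr.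
have := concave_powR p10 p1' b0 ab.
rewrite (_ : p - 1 - 1 = p - 2); last by ring.
rewrite -!powR_sub2 ?enorm_ge0// Vf_mono_expand.
move: AM BA Da D0 ab; set A := enorm xi `^ _; set B := enorm eta `^ _.
set a := enorm xi; set b := enorm eta; set D := enorm (_ - _) ^+ 2.
move=> _ BA Da D0 ab hc.
have A0 : 0 <= A by exact: powR_ge0.
have k1 : 0 <= (A + B - 2 * (p - 1) * A) * (D - (a - b) ^+ 2).
  by rewrite mulr_ge0 ?subr_ge0//; nra.
have k2 : 0 <= (a - b) * (A * a - B * b - (p - 1) * A * (a - b)).
  by rewrite mulr_ge0 ?subr_ge0.
rewrite -subr_ge0.
rewrite (_ : _ - _ = 2^-1 * ((A + B - 2 * (p - 1) * A) * (D - (a - b) ^+ 2)) +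
  (a - b) * (A * a - B * b - (p - 1) * A * (a - b))); last by field.
by rewrite addr_ge0// mulr_ge0// invr_ge0.
Qed.

(** One ellipticity constant for m <= |xi| <= M and |eta| <= M: the first entry serves p > 2, the
    second p <= 2. *)
Definition kap p m M := Num.min (2^-1 * m `^ (p - 2)) ((p - 1) * M `^ (p - 2)).

Lemma kap_gt0 p m M : 1 < p -> 0 < m -> 0 < M -> 0 < kap p m M.
Proof. by move=> p1 m0 M0; rewrite lt_min !mulr_gt0 ?powR_gt0 ?invr_gt0 ?subr_gt0. Qed.

Lemma Vf_mono_range p m M xi eta : 1 < p -> 0 < m -> m <= enorm xi -> enorm xi <= M ->
  enorm eta <= M -> kap p m M * enorm (xi - eta) ^+ 2 <= dotp (Vf p xi - Vf p eta) (xi - eta).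
Proof.
move=> p1 m0 mx xM eM; have [p2|p2] := leP p 2.
  apply: le_trans (Vf_mono_le2 p1 p2 xM eM).
  by rewrite ler_wpM2r ?sqr_ge0// ge_min lexx orbT.
apply: le_trans (Vf_mono_ge2 xi eta (ltW p2)).
rewrite ler_wpM2r ?sqr_ge0// ge_min; apply/orP; left.
by rewrite ler_pM2l ?invr_gt0// powR_mono// ?subr_ge0// ltW.
Qed.

Lemma Vf_mono p xi eta : 1 < p -> 0 <= dotp (Vf p xi - Vf p eta) (xi - eta).
Proof.
move=> p1; have [p2|/ltW p2] := leP p 2.
  apply: le_trans (Vf_mono_le2 p1 p2 (_ : _ <= Num.max (enorm xi) (enorm eta)) _);
    rewrite ?le_max ?lexx ?orbT//.
  apply: mulr_ge0; last exact: sqr_ge0.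
  by apply: mulr_ge0; [rewrite subr_ge0 ltW|exact: powR_ge0].
apply: le_trans (Vf_mono_ge2 xi eta p2); apply: mulr_ge0; last exact: sqr_ge0.
by rewrite mulr_ge0 ?powR_ge0 ?invr_ge0.
Qed.

(** The weight of the energy: it degenerates at critical points when p > 2 and is identically 1 when
    p <= 2. Only one of the two gradients enters it. *)
Definition sig p xi : R := enorm xi `^ Num.max (p - 2) 0.

Lemma Vf_mono_sig p M : 1 < p -> 0 < M -> exists2 c : R, 0 < c & forall xi eta,
  enorm xi <= M -> enorm eta <= M ->
  c * sig p xi * enorm (xi - eta) ^+ 2 <= dotp (Vf p xi - Vf p eta) (xi - eta).
Proof.
move=> p1 M0; have [p2|p2] := leP p 2.
  exists ((p - 1) * M `^ (p - 2)); first by rewrite mulr_gt0 ?powR_gt0 ?subr_gt0.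
  move=> xi eta xM eM; rewrite /sig max_r ?subr_le0// powRr0 mulr1.
  exact: Vf_mono_le2.
exists 2^-1 => // xi eta _ _; rewrite /sig max_l ?subr_ge0 ?(ltW p2)//.
by apply: Vf_mono_ge2; exact: ltW.
Qed.

Lemma powR_range (s m M t : R) : 0 < m -> m <= t -> t <= M -> t `^ s <= m `^ s + M `^ s.
Proof.
move=> m0 mt tM; have [s0|/ltW s0] := leP 0 s.
  by apply: (@le_trans _ _ (M `^ s)); [apply: powR_mono => //; exact: le_trans (ltW m0) mt|rewrite lerDr powR_ge0].
by apply: (@le_trans _ _ (m `^ s)); [exact: powR_anti|rewrite lerDl powR_ge0].
Qed.

Lemma powR_lipschitz (s m M a b : R) : 0 < m -> m <= a <= M -> m <= b <= M ->
  `|a `^ s - b `^ s| <= `|s| * (m `^ (s - 1) + M `^ (s - 1)) * `|a - b|.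
Proof.
move=> m0; wlog ba : a b / b < a.
  move=> H ha hb; have [ab|ab|->] := ltgtP a b; [|exact: H|by rewrite !subrr normr0 mulr0].
  by rewrite distrC [`|a - b|]distrC; exact: H.
move=> /andP[ma aM] /andP[mb bM].
have [||c cab ->] := @MVT R (fun x => x `^ s) (fun x => s * x `^ (s - 1)) b a ba.
- by move=> x; rewrite in_itv /= => /andP[bx _]; apply: is_derive1_powR; apply: lt_trans bx; exact: lt_le_trans mb.
- apply: continuous_in_subspaceT => x /set_mem /=; rewrite in_itv /= => /andP[bx _].
  by apply: (@continuous_powR_at R x id s); [exact: lt_le_trans (le_trans mb bx)|exact: for_id].
move: cab; rewrite in_itv /= => /andP[bc ca].
rewrite !normrM ler_wpM2r// ler_wpM2l// ger0_norm ?powR_ge0//.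
by apply: powR_range => //; [exact: le_trans mb (ltW bc)|exact: le_trans (ltW ca) aM].
Qed.

Lemma Vf_lipschitz p m M : 0 < m -> exists2 C : R, 0 <= C & forall xi eta,
  m <= enorm xi <= M -> m <= enorm eta <= M ->
  enorm (Vf p xi - Vf p eta) <= C * enorm (xi - eta).
Proof.
move=> m0.
pose L := `|p - 2| * (m `^ (p - 2 - 1) + M `^ (p - 2 - 1)).
have L0 : 0 <= L by rewrite mulr_ge0// addr_ge0 ?powR_ge0.
exists (m `^ (p - 2) + M `^ (p - 2) + L * `|M|); first by rewrite addr_ge0 ?mulr_ge0// addr_ge0 ?powR_ge0.
move=> xi eta hx he; have /andP[mx xM] := hx; have /andP[me eM] := he.
have -> : Vf p xi - Vf p eta = enorm xi `^ (p - 2) *: (xi - eta) +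
    (enorm xi `^ (p - 2) - enorm eta `^ (p - 2)) *: eta.
  by rewrite scalerBr scalerBl addrA subrK.
apply: le_trans (enormD _ _) _; rewrite mulrDl !enormZ; apply: lerD.
  by rewrite ler_wpM2r ?enorm_ge0// ger0_norm ?powR_ge0// powR_range.
rewrite mulrAC; apply: ler_pM => //; first exact: enorm_ge0.
  by apply: le_trans (powR_lipschitz _ m0 hx he) _; rewrite ler_wpM2l// ler_enormB.
by apply: le_trans eM _; exact: ler_norm.
Qed.

(** The squared flux is the weight times |xi| to a power that is positive for every p > 1. That
    surplus power is what makes small gradients favourable in [source_estimate]. *)
Lemma powR_sig_q p xi : 1 < p -> enorm xi `^ (p - 1) ^+ 2 =
  enorm xi `^ (2 * (p - 1) - Num.max (p - 2) 0) * sig p xi.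
Proof.
move=> p1; have [->|x0] := eqVneq xi 0.
  rewrite enorm0 powR0 ?gt_eqF ?subr_gt0// expr0n /= powR0 ?mul0r//.
  rewrite subr_eq0 gt_eqF// gt_max; apply/andP; split; lra.
rewrite /sig -powRD ?enorm_eq0 ?x0 ?implybT// subrK -powR_mulrn ?powR_ge0// -powRrM.
by congr (_ `^ _); rewrite mulrC.
Qed.

End p_field.

(** * One-dimensional truncations of class C^1 *)

Section positive_powers.
Context {R : realType}.

(** Powers of the positive part. From exponent 2 on they are C^1, unlike the positive part itself,
    and hence admissible in test functions. *)
Definition ppow (k : nat) (t : R) : R := Num.max t 0 ^+ k.

Lemma ppow_ge0 k t : 0 <= ppow k t.
Proof. by rewrite exprn_ge0// le_max lexx orbT. Qed.

Lemma ppow_pos k t : 0 <= t -> ppow k t = t ^+ k.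
Proof. by move=> t0; rewrite /ppow max_l. Qed.

Lemma ppow_neg k t : t <= 0 -> ppow k.+1 t = 0.
Proof. by move=> t0; rewrite /ppow max_r// expr0n. Qed.

Lemma ppow_gt0 k t : 0 < t -> 0 < ppow k t.
Proof. by move=> t0; rewrite ppow_pos ?exprn_gt0// ltW. Qed.

Lemma continuous_max0 : continuous (fun t : R => Num.max t 0).
Proof.
by move=> t; apply: (@continuous_max R^o R id (fun=> 0)); [exact: for_id|exact: for_cst].
Qed.

Lemma continuous_ppow k : continuous (ppow k).
Proof.
move=> t; apply: (@continuous_comp R R R (fun t : R => Num.max t 0) (fun t => t ^+ k)).
  exact: continuous_max0.
exact: exprn_continuous.
Qed.

Lemma is_derive_ppow k t : is_derive t (1 : R) (ppow k.+2) (k.+2%:R * ppow k.+1 t).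
Proof.
have [t0|t0|->] := ltgtP t 0.
- rewrite ppow_neg ?(ltW t0)// mulr0.
  apply: (near_eq_is_derive _ (is_derive_cst 0 t (1 : R))).
  by apply: filterS (lt_nbhsl t0) => s s0; rewrite ppow_neg// ltW.
- rewrite ppow_pos ?(ltW t0)//.
  apply: (@near_eq_is_derive R R R (id ^+ k.+2)).
    by apply: filterS (lt_nbhsr t0) => s s0; rewrite ppow_pos ?fctE// ltW.
  have h := is_deriveX k.+2 (is_derive_id t (1 : R)); apply: is_derive_eq h _.
  exact: mulr1.
rewrite ppow_neg// mulr0; apply: (is_derive_small ler01) => {}t t1; rewrite mul1r.
rewrite ger0_norm ?ppow_ge0// /ppow.
have m0 : 0 <= Num.max t 0 by rewrite le_max lexx orbT.
have mt : Num.max t 0 <= `|t| by rewrite ge_max ler_norm normr_ge0.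
have m1 : Num.max t 0 <= 1 by exact: le_trans t1.
apply: (@le_trans _ _ (Num.max t 0 ^+ 2)); first by rewrite -[k.+2]addn2 exprD ler_piMl ?exprn_ge0 ?exprn_ile1.
by rewrite ler_pXn2r ?nnegrE.
Qed.

(* C^1 cut-off with value 0 on ]-oo, 0] and 1 on [1, +oo[ once restricted to nonnegative arguments *)
Definition sat (t : R) : R := 1 - ppow 2 (1 - t).

Lemma sat0 : sat 0 = 0.
Proof. by rewrite /sat subr0 ppow_pos// expr1n subrr. Qed.

Lemma sat1 t : 1 <= t -> sat t = 1.
Proof. by move=> t1; rewrite /sat ppow_neg ?subr0// subr_le0. Qed.

Lemma sat_le1 t : sat t <= 1.
Proof. by rewrite lerBlDr lerDl ppow_ge0. Qed.

Lemma sat_ge0 t : 0 <= t -> 0 <= sat t.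
Proof.
move=> t0; rewrite subr_ge0; apply: exprn_ile1; first by rewrite le_max lexx orbT.
by rewrite ge_max ler01 andbT lerBlDr lerDl.
Qed.

Definition dsat (t : R) : R := 2 * ppow 1 (1 - t).

Lemma is_derive_sat t : is_derive t (1 : R) sat (dsat t).
Proof.
have h : is_derive t (1 : R) (fun s : R => 1 - s) (-1).
  have h := is_deriveB (is_derive_cst (1 : R) t (1 : R)) (is_derive_id t (1 : R)).
  by apply: is_derive_eq h _; rewrite sub0r.
have h2 := @is_derive1_comp R (ppow 2) (fun s => 1 - s) _ _ _ (is_derive_ppow 0 _) h.
have h3 := is_deriveB (is_derive_cst (1 : R) t (1 : R)) h2.
by apply: is_derive_eq h3 _; rewrite sub0r mulrN1 opprK.
Qed.

Lemma continuous_dsat : continuous dsat.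
Proof.
move=> t; apply: (@cvgM R R); first exact: cvg_cst.
apply: (@continuous_comp R R R (fun t : R => 1 - t) (ppow 1)); last exact: continuous_ppow.
by apply: (@cvgB R R); [exact: cvg_cst|exact: for_id].
Qed.

Lemma dsat_ge0 t : 0 <= dsat t. Proof. by rewrite mulr_ge0 ?ppow_ge0. Qed.

Lemma dsat_le2 t : 0 <= t -> dsat t <= 2.
Proof.
move=> t0; rewrite /dsat /ppow expr1 ler_piMr// ge_max ler01 andbT.
by rewrite lerBlDr lerDl.
Qed.

Lemma dsat_out t : 1 <= t -> dsat t = 0.
Proof. by move=> t1; rewrite /dsat ppow_neg ?mulr0// subr_le0. Qed.

End positive_powers.

Section integral_positivity.
Context {R : realType} {N : nat}.
Implicit Types (x y z d : 'rV[R]_N) (g h phi : 'rV[R]_N -> R) (K U : set 'rV[R]_N)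
  (dphi : 'rV[R]_N -> 'rV[R]_N).

Lemma indicR_ge0 K x : 0 <= \1_K x :> R.
Proof. by rewrite indicE ler0n. Qed.

Definition rbox x (r : R) : set 'rV[R]_N := [set y | box r (y - x)].

Lemma closed_rbox x r : closed (rbox x r).
Proof.
apply: (@closed_comp _ _ (fun y : 'rV[R]_N => y - x) (box r)) => [y _|]; last exact: closed_box.
by apply: (@continuous_rvB _ _ _ y id (fun=> x)); [exact: for_id|exact: for_cst].
Qed.

Lemma rbox_le x r y : rbox x r y -> `|y| <= `|x| + r.
Proof.
by move=> h; rewrite -[y](subrK x) addrC; apply: le_trans (ler_normD _ _) _; rewrite lerD2l.
Qed.

Lemma indic_rbox x r y : \1_(rbox x r) y = \1_(box r : set 'rV[R]_N) (y - x) :> R.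
Proof. by rewrite !indicE; congr ((_ : bool)%:R); apply/idP/idP; rewrite !inE. Qed.

Lemma BM_rbox x r : BM (\1_(rbox x r) : _ -> R).
Proof.
by apply: BM_set; [exact: closed_mset (@closed_rbox _ _)|exists (`|x| + r); exact: rbox_le].
Qed.

Lemma Int_rbox x (r : R) : 0 <= r -> Int \1_(rbox x r) = (2 * r) ^+ N.
Proof.
move=> r0; rewrite -(@Int_box R N r r0) -(Int_shift (- x) (@BM_box R N r)).
by apply: eq_Int => y; exact: indic_rbox.
Qed.

Lemma CC_near_gt0 g x : continuous_at x g -> 0 < g x ->
  exists2 r : R, 0 < r & forall y, rbox x r y -> g x / 2 <= g y.
Proof.
move=> cg gx; have e0 : 0 < g x / 2 by rewrite divr_gt0.
have /cvgrPdist_lt /(_ _ e0) /nbhs_ballP[r /= r0 hr] := cg.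
exists (r / 2); first by rewrite divr_gt0.
move=> y yx; have /hr : ball x r y.
  rewrite -ball_normE /= distrC; apply: le_lt_trans yx _.
  by rewrite ltr_pdivrMr// ltr_pMr// ltr1n.
by rewrite ltr_norml => /andP[_]; lra.
Qed.

Lemma Int_ge_rbox g x (r c : R) : BM g -> 0 <= r -> (forall y, 0 <= g y) ->
  (forall y, rbox x r y -> c <= g y) -> c * (2 * r) ^+ N <= Int g.
Proof.
move=> bg r0 g0 h; rewrite -(Int_rbox x r0) -IntZ; last exact: BM_rbox.
apply: le_Int => //; first by apply: BM_scale; exact: BM_rbox.
move=> y; rewrite indicE; case: (boolP (y \in _)); last by rewrite mulr0.
by rewrite inE mulr1; exact: h.
Qed.

Lemma Int_gt0 g x : BM g -> continuous_at x g -> (forall y, 0 <= g y) -> 0 < g x -> 0 < Int g.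
Proof.
move=> bg cg g0 gx; have [r r0 h] := CC_near_gt0 cg gx.
apply: lt_le_trans (Int_ge_rbox bg (ltW r0) g0 h).
by rewrite mulr_gt0 ?divr_gt0 ?exprn_gt0 ?mulr_gt0.
Qed.

Lemma Int_le0_eq0 g : CC g -> (forall y, 0 <= g y) -> Int g <= 0 -> forall x, g x = 0.
Proof.
move=> cg g0 Ig x; apply/eqP; rewrite eq_le g0 andbT leNgt; apply/negP => gx.
by have := Int_gt0 (CC_BM cg) (cg.1 x) g0 gx; rewrite ltNge Ig.
Qed.

End integral_positivity.

(** * A Poincare inequality for functions with many zeros *)

Section poincare.
Context {R : realType} {N : nat}.
Implicit Types (x y z d : 'rV[R]_N) (g h phi : 'rV[R]_N -> R) (K U : set 'rV[R]_N)
  (dphi : 'rV[R]_N -> 'rV[R]_N).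

Lemma sqr_sum_le (m : nat) (a : 'I_m -> R) :
  (\sum_i a i) ^+ 2 <= m%:R * \sum_i a i ^+ 2.
Proof.
have := cauchy_schwarz_sqr (\row_i (1 : R)) (\row_i a i); rewrite /dotp.
under eq_bigr do rewrite !mxE mul1r.
under [X in _ <= X * _]eq_bigr do rewrite !mxE mul1r.
under [X in _ <= _ * X]eq_bigr do rewrite !mxE -expr2.
by rewrite sumr_const card_ord.
Qed.

Lemma line_continuous x z (t : R) : continuous_at t (fun s : R => x + s *: z).
Proof.
apply: continuous_rvD; first exact: for_cst.
by apply: continuous_rvZ; [exact: for_id|exact: for_cst].
Qed.

Lemma tst_CC_dir U phi dphi z : tst U phi dphi -> CC (fun x => dotp (dphi x) z).
Proof.
move=> h; have h1 : forall x, setT x -> continuous_at x (fun=> z) by move=> x _; exact: for_cst.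
have := tst_CC_dot openT (tst_sub (@subsetT _ _) h) h1.
rewrite (_ : (fun x => dotp (dphi x) z) = fun x => dotp z (dphi x)) //.
by apply/funext => x; rewrite dotpC.
Qed.

(** A Riemann sum replaces the integral of the directional derivative along the segment, which
    avoids integrating in the parameter. *)
Lemma tst_increment g dg z (e : R) (m : nat) x : tst setT g dg ->
  (forall y s, 0 <= s <= m.+1%:R^-1 -> `|dotp (dg (y + s *: z)) z - dotp (dg y) z| <= e) ->
  `|g (x + z) - g x - m.+1%:R^-1 * \sum_(i < m.+1) dotp (dg (x + (i%:R / m.+1%:R) *: z)) z| <= e.
Proof.
move=> [Hg _ _] He; set q : R := m.+1%:R^-1.
have q0 : 0 < q by rewrite invr_gt0.
have -> : g (x + z) - g x = \sum_(i < m.+1) (g (x + (i.+1%:R * q) *: z) - g (x + (i%:R * q) *: z)).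
  rewrite -(big_mkord xpredT (fun i => g (x + (i.+1%:R * q) *: z) - g (x + (i%:R * q) *: z))).
  by rewrite (telescope_sumr (fun i => g (x + (i%:R * q) *: z)))// mul0r scale0r addr0 mulfV// scale1r.
rewrite mulr_sumr -sumrB.
apply: (@le_trans _ _ (\sum_(i < m.+1) q * e)); last first.
  by rewrite sumr_const card_ord -mulr_natl mulrA mulfV// mul1r.
apply: le_trans (ler_norm_sum _ _ _) _; apply: ler_sum => i _.
have [||t t01 E] := @mvt_line _ _ g dg (x + (i%:R * q) *: z) (q *: z).
- by move=> t _; exact: Hg.
- by move=> t _; exact: is_grad_continuous (Hg _).
rewrite (_ : x + (i.+1%:R * q) *: z = x + (i%:R * q) *: z + q *: z); last first.
  by rewrite -addrA -scalerDl -natr1 mulrDl mul1r.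
rewrite E dotpZr -mulrBr normrM gtr0_norm// ler_pM2l// scalerA.
apply: He; move: t01; rewrite in_itv /= => /andP[t0 t1].
by rewrite mulr_ge0 ?(ltW t0) ?(ltW q0)//= ler_piMl ?(ltW q0) ?(ltW t1).
Qed.

Lemma sqr_add_le (a b e : R) : 0 < e -> `|a - b| <= e -> a ^+ 2 <= (1 + e) * b ^+ 2 + (e + e ^+ 2).
Proof.
move=> e0; rewrite ler_norml => /andP[h1 h2].
pose c := a - b; have -> : a = b + c by rewrite /c; ring.
have hc : c ^+ 2 <= e ^+ 2 by rewrite -subr_ge0 subr_sqr mulr_ge0 /c; lra.
have : 0 <= (e * b - c) ^+ 2 by exact: sqr_ge0.
move=> h3; have h4 : 2 * b * c * e <= e ^+ 2 * b ^+ 2 + c ^+ 2 by nra.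
rewrite -(ler_pM2r e0); nra.
Qed.

(** The increment is, up to e, a mean of directional derivatives at m + 1 points of the segment. Its
    square is bounded by the mean of the squares, each translated term has the same integral, and e
    is arbitrary. *)
Lemma translation_estimate g dg z K K' : tst setT g dg -> mset K -> mset K' ->
  (forall x t, K x -> 0 <= t <= 1 -> K' (x + t *: z)) ->
  Int (fun x => \1_K x * (g (x + z) - g x) ^+ 2) <= Int (fun x => \1_K' x * dotp (dg x) z ^+ 2).
Proof.
move=> tg mK mK' KK'.
have [cg [M HM]] := tst_CC tg.
have cd := tst_CC_dir z tg.
have bd : BM (fun x => dotp (dg x) z ^+ 2) by apply: BMM; exact: CC_BM.
have bd' : BM (fun x => \1_K' x * dotp (dg x) z ^+ 2) by exact: BM_indic.
have bg : BM (fun x => (g (x + z) - g x) ^+ 2).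
  have b0 : BM (fun x => g (x + z) - g x).
    by apply: BMB; [apply: BM_shift|]; exact: CC_BM (tst_CC tg).
  exact: BMM.
have bKg : BM (fun x => \1_K x * (g (x + z) - g x) ^+ 2) by exact: BM_indic.
set I := Int (fun x => \1_K' x * _).
pose M' : R := `|M| + `|z|.
have M0 : 0 <= M' by rewrite addr_ge0.
suff H (e : R) : 0 < e -> Int (fun x => \1_K x * (g (x + z) - g x) ^+ 2) <=
    (1 + e) * I + (e + e ^+ 2) * (2 * M') ^+ N.
  apply/ler_addgt0Pl => e e0.
  pose C := I + 2 * (2 * M') ^+ N.
  have I0 : 0 <= I by apply: Int_ge0 => x; rewrite mulr_ge0 ?sqr_ge0// indicE ler0n.
  have B0 : 0 <= (2 * M') ^+ N by rewrite exprn_ge0// mulr_ge0.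
  have C0 : 0 <= C by rewrite addr_ge0// mulr_ge0.
  pose e' := Num.min 1 (e / (C + 1)).
  have e'0 : 0 < e' by rewrite lt_min ltr01 divr_gt0// ltr_wpDl.
  have e'1 : e' <= 1 by rewrite ge_min lexx.
  have e'2 : e' * (C + 1) <= e by rewrite -ler_pdivlMr ?ltr_wpDl// ge_min lexx orbT.
  apply: le_trans (H e' e'0) _; move: e'2; rewrite /C.
  have : (e' + e' ^+ 2) * (2 * M') ^+ N <= 2 * e' * (2 * M') ^+ N by rewrite ler_wpM2r//; nra.
  nra.
move=> e0.
have [r r0 Hr] := CC_unif cd e0.
(* Over a step of length |z|/(m+1) < r the directional derivative varies by less than [e]. *)
have [m Hm] : exists m : nat, `|z| / r < m.+1%:R.
  by exists (Num.bound (`|z| / r)); apply: lt_le_trans (archi_boundP (divr_ge0 (normr_ge0 z) (ltW r0))) _; rewrite ler_nat.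
pose q : R := m.+1%:R^-1.
have inc x : `|g (x + z) - g x - q * \sum_(i < m.+1) dotp (dg (x + (i%:R / m.+1%:R) *: z)) z| <= e.
  apply: tst_increment => // y s /andP[s0 sq]; apply/ltW/Hr.
  rewrite (addrC y) addrK normrZ ger0_norm//.
  apply: (@le_lt_trans _ _ (m.+1%:R^-1 * `|z|)); first by rewrite ler_wpM2r.
  by rewrite mulrC ltr_pdivrMr// mulrC -ltr_pdivrMr.
pose G y : R := \1_K' y * dotp (dg y) z ^+ 2.
have bS : BM (fun x => \sum_(i < m.+1) G (x + (i%:R * q) *: z)).
  by apply: BM_sum => i; exact: (@BM_shift _ _ _ G).
have pt x : \1_K x * (g (x + z) - g x) ^+ 2 <=
    (1 + e) * (q * \sum_(i < m.+1) G (x + (i%:R * q) *: z)) +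
    (e + e ^+ 2) * \1_(box M') x.
  have n0 y : 0 <= G y by rewrite mulr_ge0 ?sqr_ge0// indicE ler0n.
  have p0 : 0 <= (1 + e) * (q * \sum_(i < m.+1) G (x + (i%:R * q) *: z)).
    apply: mulr_ge0; first by rewrite addr_ge0// ltW.
    by rewrite mulr_ge0 ?invr_ge0// sumr_ge0.
  have p1 : 0 <= (e + e ^+ 2) * \1_(box M') x :> R.
    by rewrite mulr_ge0 ?addr_ge0 ?sqr_ge0 ?(ltW e0)// indicE ler0n.
  rewrite [X in X * _ <= _]indicE; case: (boolP (x \in K)); last by rewrite mul0r addr_ge0.
  rewrite inE => Kx; rewrite mul1r.
  have [g0|gn] := eqVneq (g (x + z) - g x) 0; first by rewrite g0 expr0n addr_ge0.
  have xM : box M' x.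
    have [gx|gx] := eqVneq (g x) 0.
      have gxz : g (x + z) != 0 by move: gn; rewrite gx subr0.
      rewrite /box /= -[x](addrK z); apply: le_trans (ler_normB _ _) _.
      by rewrite lerD2r; apply: le_trans (HM _ gxz) (ler_norm _).
    by apply: le_trans (HM _ gx) _; apply: le_trans (ler_norm _) _; rewrite lerDl.
  rewrite indicE mem_set// mulr1.
  apply: le_trans (sqr_add_le e0 (inc x)) _; rewrite lerD2r ler_pM2l ?addr_gt0//.
  rewrite exprMn; apply: le_trans (ler_wpM2l (sqr_ge0 _) (sqr_sum_le _)) _.
  rewrite le_eqVlt; apply/orP; left; apply/eqP.
  have qm : q * m.+1%:R = 1 by rewrite /q mulVf.
  rewrite mulrA expr2 -[q * q * _]mulrA qm mulr1; congr (_ * _); apply: eq_bigr => i _.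
  rewrite /G indicE mem_set ?mul1r//; apply: KK' => //.
  by rewrite divr_ge0//= ler_pdivrMr// mul1r ler_nat ltnW.
apply: le_trans (le_Int bKg _ pt) _.
  by apply: BMD; apply: BM_scale; [exact: BM_scale|exact: BM_box].
rewrite IntD; first last.
- by apply: BM_scale; exact: BM_box.
- by apply: BM_scale; exact: BM_scale.
rewrite IntZ; last exact: BM_scale.
rewrite (IntZ _ bS) IntZ; last exact: BM_box.
rewrite Int_box// lerD2r ler_pM2l ?addr_gt0// Int_sum; last by move=> i; exact: (@BM_shift _ _ _ G).
under eq_bigr do rewrite (@Int_shift _ _ _ G)//.
by rewrite sumr_const card_ord -[_ *+ _]mulr_natl mulrA mulVf// mul1r.
Qed.

(* Average translation_estimate over the translates that land in Z, where g vanishes. *)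
Lemma poincare g dg K K' Z (r theta : R) : tst setT g dg -> mset K -> mset K' -> mset Z ->
  0 <= r -> (forall x z, K x -> `|z| <= r -> K' (x + z)) -> (forall x, Z x -> g x = 0) ->
  (forall x, K x -> theta <= Int (fun z => \1_(box r) z * \1_Z (x + z))) ->
  theta * Int (fun x => \1_K x * g x ^+ 2) <=
    (2 * r) ^+ N * ((N%:R * r) ^+ 2 * Int (fun x => \1_K' x * dotp (dg x) (dg x))).
Proof.
move=> tg mK mK' mZ r0 KK' gZ Hth.
have cg := tst_CC tg; have bg := CC_BM cg; have mg := BM_mfun bg.
have [cg0 [M HM]] := cg; have [Mg HMg] := BM_bounded bg.
have bKg : BM (fun x => \1_K x * g x ^+ 2) by apply: BM_indic => //; exact: BMM.
have bd : BM (fun x => dotp (dg x) (dg x)).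
  by apply: BM_sum => i; apply: BMM; exact: CC_BM (tst_CC_coord i tg).
have bd' : BM (fun x => \1_K' x * dotp (dg x) (dg x)) by exact: BM_indic.
pose F x z : R := \1_K x * (\1_(box r) z * (g (x + z) - g x) ^+ 2).
have bF : BM2 F.
  split.
    apply: mfun2M; first by apply: mfun2_fst; exact: mfun_indic.
    apply: mfun2M; first by apply: mfun2_snd; apply: mfun_indic; exact: closed_mset (closed_box _).
    have h : mfun2 (fun x z => g (x + z) - g x).
      apply: mfun2D; first exact: mfun2_add.
      by apply: (@mfun2_fst _ _ (fun x => - g x)); exact: BM_mfun (BMN bg).
    exact: mfun2M.
  exists (Num.max ((2 * Mg) ^+ 2) (`|M| + r)) => x z.
  rewrite /F !indicE; case: (boolP (x \in K)); last by rewrite mul0r normr0 eqxx le_max sqr_ge0.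
  move=> _; case: (boolP (z \in _)); last by rewrite mul0r mulr0 normr0 eqxx le_max sqr_ge0.
  rewrite inE !mul1r => zr; split.
    rewrite le_max; apply/orP; left; rewrite normrX ler_pXn2r ?nnegrE//.
      by apply: le_trans (ler_normB _ _) _; have := HMg (x + z); have := HMg x; lra.
    by rewrite mulr_ge0//; apply: le_trans (HMg 0).
  move=> gn; split; rewrite le_max; apply/orP; right; last first.
    by apply: le_trans zr _; rewrite lerDr.
  have [gx|gx] := eqVneq (g x) 0; last first.
    by apply: le_trans (HM _ gx) _; apply: le_trans (ler_norm _) _; rewrite lerDl.
  have gxz : g (x + z) != 0 by apply: contraNneq gn => ->; rewrite gx subr0 expr0n.
  rewrite -[x](addrK z); apply: le_trans (ler_normB _ _) _.
  by rewrite lerD//; apply: le_trans (HM _ gxz) (ler_norm _).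
have bZ x : BM (fun z => \1_(box r) z * \1_Z (x + z) : R).
  under eq_fun do rewrite mulrC.
  apply: (@BMMl _ _ (\1_(box r)) (fun z => \1_Z (x + z))); first exact: BM_box.
    under eq_fun do rewrite addrC; exact: (mfun_shift x (mfun_indic mZ)).
  by exists 1 => z _; rewrite indicE ger0_norm// lern1 leq_b1.
(* Integrated in z alone, [F] is at least theta g(x)^2, by the zeros of [g] on [Z]; integrated in x
   alone it is bounded by [translation_estimate]. *)
apply: (@le_trans _ _ (Int (fun x => Int (F x)))).
  rewrite -IntZ//; apply: le_Int; [exact: BM_scale|exact: BM_Int|move=> x].
  rewrite [X in _ * (X * _)]indicE; case: (boolP (x \in K)); last first.
    rewrite mul0r mulr0 => _; apply: Int_ge0 => z; apply: mulr_ge0; first exact: indicR_ge0.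
    by apply: mulr_ge0; [exact: indicR_ge0|exact: sqr_ge0].
  rewrite inE => Kx; rewrite mul1r.
  apply: le_trans (ler_wpM2r (sqr_ge0 _) (Hth x Kx)) _.
  rewrite -IntZr//; apply: le_Int; first by under eq_fun do rewrite mulrC; exact: BM_scale.
    exact: BM2_section.
  move=> z; rewrite /F indicE [X in _ <= X * _]indicE (mem_set Kx) mul1r -mulrA ler_wpM2l//.
  rewrite indicE; case: (boolP (_ \in Z)); last by rewrite mul0r sqr_ge0.
  by rewrite inE => /gZ ->; rewrite mul1r sub0r sqrrN.
rewrite (Int_fubini bF) -(@Int_box R N r r0) -IntZr; last exact: BM_box.
apply: le_Int.
- by have := BM_Int (BM2_swap bF).
- under eq_fun do rewrite mulrC; apply: BM_scale; exact: BM_box.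
move=> z; rewrite [X in _ <= X * _]indicE; case: (boolP (z \in _)) => zr; last first.
  rewrite mul0r (_ : (fun x => F x z) = fun=> 0) ?Int0//; apply/funext => x.
  by rewrite /F [X in _ * (X * _)]indicE (negbTE zr) mul0r mulr0.
have zr' := zr; rewrite inE in zr'.
rewrite mul1r (_ : (fun x => F x z) = fun x => \1_K x * (g (x + z) - g x) ^+ 2); last first.
  by apply/funext => x; rewrite /F [X in _ * (X * _)]indicE zr mul1r.
apply: le_trans (translation_estimate (z := z) tg mK mK' _) _.
  move=> x t Kx /andP[t0 t1]; apply: KK' => //.
  by rewrite normrZ ger0_norm//; apply: le_trans zr'; rewrite ler_piMl.
rewrite -IntZ//; apply: le_Int; [|exact: BM_scale|].
  by apply: BM_indic => //; apply: BMM; exact: CC_BM (tst_CC_dir _ tg).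
move=> x; rewrite [leRHS]mulrCA; apply: ler_wpM2l; first exact: indicR_ge0.
apply: le_trans (cauchy_schwarz_sqr _ _) _; rewrite mulrC ler_wpM2r ?dotp_ge0//.
rewrite -enorm_sqr ler_pXn2r ?nnegrE ?enorm_ge0 ?mulr_ge0//.
by apply: le_trans (enorm_le_norm _) _; rewrite ler_wpM2l.
Qed.

End poincare.

Section real_continuity.
Context {R : realType} {T : topologicalType}.
Implicit Types (x : T) (f g : T -> R).

Lemma continuous_rD x f g : continuous_at x f -> continuous_at x g ->
  continuous_at x (fun y => f y + g y).
Proof. by move=> cf cg; apply: (@cvgD R R T). Qed.

Lemma continuous_rB x f g : continuous_at x f -> continuous_at x g ->
  continuous_at x (fun y => f y - g y).
Proof. by move=> cf cg; apply: (@cvgB R R T). Qed.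

Lemma continuous_rN x f : continuous_at x f -> continuous_at x (fun y => - f y).
Proof. by move=> cf; apply: (@cvgN R R T). Qed.

Lemma continuous_rM x f g : continuous_at x f -> continuous_at x g ->
  continuous_at x (fun y => f y * g y).
Proof. by move=> cf cg; apply: (@cvgM R T). Qed.

Lemma continuous_rZ x (c : R) f : continuous_at x f -> continuous_at x (fun y => c * f y).
Proof. by move=> cf; apply: continuous_rM => //; exact: for_cst. Qed.

Lemma continuous_rV x f : f x != 0 -> continuous_at x f -> continuous_at x (fun y => (f y)^-1).
Proof. by move=> f0 cf; apply: (@cvgV R T). Qed.

Lemma continuous_rcomp x f (h : R -> R) : continuous_at x f -> continuous h ->
  continuous_at x (fun y => h (f y)).
Proof. by move=> cf ch; apply: (@continuous_comp T R R f h); [|exact: ch]. Qed.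

End real_continuity.

(** * Operations on test functions and cut-offs *)

Section test_functions.
Context {R : realType} {N : nat}.
Implicit Types (x y z d c : 'rV[R]_N) (g h phi : 'rV[R]_N -> R) (K U : set 'rV[R]_N)
  (dphi dh : 'rV[R]_N -> 'rV[R]_N).

Lemma tst_on K U phi dphi : open U -> compact K -> K `<=` U ->
  (forall x, U x -> is_grad phi x (dphi x)) ->
  (forall x, U x -> continuous_at x dphi) ->
  (forall x, ~ K x -> phi x = 0 /\ dphi x = 0) -> tst U phi dphi.
Proof.
move=> oU cK KU gphi cphi out.
have h := tst_cut oU cK KU gphi cphi (fun x _ => out x).
have E1 : cut K phi = phi.
  by apply/funext => x; apply: (@cut_eq _ _ K setT) => // y _ /out [].
have E2 : cut K dphi = dphi.
  by apply/funext => x; apply: (@cut_eq _ _ K setT) => // y _ /out [].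
by rewrite E1 E2 in h.
Qed.

Lemma tst_mul U phi dphi h dh : open U -> tst U phi dphi ->
  (forall x, U x -> is_grad h x (dh x)) -> (forall x, U x -> continuous_at x dh) ->
  tst U (fun x => h x * phi x) (fun x => h x *: dphi x + phi x *: dh x).
Proof.
move=> oU [gphi cphi [K cK [KU out]]] gh ch; apply: (tst_on oU cK KU).
- by move=> x Ux; apply: is_gradM; [exact: gh|exact: gphi].
- move=> x Ux; apply: continuous_rvD; apply: continuous_rvZ; [|exact: cphi| |exact: ch].
    exact: is_grad_continuous (gh x Ux).
  exact: is_grad_continuous (gphi x).
- by move=> x /out [-> ->]; rewrite mulr0 scaler0 scale0r addr0.
Qed.

Lemma tst_comp U phi dphi (f f' : R -> R) : open U -> tst U phi dphi -> f 0 = 0 ->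
  (forall t, is_derive t (1 : R) f (f' t)) -> continuous f' ->
  tst U (fun x => f (phi x)) (fun x => f' (phi x) *: dphi x).
Proof.
move=> oU [gphi cphi [K cK [KU out]]] f0 df cf; apply: (tst_on oU cK KU).
- by move=> x Ux; apply: is_grad_comp.
- move=> x Ux; apply: continuous_rvZ; last exact: cphi.
  apply: (@continuous_comp _ R R phi f'); last exact: cf.
  exact: is_grad_continuous (gphi x).
- by move=> x /out [-> ->]; rewrite scaler0.
Qed.

Lemma is_derive_sqr (t : R) : is_derive t (1 : R) (fun s : R => s ^+ 2) (2 * t).
Proof.
have h := is_deriveX 2 (is_derive_id t (1 : R)); apply: is_derive_eq h _; exact: mulr1.
Qed.

Lemma tst_sqr U phi dphi : open U -> tst U phi dphi ->
  tst U (fun x => phi x ^+ 2) (fun x => (2 * phi x) *: dphi x).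
Proof.
move=> oU tphi; apply: (@tst_comp _ _ _ (fun t => t ^+ 2) (fun t => 2 * t)) => //.
- by rewrite expr0n.
- exact: is_derive_sqr.
- exact: mulrl_continuous.
Qed.

Lemma tst_dphi0 phi dphi : tst setT phi dphi -> (forall x, dphi x = 0) -> (0 < N)%N ->
  forall x, phi x = 0.
Proof.
move=> tphi d0 N0 x; have [gphi _ _] := tphi; have [_ [M HM]] := tst_CC tphi.
(* Far enough along one coordinate axis to leave the support from any starting point [x]; this is
   where the dimension must be positive. *)
pose z : 'rV[R]_N := (`|M| + 1 + `|x|) *: delta_mx 0 (Ordinal N0).
have [||t _] := @mvt_line _ _ phi dphi x z.
- by move=> t _; exact: gphi.
- by move=> t _; exact: is_grad_continuous (gphi _).
rewrite d0 dotp0l => /eqP; rewrite subr_eq0 => /eqP <-.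
apply/eqP; apply/negPn/negP => /HM; apply/negP; rewrite -ltNge.
have h : `|M| + 1 + `|x| <= `|z|.
  have := rV_coord_le z (Ordinal N0); rewrite !mxE !eqxx mulr1 [leLHS]ger0_norm// !addr_ge0//.
have : `|z| <= `|x + z| + `|x|.
  by rewrite -{1}[z](addKr x) addrC; apply: le_trans (ler_normB _ _) _; rewrite [x + z]addrC.
have := ler_norm M; move: h; lra.
Qed.

Lemma is_grad_sqr_dist c x : is_grad (fun y => dotp (y - c) (y - c)) x (2 *: (x - c)).
Proof.
apply: is_gradP => e e0.
have d0 : 0 < e / (N%:R ^+ 2 + 1) by rewrite divr_gt0// ltr_wpDl// sqr_ge0.
have : \forall h \near (0 : 'rV[R]_N), `|h| < e / (N%:R ^+ 2 + 1).
  by apply/nbhs_ballP; exists (e / (N%:R ^+ 2 + 1)) => //= h; rewrite -ball_normE /= sub0r normrN.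
apply: filterS => h hh.
rewrite -addrA dotpZl; move: (x - c) => y.
rewrite (_ : _ - _ = dotp h h); last by rewrite dotpDr !dotpDl (dotpC y h); ring.
apply: le_trans (dotp_norm_le _ _) _; rewrite mulrA ler_wpM2r//.
apply: (@le_trans _ _ ((N%:R ^+ 2 + 1) * `|h|)); first by rewrite ler_wpM2r// lerDl.
by rewrite mulrC -ler_pdivlMr ?ltr_wpDl ?sqr_ge0// ltW.
Qed.

Lemma continuous_enorm_dist c x : continuous_at x (fun y => enorm (y - c)).
Proof.
apply: continuous_enorm; apply: continuous_rvB; [exact: for_id|exact: for_cst].
Qed.

Lemma compact_edisk c (r : R) : compact [set y | enorm (y - c) <= r].
Proof.
apply: (@compact_closed_bounded _ _ _ (`|c| + r)).
  apply: (@closed_comp _ _ (fun y : 'rV[R]_N => enorm (y - c)) [set t | t <= r]); last exact: closed_le.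
  by move=> y _; exact: continuous_enorm_dist.
move=> y /= /(le_trans (norm_le_enorm _)) h.
by rewrite -[y](subrK c) addrC; apply: le_trans (ler_normD _ _) _; rewrite lerD2l.
Qed.

Lemma open_edisk c (r : R) : open [set y | enorm (y - c) < r].
Proof.
apply: (@open_comp _ _ (fun y : 'rV[R]_N => enorm (y - c)) [set t | t < r]); last exact: open_lt.
by move=> y _; exact: continuous_enorm_dist.
Qed.

(** A function of |y - c|^2, hence C^1 at the centre too. It vanishes from radius 3r/2 on. Inside
    radius r the excess (3r/2)^2 - |y - c|^2 is at least 5r^2/4, which is beyond the saturation
    point r^2. *)
Lemma cutoff c (r : R) : 0 < r -> exists chi dchi,
  [/\ tst [set y | enorm (y - c) < 2 * r] chi dchi, (forall y, 0 <= chi y <= 1) &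
      forall y, enorm (y - c) <= r -> chi y = 1 /\ dchi y = 0].
Proof.
move=> r0; pose q y := (3 / 2 * r) ^+ 2 - dotp (y - c) (y - c).
have r20 : 0 < r ^+ 2 by rewrite exprn_gt0.
pose f (t : R) := sat (r ^- 4 * ppow 2 t).
pose f' (t : R) := dsat (r ^- 4 * ppow 2 t) * (r ^- 4 * (2 * ppow 1 t)).
have df t : is_derive t (1 : R) f (f' t).
  apply: (@is_derive1_comp R sat (fun t => r ^- 4 * ppow 2 t)); first exact: is_derive_sat.
  have h := is_deriveZ (r ^- 4) (is_derive_ppow 0 t).
  exact: is_derive_eq h _.
have cf' : continuous f'.
  move=> t; apply: (@cvgM R R); last first.
    by apply: (@cvgM R R); [exact: cvg_cst|apply: (@cvgM R R); [exact: cvg_cst|exact: continuous_ppow]].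
  apply: (@continuous_comp R R R (fun t => r ^- 4 * ppow 2 t) dsat); last exact: continuous_dsat.
  by apply: (@cvgM R R); [exact: cvg_cst|exact: continuous_ppow].
have gq y : is_grad q y (- (2 *: (y - c))).
  have h := is_gradB (is_grad_cst ((3 / 2 * r) ^+ 2) y) (is_grad_sqr_dist c y).
  by rewrite sub0r in h.
exists (fun y => f (q y)), (fun y => f' (q y) *: - (2 *: (y - c))); split.
- apply: (tst_on (K := [set y | enorm (y - c) <= 3 / 2 * r])).
  + exact: open_edisk.
  + exact: compact_edisk.
  + by move=> y /= h; apply: le_lt_trans h _; rewrite ltr_pM2r//; lra.
  + by move=> y _; exact: is_grad_comp.
  + move=> y _; apply: continuous_rvZ.
      apply: (@continuous_comp _ R R q f'); last exact: cf'.
      exact: is_grad_continuous (gq y).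
    apply: continuous_rvN; apply: continuous_rvZ; first exact: for_cst.
    by apply: continuous_rvB; [exact: for_id|exact: for_cst].
  + move=> y /= /negP; rewrite -ltNge => h.
    have q0 : q y <= 0.
      rewrite subr_le0 -enorm_sqr.
      by rewrite ler_pXn2r ?nnegrE ?enorm_ge0 ?(ltW h)// !mulr_ge0 ?ltW.
    by rewrite /f /f' !ppow_neg// !mulr0 sat0 scale0r.
- move=> y; rewrite sat_le1 andbT sat_ge0// mulr_ge0 ?ppow_ge0// invr_ge0.
  by rewrite exprn_ge0// ltW.
- move=> y yr; have h : 1 <= r ^- 4 * ppow 2 (q y).
    have qr : r ^+ 2 <= q y.
      rewrite /q -enorm_sqr.
      have : enorm (y - c) ^+ 2 <= r ^+ 2 by rewrite ler_pXn2r ?nnegrE ?enorm_ge0 ?(ltW r0).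
      by rewrite exprMn; lra.
    rewrite mulrC ler_pdivlMr ?exprn_gt0// mul1r ppow_pos; last by apply: le_trans qr; exact: ltW.
    rewrite (_ : r ^+ 4 = (r ^+ 2) ^+ 2); last by rewrite -exprM.
    by rewrite ler_pXn2r ?nnegrE ?(ltW r20)//; apply: le_trans qr; exact: ltW.
  by rewrite /f /f' sat1// dsat_out// mul0r scale0r.
Qed.

End test_functions.

(** * Comparison principles *)

Section strong_comparison.
Context {R : realType} {N : nat}.
Implicit Types (x y z d c : 'rV[R]_N) (g h phi : 'rV[R]_N -> R) (K U : set 'rV[R]_N)
  (dphi dh : 'rV[R]_N -> 'rV[R]_N).

Lemma mset_rbox_eq x0 (r : R) (v1 v2 : 'rV[R]_N -> R) : continuous v1 -> continuous v2 ->
  mset [set x | rbox x0 r x /\ v1 x = v2 x].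
Proof.
move=> c1 c2; apply: closed_mset; apply: closedI; first exact: closed_rbox.
rewrite (_ : (fun x => v1 x = v2 x) = [set x | v1 x - v2 x = 0]); last first.
  by apply/seteqP; split=> x /= => [->|/eqP]; rewrite ?subrr// subr_eq0 => /eqP.
apply: (@closed_comp _ _ (fun x => v1 x - v2 x) [set 0]); last exact: closed_eq.
by move=> x _; apply: continuous_rB; [exact: c1|exact: c2].
Qed.

Variables (p m M L : R) (U : set 'rV[R]_N) (v1 v2 H1 H2 : 'rV[R]_N -> R)
  (G1 G2 : 'rV[R]_N -> 'rV[R]_N).
Hypotheses (p1 : 1 < p) (oU : open U) (c1 : continuous v1) (c2 : continuous v2).
Hypotheses (g1 : forall x, U x -> is_grad v1 x (G1 x)) (g2 : forall x, U x -> is_grad v2 x (G2 x)).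
Hypotheses (cG1 : forall x, U x -> continuous_at x G1) (cG2 : forall x, U x -> continuous_at x G2).
Hypotheses (cH1 : forall x, U x -> continuous_at x H1) (cH2 : forall x, U x -> continuous_at x H2).
Hypotheses (m0 : 0 < m) (rG1 : forall x, U x -> m <= enorm (G1 x) <= M)
  (rG2 : forall x, U x -> m <= enorm (G2 x) <= M).
Hypotheses (L0 : 0 <= L) (w0 : forall x, U x -> v2 x <= v1 x)
  (HL : forall x, U x -> `|H1 x - H2 x| <= L * (v1 x - v2 x)).
Hypothesis weak : forall phi dphi, tst U phi dphi ->
  Int (fun x => dotp (Vf p (G1 x) - Vf p (G2 x)) (dphi x)) = Int (fun x => (H1 x - H2 x) * phi x).

Let w x := v1 x - v2 x.
Let dw x := G1 x - G2 x.

Let gw x : U x -> is_grad w x (dw x).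
Proof. by move=> Ux; apply: is_gradB; [exact: g1|exact: g2]. Qed.

Let cdw x : U x -> continuous_at x dw.
Proof. by move=> Ux; apply: continuous_rvB; [exact: cG1|exact: cG2]. Qed.

Let cDV x : U x -> continuous_at x (fun x => Vf p (G1 x) - Vf p (G2 x)).
Proof. by move=> Ux; apply: continuous_rvB; apply: continuous_Vf => //; [exact: cG1|exact: cG2]. Qed.

Let w_ge0 x : U x -> 0 <= w x.
Proof. by move=> Ux; rewrite subr_ge0; exact: w0. Qed.

Let cw x : continuous_at x w.
Proof. by apply: continuous_rB; [exact: c1|exact: c2]. Qed.

(* Testing the difference of the equations with chi^2 / (w + e). *)
Lemma log_estimate chi dchi : tst U chi dchi -> (forall x, 0 <= chi x) ->
  exists E : R, forall e : R, 0 < e ->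
  Int (fun x => chi x ^+ 2 * ((w x + e) ^-1 ^+ 2 * dotp (dw x) (dw x))) <= E.
Proof.
move=> tchi chi0; have tchi2 := tst_sqr oU tchi.
have M0 : 0 < M \/ forall x, ~ U x.
  have [[x Ux]|nU] := pselect (exists x, U x); last by right=> x Ux; apply: nU; exists x.
  left; have /andP[a b] := rG1 Ux; exact: lt_le_trans m0 (le_trans a b).
case: M0 => [M0|nU]; last first.
  exists 0 => e e0; rewrite (_ : (fun x => _) = fun=> 0) ?Int0//; apply/funext => x.
  have [_ _ [K _ [KU out]]] := tchi; have [//|->] := out x.
    by move=> /KU; exact: nU.
  by rewrite expr0n mul0r.
have k0 := kap_gt0 p1 m0 M0; set k := kap p m M in k0.
have [C C0 HC] := @Vf_lipschitz R N p m M m0.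
have bchi : BM (fun x => chi x ^+ 2) by exact: CC_BM (tst_CC tchi2).
have bdchi : BM (fun x => dotp (dchi x) (dchi x)).
  by apply: BM_sum => i; apply: BMM; exact: CC_BM (tst_CC_coord i tchi).
(* The bound is free of [e]: the first term is what remains of the gradient of [chi] after
   absorption, the second comes from |H1 - H2| <= L w and w/(w + e) <= 1. *)
exists (2 / k * (2 * C ^+ 2 / k * Int (fun x => dotp (dchi x) (dchi x)) + L * Int (fun x => chi x ^+ 2))).
move=> e e0; pose h x := (w x + e)^-1.
have we x : U x -> 0 < w x + e by move=> Ux; rewrite ltr_wpDl// w_ge0.
have gh x : U x -> is_grad h x ((- h x ^+ 2) *: dw x).
  move=> Ux; have dv : is_derive (w x) (1 : R) (fun t : R => (t + e)^-1) (- h x ^+ 2).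
    have a1 := is_deriveD (is_derive_id (w x) (1 : R)) (is_derive_cst e (w x) (1 : R)).
    have n0 : (fun t : R => t + e) (w x) != 0 by rewrite /= gt_eqF// we.
    have a2 := @is_deriveV R (fun t : R => t + e) (w x) _ _ n0 a1; apply: is_derive_eq a2 _.
    by rewrite addr0 /h exprVn; exact: mulr1.
  by have := is_grad_comp (gw Ux) dv.
have ch x : U x -> continuous_at x h.
  by move=> Ux; exact: is_grad_continuous (gh _ Ux).
have cdh x : U x -> continuous_at x (fun x => (- h x ^+ 2) *: dw x).
  move=> Ux; apply: continuous_rvZ; last exact: cdw.
  by apply: continuous_rN; apply: continuous_rM; exact: ch.
have tphi := tst_mul oU tchi2 gh cdh.
set phi := (fun x => h x * chi x ^+ 2) in tphi.
set dphi := (fun x => h x *: _ + _) in tphi.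
have bD : BM (fun x => dotp (Vf p (G1 x) - Vf p (G2 x)) (dphi x)).
  by apply: CC_BM; exact: tst_CC_dot tphi cDV.
have cDH x : U x -> continuous_at x (fun x => H1 x - H2 x).
  by move=> Ux; apply: continuous_rB; [exact: cH1|exact: cH2].
have bH : BM (fun x => (H1 x - H2 x) * phi x) by apply: CC_BM; exact: tst_CC_mul tphi cDH.
have bI : BM (fun x => chi x ^+ 2 * (h x ^+ 2 * dotp (dw x) (dw x))).
  under eq_fun do rewrite mulrC; apply: CC_BM; apply: (tst_CC_mul oU tchi2) => x Ux.
  apply: continuous_rM; first by apply: continuous_rM; exact: ch.
  by apply: continuous_dotp; exact: cdw.
have pt x : k / 2 * (chi x ^+ 2 * (h x ^+ 2 * dotp (dw x) (dw x))) <=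
    2 * C ^+ 2 / k * dotp (dchi x) (dchi x) - dotp (Vf p (G1 x) - Vf p (G2 x)) (dphi x).
  have [Ux|nUx] := pselect (U x); last first.
    have [_ _ [K _ [KU out]]] := tchi; have [|a b] := out x; first by move=> /KU.
    by rewrite /dphi a b expr0n !(mulr0, mul0r, scale0r, scaler0, addr0, dotp0r, subrr).
  rewrite [dotp _ (dphi x)]dotpDr !dotpZr -!enorm_sqr.
  have A1 := Vf_mono_range p1 m0 (andP (rG1 Ux)).1 (andP (rG1 Ux)).2 (andP (rG2 Ux)).2.
  have A2 : `|dotp (Vf p (G1 x) - Vf p (G2 x)) (dchi x)| <= C * enorm (dw x) * enorm (dchi x).
    apply: le_trans (cauchy_schwarz _ _) _; rewrite ler_wpM2r ?enorm_ge0//.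
    exact: HC (rG1 Ux) (rG2 Ux).
  have h0 : 0 <= h x by rewrite invr_ge0 ltW// we.
  move: A1 A2; rewrite -/k -/(dw x); set Y := dotp _ (dw x); set X := dotp _ (dchi x).
  set a := enorm (dw x); set b := enorm (dchi x); rewrite ler_norml => A1 /andP[_ A2].
  have c0 := chi0 x; set s := chi x * h x; have s0 : 0 <= s by rewrite mulr_ge0.
  have B1 : s ^+ 2 * (k * a ^+ 2) <= s ^+ 2 * Y by rewrite ler_wpM2l ?sqr_ge0.
  have B2 : 2 * s * X <= 2 * s * (C * a * b) by rewrite ler_wpM2l ?mulr_ge0.
  (* The square that absorbs the mixed term into half of the elliptic term. *)
  have B3 : 0 <= k / 2 * (s * a - 2 * C * b / k) ^+ 2 by rewrite mulr_ge0 ?sqr_ge0// divr_ge0 ?ltW.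
  have B4 : k / 2 * (s * a - 2 * C * b / k) ^+ 2 =
    k / 2 * (s * a) ^+ 2 - 2 * s * (C * a * b) + 2 * C ^+ 2 / k * b ^+ 2.
    by field; rewrite gt_eqF.
  rewrite B4 in B3.
  have -> : chi x ^+ 2 * (h x ^+ 2 * a ^+ 2) = (s * a) ^+ 2 by rewrite /s; ring.
  have -> : h x * (2 * chi x * X) + chi x ^+ 2 * (- h x ^+ 2 * Y) = 2 * s * X - s ^+ 2 * Y.
    by rewrite /s; ring.
  have E1 : s ^+ 2 * (k * a ^+ 2) = k * (s * a) ^+ 2 by ring.
  rewrite E1 in B1.
  move: B1 B2 B3; move: (2 * s * (C * a * b)) (2 * C ^+ 2 / k * b ^+ 2) ((s * a) ^+ 2) => u1 u2 u3.
  move: (2 * s * X) (s ^+ 2 * Y) => u4 u5; rewrite mulrAC.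
  by move: (k * u3) => u6; lra.
have := le_Int (BM_scale _ bI) (BMB (BM_scale _ bdchi) bD) pt.
rewrite IntZ// IntB//; last exact: BM_scale.
rewrite IntZ// (weak tphi) => I1.
have I2 : - Int (fun x => (H1 x - H2 x) * phi x) <= L * Int (fun x => chi x ^+ 2).
  rewrite -IntN// -IntZ//; apply: le_Int; [exact: BMN|exact: BM_scale|move=> x].
  have [Ux|nUx] := pselect (U x); last first.
    have [_ _ [K _ [KU out]]] := tchi; have [|a b] := out x; first by move=> /KU.
    by rewrite /phi a expr0n !mulr0 oppr0.
  rewrite -mulNr /phi mulrA ler_wpM2r ?sqr_ge0//.
  apply: (@le_trans _ _ (`|H1 x - H2 x| * h x)).
    by rewrite ler_wpM2r ?invr_ge0 ?(ltW (we _ Ux))// -normrN ler_norm.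
  apply: (@le_trans _ _ (L * w x * h x)).
    by rewrite ler_wpM2r ?invr_ge0 ?(ltW (we _ Ux))// HL.
  rewrite -mulrA ler_piMr// /h ler_pdivrMr ?we// mul1r lerDl ltW//.
by rewrite mulrC -ler_pdivrMr ?divr_gt0// invf_div mulrC; apply: le_trans I1 _; rewrite lerD2l.
Qed.

(** Suppose w > 0 at a point near x0. For small e the function ln((w + e)/e) exceeds any given T
    around that point while it vanishes on the coincidence set. [poincare] bounds its square
    integral by an energy that [log_estimate] bounds independently of e, which is impossible for
    large T. *)
Lemma strong_comparison x0 : U x0 -> exists2 r : R, 0 < r &
  0 < Int \1_([set x | rbox x0 r x /\ v1 x = v2 x]) -> forall y, `|y - x0| < r -> v1 y = v2 y.
Proof.
move=> Ux0.
have /nbhs_ballP[s /= s0 sU] : nbhs x0 U by apply: open_nbhs_nbhs.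
have [rho rho0 rhoU] : exists2 rho : R, 0 < rho & [set y | enorm (y - x0) < 2 * rho] `<=` U.
  exists (s / 2); first by rewrite divr_gt0.
  move=> y /= ys; apply: sU; rewrite -ball_normE /= -normrN opprB.
  apply: le_lt_trans (norm_le_enorm _) _; move: ys; rewrite mulrC divfK//.
have [chi [dchi [tchi' chi01 chi1]]] := cutoff x0 rho0.
have tchi := tst_sub rhoU tchi'.
have chi0 x : 0 <= chi x by case/andP: (chi01 x).
have [E HE] := log_estimate tchi chi0.
(* The box of radius 3r, which contains all translates used by [poincare], then lies in the ball
   where [chi] is 1. *)
pose r := rho / (3 * (N%:R + 1)).
have r0 : 0 < r by rewrite divr_gt0// mulr_gt0// ltr_wpDl.
have chi3 y : rbox x0 (3 * r) y -> chi y = 1 /\ dchi y = 0.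
  move=> h; apply: chi1; apply: le_trans (enorm_le_norm _) _.
  apply: (@le_trans _ _ (N%:R * (3 * r))); first by rewrite ler_wpM2l.
  have -> : 3 * r = rho / (N%:R + 1) by rewrite /r; field; rewrite gt_eqF// ltr_wpDl.
  rewrite mulrA ler_pdivrMr ?ltr_wpDl// mulrC ler_pM2l//; lra.
pose Z := [set x | rbox x0 r x /\ v1 x = v2 x].
have mZ : mset Z by exact: mset_rbox_eq.
have bZ : BM (\1_Z : _ -> R).
  by apply: BM_set => //; exists (`|x0| + r) => y [+ _]; exact: rbox_le.
exists r => // th0 y yr; apply/eqP; rewrite -subr_eq0 -/(w y); apply: contrapT => /negP wy.
have xU x : rbox x0 (3 * r) x -> U x.
  have [_ _ [K _ [KU out]]] := tchi; move=> /chi3 [cx _].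
  by apply: KU; apply: contrapT => /out []; rewrite cx => /eqP; rewrite oner_eq0.
have r3 x : rbox x0 r x -> rbox x0 (3 * r) x.
  by move=> h; apply: le_trans h _; rewrite ler_peMl ?(ltW r0)//; lra.
have wy0 : 0 < w y by rewrite lt_neqAle eq_sym wy w_ge0//; apply: xU; apply: r3; exact: ltW.
have [s' s'0 hs'] := CC_near_gt0 (@cw y) wy0.
set theta := Int _ in th0.
pose t := Num.min s' (r - `|y - x0|).
have t0 : 0 < t by rewrite lt_min s'0 subr_gt0.
have ty x : rbox y t x -> rbox x0 r x /\ w y / 2 <= w x.
  move=> h; split; last by apply: hs'; apply: le_trans h _; rewrite ge_min lexx.
  rewrite /rbox /box /= (_ : x - x0 = (x - y) + (y - x0)); last by rewrite addrA subrK.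
  apply: le_trans (ler_normD _ _) _; rewrite -lerBrDr; apply: le_trans h _.
  by rewrite ge_min lexx orbT.
pose E' := (2 * (2 * r)) ^+ N * ((N%:R * (2 * r)) ^+ 2 * E).
suff main T : 0 <= T -> theta * (T ^+ 2 * (2 * t) ^+ N) <= E'.
  pose q := theta * (2 * t) ^+ N.
  have q0 : 0 < q by rewrite mulr_gt0// exprn_gt0// mulr_gt0.
  have T0 : 0 <= `|E'| / q + 1 by rewrite addr_ge0// divr_ge0// ltW.
  have := main _ T0; apply/negP; rewrite -ltNge mulrCA -/q.
  have h : E' < (`|E'| / q + 1) * q.
    by rewrite mulrDl divfK ?gt_eqF// mul1r ltr_pwDr// ler_norm.
  apply: lt_le_trans h _; rewrite ler_pM2r// expr2 ler_peMl//.
  by rewrite lerDr divr_ge0// ltW.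
(* With this [e] the quotient (w + e)/e is at least exp(T) wherever w >= w(y)/2. *)
move=> T0; pose e := w y / 2 * expR (- T).
have e0 : 0 < e by rewrite mulr_gt0 ?expR_gt0// divr_gt0.
have we x : U x -> 0 < w x + e by move=> Ux; rewrite ltr_wpDl// w_ge0.
pose zeta x := ln ((w x + e) / e).
have gz x : U x -> is_grad zeta x ((w x + e)^-1 *: dw x).
  move=> Ux; have q0 : 0 < (w x + e) / e by rewrite divr_gt0// we.
  have a1 := is_deriveD (is_derive_id (w x) (1 : R)) (is_derive_cst e (w x) (1 : R)).
  have a2 : is_derive (w x) (1 : R) (fun t : R => (t + e) / e) (e^-1).
    have a2 := is_deriveM a1 (is_derive_cst e^-1 (w x) (1 : R)); apply: is_derive_eq a2 _.
    by rewrite scaler0 add0r addr0; exact: mulr1.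
  have a3 : is_derive (w x) (1 : R) (fun t : R => ln ((t + e) / e)) (((w x + e) / e)^-1 * e^-1).
    by apply: (@is_derive1_comp R (@ln R) (fun t : R => (t + e) / e)) => //; exact: is_derive1_ln.
  have a4 : is_derive (w x) (1 : R) (fun t : R => ln ((t + e) / e)) (w x + e)^-1.
    apply: is_derive_eq a3 _; rewrite invf_div; field.
    by rewrite !gt_eqF ?we.
  exact: is_grad_comp (gw Ux) a4.
have cz x : U x -> continuous_at x (fun x => (w x + e)^-1 *: dw x).
  move=> Ux; apply: continuous_rvZ; last exact: cdw.
  apply: continuous_rV; first by rewrite gt_eqF// we.
  by apply: continuous_rD; [exact: cw|exact: for_cst].
have tg := tst_sub (@subsetT _ _) (tst_mul oU tchi gz cz).
set g := (fun x => zeta x * _) in tg; set dg := (fun x => zeta x *: _ + _) in tg.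
have mK (s1 : R) : mset (rbox x0 s1 : set 'rV[R]_N) by exact: closed_mset (@closed_rbox _ _ _ _).
have r20 : 0 <= 2 * r by rewrite mulr_ge0// ltW.
have KK x z : rbox x0 r x -> `|z| <= 2 * r -> rbox x0 (3 * r) (x + z).
  move=> h hz; rewrite /rbox /box /= addrAC; apply: le_trans (ler_normD _ _) _.
  rewrite (_ : 3 * r = r + 2 * r); last by ring.
  by rewrite lerD.
have gZ x : Z x -> g x = 0.
  by move=> [_ E1]; rewrite /g /zeta /w E1 subrr add0r divff ?gt_eqF// ln1 mul0r.
(* Translations by at most 2r take any point of the box of radius r to all of that box, so each x
   sees the whole of [Z]. *)
have Hth x : rbox x0 r x -> theta <= Int (fun z => \1_(box (2 * r)) z * \1_Z (x + z)).
  move=> hx; rewrite /theta -(Int_shift x bZ).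
  rewrite le_eqVlt; apply/orP; left; apply/eqP; apply: eq_Int => z.
  rewrite addrC [X in _ = X * _]indicE; case: (boolP (z \in _)) => [_|hz]; first by rewrite mul1r.
  rewrite mul0r indicE; case: (boolP (_ \in Z)) => //; rewrite inE => -[xz _].
  exfalso; move/negP: hz; apply; rewrite inE /box /= (_ : z = (x + z - x0) - (x - x0)).
    by apply: le_trans (ler_normB _ _) _; rewrite (_ : 2 * r = r + r) ?lerD//; ring.
  by rewrite opprB addrA subrK addrC addKr.
have P := poincare tg (mK r) (mK (3 * r)) mZ r20 KK gZ Hth.
apply: le_trans (le_trans P _); last first.
  apply: ler_wpM2l; first by rewrite exprn_ge0// mulr_ge0.
  apply: ler_wpM2l; first exact: sqr_ge0.
  apply: le_trans (HE e e0); apply: le_Int.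
  - apply: BM_indic => //; apply: BM_sum => i; apply: BMM; exact: CC_BM (tst_CC_coord i tg).
  - under eq_fun do rewrite mulrC; apply: CC_BM; apply: (tst_CC_mul oU (tst_sqr oU tchi)) => x Ux.
    apply: continuous_rM; last by apply: continuous_dotp; exact: cdw.
    have h : continuous_at x (fun x => (w x + e)^-1).
      apply: continuous_rV; first by rewrite gt_eqF// we.
      by apply: continuous_rD; [exact: cw|exact: for_cst].
    exact: continuous_rM.
  move=> x; rewrite indicE; case: (boolP (x \in _)); last first.
    move=> _; rewrite mul0r mulr_ge0 ?sqr_ge0// mulr_ge0 ?dotp_ge0//; exact: sqr_ge0.
  rewrite inE => /chi3 [E1 E2].
  by rewrite /dg E1 E2 scaler0 add0r scale1r dotpZl dotpZr !mul1r expr1n mul1r mulrA -expr2.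
rewrite ler_pM2l//; apply: Int_ge_rbox; [|exact: ltW| |].
- by apply: BM_indic => //; apply: BMM; exact: CC_BM (tst_CC tg).
- by move=> x; rewrite mulr_ge0 ?sqr_ge0// indicR_ge0.
move=> x /ty [xr wx]; rewrite indicE mem_set// mul1r /g (chi3 x (r3 x xr)).1 mulr1.
have hT : T <= zeta x.
  rewrite /zeta -[leLHS]expRK ler_ln ?posrE ?expR_gt0 ?divr_gt0 ?we//; last by apply: xU; exact: r3.
  rewrite ler_pdivlMr// /e mulrCA -expRD subrr expR0 mulr1.
  by apply: le_trans wx _; rewrite lerDl mulr_ge0 ?expR_ge0// divr_ge0// ltW.
by rewrite ler_pXn2r ?nnegrE// (le_trans T0).
Qed.

End strong_comparison.

(** * Solutions under isometries *)

Section isometries.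
Context {R : realType} {N : nat}.
Implicit Types (x y z d b : 'rV[R]_N) (g h phi v H : 'rV[R]_N -> R) (K U : set 'rV[R]_N)
  (G dphi dh : 'rV[R]_N -> 'rV[R]_N) (Q : 'M[R]_N) (p : R).

(* -div (Vf p (grad v)) = H weakly in U, where G = grad v *)
Record psol U p v G H : Prop := {
  psol_open : open U;
  psol_grad : forall x, U x -> is_grad v x (G x);
  psol_G : forall x, U x -> continuous_at x G;
  psol_H : forall x, U x -> continuous_at x H;
  psol_weak : forall phi dphi, tst U phi dphi ->
    Int (fun x => dotp (Vf p (G x)) (dphi x)) = Int (fun x => H x * phi x) }.

Lemma psol_sub U W p v G H : open W -> W `<=` U -> psol U p v G H -> psol W p v G H.
Proof.
move=> oW WU [oU gv cG cH wk]; split=> //.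
- by move=> x /WU; exact: gv.
- by move=> x /WU; exact: cG.
- by move=> x /WU; exact: cH.
- by move=> phi dphi t; apply: wk; exact: tst_sub t.
Qed.

Definition aff Q b x : 'rV[R]_N := x *m Q + b.

Lemma continuous_mulmx (T : topologicalType) (t : T) (F : T -> 'rV[R]_N) Q :
  continuous_at t F -> continuous_at t (fun s => F s *m Q).
Proof.
move=> cF; apply: rV_continuousP => i; rewrite /continuous_at.
have -> : (fun s : T => (F s *m Q) 0 i) = (fun s => \sum_j F s 0 j * Q j i).
  by apply/funext => y; rewrite mxE.
rewrite mxE; apply: continuous_sumr => j; apply: continuous_rM; last exact: for_cst.
exact: continuous_coord.
Qed.

Lemma aff_continuous Q b : continuous (aff Q b).
Proof.
move=> x; apply: continuous_rvD; last exact: for_cst.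
by apply: continuous_mulmx; exact: for_id.
Qed.

Lemma is_grad_aff Q b v x d : is_grad v (aff Q b x) d ->
  is_grad (fun y => v (aff Q b y)) x (d *m Q^T).
Proof. exact: is_grad_affine. Qed.

Lemma enorm_orth Q x : Q *m Q^T = 1%:M -> enorm (x *m Q) = enorm x.
Proof. by move=> QQ; rewrite /enorm dotp_orth. Qed.

Lemma Vf_orth Q p x : Q *m Q^T = 1%:M -> Vf p (x *m Q) = Vf p x *m Q.
Proof. by move=> QQ; rewrite /Vf enorm_orth// scalemxAl. Qed.

Lemma orth_tr Q : Q *m Q^T = 1%:M -> Q^T *m Q = 1%:M.
Proof. exact: mulmx1C. Qed.

Lemma aff_inv Q b x : Q *m Q^T = 1%:M -> aff Q^T (- (b *m Q^T)) (aff Q b x) = x.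
Proof. by move=> QQ; rewrite /aff mulmxDl -mulmxA QQ mulmx1 addrK. Qed.

Lemma aff_inv' Q b y : Q *m Q^T = 1%:M -> aff Q b (aff Q^T (- (b *m Q^T)) y) = y.
Proof.
move=> QQ; have QQ' := orth_tr QQ.
by rewrite /aff mulmxDl mulNmx -!mulmxA QQ' !mulmx1 subrK.
Qed.

Lemma Int_aff Q b g : Q *m Q^T = 1%:M -> BM g -> Int (fun x => g (aff Q b x)) = Int g.
Proof.
move=> QQ bg; rewrite (@Int_orth _ _ Q QQ (fun x => g (x + b))); last exact: BM_shift.
exact: Int_shift.
Qed.

Lemma aff_open U Q b : open U -> open (aff Q b @^-1` U).
Proof. by move=> oU; apply: open_comp => // x _; exact: aff_continuous. Qed.

Lemma tst_aff U Q b phi dphi : open U -> Q *m Q^T = 1%:M -> tst U phi dphi ->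
  tst (aff Q b @^-1` U) (fun x => phi (aff Q b x)) (fun x => dphi (aff Q b x) *m Q^T).
Proof.
move=> oU QQ [gphi cphi [K cK [KU out]]].
pose Ti := aff Q^T (- (b *m Q^T)).
apply: (@tst_on _ _ (Ti @` K)).
- exact: aff_open.
- apply: continuous_compact => //; apply: continuous_subspaceT => x; exact: aff_continuous.
- by move=> _ [y Ky <-] /=; rewrite aff_inv'//; exact: KU.
- by move=> x _; exact: is_grad_aff.
- move=> x _.
  apply: continuous_mulmx; exact: (continuous_comp (@aff_continuous Q b x) (cphi _)).
- move=> x nK; have [|-> ->] := out (aff Q b x); last by rewrite mul0mx.
  by move=> Kx; apply: nK; exists (aff Q b x) => //; exact: aff_inv.
Qed.

(** Test functions are pulled back by the inverse isometry; the integral is invariant, and [Vf]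
    commutes with orthogonal matrices because it is a scalar function of the Euclidean norm times
    its argument. *)
Lemma psol_aff U p v G H Q b : 1 < p -> Q *m Q^T = 1%:M -> psol U p v G H ->
  psol (aff Q b @^-1` U) p (fun x => v (aff Q b x)) (fun x => G (aff Q b x) *m Q^T)
    (fun x => H (aff Q b x)).
Proof.
move=> p1 QQ [oU gv cG cH wk]; split.
- exact: aff_open.
- by move=> x Ux; apply: is_grad_aff; exact: gv.
- move=> x Ux.
  apply: continuous_mulmx; exact: (continuous_comp (@aff_continuous Q b x) (cG _ Ux)).
- by move=> x Ux; exact: (continuous_comp (@aff_continuous Q b x) (cH _ Ux)).
move=> phi dphi tphi.
have QQ' := orth_tr QQ; pose b' := - (b *m Q^T).
have oU' : open (aff Q b @^-1` U) by exact: aff_open.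
have QQ2 : Q^T *m Q^T^T = 1%:M by rewrite trmxK.
have := tst_aff b' oU' QQ2 tphi.
rewrite (_ : aff Q^T b' @^-1` _ = U); last first.
  by apply/seteqP; split=> x /=; rewrite aff_inv'.
rewrite trmxK => tpsi; have := wk _ _ tpsi.
have bV : BM (fun x => dotp (Vf p (G x)) (dphi (aff Q^T b' x) *m Q)).
  by apply: CC_BM; apply: (tst_CC_dot oU tpsi) => x Ux; apply: continuous_Vf => //; exact: cG.
have bH : BM (fun x => H x * phi (aff Q^T b' x)).
  by apply: CC_BM; exact: (tst_CC_mul oU tpsi).
rewrite -(Int_aff b QQ bV) -(Int_aff b QQ bH) => E.
transitivity (Int (fun x => dotp (Vf p (G (aff Q b x))) (dphi (aff Q^T b' (aff Q b x)) *m Q))).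
  apply: eq_Int => x; rewrite aff_inv// Vf_orth; last by rewrite trmxK.
  by rewrite -(dotp_orth QQ) -mulmxA QQ' mulmx1.
by rewrite E; apply: eq_Int => x; rewrite aff_inv.
Qed.

End isometries.

Section reflections.
Context {R : realType} {n : nat}.
Implicit Types (x y z : 'rV[R]_n.+1) (mu t : R).

Definition refl_mx : 'M[R]_n.+1 := diag_mx (\row_i (if i == ord0 then -1 else 1)).
Definition refl mu : 'rV[R]_n.+1 -> 'rV[R]_n.+1 := aff refl_mx ((2 * mu) *: e1).

Lemma mul_refl_mx x : x *m refl_mx = reflect1 x.
Proof.
apply/rowP => i; rewrite mul_mx_diag !mxE.
by case: (i == ord0); rewrite ?mulrN1 ?mulr1.
Qed.

Lemma tr_refl_mx : refl_mx^T = refl_mx.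
Proof. by rewrite /refl_mx tr_diag_mx. Qed.

Lemma refl_mx_orth : refl_mx *m refl_mx^T = 1%:M.
Proof.
rewrite tr_refl_mx /refl_mx mulmx_diag -diag_const_mx; congr diag_mx.
by apply/rowP => i; rewrite !mxE; case: (i == ord0); rewrite ?mulrNN mulr1.
Qed.

Lemma reflE mu x i : refl mu x 0 i = if i == ord0 then 2 * mu - x 0 i else x 0 i.
Proof.
rewrite /refl /aff mul_refl_mx !mxE; case: eqP => [->|/eqP/negbTE h] /=; last by rewrite mulr0 addr0.
by rewrite mulr1 addrC.
Qed.

Lemma refl0 mu x : refl mu x 0 ord0 = 2 * mu - x 0 ord0.
Proof. by rewrite reflE eqxx. Qed.

Lemma reflK mu x : refl mu (refl mu x) = x.
Proof. by apply/rowP => i; rewrite !reflE; case: eqP => // ->; ring. Qed.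

Lemma refl_reflect1 x : refl 0 x = reflect1 x.
Proof. by apply/rowP => i; rewrite reflE mxE; case: eqP => // ->; ring. Qed.

Lemma refl_shift mu x : refl mu x = x + (2 * (mu - x 0 ord0)) *: e1.
Proof.
apply/rowP => i; rewrite reflE !mxE /=; case: (eqVneq i ord0) => [->|_] /=; first by ring.
by rewrite mulr0 addr0.
Qed.

Lemma refl_fix mu x : x 0 ord0 = mu -> refl mu x = x.
Proof. by move=> <-; rewrite refl_shift subrr mulr0 scale0r addr0. Qed.

Lemma norm_reflB mu x y : `|refl mu x - refl mu y| = `|x - y|.
Proof.
have h a b : `|refl mu a - refl mu b| <= `|a - b|.
  apply/rV_normP => // i; have := rV_coord_le (a - b) i; rewrite 2![in X in X -> _]mxE.
  rewrite [X in _ -> `|X| <= _](_ : _ = refl mu a 0 i - refl mu b 0 i); last by rewrite !mxE.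
  rewrite !reflE; case: eqP => // _.
  by rewrite (_ : _ - _ - _ = - (a 0 i - b 0 i)) ?normrN//; ring.
by apply/eqP; rewrite eq_le h/=; have := h (refl mu x) (refl mu y); rewrite !reflK.
Qed.

End reflections.

(** * The reduced problem and symmetric domains *)

Section psys.
Context {R : realType} {n : nat}.
Implicit Types (x y z : 'rV[R]_n.+1) (Omega : set 'rV[R]_n.+1) (v H : 'rV[R]_n.+1 -> R)
  (G : 'rV[R]_n.+1 -> 'rV[R]_n.+1) (p mu : R).

(* sys_lip says that H is a Lipschitz function of v; sys_hopf is the conclusion of Hopf's lemma. *)
Record psys Omega p v G H : Prop := {
  sys_sol : psol Omega p v G H;
  sys_compact : compact (closure Omega);
  sys_cont : continuous v;
  sys_pos : forall x, Omega x -> 0 < v x;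
  sys_out : forall x, ~ Omega x -> v x = 0;
  sys_unif : forall e : R, 0 < e -> exists2 r : R, 0 < r & forall x y,
    closure Omega x -> closure Omega y -> `|x - y| < r -> enorm (G x - G y) < e;
  sys_Hcont : continuous H;
  sys_Hpos : forall x, Omega x -> 0 < H x;
  sys_lip : exists2 L : R, 0 <= L & forall x y, `|H x - H y| <= L * `|v x - v y|;
  sys_hopf : forall x, closure Omega x -> ~ Omega x -> G x != 0 }.

Section consequences.
Variables (Omega : set 'rV[R]_n.+1) (p : R) (v H : 'rV[R]_n.+1 -> R)
  (G : 'rV[R]_n.+1 -> 'rV[R]_n.+1).
Hypothesis S : psys Omega p v G H.

Lemma sys_ge0 x : 0 <= v x.
Proof. by have [/(sys_pos S)/ltW|/(sys_out S) ->] := pselect (Omega x). Qed.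

Lemma sys_in x : 0 < v x -> Omega x.
Proof.
by move=> vx; apply: contrapT => /(sys_out S) v0; move: vx; rewrite v0 ltxx.
Qed.

Lemma sys_CC : CC v.
Proof.
split; first exact: sys_cont S.
have [M M0 HM] := compact_bound (sys_compact S).
exists M => x vx; apply: HM; apply: subset_closure; apply: sys_in.
by rewrite lt_neqAle eq_sym vx sys_ge0.
Qed.

(** [compact_unif] is applied with the parameter [s] as the inverse of the bound. *)
Lemma sys_G_bound : exists2 K : R, 0 < K & forall x, closure Omega x -> enorm (G x) <= K.
Proof.
have [|r r0 Hr] := compact_unif (P := fun s y => closure Omega y -> enorm (G y) <= s^-1) (sys_compact S).
  move=> x Kx; have [r r0 Hr] := sys_unif S ltr01.
  have q0 : 0 < (enorm (G x) + 1)^-1 by rewrite invr_gt0 ltr_wpDl ?enorm_ge0.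
  exists (Num.min r (enorm (G x) + 1)^-1); first by rewrite lt_min r0.
  move=> y; rewrite lt_min => /andP[xy _] s /andP[s0]; rewrite lt_min => /andP[_ sq] Ky.
  apply: (@le_trans _ _ (enorm (G x) + 1)); last first.
    rewrite -[leLHS]invrK lef_pV2 ?posrE//; exact: ltW.
  have h1 := Hr _ _ Kx Ky xy; have := ler_enormB (G x) (G y).
  by rewrite ler_norml => /andP[h2 _]; have := enormB (G x) (G y); lra.
exists ((r / 2)^-1); first by rewrite invr_gt0 divr_gt0.
move=> x Kx; apply: Hr => //.
by rewrite divr_gt0//= ltr_pdivrMr// ltr_pMr// ltr1n.
Qed.

(** [H] may vanish on the boundary, but there the gradient is nonzero, so the premise fails for
    small [h]. Inside, [H] is positive. Compactness provides one [h] for both situations. *)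
Lemma sys_H_bound : exists2 h : R, 0 < h &
  forall x, closure Omega x -> enorm (G x) < h -> h <= H x.
Proof.
have [|r r0 Hr] := compact_unif (P := fun s y => closure Omega y -> enorm (G y) < s -> s <= H y)
    (sys_compact S).
  move=> x Kx; have [Ox|nOx] := pselect (Omega x).
    have Hx := sys_Hpos S Ox; have e0 : 0 < H x / 2 by rewrite divr_gt0.
    have /cvgrPdist_lt/(_ _ e0)/nbhs_ballP[r /= r0 hr] := sys_Hcont S (x := x).
    exists (Num.min r (H x / 2)); first by rewrite lt_min r0.
    move=> y; rewrite lt_min => /andP[xy _] s /andP[s0]; rewrite lt_min => /andP[_ sq] Ky _.
    have := hr y; rewrite -ball_normE /= => /(_ xy); rewrite ltr_norml => /andP[_ ?]; lra.
  have g0 : 0 < enorm (G x) / 2 by rewrite divr_gt0// enorm_gt0; exact: (sys_hopf S Kx nOx).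
  have [r r0 Hr] := sys_unif S g0.
  exists (Num.min r (enorm (G x) / 2)); first by rewrite lt_min r0.
  move=> y; rewrite lt_min => /andP[xy _] s /andP[s0]; rewrite lt_min => /andP[_ sq] Ky Gy.
  have := Hr _ _ Kx Ky xy; have := ler_enormB (G x) (G y).
  by rewrite ler_norml => /andP[_ ? ?]; exfalso; lra.
exists (r / 2); first by rewrite divr_gt0.
move=> x Kx; apply: Hr => //.
by rewrite divr_gt0//= ltr_pdivrMr// ltr_pMr// ltr1n.
Qed.

Lemma mset_G (d : R) : mset [set x | Omega x /\ d <= enorm (G x)].
Proof.
have oO := psol_open (sys_sol S).
have c x : Omega x -> continuous_at x (fun x => enorm (G x)).
  by move=> Ox; apply: continuous_enorm; exact: psol_G (sys_sol S) _ Ox.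
have od : open [set t : R | t < d] by exact: open_lt.
have o := open_preimage oO c od.
rewrite /mset (_ : _ @^-1` _ = rV_of_tuple @^-1` Omega `\` rV_of_tuple @^-1` (Omega `&` (fun x => enorm (G x)) @^-1` [set t | t < d])).
  by apply: measurableD; exact: open_mset.
apply/seteqP; split=> t /=; first by move=> [Ot dt]; split=> // -[_]; rewrite ltNge dt.
by move=> [Ot nt]; split=> //; rewrite leNgt; apply/negP => h; exact: nt.
Qed.

Lemma psys_refl mu : 1 < p -> psol (refl mu @^-1` Omega) p (fun x => v (refl mu x))
  (fun x => reflect1 (G (refl mu x))) (fun x => H (refl mu x)).
Proof.
move=> p1; have := psol_aff ((2 * mu) *: e1) p1 (@refl_mx_orth R n) (sys_sol S).
by under [X in psol _ _ _ X _]eq_fun do rewrite tr_refl_mx mul_refl_mx.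
Qed.

Lemma sys_refl_cont mu : continuous (fun x => v (refl mu x)).
Proof.
move=> x; apply: (@continuous_comp _ _ _ (refl mu) v); first exact: aff_continuous.
exact: sys_cont S _.
Qed.

End consequences.

Section symmetric_domain.
Variable (Omega : set 'rV[R]_n.+1).
Hypotheses (sO : symmetric_x1 Omega) (cO : strictly_convex_x1 Omega).

Lemma closure_reflect1 x : closure Omega x -> closure Omega (reflect1 x).
Proof.
move=> cx B nB.
have : nbhs x (refl 0 @^-1` B).
  by apply: aff_continuous; rewrite -/(refl 0) refl_reflect1.
by move=> /cx[y [/sO Oy /= By]]; exists (reflect1 y); split=> //; rewrite -refl_reflect1.
Qed.

(** The point [refl mu x] lies strictly between x and its mirror image in {x_1 = 0}, both in the
    closure; strict convexity in the x_1-direction puts it in [Omega]. *)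
Lemma refl_closure_in mu x : closure Omega x -> x 0 ord0 < mu -> mu < 0 -> Omega (refl mu x).
Proof.
move=> cx xm m0; have x0 : x 0 ord0 < 0 by exact: lt_trans m0.
have := cO (x := x) (t := - (2 * x 0 ord0)) _ cx _ (s := (x 0 ord0 - mu) / x 0 ord0) _.
rewrite (_ : x + - (2 * x 0 ord0) *: e1 = reflect1 x); last first.
  by rewrite -refl_reflect1 refl_shift; congr (_ + _ *: _); ring.
move=> /(_ _ (closure_reflect1 cx) _).
rewrite refl_shift (_ : _ / _ * _ = 2 * (mu - x 0 ord0)); last by field; rewrite lt_eqF.
apply; first by rewrite oppr_eq0 mulf_neq0// lt_eqF.
by rewrite ltr_ndivlMr// ltr_ndivrMr// mul0r mul1r; lra.
Qed.

Lemma refl_in mu x : Omega x -> x 0 ord0 < mu -> mu <= 0 -> Omega (refl mu x).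
Proof.
move=> Ox xm; rewrite le_eqVlt => /predU1P[->|m0]; first by rewrite refl_reflect1; exact: (sO x).1.
by apply: refl_closure_in => //; exact: subset_closure.
Qed.

End symmetric_domain.

End psys.

(** * Weak comparison up to a small set of noncritical points *)

Section weak_comparison.
Context {R : realType} {n : nat}.
Implicit Types (x y z : 'rV[R]_n.+1) (mu e : R).

Lemma continuous_enorm_powR (T : topologicalType) (t : T) (F : T -> 'rV[R]_n.+1) (s : R) :
  0 <= s -> continuous_at t F -> continuous_at t (fun i => enorm (F i) `^ s).
Proof.
rewrite le_eqVlt => /predU1P[<- cF|s0 cF].
  by under eq_fun do rewrite powRr0; exact: for_cst.
have [Ft|Ft] := eqVneq (F t) 0; last first.
  by apply: continuous_powR_at; [rewrite enorm_gt0|exact: continuous_enorm].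
apply/cvgrPdist_lt => e e0; rewrite Ft enorm0 powR0 ?gt_eqF//.
have d0 : 0 < e `^ s^-1 by rewrite powR_gt0.
have /cvgrPdist_lt/(_ _ d0) := continuous_enorm cF; rewrite Ft enorm0.
apply: filterS => x; rewrite !sub0r !normrN !ger0_norm ?enorm_ge0 ?powR_ge0// => h.
have -> : e = (e `^ s^-1) `^ s by rewrite -powRrM mulVf ?gt_eqF// powRr1// ltW.
by rewrite gt0_ltr_powR// nnegrE ?enorm_ge0// ltW.
Qed.

Lemma continuous_sig p (T : topologicalType) (t : T) (F : T -> 'rV[R]_n.+1) :
  continuous_at t F -> continuous_at t (fun i => sig p (F i)).
Proof. by apply: continuous_enorm_powR; rewrite le_max lexx orbT. Qed.

Lemma sig_exponent_gt0 (p : R) : 1 < p -> 0 < 2 * (p - 1) - Num.max (p - 2) 0.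
Proof. by move=> p1; rewrite subr_gt0 gt_max; apply/andP; split; lra. Qed.

Variables (Omega : set 'rV[R]_n.+1) (p : R) (v H : 'rV[R]_n.+1 -> R)
  (G : 'rV[R]_n.+1 -> 'rV[R]_n.+1).
Hypotheses (p1 : 1 < p) (S : psys Omega p v G H).
Hypotheses (sO : symmetric_x1 Omega) (cO : strictly_convex_x1 Omega).

Definition bad_set mu : set 'rV[R]_n.+1 :=
  [set x | [/\ Omega x, x 0 ord0 < mu & v (refl mu x) < v x]].

Section fixed_mu.
Variable mu : R.
Hypothesis mu0 : mu <= 0.

Let w x := v x - v (refl mu x).
Let dw x := G x - reflect1 (G (refl mu x)).
Let U : set 'rV[R]_n.+1 := Omega `&` [set x : 'rV[R]_n.+1 | x 0 ord0 < mu].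
Let K e : set 'rV[R]_n.+1 := [set x | [/\ closure Omega x, x 0 ord0 <= mu & e <= w x]].

Let cw : continuous w.
Proof.
by move=> x; apply: continuous_rB; [exact: sys_cont S x|exact: (sys_refl_cont S)].
Qed.

Let oU : open U.
Proof.
apply: openI; first exact: psol_open (sys_sol S).
apply: (@open_comp _ _ (fun x : 'rV[R]_n.+1 => x 0 ord0) [set t | t < mu]) => [x _|].
  exact: coord_continuous.
exact: open_lt.
Qed.

Let U_refl x : U x -> (refl mu @^-1` Omega) x.
Proof. by move=> [Ox xm]; exact: refl_in. Qed.

Let sol2 := psol_sub oU U_refl (psys_refl S mu p1).
Let sol1 := psol_sub oU (@subIsetl _ Omega _) (sys_sol S).

Let gw x : U x -> is_grad w x (dw x).
Proof. by move=> Ux; apply: is_gradB; [exact: psol_grad sol1 _ Ux|exact: psol_grad sol2 _ Ux]. Qed.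

Let cdw x : U x -> continuous_at x dw.
Proof. by move=> Ux; apply: continuous_rvB; [exact: psol_G sol1 _ Ux|exact: psol_G sol2 _ Ux]. Qed.

Let cK e : compact (K e).
Proof.
have h1 : closed ([set x : 'rV[R]_n.+1 | x 0 ord0 <= mu] : set 'rV[R]_n.+1).
  apply: (@closed_comp _ _ (fun x : 'rV[R]_n.+1 => x 0 ord0) [set t | t <= mu]) => [x _|].
    exact: coord_continuous.
  exact: closed_le.
have h2 : closed ([set x | e <= w x] : set 'rV[R]_n.+1).
  apply: (@closed_comp _ _ w [set t | e <= t]) => [x _|]; first exact: cw.
  exact: closed_ge.
have h := closedI (@closed_closure _ Omega) (closedI h1 h2).
have -> : K e = closure Omega `&` ([set x : 'rV[R]_n.+1 | x 0 ord0 <= mu] `&` [set x | e <= w x]).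
  by apply/seteqP; split=> x /= [a b] => [c|]; [|case: b].
by apply: (subclosed_compact h (sys_compact S)) => x [].
Qed.

(** The role of e > 0: where w >= e one has v > 0, hence the point is in [Omega], and it is not on
    the plane, where w = 0. *)
Let KU e : 0 < e -> K e `<=` U.
Proof.
move=> e0 x [cx xm wx]; have w0 : 0 < w x by exact: lt_le_trans wx.
have vx : 0 < v x by move: w0; rewrite subr_gt0; apply: le_lt_trans; exact: sys_ge0 S _.
split; first exact: (sys_in S vx).
rewrite /= lt_neqAle xm andbT; apply/eqP => E.
by move: w0; rewrite /w refl_fix// subrr ltxx.
Qed.

(** The k-th power of the positive part of w - e, supported in [U]. The cube tests the difference of
    the two equations, the fourth power, as [s 2 e x ^+ 2], tests the equation of [v], and the
    energy is that of the square. *)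
Let s k e := cut (K e) (fun x => ppow k (w x - e)).
Let ds k e := @cut R n.+1 (K e) 'rV[R]_n.+1 (fun x => (k%:R * ppow k.-1 (w x - e)) *: dw x).

Let s_tst k e : 0 < e -> tst U (s k.+2 e) (ds k.+2 e).
Proof.
move=> e0; apply: tst_cut; first exact: oU.
- exact: cK.
- exact: KU.
- move=> x Ux; apply: (@is_grad_comp _ _ (ppow k.+2) (fun x => w x - e)); last exact: is_derive_ppow.
  by rewrite -[dw x]subr0; apply: is_gradB; [exact: gw|exact: is_grad_cst].
- move=> x Ux; apply: continuous_rvZ; last exact: cdw.
  apply: continuous_rZ; apply: continuous_rcomp; last exact: continuous_ppow.
  by apply: continuous_rB; [exact: cw|exact: for_cst].
- move=> x [Ox xm] nK; have we : w x - e <= 0.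
    rewrite subr_le0 leNgt; apply/negP => h; apply: nK; split; last exact: ltW.
      exact: subset_closure.
    exact: ltW.
  by rewrite !ppow_neg// mulr0 scale0r.
Qed.

Let bm_energy e : 0 < e -> BM (fun x => sig p (G x) * dotp (ds 2 e x) (ds 2 e x)).
Proof.
move=> e0; have t2 := s_tst 0 e0.
under eq_fun do rewrite -dotpZl.
apply: CC_BM; apply: (tst_CC_dot oU t2) => x Ux; apply: continuous_rvZ.
  by apply: continuous_sig; exact: psol_G sol1 _ Ux.
by have [_ cd _] := t2; exact: cd.
Qed.

(** The difference of the equations is tested with (w - e)^3. Its gradient is 3 (w - e)^2 dw, and 3
    (w - e)^2 |dw|^2 is 3/4 of the squared gradient of (w - e)^2. On the right, L w (w - e)^3 is L
    ((w - e)^4 + e (w - e)^3). *)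
Lemma energy_estimate (c0 L M e : R) : 0 < c0 -> 0 <= L -> 0 < e -> 0 <= M ->
  (forall xi eta : 'rV[R]_n.+1, enorm xi <= M -> enorm eta <= M ->
    c0 * sig p xi * enorm (xi - eta) ^+ 2 <= dotp (Vf p xi - Vf p eta) (xi - eta)) ->
  (forall x, closure Omega x -> enorm (G x) <= M) ->
  (forall x y, `|H x - H y| <= L * `|v x - v y|) ->
  3 / 4 * c0 * Int (fun x => sig p (G x) * dotp (ds 2 e x) (ds 2 e x)) <=
    L * (Int (fun x => s 2 e x ^+ 2) + e * Int (s 3 e)).
Proof.
move=> c00 L0 e0 M0 mono GM HL.
have t2 := s_tst 0 e0; have t3 := s_tst 1 e0.
have cG x : U x -> continuous_at x G by exact: psol_G sol1 x.
have b2 : BM (fun x => s 2 e x ^+ 2) by exact: CC_BM (tst_CC (tst_sqr oU t2)).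
have b3 : BM (s 3 e) by exact: CC_BM (tst_CC t3).
have bY : BM (fun x => sig p (G x) * dotp (ds 2 e x) (ds 2 e x)).
  exact: bm_energy.
have c1 x : U x -> continuous_at x (fun x => Vf p (G x)).
  by move=> Ux; apply: continuous_Vf => //; exact: cG.
have c2 x : U x -> continuous_at x (fun x => Vf p (reflect1 (G (refl mu x)))).
  by move=> Ux; apply: continuous_Vf => //; exact: psol_G sol2 _ Ux.
have b1' := CC_BM (tst_CC_dot oU t3 c1); have b2' := CC_BM (tst_CC_dot oU t3 c2).
have h1 := CC_BM (tst_CC_mul oU t3 (psol_H sol1)).
have h2 := CC_BM (tst_CC_mul oU t3 (psol_H sol2)).
have := psol_weak sol1 t3; have := psol_weak sol2 t3 => E2 E1.
rewrite -(IntZ _ bY); apply: (@le_trans _ _ (Int (fun x => dotp (Vf p (G x)) (ds 3 e x) -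
    dotp (Vf p (reflect1 (G (refl mu x)))) (ds 3 e x)))).
  apply: le_Int; [exact: BM_scale|exact: BMB|move=> x].
  have [Kx|nK] := pselect (K e x); last by rewrite /ds !cut_out// !dotp0r subrr mulr0 mulr0.
  rewrite /ds !cut_in// -dotpBl !dotpZr dotpZl -enorm_sqr /=.
  have [Ox xm] := KU e0 Kx.
  have R1 : enorm (G x) <= M by apply: GM; exact: subset_closure.
  have R2 : enorm (reflect1 (G (refl mu x))) <= M.
    rewrite -mul_refl_mx enorm_orth; last exact: refl_mx_orth.
    by apply: GM; apply: subset_closure; exact: refl_in.
  have := mono _ _ R1 R2; rewrite -/(dw x).
  set D := dotp _ (dw x); set Y := sig p _ * _; set X := enorm _ ^+ 2.
  have we : 0 <= w x - e by have [_ _] := Kx; rewrite subr_ge0.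
  rewrite /Y /ppow max_l// => h; set q := w x - e.
  have q0 : 0 <= 3 * q ^+ 2 by rewrite mulr_ge0 ?sqr_ge0.
  have := ler_wpM2l q0 h; apply: le_trans; rewrite le_eqVlt; apply/orP; left; apply/eqP.
  by rewrite /X; field.
rewrite IntB// E1 E2 -IntB// -(IntZ _ b3).
rewrite -IntD//; last exact: BM_scale.
rewrite -IntZ; last by apply: BMD => //; exact: BM_scale.
apply: le_Int; [exact: BMB|by apply: BM_scale; apply: BMD => //; exact: BM_scale|move=> x].
have [Kx|nK] := pselect (K e x); last by rewrite /s !cut_out// expr0n !mulr0 subrr addr0 mulr0.
rewrite /s !cut_in// -mulrBl.
have we : 0 <= w x - e by have [_ _] := Kx; rewrite subr_ge0.
rewrite /ppow max_l//; have -> : w x = (w x - e) + e by rewrite subrK.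
move: we; set q := w x - e => q0; rewrite addrK.
have -> : (q ^+ 2) ^+ 2 + e * q ^+ 3 = (q + e) * q ^+ 3 by ring.
rewrite mulrA; apply: ler_wpM2r; first exact: exprn_ge0.
apply: le_trans (ler_norm _) _; apply: le_trans (HL _ _) _; apply: ler_wpM2l => //.
have wE : w x = q + e by rewrite /q subrK.
rewrite -[v x - _]/(w x) wE ger0_norm//; apply: addr_ge0 => //; exact: ltW.
Qed.

(** Only the equation of [v] itself is used, tested with (w - e)^4: where |G| < d <= h the source is
    at least h, and this bounds the zero-order integral by the energy. Young's inequality with
    parameter tau splits the flux by [powR_sig_q] into tau times the energy and a zero-order term
    with the factor |G|^q, which is small where |G| < d. *)
Lemma source_estimate (h d tau M q e : R) : 0 < e -> 0 < d -> d <= h -> 0 < tau ->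
  q = 2 * (p - 1) - Num.max (p - 2) 0 ->
  (forall x, closure Omega x -> enorm (G x) <= M) ->
  (forall x, closure Omega x -> enorm (G x) < h -> h <= H x) ->
  h * Int (fun x => s 2 e x ^+ 2) <=
    tau^-1 * d `^ q * Int (fun x => s 2 e x ^+ 2) +
    (h + tau^-1 * M `^ q) * Int (fun x => \1_[set x | Omega x /\ d <= enorm (G x)] x * s 2 e x ^+ 2) +
    tau * Int (fun x => sig p (G x) * dotp (ds 2 e x) (ds 2 e x)).
Proof.
move=> e0 d0 dh tau0 qE GM Hh.
have t2 := s_tst 0 e0; have t4 := tst_sqr oU t2.
have q0 : 0 < q by rewrite qE sig_exponent_gt0.
have c1 x : U x -> continuous_at x (fun x => Vf p (G x)).
  by move=> Ux; apply: continuous_Vf => //; exact: psol_G sol1 _ Ux.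
have b4 : BM (fun x => s 2 e x ^+ 2) by exact: CC_BM (tst_CC t4).
have b1 := CC_BM (tst_CC_dot oU t4 c1).
have h1 := CC_BM (tst_CC_mul oU t4 (psol_H sol1)).
have bY := bm_energy e0.
have bN : BM (fun x => \1_[set x | Omega x /\ d <= enorm (G x)] x * s 2 e x ^+ 2).
  by apply: BM_indic => //; exact: mset_G S d.
have E1 := psol_weak sol1 t4.
set I2 := Int (fun x => _ ^+ 2); set IN := Int (fun x => \1__ _ * _); set IY := Int (fun x => sig p _ * _).
have A1 : h * I2 - h * IN <= Int (fun x => H x * s 2 e x ^+ 2).
  rewrite -IntZ// -IntZ// -IntB; [|exact: BM_scale|exact: BM_scale].
  apply: le_Int => //; first by apply: BMB; exact: BM_scale.
  move=> x; have [Kx|nK] := pselect (K e x); last by rewrite /s !cut_out// expr0n !mulr0 subrr.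
  have [Ox _] := KU e0 Kx; have cx := subset_closure Ox.
  rewrite [h * (\1__ _ * _)]mulrA -mulrBl; apply: ler_wpM2r; first exact: sqr_ge0.
  rewrite indicE; case: (boolP (x \in _)); first by move=> _; rewrite mulr1 subrr ltW// (sys_Hpos S).
  rewrite notin_setE /= => nd; rewrite mulr0 subr0; apply: Hh => //.
  by apply: lt_le_trans dh; rewrite ltNge; apply/negP => dG; exact: nd.
have A2 : Int (fun x => dotp (Vf p (G x)) ((2 * s 2 e x) *: ds 2 e x)) <=
    tau^-1 * (d `^ q * I2 + M `^ q * IN) + tau * IY.
  rewrite -IntZ// -IntZ// -IntD; [|exact: BM_scale|exact: BM_scale].
  rewrite -IntZ; last by apply: BMD; exact: BM_scale.
  rewrite -(IntZ _ bY) -IntD; [|by apply: BM_scale; apply: BMD; exact: BM_scale|exact: BM_scale].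
  apply: le_Int => //; first by apply: BMD; apply: BM_scale => //; apply: BMD; exact: BM_scale.
  move=> x; have [Kx|nK] := pselect (K e x); last first.
    by rewrite /s /ds !cut_out// scaler0 !dotp0r expr0n !mulr0 !addr0 mulr0.
  have [Ox _] := KU e0 Kx; have cx := subset_closure Ox.
  rewrite dotpZr; set g := s 2 e x; set dg := ds 2 e x.
  have g0 : 0 <= g by rewrite /g /s cut_in// ppow_ge0.
  set P := g ^+ 2 * enorm (G x) `^ q; set Q := sig p (G x) * dotp dg dg.
  have PQ : 2 * (g * (enorm (G x) `^ (p - 1) * enorm dg)) <= tau^-1 * P + tau * Q.
    have T2 : (g * (enorm (G x) `^ (p - 1) * enorm dg)) ^+ 2 = P * Q.
      rewrite !exprMn (powR_sig_q (G x) p1) -qE enorm_sqr /P /Q; ring.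
    have Q0 : 0 <= Q by rewrite mulr_ge0 ?dotp_ge0// powR_ge0.
    have P0 : 0 <= P by rewrite mulr_ge0 ?sqr_ge0 ?powR_ge0.
    rewrite -ler_sqr ?nnegrE; last 2 first.
    - by rewrite !mulr_ge0 ?powR_ge0 ?enorm_ge0.
    - by rewrite addr_ge0// mulr_ge0// ?invr_ge0 ltW.
    rewrite exprMn T2 -subr_ge0 (_ : _ - _ = (tau^-1 * P - tau * Q) ^+ 2) ?sqr_ge0//.
    by field; rewrite gt_eqF.
  have D1 : dotp (Vf p (G x)) dg <= enorm (G x) `^ (p - 1) * enorm dg.
    by rewrite -(enorm_Vf (G x) p1); exact: dotp_le.
  have D2 : 2 * g * dotp (Vf p (G x)) dg <= tau^-1 * P + tau * Q.
    apply: le_trans PQ; rewrite -mulrA; apply: ler_wpM2l => //; exact: ler_wpM2l.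
  apply: le_trans D2 _; rewrite lerD2r; apply: ler_wpM2l; first by rewrite invr_ge0 ltW.
  rewrite /P indicE; case: (boolP (x \in _)).
    move=> _; rewrite mul1r -mulrDl mulrC; apply: ler_wpM2r; first exact: sqr_ge0.
    apply: (@le_trans _ _ (M `^ q)); last by rewrite lerDr powR_ge0.
    by apply: powR_mono; [exact: ltW|exact: enorm_ge0|exact: GM].
  rewrite notin_setE /= => nd; rewrite mul0r mulr0 addr0 mulrC; apply: ler_wpM2r; first exact: sqr_ge0.
  apply: powR_mono; [exact: ltW|exact: enorm_ge0|].
  by apply/ltW; rewrite ltNge; apply/negP => dG; exact: nd.
rewrite E1 in A2; have := le_trans A1 A2; rewrite lerBlDr => /le_trans; apply.
by rewrite le_eqVlt; apply/orP; left; apply/eqP; ring.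
Qed.

(** If |G| >= 2d at x, then |G| >= d at the points of [Omega] in the box of radius r around x, so
    any point of this box where [s 2 e] is nonzero is a bad noncritical point. These fill at most
    half of the box; on the other half the function vanishes and [poincare] applies. The weight is
    at least sg where |G| >= d, which restores the weighted energy. *)
Lemma small_set_estimate (d r sg e : R) : 0 < e -> 0 < d -> 0 < r -> 0 < sg ->
  (forall x y, closure Omega x -> closure Omega y -> `|x - y| <= r -> enorm (G x - G y) < d) ->
  Int \1_(bad_set mu `&` [set x | Omega x /\ d <= enorm (G x)]) <= 2^-1 * (2 * r) ^+ n.+1 ->
  (forall x, d <= enorm (G x) -> sg <= sig p (G x)) ->
  Int (fun x => \1_[set x | Omega x /\ 2 * d <= enorm (G x)] x * s 2 e x ^+ 2) <=
    2 * (n.+1%:R * r) ^+ 2 / sg * Int (fun x => sig p (G x) * dotp (ds 2 e x) (ds 2 e x)).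
Proof.
move=> e0 d0 r0 sg0 Gr Hbad Hsg; have t2 := s_tst 0 e0; have tg := tst_sub (@subsetT _ U) t2.
have mg := BM_mfun (CC_BM (tst_CC tg)).
have mZ : mset [set x | s 2 e x = 0].
  by apply: (mset_comp (D := [set 0])) => //; exact: mg.
have oO := psol_open (sys_sol S).
have mO : mset Omega by exact: open_mset.
pose A := [set x | (Omega x /\ 2 * d <= enorm (G x)) /\ s 2 e x != 0].
(* Translates may leave [Omega]; this costs nothing because [ds 2 e] vanishes there. *)
pose B := ~` Omega `|` [set x | Omega x /\ d <= enorm (G x)].
have mA : mset A.
  rewrite (_ : A = [set x | Omega x /\ 2 * d <= enorm (G x)] `\` [set x | s 2 e x = 0]).
    by apply: measurableD => //; exact: mset_G S _.
  by apply/seteqP; split=> x /= [a b]; split=> //; [move: b => /eqP|apply/eqP].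
have mB : mset B.
  by apply: measurableU; [exact: measurableC|exact: mset_G S d].
have AB x z : A x -> `|z| <= r -> B (x + z).
  move=> [[Ox dx] _] zr; have [Oz|nO] := pselect (Omega (x + z)); last by left.
  right; split=> //; have := Gr x (x + z) (subset_closure Ox) (subset_closure Oz) _.
  rewrite opprD addrA subrr sub0r normrN => /(_ zr).
  by have := ler_enormB (G x) (G (x + z)); rewrite ler_norml => /andP[_ h1 h2]; lra.
pose bad := bad_set mu `&` [set x | Omega x /\ d <= enorm (G x)].
have mbad : mset bad.
  apply: measurableI; last exact: mset_G S d.
  apply: open_mset.
  rewrite (_ : bad_set mu = U `&` [set x | 0 < w x]).
    apply: openI => //; apply: (@open_comp _ _ w [set t | 0 < t]) => [x _|]; first exact: cw.
    exact: open_gt.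
  by apply/seteqP; split=> x /= => [[a b c]|[[a b] c]]; split=> //; move: c; rewrite subr_gt0.
have bbad : BM (\1_bad : _ -> R).
  apply: BM_set => //; have [M _ HM] := compact_bound (sys_compact S).
  by exists M => x [[Ox _ _] _]; apply: HM; exact: subset_closure.
have Hth x : A x -> 2^-1 * (2 * r) ^+ n.+1 <=
    Int (fun z => \1_(box r) z * \1_[set x | s 2 e x = 0] (x + z)).
  move=> [[Ox dx] _].
  apply: (@le_trans _ _ (Int (\1_(box r) : 'rV[R]_n.+1 -> R) - Int (fun z => \1_bad (z + x)))).
    rewrite (@Int_box R n.+1 r (ltW r0)) (Int_shift x bbad).
    by move: Hbad; rewrite -/bad; move: (Int _) ((2 * r) ^+ _) => i1 i2 ?; lra.
  have bb := @BM_box R n.+1 r; have bb' := BM_shift x bbad.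
  rewrite -IntB//; apply: le_Int; first exact: BMB.
    under eq_fun do rewrite mulrC.
    apply: (@BMMl _ _ (\1_(box r)) (fun z => \1_[set x | s 2 e x = 0] (x + z))) => //.
      under eq_fun do rewrite addrC; exact: (mfun_shift x (mfun_indic mZ)).
    by exists 1 => z _; rewrite indicE ger0_norm// lern1 leq_b1.
  move=> z; rewrite [X in X - _ <= X * _]indicE; case: (boolP (z \in box r)); last first.
    by move=> _; rewrite mul0r sub0r oppr_le0 indicR_ge0.
  rewrite inE => zr; rewrite mul1r [X in _ <= X]indicE; case: (boolP (_ \in [set _ | _])).
    by move=> _; rewrite lerBlDr lerDl indicR_ge0.
  rewrite notin_setE /= => sn; rewrite lerBlDr add0r indicE mem_set//.
  have Kz : K e (x + z) by apply: contrapT => nK; apply: sn; rewrite /s cut_out.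
  have [Oz zm] := KU e0 Kz; rewrite addrC; split; split=> //.
    by have [_ _ we] := Kz; rewrite -subr_gt0; exact: lt_le_trans we.
  have := Gr x (x + z) (subset_closure Ox) (subset_closure Oz) _.
  rewrite opprD addrA subrr sub0r normrN => /(_ zr).
  by have := ler_enormB (G x) (G (x + z)); rewrite ler_norml => /andP[_ h1 h2]; lra.
have P := poincare tg mA mB mZ (ltW r0) AB (fun x h => h) Hth.
have -> : (fun x => \1_[set x | Omega x /\ 2 * d <= enorm (G x)] x * s 2 e x ^+ 2) =
    (fun x => \1_A x * s 2 e x ^+ 2).
  apply/funext => x; have [->|gn] := eqVneq (s 2 e x) 0; first by rewrite expr0n !mulr0.
  congr (_ * _); rewrite !indicE; congr ((_ : bool)%:R).
  by apply/idP/idP; rewrite !inE => //; case.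
have V0 : 0 < (2 * r) ^+ n.+1 by rewrite exprn_gt0// mulr_gt0.
move: P; set a := Int _; set b := Int _; set Y := Int _ => P.
have bY : sg * b <= Y.
  have bB : BM (fun x => \1_B x * dotp (ds 2 e x) (ds 2 e x)).
    apply: BM_indic => //; apply: BM_sum => i; apply: BMM; exact: CC_BM (tst_CC_coord i tg).
  rewrite -IntZ//; apply: le_Int; [exact: BM_scale|exact: bm_energy|move=> x].
  have [Kx|nK] := pselect (K e x); last by rewrite /ds !cut_out// !dotp0r !mulr0.
  have [Ox _] := KU e0 Kx; rewrite mulrA; apply: ler_wpM2r; first exact: dotp_ge0.
  rewrite indicE; case: (boolP (x \in B)); last by move=> _; rewrite mulr0 powR_ge0.
  by rewrite inE => -[//|[_ h]]; rewrite mulr1; exact: Hsg.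
have P' : a <= 2 * (n.+1%:R * r) ^+ 2 * b.
  move: V0 P; move: ((2 * r) ^+ _) => V V0.
  by rewrite -[2^-1 * V * a]mulrA [2^-1 * _]mulrCA ler_pM2l// ler_pdivrMl// mulrA.
apply: le_trans P' _; rewrite -[_ / sg * Y]mulrA; apply: ler_wpM2l; first by rewrite mulr_ge0 ?sqr_ge0.
by rewrite ler_pdivlMl.
Qed.

(** The lower bound does not depend on [e], so that the error terms of order e can be made small
    against it. *)
Lemma positive_somewhere x : U x -> 0 < w x -> exists2 c : R, 0 < c &
  forall e, 0 < e -> e <= w x / 4 -> c <= Int (fun x => s 2 e x ^+ 2).
Proof.
move=> Ux wx; have [r1 r10 h1] := CC_near_gt0 (@cw x) wx.
have /nbhs_ballP[r2 /= r20 h2] : nbhs x U by apply: open_nbhs_nbhs; split.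
pose r := Num.min r1 (r2 / 2); have r0 : 0 < r by rewrite lt_min r10 divr_gt0.
exists (((w x / 4) ^+ 2) ^+ 2 * (2 * r) ^+ n.+1).
  by rewrite mulr_gt0// ?exprn_gt0 ?divr_gt0// mulr_gt0.
move=> e e0 ew; have t2 := s_tst 0 e0.
apply: (@Int_ge_rbox _ _ _ x); [exact: CC_BM (tst_CC (tst_sqr oU t2))|exact: ltW|by move=> y; exact: sqr_ge0|].
move=> y yr; have wy : w x / 2 <= w y by apply: h1; apply: le_trans yr _; rewrite ge_min lexx.
have [Oy ym] : U y.
  apply: h2; rewrite -ball_normE /= -normrN opprB; apply: le_lt_trans yr _.
  by rewrite gt_min; apply/orP; right; rewrite ltr_pdivrMr// ltr_pMr// ltr1n.
have Ky : K e y by split; [exact: subset_closure|exact: ltW|lra].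
rewrite /s cut_in//; have q : w x / 4 <= w y - e by lra.
have q0 : 0 <= w x / 4 by rewrite divr_ge0// ltW.
rewrite ppow_pos ?(le_trans q0)//.
by rewrite ler_pXn2r ?nnegrE ?sqr_ge0// ler_pXn2r ?nnegrE// (le_trans q0).
Qed.

Lemma s3_bound (M Mv e : R) : 0 < e -> 0 <= M -> (forall x, Omega x -> `|x| <= M) ->
  (forall x, v x <= Mv) -> Int (s 3 e) <= Mv ^+ 3 * (2 * M) ^+ n.+1.
Proof.
move=> e0 M0 HM HMv; have t3 := s_tst 1 e0.
have Mv0 : 0 <= Mv by apply: le_trans (HMv 0); exact: sys_ge0 S _.
apply: Int_le_box => //; [exact: CC_BM (tst_CC t3)| |exact: exprn_ge0|].
  move=> x; have [Kx|nK] := pselect (K e x); last by rewrite /s cut_out// exprn_ge0.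
  rewrite /s cut_in// ppow_pos; last by have [_ _] := Kx; rewrite subr_ge0.
  have [_ _ we] := Kx; rewrite ler_pXn2r ?nnegrE ?subr_ge0//.
  apply: le_trans (HMv x); rewrite lerBlDr /w lerBlDr -addrA lerDl addr_ge0 ?(ltW e0)//.
  exact: sys_ge0 S _.
move=> x sx; have Kx : K e x by apply: contrapT => nK; move: sx; rewrite /s cut_out// eqxx.
by have [Ox _] := KU e0 Kx; exact: HM.
Qed.

End fixed_mu.

(** Let X be the integral of (w - e)^4 and Y the weighted energy. The estimates give Y <= C X + O(e)
    and X <= X/8 + Y/(4C), hence 5X/8 = O(e), against the positive lower bound of
    [positive_somewhere]. The constants [d] and [theta] are fixed before [mu]. *)
Lemma weak_comparison : exists2 d : R, 0 < d & exists2 theta : R, 0 < theta &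
  forall mu, mu <= 0 ->
    Int \1_(bad_set mu `&` [set x | Omega x /\ d <= enorm (G x)]) <= theta ->
    forall x, x 0 ord0 <= mu -> v x <= v (refl mu x).
Proof.
have [M M0 GM] := sys_G_bound S.
have [c c0 mono] := @Vf_mono_sig R n.+1 p M p1 M0.
have [L L0 HL] := sys_lip S.
have [h h0 Hh] := sys_H_bound S.
pose q := 2 * (p - 1) - Num.max (p - 2) 0; have q0 : 0 < q by exact: sig_exponent_gt0.
(* The coefficient of X in the energy estimate, increased by 1 so that C >= 1 even for L = 0. *)
pose C := 4 * L / (3 * c) + 1.
have C0 : 0 < C by rewrite ltr_wpDl// divr_ge0 ?mulr_ge0// ltW.
(* Budget for h X: [tau] and [kp] are chosen so that the flux term and the term of the noncritical
   points cost h Y/(8C) each, and [d2] so that the term of small gradients costs h X/8. *)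
pose tau := h / (8 * C); have tau0 : 0 < tau by rewrite divr_gt0// mulr_gt0.
pose d2 := Num.min h ((tau * h / 8) `^ q^-1).
have d20 : 0 < d2 by rewrite lt_min h0 powR_gt0// divr_gt0// mulr_gt0.
have d2h : d2 <= h by rewrite ge_min lexx.
have d2q : tau^-1 * d2 `^ q <= h / 8.
  rewrite ler_pdivrMl// mulrA; apply: (@le_trans _ _ (((tau * h / 8) `^ q^-1) `^ q)).
    by apply: powR_mono; [exact: ltW|exact: ltW|rewrite ge_min lexx orbT].
  by rewrite -powRrM mulVf ?gt_eqF// powRr1// divr_ge0// mulr_ge0 ?ltW.
pose A := h + tau^-1 * M `^ q.
have A0 : 0 < A by rewrite ltr_wpDr// mulr_ge0 ?powR_ge0// invr_ge0 ltW.
pose kp := h / (8 * A * C); have kp0 : 0 < kp by rewrite divr_gt0// !mulr_gt0.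
pose d := d2 / 2; have d0 : 0 < d by rewrite divr_gt0.
pose sg := d `^ Num.max (p - 2) 0; have sg0 : 0 < sg by rewrite powR_gt0.
have Hsg x : d <= enorm (G x) -> sg <= sig p (G x).
  by move=> dG; apply: powR_mono => //; [rewrite le_max lexx orbT|exact: ltW].
have [r1 r10 Hr1] := sys_unif S d0.
pose B : R := 2 * n.+1%:R ^+ 2.
have B0 : 0 < B by rewrite mulr_gt0// exprn_gt0.
(* Three demands on the box: the gradient varies by less than d over it, r^2 <= r, and the Poincare
   factor B r^2/sg is at most [kp]. *)
pose r := Num.min (r1 / 2) (Num.min 1 (kp * sg / B)).
have r0 : 0 < r by rewrite !lt_min divr_gt0//= ltr01/= divr_gt0// mulr_gt0.
have r1' : r <= 1 by rewrite !ge_min lexx orbT.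
have rk : B * r <= kp * sg by rewrite -ler_pdivlMl// mulrC !ge_min lexx !orbT.
have Gr x y : closure Omega x -> closure Omega y -> `|x - y| <= r -> enorm (G x - G y) < d.
  move=> cx cy xy; apply: Hr1 => //; apply: le_lt_trans xy _; rewrite gt_min; apply/orP; left.
  by rewrite ltr_pdivrMr// ltr_pMr// ltr1n.
have [N1 N10 HN] := compact_bound (sys_compact S).
have [Mv HMv] := BM_bounded (CC_BM (sys_CC S)).
exists d => //; exists (2^-1 * (2 * r) ^+ n.+1); first by rewrite mulr_gt0 ?invr_gt0// exprn_gt0// mulr_gt0.
move=> mu mu0 Hbad x; rewrite le_eqVlt => /predU1P[xm|xm]; first by rewrite refl_fix.
have [Ox|/(sys_out S) ->] := pselect (Omega x); last exact: sys_ge0 S _.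
rewrite leNgt; apply/negP => vx.
have wx : 0 < v x - v (refl mu x) by rewrite subr_gt0.
have [c1 c10 Hc1] := positive_somewhere mu0 (conj Ox xm) wx.
pose E := L * (Mv ^+ 3 * (2 * N1) ^+ n.+1).
have Mv0 : 0 <= Mv by apply: le_trans (HMv 0).
have E0 : 0 <= E by rewrite mulr_ge0// mulr_ge0// exprn_ge0// mulr_ge0// ltW.
(* The first entry is required by [positive_somewhere]; the second makes the error e E/(3c) at most
   c1/8. *)
pose e := Num.min ((v x - v (refl mu x)) / 4) (3 * c * c1 / (4 * (E + 1)) / 2).
have e0 : 0 < e by rewrite lt_min !divr_gt0 ?mulr_gt0// ltr_wpDl.
have X0 := Hc1 e e0 _; have {}X0 := X0 (ltac:(by rewrite ge_min lexx)).
have En := energy_estimate mu0 c0 L0 e0 (ltW M0) mono GM HL.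
have So := source_estimate mu0 e0 d20 d2h tau0 erefl GM Hh.
have Sm := small_set_estimate mu0 e0 d0 r0 sg0 Gr Hbad Hsg.
have S3 : Int _ <= _ := s3_bound mu0 e0 (ltW N10) (fun x Ox => HN x (subset_closure Ox))
  (fun x => le_trans (ler_norm _) (HMv x)).
rewrite (_ : 2 * d = d2) in Sm; last by rewrite /d; field.
move: X0 En So Sm S3; rewrite -/q -/A.
have Y0 : 0 <= Int (fun x => sig p (G x) * dotp (cut [set y | [/\ closure Omega y, y 0 ord0 <= mu &
    e <= v y - v (refl mu y)]] (fun y => (2 * ppow 1 (v y - v (refl mu y) - e)) *: (G y - reflect1 (G (refl mu y)))) x)
    (cut [set y | [/\ closure Omega y, y 0 ord0 <= mu &
    e <= v y - v (refl mu y)]] (fun y => (2 * ppow 1 (v y - v (refl mu y) - e)) *: (G y - reflect1 (G (refl mu y)))) x)).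
  by apply: Int_ge0 => y; rewrite mulr_ge0 ?dotp_ge0// powR_ge0.
move: Y0; set Y := Int _ => Y0; rewrite -/Y.
set X := Int (fun x => _ ^+ 2); set I := Int (fun x => \1__ _ * _); set S3 := Int (cut _ _).
move=> X0 En So Sm HS3.
have C1 : 1 <= C by rewrite /C lerDr divr_ge0// ?mulr_ge0// ltW.
have S3E : L * S3 <= E by rewrite /E; apply: ler_wpM2l.
have Y1 : Y <= C * X + 4 / (3 * c) * (e * E).
  have e1 : L * (X + e * S3) <= L * X + e * E by rewrite mulrDr lerD2l mulrCA; apply: ler_wpM2l => //; exact: ltW.
  have e2 : Y <= 4 / (3 * c) * (L * X + e * E).
    have -> : Y = 4 / (3 * c) * (3 / 4 * c * Y) by field; rewrite gt_eqF.
    apply: ler_wpM2l; first by rewrite divr_ge0// mulr_ge0// ltW.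
    exact: le_trans e1.
  apply: le_trans e2 _; rewrite mulrDr lerD2r mulrA; apply: ler_wpM2r; first exact: le_trans (ltW c10) X0.
  by rewrite mulrAC lerDl.
have I1 : A * I <= h / (8 * C) * Y.
  have -> : h / (8 * C) = A * kp by rewrite /kp; field; rewrite !gt_eqF.
  rewrite -mulrA; apply: ler_wpM2l; first exact: ltW.
  apply: le_trans Sm _; apply: ler_wpM2r => //.
  rewrite ler_pdivrMr// exprMn mulrA -/B; apply: le_trans rk.
  by rewrite -/B ler_pM2l// expr2 ler_piMl// ltW.
have X1 : X <= X / 8 + Y / (4 * C).
  rewrite -(ler_pM2l h0); apply: le_trans So _.
  have h1 : tau^-1 * d2 `^ q * X <= h / 8 * X by apply: ler_wpM2r => //; exact: le_trans (ltW c10) X0.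
  apply: (@le_trans _ _ (h / 8 * X + h / (8 * C) * Y + tau * Y)); first by rewrite lerD2r; exact: lerD.
  by rewrite le_eqVlt; apply/orP; left; apply/eqP; rewrite /tau; field; rewrite gt_eqF.
have X2 : X <= X / 8 + X / 4 + e * E / (3 * c).
  apply: le_trans X1 _; rewrite -addrA lerD2l ler_pdivrMr ?mulr_gt0//; apply: le_trans Y1 _.
  rewrite [leRHS]mulrDl; apply: lerD; first by rewrite le_eqVlt; apply/orP; left; apply/eqP; field.
  have -> : 4 / (3 * c) * (e * E) = e * E / (3 * c) * (4 * 1) by field; rewrite gt_eqF.
  apply: ler_wpM2l; first by rewrite divr_ge0// mulr_ge0// ltW.
  by rewrite ler_pM2l.
have e1 : e * E / (3 * c) <= c1 / 8.
  rewrite ler_pdivrMr ?mulr_gt0//.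
  apply: (@le_trans _ _ (e * (E + 1))); first by apply: ler_wpM2l; [exact: ltW|rewrite lerDl].
  rewrite -ler_pdivlMr ?ltr_wpDl//; apply: (@le_trans _ _ (3 * c * c1 / (4 * (E + 1)) / 2)); first by rewrite ge_min lexx orbT.
  rewrite le_eqVlt; apply/orP; left; apply/eqP; field; rewrite gt_eqF// ltr_wpDl//.
by lra.
Qed.

End weak_comparison.

(** * Cut-off functions of the difference quotients *)

Section one_dimensional_cutoffs.
Context {R : realType}.
Implicit Types (s t e : R).

(** An even threshold, 0 for t^2 <= 1 and at least 1 for t^2 >= 2. Summed over the difference
    quotients in all directions, it detects whether the gradient exceeds the chosen scale. *)
Definition sqcut t : R := ppow 2 (t ^+ 2 - 1).
Definition dsqcut t : R := 2 * ppow 1 (t ^+ 2 - 1) * (2 * t).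

Lemma is_derive_sqcut t : is_derive t (1 : R) sqcut (dsqcut t).
Proof.
apply: (@is_derive1_comp R (ppow 2) (fun t => t ^+ 2 - 1)); first exact: is_derive_ppow.
have h := is_deriveB (is_derive_sqr t) (is_derive_cst (1 : R) t (1 : R)).
by apply: is_derive_eq h _; rewrite subr0.
Qed.

Lemma continuous_dsqcut : continuous dsqcut.
Proof.
move=> t; apply: continuous_rM; last by apply: continuous_rZ; exact: for_id.
apply: continuous_rZ; apply: continuous_rcomp; last exact: continuous_ppow.
by apply: continuous_rB; [apply: continuous_rM; exact: for_id|exact: for_cst].
Qed.

Lemma sqcut_ge0 t : 0 <= sqcut t. Proof. exact: ppow_ge0. Qed.

Lemma sqcut_ge1 t : 2 <= t ^+ 2 -> 1 <= sqcut t.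
Proof. by move=> t2; rewrite /sqcut ppow_pos ?subr_ge0; nra. Qed.

Lemma sqcut_lt1 t : sqcut t < 1 -> t ^+ 2 < 2.
Proof. by move=> h; rewrite ltNge; apply/negP => /sqcut_ge1; rewrite leNgt h. Qed.

Lemma sqcut_out t : t ^+ 2 <= 1 -> sqcut t = 0 /\ dsqcut t = 0.
Proof. by move=> h; rewrite /sqcut /dsqcut !ppow_neg ?subr_le0// mulr0 mul0r. Qed.

Lemma dsqcut_bound t : t ^+ 2 <= 2 -> `|dsqcut t| <= 8.
Proof.
move=> h; rewrite /dsqcut normrM ger0_norm ?mulr_ge0 ?ppow_ge0//.
have a : ppow 1 (t ^+ 2 - 1) <= 1 by rewrite /ppow expr1 ge_max ler01 andbT; lra.
have b : `|2 * t| <= 4 by rewrite ler_norml; apply/andP; split; nra.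
rewrite (_ : 8 = 2 * 1 * 4 :> R); last by ring.
by apply: ler_pM; rewrite ?mulr_ge0 ?ppow_ge0// ler_pM2l.
Qed.

(** The offset 1/2 leaves the zone |t| <= 1/2 flat, and since sqrt 2 - 1/2 < 1 the saturation is not
    reached before t^2 = 2: the slope stays at least 1/8 where [sqcut] varies below 1. *)
Let beta t : R := sat (ppow 2 (t - 2^-1)).
Let dbeta t : R := dsat (ppow 2 (t - 2^-1)) * (2 * ppow 1 (t - 2^-1)).

Let is_derive_beta t : is_derive t (1 : R) beta (dbeta t).
Proof.
apply: (@is_derive1_comp R sat (fun t => ppow 2 (t - 2^-1))); first exact: is_derive_sat.
have h := is_deriveB (is_derive_id t (1 : R)) (is_derive_cst (2^-1 : R) t (1 : R)).
have h2 := @is_derive1_comp R (ppow 2) (fun t => t - 2^-1) _ _ _ (is_derive_ppow 0 _) h.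
by apply: is_derive_eq h2 _; rewrite subr0 mulr1.
Qed.

Let beta_out t : t <= 2^-1 -> beta t = 0 /\ dbeta t = 0.
Proof. by move=> t1; rewrite /beta /dbeta !ppow_neg ?subr_le0// sat0 !mulr0. Qed.

Let beta_ge0 t : 0 <= beta t. Proof. by rewrite sat_ge0// ppow_ge0. Qed.
Let dbeta_ge0 t : 0 <= dbeta t. Proof. by rewrite !mulr_ge0 ?dsat_ge0 ?ppow_ge0. Qed.

Let continuous_dbeta : continuous dbeta.
Proof.
have h (k : nat) : continuous (fun t : R => ppow k (t - 2^-1)).
  move=> t; apply: continuous_rcomp; last exact: continuous_ppow.
  by apply: continuous_rB; [exact: for_id|exact: for_cst].
move=> t; apply: continuous_rM; last by apply: continuous_rZ; exact: h.
by apply: continuous_rcomp; [exact: h|exact: continuous_dsat].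
Qed.

Let dbeta_lb t : 1 <= t -> t ^+ 2 <= 2 -> 8^-1 <= dbeta t.
Proof.
move=> t1 t2; have t3 : t <= 29/20 by nra.
rewrite /dbeta /dsat; set s := t - 2^-1; have s1 : 2^-1 <= s by rewrite /s; lra.
have s2 : s <= 19/20 by rewrite /s; lra.
have s0 : 0 <= s by lra.
have q : 39/400 <= 1 - s ^+ 2 by nra.
rewrite (ppow_pos 2 s0) (ppow_pos 1 s0) ppow_pos ?expr1; last by lra.
by nra.
Qed.

(* odd, nondecreasing and bounded; vanishes on [-1/2, 1/2] and strictly increases for 1 <= t^2 <= 2 *)
Definition oddcut t : R := beta t - beta (- t).
Definition doddcut t : R := dbeta t + dbeta (- t).

Lemma is_derive_oddcut t : is_derive t (1 : R) oddcut (doddcut t).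
Proof.
have h := is_deriveN (is_derive_id t (1 : R)).
have h2 := @is_derive1_comp R beta (fun t => - t) _ _ _ (is_derive_beta _) h.
have h3 := is_deriveB (is_derive_beta t) h2.
by apply: is_derive_eq h3 _; rewrite mulrN1 opprK.
Qed.

Lemma continuous_doddcut : continuous doddcut.
Proof.
move=> t; apply: continuous_rD; first exact: continuous_dbeta.
by apply: continuous_rcomp; [apply: continuous_rN; exact: for_id|exact: continuous_dbeta].
Qed.

Lemma oddcut_out t : `|t| <= 2^-1 -> oddcut t = 0 /\ doddcut t = 0.
Proof.
rewrite ler_norml => /andP[a b]; rewrite /oddcut /doddcut.
have [-> ->] := beta_out b; have [|-> ->] := @beta_out (- t); first by lra.
by rewrite subrr addr0.
Qed.

Lemma oddcut_bound t : `|oddcut t| <= 1.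
Proof.
have a := beta_ge0 t; have b := beta_ge0 (- t); have c := sat_le1 (ppow 2 (t - 2^-1)).
have d := sat_le1 (ppow 2 (- t - 2^-1)); rewrite -/(beta _) in c; rewrite -/(beta _) in d.
by rewrite /oddcut ler_norml; apply/andP; split; lra.
Qed.

Lemma doddcut_ge0 t : 0 <= doddcut t. Proof. by rewrite addr_ge0. Qed.

Lemma doddcut_lb t : 1 <= t ^+ 2 -> t ^+ 2 <= 2 -> 8^-1 <= doddcut t.
Proof.
move=> t1 t2; have [t0|t0] := leP 0 t.
  by apply: le_trans (dbeta_lb (_ : 1 <= t) t2) _; [nra|rewrite lerDl].
by apply: le_trans (dbeta_lb (_ : 1 <= - t) _) _; rewrite ?sqrrN//; [nra|rewrite lerDr].
Qed.

End one_dimensional_cutoffs.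

Section scaling.
Context {R : realType} {N : nat}.

Lemma kap_scale (p m M e : R) : 0 <= m -> 0 <= M -> 0 < e ->
  kap p (m * e) (M * e) = e `^ (p - 2) * kap p m M.
Proof.
move=> m0 M0 e0; rewrite /kap !powRM ?(ltW e0)//.
rewrite [RHS]mulrC minr_pMl ?powR_ge0//.
by congr Num.min; rewrite mulrA.
Qed.

Lemma enorm_le_coord (x : 'rV[R]_N) (c : R) : 0 <= c -> (forall i, `|x 0 i| <= c) -> enorm x <= N%:R * c.
Proof.
by move=> c0 h; apply: le_trans (enorm_le_norm _) _; apply: ler_wpM2l => //; apply/rV_normP.
Qed.

Lemma enorm_delta (j : 'I_N) : enorm (delta_mx 0 j : 'rV[R]_N) = 1.
Proof. by rewrite /enorm dotp_delta mxE !eqxx sqrtr1. Qed.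

End scaling.

(** * Critical points and the boundary *)

Section no_critical_island.
Context {R : realType} {N : nat}.
Implicit Types (x y z : 'rV[R]_N) (j : 'I_N).
Variables (Omega D : set 'rV[R]_N) (p L : R) (v H : 'rV[R]_N -> R) (G : 'rV[R]_N -> 'rV[R]_N).
Hypotheses (p1 : 1 < p) (S : psol Omega p v G H) (cv : continuous v).
Hypotheses (L0 : 0 <= L) (HL : forall x y, `|H x - H y| <= L * `|v x - v y|).
Hypothesis Hpos : forall x, Omega x -> 0 < H x.
Hypotheses (oD : open D) (cD : compact (closure D)) (DO : closure D `<=` Omega).
Hypotheses (GD : forall x, D x -> G x != 0) (GbD : forall x, closure D x -> ~ D x -> G x = 0).

Section fixed_scale.
Variables (e k : R) (M K0 : R).
Hypotheses (e0 : 0 < e) (k0 : 0 < k).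
Hypothesis kO : forall x z, closure D x -> `|z| <= k -> Omega (x + z) /\ enorm (G (x + z) - G x) <= e / 4.
Hypotheses (M0 : 0 <= M) (DM : forall x, closure D x -> `|x| <= M).
Hypotheses (K00 : 0 <= K0) (GK : forall x, closure D x -> enorm (G x) + e / 4 <= K0).

(** Compact in [D] because the boundary points of [D] are critical. On the rest of [D] all quotients
    [q j x / e] are at most 1/2 in modulus, where the cut-offs vanish. *)
Let K : set 'rV[R]_N := [set x | closure D x /\ e / 4 <= enorm (G x)].
Let sh j : 'rV[R]_N := k *: delta_mx 0 j.
(** A difference quotient in place of the j-th partial derivative: the latter is merely continuous,
    while [q j] is C^1 and can enter a test function. It differs from the partial derivative by at
    most e/4. *)
Let q j x := k^-1 * (v (x + sh j) - v x).
Let dq j x := k^-1 *: (G (x + sh j) - G x).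
Let cG x : Omega x -> continuous_at x G. Proof. exact: psol_G S x. Qed.

Let e40 : 0 < e / 4. Proof. by rewrite divr_gt0. Qed.

Let D_cl x : D x -> closure D x. Proof. exact: subset_closure. Qed.

Let cK : compact K.
Proof.
have oO := psol_open S.
have oV : open (Omega `&` (fun x => enorm (G x)) @^-1` [set t | t < e / 4]).
  apply: (@open_preimage _ _ _ (fun x => enorm (G x))); [exact: oO| |exact: open_lt].
  by move=> x Ox; apply: continuous_enorm; exact: cG.
have clK : closed K.
  rewrite (_ : K = closure D `&` ~` (Omega `&` (fun x => enorm (G x)) @^-1` [set t | t < e / 4])).
    by apply: closedI; [exact: closed_closure|exact: open_closedC].
  apply/seteqP; split=> x /= [a b]; split=> //.
    by move=> [_]; rewrite ltNge b.
  by rewrite leNgt; apply/negP => c; apply: b; split=> //; exact: DO.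
by apply: (subclosed_compact clK cD) => x [].
Qed.

Let KD : K `<=` D.
Proof.
move=> x [cx ex]; apply: contrapT => nD; move: ex; rewrite GbD// enorm0 => h.
by have := lt_le_trans e40 h; rewrite ltxx.
Qed.

Let sh_le j t : 0 <= t <= 1 -> `|t *: sh j| <= k.
Proof.
move=> /andP[t0 t1]; apply: le_trans (norm_le_enorm _) _.
by rewrite !enormZ enorm_delta mulr1 !ger0_norm ?(ltW k0)// ler_piMl// ltW.
Qed.

Let sh_O j x : closure D x -> Omega (x + sh j).
Proof. by move=> Dx; rewrite -[sh j]scale1r; apply: (kO Dx _).1; apply: sh_le; rewrite ler01 lexx. Qed.

Let sh_G j x : closure D x -> enorm (G (x + sh j) - G x) <= e / 4.
Proof. by move=> Dx; rewrite -[sh j]scale1r; apply: (kO Dx _).2; apply: sh_le; rewrite ler01 lexx. Qed.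

Let q_G j x : closure D x -> `|q j x - G x 0 j| <= e / 4.
Proof.
move=> Dx; have [||t] := @mvt_line _ _ v G x (sh j).
- move=> t; rewrite in_itv /= => /andP[t0 t1]; apply: (psol_grad S); apply: (kO Dx _).1.
  by apply: sh_le; rewrite !ltW.
- by move=> t _; exact: cv.
rewrite in_itv /= => /andP[t0 t1] E.
rewrite /q E /sh dotpZr dotp_delta mulKf ?gt_eqF//.
have := coord_le_enorm (G (x + t *: sh j) - G x) j; rewrite !mxE => h.
apply: le_trans h _; apply: (kO Dx _).2.
by apply: sh_le; rewrite !ltW.
Qed.

Let gq j x : D x -> is_grad (q j) x (dq j x).
Proof.
move=> Dx; apply: is_gradZ; apply: is_gradB.
  by apply: is_grad_shift; apply: (psol_grad S); apply: sh_O; exact: D_cl.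
by apply: (psol_grad S); apply: DO; exact: D_cl.
Qed.

Let csh j x : D x -> continuous_at x (fun y => G (y + sh j)).
Proof.
move=> Dx; apply: (@continuous_comp _ _ _ (fun y : 'rV[R]_N => y + sh j) G).
  by apply: continuous_rvD; [exact: for_id|exact: for_cst].
by apply: cG; apply: sh_O; exact: D_cl.
Qed.

Let cGD x : D x -> continuous_at x G.
Proof. by move=> Dx; apply: cG; apply: DO; exact: D_cl. Qed.

Let cdq j x : D x -> continuous_at x (dq j).
Proof.
move=> Dx; apply: continuous_rvZ; first exact: for_cst.
by apply: continuous_rvB; [exact: csh|exact: cGD].
Qed.

Let q_out j x : D x -> ~ K x -> `|q j x / e| <= 2^-1.
Proof.
move=> Dx nK; have Gx : enorm (G x) < e / 4.
  by rewrite ltNge; apply/negP => h; apply: nK; split=> //; exact: D_cl.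
rewrite normrM normfV (gtr0_norm e0) ler_pdivrMr//.
have := q_G j (D_cl Dx); have := coord_le_enorm (G x) j.
rewrite !ler_norml => /andP[a b] /andP[c d]; apply/andP; split; lra.
Qed.

Let f_grad (f f' : R -> R) j x : (forall t, is_derive t (1 : R) f (f' t)) -> D x ->
  is_grad (fun y => f (q j y / e)) x ((f' (q j x / e) / e) *: dq j x).
Proof.
move=> df Dx; have h : is_grad (fun y => q j y / e) x (e^-1 *: dq j x).
  by under eq_fun do rewrite mulrC; apply: is_gradZ; exact: gq.
by rewrite -scalerA; exact: is_grad_comp h (df _).
Qed.

Let f_cont (f' : R -> R) j x : continuous f' -> D x ->
  continuous_at x (fun y => (f' (q j y / e) / e) *: dq j y).
Proof.
move=> cf Dx; apply: continuous_rvZ; last exact: cdq.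
apply: continuous_rM; last exact: for_cst.
apply: continuous_rcomp => //; apply: continuous_rM; last exact: for_cst.
exact: is_grad_continuous (gq j Dx).
Qed.

Let phi j := cut K (fun x => oddcut (q j x / e)).
Let dphi j := @cut R N K 'rV[R]_N (fun x => (doddcut (q j x / e) / e) *: dq j x).

Let t_phi j : tst D (phi j) (dphi j).
Proof.
apply: tst_cut; first exact: oD.
- exact: cK.
- exact: KD.
- by move=> x Dx; apply: (f_grad _ is_derive_oddcut Dx).
- by move=> x Dx; apply: f_cont; [exact: continuous_doddcut|exact: Dx].
- by move=> x Dx nK; have [-> ->] := oddcut_out (q_out j Dx nK); rewrite mul0r scale0r.
Qed.

Let sm x := \sum_j sqcut (q j x / e).
Let dsm x := \sum_j (dsqcut (q j x / e) / e) *: dq j x.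
(** A test function equal to 1 where some quotient satisfies (q/e)^2 >= 2 and to 0 off [K]. Its
    gradient lives where the gradient of [v] is of order e, and there the flux is small. *)
Let psi := cut K (fun x => sat (sm x)).
Let dpsi := @cut R N K 'rV[R]_N (fun x => dsat (sm x) *: dsm x).

Let gsm x : D x -> is_grad sm x (dsm x).
Proof. by move=> Dx; apply: is_grad_sum => j; apply: (f_grad _ is_derive_sqcut Dx). Qed.

Let t_psi : tst D psi dpsi.
Proof.
apply: tst_cut; first exact: oD.
- exact: cK.
- exact: KD.
- by move=> x Dx; apply: is_grad_comp; [exact: gsm|exact: is_derive_sat].
- move=> x Dx; apply: continuous_rvZ.
    by apply: continuous_rcomp; [exact: is_grad_continuous (gsm Dx)|exact: continuous_dsat].
  apply: rV_continuousP => i; rewrite /continuous_at /dsm.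
  under eq_fun do rewrite summxE.
  rewrite summxE; apply: continuous_sumr => j; apply: continuous_coord.
  by apply: f_cont; [exact: continuous_dsqcut|exact: Dx].
- move=> x Dx nK; rewrite /sm big1 ?sat0 => [|j _]; last first.
    have := q_out j Dx nK; rewrite ler_norml => /andP[a b].
    by have [|-> _] // := @sqcut_out R (q j x / e); nra.
  rewrite /dsm big1 ?scaler0// => j _.
  have := q_out j Dx nK; rewrite ler_norml => /andP[a b].
  by have [|_ ->] := @sqcut_out R (q j x / e); [nra|rewrite mul0r scale0r].
Qed.

Let S1 j : psol D p (fun x => v (x + sh j)) (fun x => G (x + sh j)) (fun x => H (x + sh j)).
Proof.
have QQ : (1%:M : 'M[R]_N) *m 1%:M^T = 1%:M by rewrite trmx1 mulmx1.
have := psol_aff (sh j) p1 QQ S; rewrite /aff trmx1.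
under [X in psol _ _ X _ _]eq_fun do rewrite mulmx1.
under [X in psol _ _ _ X _]eq_fun do rewrite !mulmx1.
under [X in psol _ _ _ _ X]eq_fun do rewrite mulmx1.
apply: psol_sub => // x Dx; rewrite /= mulmx1; apply: sh_O; exact: D_cl.
Qed.

Let S0 : psol D p v G H.
Proof. by apply: (psol_sub oD _ S) => x Dx; apply: DO; exact: D_cl. Qed.

(** The equations of [v] and of its translate are subtracted and tested with the bounded function
    [phi j]. Their sources differ by at most L |v(x + sh) - v(x)|, which is of order k. *)
Let flux_term j : Int (fun x => dotp (Vf p (G (x + sh j)) - Vf p (G x)) (dphi j x)) <=
  L * K0 * k * (2 * M) ^+ N.
Proof.
have cV x : D x -> continuous_at x (fun x => Vf p (G x)).
  by move=> Dx; apply: continuous_Vf => //; exact: cGD.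
have cV1 x : D x -> continuous_at x (fun x => Vf p (G (x + sh j))).
  by move=> Dx; apply: continuous_Vf => //; exact: csh.
have b1 := CC_BM (tst_CC_dot oD (t_phi j) cV); have b2 := CC_BM (tst_CC_dot oD (t_phi j) cV1).
have h1 := CC_BM (tst_CC_mul oD (t_phi j) (psol_H S0)).
have h2 := CC_BM (tst_CC_mul oD (t_phi j) (psol_H (S1 j))).
under eq_Int do rewrite dotpBl.
rewrite IntB// (psol_weak S0 (t_phi j)) (psol_weak (S1 j) (t_phi j)) -IntB//.
have C0 : 0 <= L * K0 * k by rewrite !mulr_ge0// ltW.
apply: Int_le_box => //; first exact: BMB.
  move=> x; have [Kx|nK] := pselect (K x); last by rewrite /phi !cut_out// !mulr0 subrr.
  have Dx := KD Kx; have cx := D_cl Dx; rewrite -mulrBl /phi cut_in//.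
  apply: le_trans (ler_norm _) _; rewrite normrM.
  apply: (@le_trans _ _ (L * K0 * k * 1)); last by rewrite mulr1.
  apply: ler_pM => //; last exact: oddcut_bound.
  apply: le_trans (HL _ _) _; rewrite -mulrA; apply: ler_wpM2l => //.
  have -> : v (x + sh j) - v x = q j x * k by rewrite /q mulrC mulVKf ?gt_eqF.
  rewrite normrM (gtr0_norm k0); apply: ler_wpM2r; first exact: ltW.
  apply: le_trans (GK cx); have := q_G j cx; have := coord_le_enorm (G x) j.
  by rewrite !ler_norml => /andP[a b] /andP[c d]; apply/andP; split; lra.
move=> x px; have Kx : K x.
  by apply: contrapT => nK; move: px; rewrite /phi !cut_out// !mulr0 subrr eqxx.
by apply: DM; case: Kx.
Qed.

(** The product of the bounds 2 for [dsat], 8 for [dsqcut] and (2N)^(p-1) for the flux at |G| <= 2 N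
    e. The constant [kk] is the ellipticity at unit scale, from which [kap_scale] factors out the
    power of e. *)
Let A : R := 16 * (2 * N%:R) `^ (p - 1).
Let kk : R := kap p 2^-1 (2 * N%:R + 1).

Let kk0 : 0 < kk.
Proof. by apply: kap_gt0 => //; rewrite ?invr_gt0// ltr_wpDl// mulr_ge0. Qed.

Let DV_ge0 j x : K x -> 0 <= dotp (Vf p (G (x + sh j)) - Vf p (G x)) (dq j x).
Proof. by move=> Kx; rewrite dotpZr mulr_ge0 ?invr_ge0 ?(ltW k0)//; exact: Vf_mono. Qed.

(** The left side is nonzero only if 1 < (q_j/e)^2 < 2 and every other quotient is below sqrt 2 e in
    modulus. There both gradients are comparable to e, the slope of [oddcut] is at least 1/8, and
    monotonicity controls k e^(p-2) |dq|^2; Young's inequality with weight lam then separates |dq|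
    from the flux. *)
Let flux_pointwise (lam : R) j x : 0 < lam -> K x ->
  dsat (sm x) * (dsqcut (q j x / e) / e) * dotp (Vf p (G x)) (dq j x) <=
  A / 2 * (lam * (8 * e / (kk * k)) * dotp (Vf p (G (x + sh j)) - Vf p (G x)) (dphi j x) +
    e `^ (p - 2) / lam).
Proof.
move=> lam0 Kx; have Dx := KD Kx; have cx := D_cl Dx.
have A0 : 0 <= A by rewrite mulr_ge0// powR_ge0.
have DV := DV_ge0 j Kx.
have kk2 : 0 < kk * k by rewrite mulr_gt0.
rewrite /dphi cut_in// [dotp (Vf p (G (x + sh j)) - _) _]dotpZr; set t := q j x / e.
set X := dotp _ (dq j x) in DV *.
have R0 : 0 <= A / 2 * (lam * (8 * e / (kk * k)) * (doddcut t / e * X) + e `^ (p - 2) / lam).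
  rewrite mulr_ge0 ?divr_ge0// addr_ge0//; last by rewrite divr_ge0 ?powR_ge0// ltW.
  rewrite mulr_ge0//; last by rewrite mulr_ge0// divr_ge0 ?doddcut_ge0// ltW.
  by rewrite mulr_ge0// ?(ltW lam0)// divr_ge0 ?mulr_ge0// ltW.
have [t1|t1] := leP (t ^+ 2) 1; first by rewrite (sqcut_out t1).2 mul0r mulr0 mul0r.
have [s1|s1] := leP 1 (sm x); first by rewrite dsat_out// !mul0r.
have ti i : (q i x / e) ^+ 2 < 2.
  apply: sqcut_lt1; apply: le_lt_trans s1; rewrite /sm (bigD1 i)//= lerDl.
  by apply: sumr_ge0 => l _; exact: sqcut_ge0.
have Gi i : `|G x 0 i| <= 2 * e.
  have := q_G i cx; have := ti i; set u := q i x / e => u2.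
  have -> : q i x = u * e by rewrite /u divfK ?gt_eqF.
  have : `|u * e| <= 3 / 2 * e.
    rewrite normrM (gtr0_norm e0) ler_pM2r// ler_norml; apply/andP; split; nra.
  by rewrite !ler_norml => /andP[a b] /andP[c d]; apply/andP; split; lra.
have Gu : enorm (G x) <= 2 * N%:R * e.
  by rewrite (mulrC 2) -mulrA; apply: enorm_le_coord => //; rewrite mulr_ge0// ltW.
have Gl : 3 / 4 * e <= enorm (G x).
  apply: le_trans (coord_le_enorm _ j).
  have := q_G j cx; have -> : q j x = t * e by rewrite /t divfK ?gt_eqF.
  have : e <= `|t * e|.
    rewrite normrM (gtr0_norm e0) ler_peMl ?(ltW e0)//.
    by rewrite -(@ler_pXn2r _ 2)// ?nnegrE// expr1n -normrX ger0_norm ?sqr_ge0// ltW.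
  by have := ler_distD (G x 0 j) (t * e) 0; rewrite !subr0; lra.
have [g1 g2] : enorm (G (x + sh j)) <= (2 * N%:R + 1) * e /\ 2^-1 * e <= enorm (G (x + sh j)).
  have := sh_G j cx; have := ler_enormB (G (x + sh j)) (G x).
  by rewrite ler_norml => /andP[a b] c; split; lra.
have Y1 : e `^ (p - 2) * kk * k * enorm (dq j x) ^+ 2 <= X.
  have m0 : 0 < 2^-1 * e by rewrite mulr_gt0// invr_gt0.
  have Gu' : enorm (G x) <= (2 * N%:R + 1) * e by apply: le_trans Gu _; rewrite ler_pM2r// lerDl.
  have := Vf_mono_range p1 m0 g2 g1 Gu'.
  rewrite kap_scale ?invr_ge0 ?addr_ge0 ?mulr_ge0// -/kk.
  have -> : G (x + sh j) - G x = k *: dq j x by rewrite /dq scalerA mulfV ?gt_eqF// scale1r.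
  rewrite dotpZr enormZ (gtr0_norm k0) exprMn -/X (_ : _ * (k ^+ 2 * _) = k * (e `^ (p - 2) * kk * k * enorm (dq j x) ^+ 2)); last by ring.
  by rewrite ler_pM2l.
set d := enorm (dq j x) in Y1.
have E1 : dsat (sm x) * (dsqcut t / e) * dotp (Vf p (G x)) (dq j x) <= A * (e `^ (p - 2) * d).
  apply: le_trans (ler_norm _) _; rewrite 2!normrM [`|_ / e|]normrM normfV (gtr0_norm e0).
  have a1 : `|dsat (sm x)| <= 2.
    by rewrite ger0_norm ?dsat_ge0// dsat_le2//; apply: sumr_ge0 => l _; exact: sqcut_ge0.
  have a2 : `|dsqcut t| <= 8 by apply: dsqcut_bound; exact: ltW (ti j).
  have a3 : `|dotp (Vf p (G x)) (dq j x)| <= (2 * N%:R) `^ (p - 1) * e `^ (p - 1) * d.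
    apply: le_trans (cauchy_schwarz _ _) _; apply: ler_wpM2r; first exact: enorm_ge0.
    rewrite enorm_Vf// -powRM ?mulr_ge0 ?(ltW e0)//; apply: powR_mono => //; last exact: enorm_ge0.
    by rewrite subr_ge0 ltW.
  have -> : A * (e `^ (p - 2) * d) = 2 * (8 / e) * ((2 * N%:R) `^ (p - 1) * e `^ (p - 1) * d).
    by rewrite -(powR_sub2 (ltW e0) p1) /A; field; rewrite gt_eqF.
  apply: ler_pM => //; first by rewrite mulr_ge0// divr_ge0// ltW.
  apply: ler_pM => //; first by rewrite divr_ge0// ltW.
  by rewrite ler_pM2r ?invr_gt0.
apply: le_trans E1 _; rewrite -[A / 2 * _]mulrA; apply: ler_wpM2l => //.
have d1 : 8^-1 <= doddcut t by apply: doddcut_lb; apply: ltW => //; exact: ti.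
have E2 : lam * (8 * e / (kk * k)) * (doddcut t / e * X) >= lam * (e `^ (p - 2) * d ^+ 2).
  rewrite -mulrA; apply: ler_wpM2l; first exact: ltW.
  apply: (@le_trans _ _ (8 * e / (kk * k) * (8^-1 / e * X))); last first.
    apply: ler_wpM2l; first by rewrite divr_ge0 ?mulr_ge0// ltW.
    by apply: ler_wpM2r => //; apply: ler_wpM2r => //; rewrite invr_ge0 ltW.
  have -> : 8 * e / (kk * k) * (8^-1 / e * X) = X / (kk * k) by field; rewrite !gt_eqF.
  by rewrite ler_pdivlMr//; apply: le_trans Y1; rewrite le_eqVlt; apply/orP; left; apply/eqP; ring.
have E3 : 2 * (e `^ (p - 2) * d) <= lam * (e `^ (p - 2) * d ^+ 2) + e `^ (p - 2) / lam.
  rewrite -subr_ge0 (_ : _ - _ = e `^ (p - 2) * (lam^-1 * (lam * d - 1) ^+ 2)); last by field; rewrite gt_eqF.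
  by rewrite mulr_ge0 ?powR_ge0// mulr_ge0 ?sqr_ge0// invr_ge0 ltW.
by rewrite ler_pdivlMl//; apply: le_trans E3 _; rewrite lerD2r.
Qed.

(** The factor 1/k from the ellipticity is compensated by the factor k of [flux_term], so the bound
    depends on e alone and tends to 0 with it. *)
Lemma flux_bound : Int (fun x => H x * psi x) <=
  N%:R * (A / 2) * (2 * M) ^+ N * (8 * (L * K0) / kk + 1) * e `^ ((p - 1) / 2).
Proof.
have A0 : 0 <= A by rewrite mulr_ge0// powR_ge0.
have kk2 : 0 < kk * k by rewrite mulr_gt0.
(* This weight balances the two terms: lam e and e^(p-2)/lam both equal e^((p-1)/2). *)
pose lam := e `^ ((p - 3) / 2); have lam0 : 0 < lam by exact: powR_gt0.
have cV x : D x -> continuous_at x (fun x => Vf p (G x)).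
  by move=> Dx; apply: continuous_Vf => //; exact: cGD.
have cV1 j x : D x -> continuous_at x (fun x => Vf p (G (x + sh j)) - Vf p (G x)).
  by move=> Dx; apply: continuous_rvB; [apply: continuous_Vf => //; exact: csh|exact: cV].
have bj j := CC_BM (tst_CC_dot oD (t_phi j) (cV1 j)).
have bp := CC_BM (tst_CC_dot oD t_psi cV).
have bK : BM (\1_K : _ -> R).
  apply: BM_set; first by apply: closed_mset; exact: compact_closed_rV.
  by exists M => x [cx _]; exact: DM.
rewrite -(psol_weak S0 t_psi).
pose F j x := A / 2 * (lam * (8 * e / (kk * k)) *
  dotp (Vf p (G (x + sh j)) - Vf p (G x)) (dphi j x) + e `^ (p - 2) / lam * \1_K x).
have bF j : BM (F j) by apply: BM_scale; apply: BMD; exact: BM_scale.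
apply: (@le_trans _ _ (Int (fun x => \sum_j F j x))).
  apply: le_Int => //; first exact: BM_sum.
  move=> x; have [Kx|nK] := pselect (K x); last first.
    rewrite /dpsi cut_out// dotp0r; apply: sumr_ge0 => j _.
    by rewrite /F /dphi cut_out// dotp0r mulr0 add0r indicE memNset// mulr0 mulr0.
  rewrite /dpsi cut_in// dotpZr /dsm dotpE linear_sum mulmx_sumr summxE mulr_sumr.
  apply: ler_sum => j _; rewrite /F indicE mem_set// mulr1.
  apply: le_trans (flux_pointwise j lam0 Kx).
  by rewrite -dotpE dotpZr mulrA.
rewrite Int_sum// -mulrA -mulrA -mulrA mulrA -[N%:R * _ * _]mulrA.
have -> (c : R) : N%:R * c = \sum_(j < N) c by rewrite sumr_const card_ord mulr_natl.
apply: ler_sum => j _; rewrite /F IntZ; last by apply: BMD; exact: BM_scale.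
apply: ler_wpM2l; first exact: divr_ge0.
rewrite IntD; [|exact: BM_scale|exact: BM_scale].
rewrite IntZ// IntZ//.
have e1 : lam * e = e `^ ((p - 1) / 2).
  rewrite -[X in _ * X = _]powRr1 ?(ltW e0)// -powRD; last by rewrite (gt_eqF e0) implybT.
  by congr (_ `^ _); field.
have e2 : e `^ (p - 2) / lam = e `^ ((p - 1) / 2).
  rewrite /lam -powRN -powRD; last by rewrite (gt_eqF e0) implybT.
  by congr (_ `^ _); field.
have MN : 0 <= (2 * M) ^+ N by rewrite exprn_ge0// mulr_ge0.
have i1 : Int (\1_K : _ -> R) <= (2 * M) ^+ N.
  rewrite -[leRHS]mul1r; apply: Int_le_box => //.
  move=> x; rewrite indicE; case: (boolP (x \in K)); last by rewrite eqxx.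
  by rewrite inE => -[cx _] _; exact: DM.
rewrite e2; set P := e `^ _ in e1 *.
have P0 : 0 <= P by exact: powR_ge0.
rewrite (_ : (2 * M) ^+ N * _ = 8 * (L * K0) / kk * P * (2 * M) ^+ N + P * (2 * M) ^+ N); last by ring.
apply: lerD; last exact: ler_wpM2l.
have -> : lam * (8 * e / (kk * k)) = 8 * P / (kk * k) by rewrite -e1; ring.
apply: le_trans (ler_wpM2l _ (flux_term j)) _; first by rewrite divr_ge0 ?mulr_ge0// ltW.
rewrite le_eqVlt; apply/orP; left; apply/eqP; field.
by rewrite !gt_eqF.
Qed.

(** Near a noncritical point [psi] is 1 as soon as e is small against the gradient, so the source
    contributes an amount independent of e. *)
Lemma flux_lower j x0 (r h : R) : 0 < r -> 0 <= h ->
  (forall y, rbox x0 r y -> [/\ D y, 2 * e <= `|G y 0 j| & h <= H y]) ->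
  h * (2 * r) ^+ N <= Int (fun x => H x * psi x).
Proof.
move=> r0 h0 hr; have sm0 x : 0 <= sm x by apply: sumr_ge0 => i _; exact: sqcut_ge0.
apply: (@Int_ge_rbox _ _ _ x0); [exact: CC_BM (tst_CC_mul oD t_psi (psol_H S0))|exact: ltW| |].
  move=> x; have [Kx|nK] := pselect (K x); last by rewrite /psi cut_out// mulr0.
  rewrite /psi cut_in// mulr_ge0 ?sat_ge0// ltW// Hpos//; apply: DO; exact: D_cl (KD Kx).
move=> y /hr[Dy Gy hy]; have cy := D_cl Dy.
have Ky : K y.
  by split=> //; apply: le_trans (coord_le_enorm _ j); apply: le_trans Gy; have := e0; lra.
rewrite /psi cut_in// sat1 ?mulr1//.
rewrite /sm (bigD1 j)//= -[leLHS]addr0; apply: lerD; last first.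
  by apply: sumr_ge0 => i _; exact: sqcut_ge0.
apply: sqcut_ge1; have := q_G j cy; have := ler_distD (q j y) (G y 0 j) 0.
rewrite !subr0 distrC => a b; have {a b}c : 7 / 4 * e <= `|q j y| by lra.
rewrite -[X in _ <= X]ger0_norm ?sqr_ge0// normrX normrM normfV (gtr0_norm e0).
have : 7 / 4 <= `|q j y| / e by rewrite ler_pdivlMr.
by nra.
Qed.

End fixed_scale.
(** [flux_lower] and [flux_bound] bound the same integral from below by a constant and from above by
    C e^((p-1)/2). The scale [e] is chosen to contradict this, and only then the increment of the
    quotients. *)
Lemma no_critical_island x0 : D x0 -> False.
Proof.
move=> Dx0.
have D_cl x : D x -> closure D x by exact: subset_closure.
have cG x : Omega x -> continuous_at x G by exact: psol_G S x.
have [M M0 DM] := compact_bound cD.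
have [K1 K10 GK1] : exists2 K1 : R, 0 < K1 & forall x, closure D x -> `|enorm (G x)| <= K1.
  apply: continuous_bounded => //; apply: continuous_in_subspaceT => x /set_mem cx.
  by apply: continuous_enorm; apply: cG; exact: DO.
have [j Gj] : exists j, G x0 0 j != 0.
  apply: contrapT => /forallNP h; have /negP := GD Dx0; apply; apply/eqP/rowP => j.
  by rewrite mxE; apply: contrapT => /eqP; exact: h.
pose g := `|G x0 0 j| / 2; have g0 : 0 < g by rewrite divr_gt0// normr_gt0.
have hx := Hpos (DO (D_cl _ Dx0)).
have [r r0 hr] : exists2 r : R, 0 < r & forall y, rbox x0 r y -> [/\ D y, g <= `|G y 0 j| & H x0 / 2 <= H y].
  have [r1 r10 h1] : exists2 r : R, 0 < r & forall y, rbox x0 r y -> `|G x0 0 j| / 2 <= `|G y 0 j|.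
    apply: (@CC_near_gt0 _ _ (fun y => `|G y 0 j|)); last by rewrite normr_gt0.
    apply: (continuous_rcomp (f := fun y => G y 0 j)); last exact: norm_continuous.
    apply: continuous_coord; apply: cG; exact: DO (D_cl _ Dx0).
  have [r2 r20 h2] := CC_near_gt0 (psol_H S (DO (D_cl _ Dx0))) hx.
  have /nbhs_ballP[r3 /= r30 h3] : nbhs x0 D by apply: open_nbhs_nbhs.
  exists (Num.min r1 (Num.min r2 (r3 / 2))); first by rewrite !lt_min r10 r20 divr_gt0.
  move=> y yr; split.
  - apply: h3; rewrite -ball_normE /= -normrN opprB; apply: le_lt_trans yr _.
    by rewrite !gt_min; apply/orP; right; apply/orP; right; rewrite ltr_pdivrMr// ltr_pMr// ltr1n.
  - by apply: h1; apply: le_trans yr _; rewrite ge_min lexx.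
  - by apply: h2; apply: le_trans yr _; rewrite !ge_min lexx orbT.
pose C := N%:R * (16 * (2 * N%:R) `^ (p - 1) / 2) * (2 * M) ^+ N *
  (8 * (L * (K1 + 1)) / kap p 2^-1 (2 * N%:R + 1) + 1).
have C0 : 0 <= C.
  rewrite !mulr_ge0 ?powR_ge0 ?exprn_ge0 ?mulr_ge0 ?(ltW M0)// addr_ge0// divr_ge0 ?mulr_ge0 ?addr_ge0 ?(ltW K10)//.
  by apply/ltW/kap_gt0 => //; rewrite ltr_wpDl// mulr_ge0.
pose c := H x0 / 2 * (2 * r) ^+ N.
have c0 : 0 < c by rewrite mulr_gt0 ?divr_gt0// exprn_gt0// mulr_gt0.
have s0 : 0 < (p - 1) / 2 by rewrite divr_gt0// subr_gt0.
(* The entry g/2 gives |G_j| >= 2e around x0, and the last entry makes C e^((p-1)/2) smaller than c;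
   C + 1 avoids a division by 0. *)
pose e := Num.min (Num.min 1 (g / 2)) ((c / (C + 1)) `^ ((p - 1) / 2)^-1).
have cC0 : 0 < c / (C + 1) by rewrite divr_gt0// ltr_wpDl.
have e0 : 0 < e by rewrite !lt_min ltr01 divr_gt0//= powR_gt0.
have e1 : e <= 1 by rewrite !ge_min lexx.
have eg : 2 * e <= g by rewrite -ler_pdivlMl// mulrC !ge_min lexx orbT.
have ec : C * e `^ ((p - 1) / 2) < c.
  have : e `^ ((p - 1) / 2) <= c / (C + 1).
    apply: (@le_trans _ _ (((c / (C + 1)) `^ ((p - 1) / 2)^-1) `^ ((p - 1) / 2))).
      by apply: powR_mono; [exact: ltW|exact: ltW|rewrite ge_min lexx orbT].
    by rewrite -powRrM mulVf ?gt_eqF// powRr1// ltW.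
  rewrite ler_pdivlMr ?ltr_wpDl// => h; apply: lt_le_trans h.
  by rewrite mulrDr mulr1 mulrC ltrDl powR_gt0.
have [|k k0 hk] := compact_unif (P := fun s y => forall z, `|z| < s ->
    Omega (y + z) /\ (closure D y -> enorm (G (y + z) - G y) <= e / 4)) cD.
  move=> x cx; have Ox := DO cx; have e8 : 0 < e / (8 * (N%:R + 1)) by rewrite divr_gt0// mulr_gt0// ltr_wpDl.
  have /nbhs_ballP[r1 /= r10 h1] : nbhs x Omega by apply: open_nbhs_nbhs; split; [exact: psol_open S|].
  have /cvgrPdist_lt/(_ _ e8)/nbhs_ballP[r2 /= r20 h2] := cG x Ox.
  exists (Num.min r1 r2 / 2); first by rewrite divr_gt0// lt_min r10.
  move=> y xy s /andP[s0' sr] z zs.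
  have xyz : `|x - (y + z)| < Num.min r1 r2.
    rewrite opprD addrA; apply: le_lt_trans (ler_normB _ _) _.
    by rewrite [X in _ < X]splitr ltrD// (lt_trans zs).
  have xy' : `|x - y| < Num.min r1 r2.
    apply: lt_le_trans xy _; rewrite ler_pdivrMr// ler_pMr ?ler1n//.
    by rewrite lt_min r10.
  split; first by apply: h1; rewrite -ball_normE /=; apply: lt_le_trans xyz _; rewrite ge_min lexx.
  move=> _; have a1 : `|G x - G (y + z)| < e / (8 * (N%:R + 1)).
    by apply: h2; rewrite -ball_normE /=; apply: lt_le_trans xyz _; rewrite ge_min lexx orbT.
  have a2 : `|G x - G y| < e / (8 * (N%:R + 1)).
    by apply: h2; rewrite -ball_normE /=; apply: lt_le_trans xy' _; rewrite ge_min lexx orbT.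
  apply: le_trans (enorm_le_norm _) _.
  have -> : G (y + z) - G y = (G x - G y) - (G x - G (y + z)).
    by apply/rowP => i; rewrite !mxE; ring.
  apply: (@le_trans _ _ (N%:R * (e / (8 * (N%:R + 1)) + e / (8 * (N%:R + 1))))).
    by apply: ler_wpM2l => //; apply: le_trans (ler_normB _ _) _; exact: ltW (ltrD a2 a1).
  have n1 : 0 < N%:R + 1 :> R by rewrite ltr_wpDl.
  rewrite (_ : _ * _ = e / 4 * (N%:R / (N%:R + 1))); last by field; rewrite gt_eqF.
  rewrite ler_piMr ?divr_ge0 ?(ltW e0)// ler_pdivrMr// mul1r lerDl//.
(* Halved twice: once to choose a parameter below the threshold [k], once to turn a strict bound on
   the translation into a weak one. *)
have k20 : 0 < k / 2 / 2 by rewrite !divr_gt0.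
have kk : 0 < k / 2 < k by rewrite divr_gt0//= ltr_pdivrMr// ltr_pMr// ltr1n.
have kO x z : closure D x -> `|z| <= k / 2 / 2 -> Omega (x + z) /\ enorm (G (x + z) - G x) <= e / 4.
  move=> cx zk; have [] := hk _ kk x cx z _.
    by apply: le_lt_trans zk _; rewrite ltr_pdivrMr// ltr_pMr ?divr_gt0// ltr1n.
  by move=> a b; split=> //; exact: b.
have GK x : closure D x -> enorm (G x) + e / 4 <= K1 + 1.
  move=> cx; apply: lerD; first by apply: le_trans (GK1 x cx); exact: ler_norm.
  by lra.
have K11 : 0 <= K1 + 1 by rewrite addr_ge0// ltW.
have fb := flux_bound e0 k20 kO (ltW M0) DM K11 GK.
have hr' y : rbox x0 r y -> [/\ D y, 2 * e <= `|G y 0 j| & H x0 / 2 <= H y].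
  by move=> /hr[a b c']; split=> //; exact: le_trans b.
have hx2 : 0 <= H x0 / 2 by rewrite divr_ge0// ltW.
have fl := flux_lower e0 k20 kO r0 hx2 hr'.
by have := lt_le_trans (le_lt_trans (le_trans fl fb) ec) (lexx _); rewrite ltxx.
Qed.

End no_critical_island.

(** * Hopf's lemma *)

Section hopf.
Context {R : realType} {N : nat}.
Implicit Types (x y z : 'rV[R]_N).
Variables (Omega : set 'rV[R]_N) (p : R) (v H : 'rV[R]_N -> R) (G : 'rV[R]_N -> 'rV[R]_N).
Hypotheses (N0 : (0 < N)%N) (p1 : 1 < p) (S : psol Omega p v G H) (cv : continuous v).
Hypotheses (vpos : forall x, Omega x -> 0 < v x) (vout : forall x, ~ Omega x -> v x = 0).
Hypothesis unif : forall e : R, 0 < e -> exists2 r : R, 0 < r & forall x y,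
    closure Omega x -> closure Omega y -> `|x - y| < r -> enorm (G x - G y) < e.
Hypothesis Hpos : forall x, Omega x -> 0 < H x.
Variables (c : 'rV[R]_N) (rho m a : R).
Hypotheses (rho0 : 0 < rho) (ball_in : forall y, enorm (y - c) < rho -> Omega y).
Hypotheses (m1 : 1 < m) (aE : a = m * (p - 1) - (p - 2) / 2) (a0 : N%:R <= 2 * a).

Let tau y := dotp (y - c) (y - c).

Let gtau y : is_grad tau y (2 *: (y - c)). Proof. exact: is_grad_sqr_dist. Qed.
Let ctau : continuous tau. Proof. by move=> y; exact: is_grad_continuous (gtau y). Qed.
Let tau_ge0 y : 0 <= tau y. Proof. exact: dotp_ge0. Qed.
Let tauE y : enorm (y - c) = tau y `^ 2^-1.
Proof. by rewrite powR12_sqrt. Qed.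

Let gpow (s : R) y : 0 < tau y -> is_grad (fun y => tau y `^ s) y ((2 * s * tau y `^ (s - 1)) *: (y - c)).
Proof.
move=> ty; have := is_grad_comp (gtau y) (is_derive1_powR s ty).
by rewrite scalerA; congr (is_grad _ _ (_ *: _)); ring.
Qed.

Let cpow (s : R) y : 0 < tau y -> continuous_at y (fun y => tau y `^ s).
Proof. by move=> ty; exact: is_grad_continuous (gpow s ty). Qed.

Let csub y : continuous_at y (fun y => y - c).
Proof. by apply: continuous_rvB; [exact: for_id|exact: for_cst]. Qed.

(* the field tau^{-a} (y - c) has divergence tau^{-a} (N - 2 a) <= 0 *)
Let field_le0 W phi dphi : open W -> (forall y, W y -> 0 < tau y) -> tst W phi dphi ->
  (forall y, 0 <= phi y) -> 0 <= Int (fun y => dotp (tau y `^ (- a) *: (y - c)) (dphi y)).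
Proof.
move=> oW Wtau tphi phi0.
pose h i y := tau y `^ (- a) * (y - c) 0 i.
pose dh i y := tau y `^ (- a) *: delta_mx 0 i + (y - c) 0 i *: ((2 * (- a) * tau y `^ (- a - 1)) *: (y - c)).
have gh i y : W y -> is_grad (h i) y (dh i y).
  move=> Wy; apply: is_gradM; first exact: gpow (Wtau y Wy).
  rewrite -[delta_mx 0 i]subr0 (_ : (fun y => _) = fun y => y 0 i - c 0 i); last by apply/funext => z; rewrite !mxE.
  by apply: is_gradB; [exact: is_grad_coord|exact: is_grad_cst].
have cdh i y : W y -> continuous_at y (dh i).
  move=> Wy; have ty := Wtau y Wy; apply: continuous_rvD; apply: continuous_rvZ.
  - exact: cpow.
  - exact: for_cst.
  - by apply: continuous_coord; exact: csub.
  - by apply: continuous_rvZ; [apply: continuous_rZ; exact: cpow|exact: csub].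
have th i := tst_mul oW tphi (gh i) (cdh i).
have chF y : W y -> continuous_at y (fun y => tau y `^ (- a) *: (y - c)).
  by move=> Wy; apply: continuous_rvZ; [exact: cpow (Wtau y Wy)|exact: csub].
have b1 := CC_BM (tst_CC_dot oW tphi chF).
have sum0 : Int (fun y => \sum_i (h i y *: dphi y + phi y *: dh i y) 0 i) = 0.
  rewrite Int_sum => [|i]; first by apply: big1 => i _; exact: Int_partial0 (th i).
  exact: CC_BM (tst_CC_coord i (th i)).
have bs : BM (fun y => \sum_i (h i y *: dphi y + phi y *: dh i y) 0 i).
  by apply: BM_sum => i; exact: CC_BM (tst_CC_coord i (th i)).
rewrite -[X in X <= _]sum0; apply: le_Int => // y.
have [K cK [KW out]] : exists2 K, compact K & K `<=` W /\ forall x, ~ K x -> phi x = 0 /\ dphi x = 0.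
  by case: tphi.
have [Ky|nK] := pselect (K y); last first.
  have [-> ->] := out y nK; rewrite dotp0r big1// => i _.
  by rewrite scaler0 scale0r addr0 mxE.
have ty := Wtau y (KW y Ky).
have -> : \sum_i (h i y *: dphi y + phi y *: dh i y) 0 i =
    dotp (tau y `^ (- a) *: (y - c)) (dphi y) + phi y * (tau y `^ (- a) * (N%:R - 2 * a)).
  under eq_bigr do rewrite !mxE.
  rewrite big_split /=; congr (_ + _).
    by rewrite /dotp; apply: eq_bigr => i _; rewrite /h !mxE.
  rewrite -mulr_sumr; congr (_ * _).
  transitivity (\sum_(i < N) (tau y `^ (- a) + (2 * (- a) * tau y `^ (- a - 1)) * ((y - c) 0 i * (y - c) 0 i))).
    by apply: eq_bigr => i _; rewrite !mxE eqxx mulr1; congr (_ + _); ring.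
  rewrite big_split /= sumr_const card_ord -mulr_sumr -/(dotp (y - c) (y - c)) -/(tau y).
  have pw : tau y `^ (- a - 1) * tau y = tau y `^ (- a).
    by rewrite -[X in _ * X](powRr1 (ltW ty)) -powRD ?subrK// (gt_eqF ty) implybT.
  by rewrite -[X in _ + X]mulrA pw -[_ *+ _]mulr_natl; ring.
rewrite gerDl mulr_ge0_le0// mulr_ge0_le0 ?powR_ge0// subr_le0//.
Qed.

(** The radial barrier as a function of t = |y - c|^2: a primitive of -t^(-m)/2 that vanishes on the
    sphere of radius rho. The gradient of the barrier is then -t^(-m) (y - c). *)
Let B (t : R) : R := (2 * (m - 1))^-1 * (t `^ (1 - m) - (rho ^+ 2) `^ (1 - m)).

Let B_deriv (t : R) : 0 < t -> is_derive t (1 : R) B (- (t `^ (- m) / 2)).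
Proof.
move=> t0; have h := is_deriveB (is_derive1_powR (1 - m) t0) (is_derive_cst ((rho ^+ 2) `^ (1 - m)) t (1 : R)).
have h2 := is_deriveZ (2 * (m - 1))^-1 h.
apply: is_derive_eq h2 _; rewrite subr0 (_ : 1 - m - 1 = - m); last by ring.
rewrite [LHS](_ : _ = (2 * (m - 1))^-1 * ((1 - m) * t `^ (- m)))//.
by field; rewrite gt_eqF// subr_gt0.
Qed.

Let b y := B (tau y).
Let Gb y := - (tau y `^ (- m)) *: (y - c).

Let gb y : 0 < tau y -> is_grad b y (Gb y).
Proof.
move=> ty; have := is_grad_comp (gtau y) (B_deriv ty).
by rewrite scalerA; congr (is_grad _ _ (_ *: _)); field.
Qed.

Let B_decr (s t : R) : 0 < s -> s < t -> (t `^ (- m) / 2) * (t - s) <= B s - B t.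
Proof.
move=> s0 st; have [||x xst E] := @MVT R B (fun t => - (t `^ (- m) / 2)) s t st.
- by move=> x; rewrite in_itv /= => /andP[sx _]; apply: B_deriv; exact: lt_trans sx.
- apply: continuous_in_subspaceT => x /set_mem /=; rewrite in_itv /= => /andP[sx _].
  apply: differentiable_continuous; apply/derivable1_diffP.
  exact: (@ex_derive _ _ _ _ _ _ _ (B_deriv (lt_le_trans s0 sx))).
rewrite -[leRHS]opprB E mulNr opprK; apply: ler_wpM2r; first by rewrite subr_ge0 ltW.
apply: ler_wpM2r; first by rewrite invr_ge0.
move: xst; rewrite in_itv /= => /andP[sx xt].
by apply: powR_anti; [rewrite oppr_le0 ltW// (lt_trans ltr01)|exact: lt_trans sx|exact: ltW].
Qed.

Let B_rho : B (rho ^+ 2) = 0. Proof. by rewrite /B subrr mulr0. Qed.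

(** The origin of [a]: the gradient has modulus tau^(1/2 - m), so the flux carries the power (1/2 -
    m)(p - 2) - m = -a of tau. *)
Let Vf_Gb (e : R) y : 0 < e -> 0 < tau y ->
  Vf p (e *: Gb y) = - (e `^ (p - 1)) *: (tau y `^ (- a) *: (y - c)).
Proof.
move=> e0 ty; have tn (s r : R) : tau y `^ s * tau y `^ r = tau y `^ (s + r).
  by rewrite powRD// (gt_eqF ty) implybT.
rewrite /Vf enormZ (gtr0_norm e0) /Gb enormZ normrN (ger0_norm (powR_ge0 _ _)) tauE tn.
rewrite !scalerA; congr (_ *: _).
rewrite powRM ?powR_ge0 ?(ltW e0)// -powRrM.
rewrite (_ : e `^ (p - 2) * tau y `^ ((- m + 2^-1) * (p - 2)) * e * - tau y `^ (- m) =
  - (e `^ (p - 2) * e) * (tau y `^ ((- m + 2^-1) * (p - 2)) * tau y `^ (- m))); last by ring.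
rewrite powR_sub2 ?(ltW e0)// tn; congr (_ * _ `^ _).
by rewrite aE; field.
Qed.

(** The annulus rho/2 < |y - c| < rho, with the inner radius expressed by its square. *)
Let W : set 'rV[R]_N := [set y | enorm (y - c) < rho] `&` [set y | rho ^+ 2 / 4 < tau y].

Let rho2 : 0 < rho ^+ 2. Proof. by rewrite exprn_gt0. Qed.

Let W_tau y : W y -> 0 < tau y.
Proof. by move=> [_ /= h]; apply: lt_trans h; rewrite divr_gt0. Qed.

Let oW : open W.
Proof.
apply: openI; first exact: open_edisk.
apply: (@open_comp _ _ tau [set t | rho ^+ 2 / 4 < t]) => [x _|]; first exact: ctau.
exact: open_gt.
Qed.

Let tau_lt y : (enorm (y - c) < rho) = (tau y < rho ^+ 2).
Proof. by rewrite /tau -enorm_sqr ltr_pXn2r ?nnegrE ?enorm_ge0 ?(ltW rho0). Qed.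

Let vge0 y : 0 <= v y.
Proof. by have [/vpos/ltW|/vout ->] := pselect (Omega y). Qed.

(** The barrier is a subsolution by [field_le0] and [v] a supersolution. The margin d > 0 keeps the
    set where z >= 0 away from the boundary of the annulus, so the square of the positive part of z
    is admissible. Testing makes the monotonicity pairing vanish. It is strict because the barrier
    has no critical point, so the test function has zero gradient and is zero. *)
Let barrier (e d : R) : 0 < e -> 0 < d ->
  (forall y, tau y <= rho ^+ 2 / 4 -> e * B (rho ^+ 2 / 4) <= v y) ->
  forall y, W y -> e * b y <= v y + d.
Proof.
move=> e0 d0 inner y0 Wy0.
pose z y := e * b y - v y - d.
pose K : set 'rV[R]_N := [set y | rho ^+ 2 / 4 <= tau y <= rho ^+ 2 /\ 0 <= z y].
have tpos y : rho ^+ 2 / 4 <= tau y -> 0 < tau y by apply: lt_le_trans; rewrite divr_gt0.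
have KW : K `<=` W.
  move=> y [/andP[t1 t2] zy]; split.
    rewrite /= tau_lt lt_neqAle t2 andbT; apply/eqP => E.
    by move: zy; rewrite /z /b E B_rho mulr0 sub0r leNgt -opprD oppr_lt0 ltr_wpDl.
  rewrite /= lt_neqAle t1 andbT; apply/eqP => E.
  by move: zy; rewrite /z /b -E leNgt subr_lt0 => /negP; apply; rewrite (le_lt_trans _ d0)// subr_le0 inner// E.
have gz y : W y -> is_grad z y (e *: Gb y - G y).
  move=> Wy; rewrite -[X in is_grad _ _ X]subr0; apply: is_gradB; last exact: is_grad_cst.
  apply: is_gradB; first by apply: is_gradZ; apply: gb; exact: W_tau.
  by apply: (psol_grad S); apply: ball_in; case: Wy.
have cG y : W y -> continuous_at y G.
  by move=> Wy; apply: (psol_G S); apply: ball_in; case: Wy.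
have cGb y : W y -> continuous_at y (fun y => e *: Gb y).
  move=> Wy; apply: continuous_rvZ; first exact: for_cst.
  by apply: continuous_rvZ; [apply: continuous_rN; exact: cpow (W_tau Wy)|exact: csub].
have cK : compact K.
  have cz y : rho ^+ 2 / 4 <= tau y -> continuous_at y z.
    move=> ty; apply: continuous_rB; last exact: for_cst; apply: continuous_rB; last exact: cv.
    by apply: continuous_rZ; exact: is_grad_continuous (gb (tpos y ty)).
  apply: (@compact_closed_bounded _ _ _ (`|c| + rho)).
    have h1 : closed [set y | rho ^+ 2 / 4 <= tau y].
      by apply: (@closed_comp _ _ tau [set t | rho ^+ 2 / 4 <= t]) => [x _|]; [exact: ctau|exact: closed_ge].
    have h2 : closed [set y | tau y <= rho ^+ 2].
      by apply: (@closed_comp _ _ tau [set t | t <= rho ^+ 2]) => [x _|]; [exact: ctau|exact: closed_le].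
    have o3 : open ([set y | 0 < tau y] `&` z @^-1` [set t | t < 0]).
      apply: (@open_preimage _ _ [set y | 0 < tau y] z).
      - by apply: (@open_comp _ _ tau [set t | 0 < t]) => [x _|]; [exact: ctau|exact: open_gt].
      - move=> x tx; apply: continuous_rB; last exact: for_cst; apply: continuous_rB; last exact: cv.
        by apply: continuous_rZ; exact: is_grad_continuous (gb tx).
      - exact: open_lt.
    rewrite (_ : K = [set y | rho ^+ 2 / 4 <= tau y] `&` ([set y | tau y <= rho ^+ 2] `&`
        ~` ([set y | 0 < tau y] `&` z @^-1` [set t | t < 0]))).
      by apply: closedI => //; apply: closedI => //; exact: open_closedC.
    apply/seteqP; split=> y /= => [[/andP[t1 t2] zy]|[t1 [t2 zy]]].
      by split=> //; split=> // -[_]; rewrite ltNge zy.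
    split; first by rewrite t1 t2.
    by rewrite leNgt; apply/negP => zn; apply: zy; split=> //; exact: tpos.
  move=> y [/andP[_ t2] _]; rewrite -[y](subrK c) addrC; apply: le_trans (ler_normD _ _) _.
  rewrite lerD2l; apply: le_trans (norm_le_enorm _) _.
  by rewrite -(@ler_pXn2r _ 2) ?nnegrE ?enorm_ge0 ?(ltW rho0)// enorm_sqr.
pose phi := cut K (fun y => ppow 2 (z y)).
pose dphi := @cut R N K 'rV[R]_N (fun y => (2 * ppow 1 (z y)) *: (e *: Gb y - G y)).
have tphi : tst W phi dphi.
  apply: tst_cut; first exact: oW.
  - exact: cK.
  - exact: KW.
  - by move=> y Wy; apply: (@is_grad_comp _ _ (ppow 2) z); [exact: gz|exact: is_derive_ppow].
  - move=> y Wy; apply: continuous_rvZ; last by apply: continuous_rvB; [exact: cGb|exact: cG].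
    apply: continuous_rZ; apply: continuous_rcomp; last exact: continuous_ppow.
    exact: is_grad_continuous (gz y Wy).
  - move=> y [Wy1 /= Wy2] nK; have zy : z y <= 0.
      rewrite leNgt; apply/negP => zy; apply: nK; split; last exact: ltW.
      by rewrite (ltW Wy2)/=; apply: ltW; rewrite -tau_lt.
    by rewrite !ppow_neg// mulr0 scale0r.
have phi0 y : 0 <= phi y.
  by have [Ky|nK] := pselect (K y); [rewrite /phi cut_in// ppow_ge0|rewrite /phi cut_out].
have cV y : W y -> continuous_at y (fun y => Vf p (G y)).
  by move=> Wy; apply: continuous_Vf => //; exact: cG.
have cVb y : W y -> continuous_at y (fun y => Vf p (e *: Gb y)).
  by move=> Wy; apply: continuous_Vf => //; exact: cGb.
have cc1 := tst_CC_dot oW tphi cV; have cc2 := tst_CC_dot oW tphi cVb.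
have cD y : W y -> continuous_at y (fun y => Vf p (e *: Gb y) - Vf p (G y)).
  by move=> Wy; apply: continuous_rvB; [exact: cVb|exact: cV].
have cc := tst_CC_dot oW tphi cD.
have WO : W `<=` Omega by move=> y [h _]; exact: ball_in.
have I1 : 0 <= Int (fun y => dotp (Vf p (G y)) (dphi y)).
  rewrite (psol_weak S (tst_sub WO tphi)); apply: Int_ge0 => y.
  have [Ky|nK] := pselect (K y); last by rewrite /phi cut_out// mulr0.
  by rewrite mulr_ge0// ltW// Hpos//; apply: WO; exact: KW.
have I2 : Int (fun y => dotp (Vf p (e *: Gb y)) (dphi y)) <= 0.
  have -> : (fun y => dotp (Vf p (e *: Gb y)) (dphi y)) =
      (fun y => - (e `^ (p - 1)) * dotp (tau y `^ (- a) *: (y - c)) (dphi y)).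
    apply/funext => y; have [Ky|nK] := pselect (K y); last by rewrite /dphi cut_out// !dotp0r mulr0.
    by rewrite Vf_Gb ?[LHS]dotpZl//; exact: W_tau (KW y Ky).
  rewrite IntZ; last first.
    apply: CC_BM; apply: (tst_CC_dot oW tphi) => y Wy.
    by apply: continuous_rvZ; [exact: cpow (W_tau Wy)|exact: csub].
  rewrite mulNr oppr_le0 mulr_ge0 ?powR_ge0//; exact: field_le0 W_tau tphi phi0.
have pos y : 0 <= dotp (Vf p (e *: Gb y) - Vf p (G y)) (dphi y).
  have [Ky|nK] := pselect (K y); last by rewrite /dphi cut_out// dotp0r.
  by rewrite /dphi cut_in// dotpZr mulr_ge0 ?Vf_mono// mulr_ge0 ?ppow_ge0.
have zero : forall y, dotp (Vf p (e *: Gb y) - Vf p (G y)) (dphi y) = 0.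
  apply: (Int_le0_eq0 cc pos); under eq_Int do rewrite dotpBl.
  by rewrite IntB; [rewrite subr_le0 (le_trans I2)|exact: CC_BM|exact: CC_BM].
have dphi0 y : dphi y = 0.
  have [Ky|nK] := pselect (K y); last by rewrite /dphi cut_out.
  have := zero y; rewrite /dphi cut_in//; set g := e *: Gb y - G y.
  rewrite dotpZr => /eqP; rewrite mulf_eq0 => /orP[/eqP ->|/eqP h]; first by rewrite scale0r.
  have ty := W_tau (KW y Ky).
  pose M := enorm (e *: Gb y) + enorm (G y).
  have gn : 0 < enorm (e *: Gb y).
    rewrite !enormZ normrN !mulr_gt0 ?normr_gt0 ?(gt_eqF e0) ?powR_eq0 ?(gt_eqF ty)//.
    by rewrite enorm_gt0 -dotp_eq0 -/(tau y) gt_eqF.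
  have M0 : 0 < M by rewrite ltr_pwDl// enorm_ge0.
  have [k k0 Hk] := @Vf_mono_sig R N p M p1 M0.
  have hM1 : enorm (e *: Gb y) <= M by rewrite /M lerDl enorm_ge0.
  have hM2 : enorm (G y) <= M by rewrite /M lerDr enorm_ge0.
  have := Hk _ _ hM1 hM2; rewrite -/g h pmulr_rle0 ?mulr_gt0 ?powR_gt0// => h2.
  have : g == 0 by rewrite -enorm_eq0 -sqrf_eq0 eq_le h2 sqr_ge0.
  by move=> /eqP ->; rewrite scaler0.
have phi_0 := tst_dphi0 (tst_sub (@subsetT _ W) tphi) dphi0 N0.
rewrite -subr_le0 opprD addrA -/(z y0) leNgt; apply/negP => zy.
have Ky : K y0.
  split; last exact: ltW.
  by have [h1 /= h2] := Wy0; rewrite (ltW h2)/=; apply: ltW; rewrite -tau_lt.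
by have := phi_0 y0; rewrite /phi cut_in// => /eqP; rewrite gt_eqF// ppow_gt0.
Qed.

(** Along the inner normal the barrier forces linear growth of [v], while a vanishing gradient at x0
    would, by uniform continuity up to the boundary, allow only a smaller slope. *)
Lemma hopf x0 : enorm (x0 - c) = rho -> ~ Omega x0 -> G x0 != 0.
Proof.
move=> x0c nO; apply/eqP => Gx0.
have q0 : 0 < rho ^+ 2 / 4 by rewrite divr_gt0.
pose B0 := B (rho ^+ 2 / 4).
have B00 : 0 < B0.
  have h : rho ^+ 2 / 4 < rho ^+ 2 by rewrite ltr_pdivrMr// ltr_pMr// ltr1n.
  have := B_decr q0 h; rewrite B_rho subr0; apply: lt_le_trans.
  by rewrite mulr_gt0 ?subr_gt0// divr_gt0 ?powR_gt0.
have [mn mn0 Hmn] : exists2 mn : R, 0 < mn & forall y, tau y <= rho ^+ 2 / 4 -> mn <= v y.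
  have in_O y : tau y <= rho ^+ 2 / 4 -> Omega y.
    move=> h; apply: ball_in; rewrite tau_lt; apply: le_lt_trans h _.
    by rewrite ltr_pdivrMr// ltr_pMr// ltr1n.
  have cK : compact [set y | tau y <= rho ^+ 2 / 4].
    apply: (@compact_closed_bounded _ _ _ (`|c| + rho)).
      by apply: (@closed_comp _ _ tau [set t | t <= rho ^+ 2 / 4]) => [x _|]; [exact: ctau|exact: closed_le].
    move=> y hy; rewrite -[y](subrK c) addrC; apply: le_trans (ler_normD _ _) _.
    rewrite lerD2l; apply: le_trans (norm_le_enorm _) _.
    by apply: ltW; rewrite tau_lt; apply: le_lt_trans hy _; rewrite ltr_pdivrMr// ltr_pMr// ltr1n.
  have [|r r0 Hr] := compact_unif (P := fun s y => tau y <= rho ^+ 2 / 4 -> s <= v y) cK.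
    move=> x /= /in_O/vpos vx; have [r r0 hr] := CC_near_gt0 (@cv x) vx.
    exists (Num.min r (v x / 2)); first by rewrite lt_min r0 divr_gt0.
    move=> y xy s /andP[s0 sr] _; apply: le_trans (hr y _).
      by apply: ltW; apply: lt_le_trans sr _; rewrite ge_min lexx orbT.
    rewrite /rbox /box /= -normrN opprB; apply: ltW; apply: lt_le_trans xy _.
    by rewrite ge_min lexx.
  exists (r / 2); first by rewrite divr_gt0.
  move=> y hy; apply: Hr => //.
  by rewrite divr_gt0//= ltr_pdivrMr// ltr_pMr// ltr1n.
pose e := mn / B0; have e0 : 0 < e by rewrite divr_gt0.
have eB : e * B0 = mn by rewrite /e divfK ?gt_eqF.
have cmp y : W y -> e * b y <= v y.
  move=> Wy; apply/ler_addgt0Pr => d d0; apply: barrier => //.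
  by move=> x hx; rewrite -/B0 eB; exact: Hmn.
pose kp := (rho ^+ 2) `^ (- m) / 2 * rho ^+ 2.
have kp0 : 0 < kp by rewrite mulr_gt0// divr_gt0 ?powR_gt0.
(* With gradients below [dl], the growth of [v] over the vector t z is at most half of the growth e
   kp t forced by the barrier. *)
pose dl := e * kp / (2 * rho); have dl0 : 0 < dl by apply: divr_gt0; apply: mulr_gt0.
have [r r0 Hr] := unif dl0.
pose z := c - x0; have zn : enorm z = rho by rewrite /z enormB.
(* A parameter of at most 1/4 stays in the annulus; the second entry stays within the modulus of
   continuity [r]. *)
pose t : R := Num.min (4^-1) (r / (2 * rho)).
have t0 : 0 < t by rewrite lt_min invr_gt0// ltr0n divr_gt0// mulr_gt0.
have t4 : t <= 4^-1 by rewrite ge_min lexx.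
have yE s : x0 + s *: z - c = - (1 - s) *: z.
  by apply/rowP => i; rewrite /z !mxE; ring.
have tauy s : tau (x0 + s *: z) = (1 - s) ^+ 2 * rho ^+ 2.
  by rewrite /tau yE -enorm_sqr enormZ zn exprMn normrN real_normK ?num_real.
have Os s : 0 < s -> s <= 4^-1 -> W (x0 + s *: z).
  move=> s0 s4; split.
    by rewrite /= tau_lt tauy -[ltRHS]mul1r ltr_pM2r//; nra.
  by rewrite /= tauy mulrC ltr_pM2r//; nra.
have clO s : 0 <= s -> s <= 4^-1 -> closure Omega (x0 + s *: z).
  rewrite le_eqVlt => /predU1P[<- _|s0 s4]; last first.
    by apply: subset_closure; apply: ball_in; case: (Os s s0 s4).
  rewrite scale0r addr0 => A /nbhs_ballP[r' /= r'0 hA].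
  pose s' : R := Num.min (4^-1) (r' / (2 * rho)).
  have s0 : 0 < s' by rewrite lt_min invr_gt0// ltr0n divr_gt0// mulr_gt0.
  exists (x0 + s' *: z); split.
    by apply: ball_in; case: (Os s' s0 _) => //; rewrite ge_min lexx.
  apply: hA; rewrite -ball_normE /= opprD addrA subrr sub0r normrN.
  apply: le_lt_trans (norm_le_enorm _) _; rewrite enormZ zn (gtr0_norm s0).
  apply: (@le_lt_trans _ _ (r' / (2 * rho) * rho)); first by rewrite ler_pM2r// ge_min lexx orbT.
  by rewrite (_ : _ * _ = r' / 2); [rewrite ltr_pdivrMr// ltr_pMr// ltr1n|field; rewrite gt_eqF].
have low : e * (kp * t) <= v (x0 + t *: z).
  apply: le_trans (cmp _ (Os t t0 t4)); apply: ler_wpM2l; first exact: ltW.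
  have tl : tau (x0 + t *: z) < rho ^+ 2 by rewrite -tau_lt; case: (Os t t0 t4).
  have := B_decr (W_tau (Os t t0 t4)) tl; rewrite B_rho subr0 -/(b _); apply: le_trans.
  rewrite /kp -mulrA; apply: ler_wpM2l; first by rewrite divr_ge0 ?powR_ge0.
  by rewrite tauy; nra.
have [||s s01 E] := @mvt_line _ _ v G x0 (t *: z).
- move=> s; rewrite in_itv /= => /andP[s0 s1]; rewrite scalerA.
  apply: (psol_grad S); apply: ball_in; case: (Os (s * t) _ _) => //; first exact: mulr_gt0.
  by apply: le_trans t4; rewrite ler_piMl// ltW.
- by move=> s _; exact: cv.
move: s01; rewrite in_itv /= => /andP[s0 s1].
have st4 : s * t <= 4^-1 by apply: le_trans t4; rewrite ler_piMl// ltW.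
have up : v (x0 + t *: z) <= t * (dl * rho).
  have -> : v (x0 + t *: z) = v (x0 + t *: z) - v x0 by rewrite (vout nO) subr0.
  rewrite E dotpZr; apply: ler_wpM2l; first exact: ltW.
  apply: le_trans (dotp_le _ _) _; rewrite zn; apply: ler_wpM2r; first exact: ltW.
  rewrite scalerA -[G _]subr0 -Gx0; apply/ltW/Hr.
  - apply: clO => //; exact/ltW/mulr_gt0.
  - by rewrite -[x0]addr0 -(scale0r z); apply: clO => //; rewrite invr_ge0.
  rewrite (addrC x0) addrK; apply: le_lt_trans (norm_le_enorm _) _.
  rewrite enormZ zn gtr0_norm ?mulr_gt0//.
  apply: (@le_lt_trans _ _ (r / (2 * rho) * rho)).
    rewrite ler_pM2r//; apply: (@le_trans _ _ t); first by rewrite ler_piMl// ltW.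
    by rewrite ge_min lexx orbT.
  by rewrite (_ : _ * _ = r / 2); [rewrite ltr_pdivrMr// ltr_pMr// ltr1n|field; rewrite gt_eqF].
have := le_trans low up; apply/negP; rewrite -ltNge.
rewrite (_ : e * (kp * t) = t * (e * kp)) ?ltr_pM2l//; last by ring.
rewrite /dl (_ : _ * rho = e * kp / 2); last by field; rewrite gt_eqF.
by rewrite ltr_pdivrMr// ltr_pMr ?ltr1n//; exact: mulr_gt0.
Qed.

End hopf.

(** * The interior ball condition *)

Section interior_ball.
Context {R : realType}.

(** Only an upper bound of second order is needed to place a ball above the graph, and two
    applications of the mean value theorem give it. *)
Lemma taylor_upper N (g : 'rV[R]_N -> R) (x : 'rV[R]_N) : smooth setT g ->
  exists (l : 'rV[R]_N) (C r : R), [/\ 0 < C, 0 < r &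
    forall h, `|h| < r -> g (x + h) <= g x + dotp l h + C * dotp h h].
Proof.
move=> sg; have g1 := sg 1; have [gg cg] := class_C1_grad openT g1.
have [_ [dg g2]] := sg 2.
have gi i := class_C1_grad openT (g2 i).
pose D i y := grad (partial i g) y.
have [r r0 Hr] : exists2 r : R, 0 < r & forall i y, `|y - x| < r -> enorm (D i y) <= enorm (D i x) + 1.
  have : \forall y \near x, forall i, enorm (D i y) <= enorm (D i x) + 1.
    apply: near_forall => i.
    have := continuous_enorm ((gi i).2 x I) => /cvgrPdist_lt/(_ _ ltr01).
    by apply: filterS => y /ltW; rewrite ler_norml => /andP[a _]; rewrite -lerBlDl -lerN2 opprB.
  move=> /nbhs_ballP[r /= r0 hr]; exists r => // i y yx; apply: hr.
  by rewrite -ball_normE /= -normrN opprB.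
pose C1 := \sum_i (enorm (D i x) + 1).
have C10 : 0 <= C1 by apply: sumr_ge0 => i _; rewrite addr_ge0 ?enorm_ge0.
exists (grad g x), (C1 + 1), r; split=> //; first by rewrite ltr_wpDl.
move=> h hr; have [||s] := @mvt_line _ _ g (grad g) x h.
- by move=> s _; exact: gg.
- by move=> s _; exact: is_grad_continuous (gg _ I).
rewrite in_itv /= => /andP[s0 s1] E.
have q0 := dotp_ge0 h.
have : dotp (grad g (x + s *: h) - grad g x) h <= C1 * dotp h h.
  rewrite /C1 mulr_suml; apply: ler_sum => i _; rewrite !mxE.
  have [||t] := @mvt_line _ _ (partial i g) (D i) x (s *: h).
  - by move=> t _; exact: (gi i).1.
  - by move=> t _; exact: is_grad_continuous ((gi i).1 _ I).
  rewrite in_itv /= => /andP[t0 t1] ->; rewrite dotpZr.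
  apply: le_trans (ler_norm _) _; rewrite !normrM (gtr0_norm s0).
  rewrite -enorm_sqr expr2 mulrA; apply: ler_pM => //; last exact: coord_le_enorm.
    by rewrite mulr_ge0// ltW.
  apply: (@le_trans _ _ (1 * (enorm (D i (x + t *: (s *: h))) * enorm h))).
    by apply: ler_pM => //; [exact: ltW|exact: ltW|exact: cauchy_schwarz].
  rewrite mul1r; apply: ler_wpM2r; first exact: enorm_ge0.
  apply: Hr; rewrite addrC addKr scalerA normrZ gtr0_norm ?mulr_gt0//.
  by apply: le_lt_trans hr; rewrite ler_piMl// mulr_ile1// ltW.
by rewrite dotpBl -E; lra.
Qed.

(** Above the graph it suffices that C'|z|^2 < nu . z, by the second-order bound on the graph. This
    inequality describes exactly the open ball of radius |nu|/(2C') centred at x0 + nu/(2C'). *)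
Lemma interior_ball n (Omega : set 'rV[R]_n.+1) (x0 : 'rV[R]_n.+1) : open Omega ->
  smooth_boundary Omega -> closure Omega x0 -> ~ Omega x0 ->
  exists (c : 'rV[R]_n.+1) (rho : R), [/\ 0 < rho, enorm (x0 - c) = rho &
    forall y, enorm (y - c) < rho -> Omega y].
Proof.
move=> oO sb clx nO.
have bx : boundary Omega x0 by split=> // /interior_subset.
have [i [b [g [sg hg]]]] := sb x0 bx.
have gi : continuous g by move=> y; apply: (class_C_continuous (sg 0)).
pose hat (y : 'rV[R]_n.+1) : 'rV[R]_n := col' i y.
have chat y : continuous_at y hat.
  apply: rV_continuousP => k; rewrite /continuous_at.
  rewrite (_ : (fun s : 'rV[R]_n.+1 => hat s 0 k) = fun s : 'rV[R]_n.+1 => s 0 (lift i k)); last first.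
    by apply/funext => s; rewrite /hat mxE.
  by rewrite /hat mxE; exact: coord_continuous.
have hatD y z : hat (y + z) = hat y + hat z by apply/rowP => k; rewrite !mxE.
pose sgn : R := (-1) ^+ b.
have sgn2 : sgn * sgn = 1 by rewrite /sgn; case: (b); rewrite ?expr1 ?expr0 ?mulrNN mulr1.
(* x0 is a limit of points above the graph, so it is not strictly below it. *)
have g0 : g (hat x0) <= sgn * x0 0 i.
  rewrite leNgt; apply/negP => h.
  have cd : continuous_at x0 (fun y => g (hat y) - sgn * y 0 i).
    apply: continuous_rB; first by apply: (@continuous_comp _ _ _ hat g); [exact: chat|exact: gi].
    by apply: continuous_rZ; exact: coord_continuous.
  have d0 : 0 < g (hat x0) - sgn * x0 0 i by rewrite subr_gt0.
  have /cvgrPdist_lt/(_ _ d0) h2 := cd.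
  have [y [Oy [Oy2]]] := clx _ (filterI hg h2); rewrite /=.
  have := Oy2.1 Oy; rewrite -/sgn -/(hat y) => a1; rewrite ltr_norml => /andP[a2 a3]; lra.
have [l [C [r [C0 r0 Hl]]]] := taylor_upper (hat x0) sg.
have /nbhs_ballP[r1 /= r10 hr1] := hg.
(* The inner normal of the graph in the original coordinates, with the orientation [sgn] in the
   distinguished direction. *)
pose nu : 'rV[R]_n.+1 := \row_k (if unlift i k is Some k' then - l 0 k' else sgn).
have nuE y : dotp nu y = sgn * y 0 i - dotp l (hat y).
  rewrite /dotp (bigD1_ord i)//= !mxE unlift_none; congr (_ + _).
  by rewrite -sumrN; apply: eq_bigr => k _; rewrite !mxE liftK mulNr.
have nu0 : 0 < enorm nu.
  rewrite enorm_gt0; apply/eqP => /rowP/(_ i); rewrite !mxE unlift_none => E.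
  by move: sgn2; rewrite E mul0r => /eqP; rewrite eq_sym oner_eq0.
have hat_norm y : `|hat y| <= `|y|.
  by apply/rV_normP => // k; rewrite /hat mxE; exact: rV_coord_le.
have hat_dot y : dotp (hat y) (hat y) <= dotp y y.
  rewrite /dotp [leRHS](bigD1_ord i)//= -[leLHS]add0r; apply: lerD; first by rewrite -expr2 sqr_ge0.
  by apply: ler_sum => k _; rewrite /hat mxE.
(* The second entry makes the diameter |nu|/C' of the ball smaller than the radii within which the
   chart and the second-order bound are valid. *)
pose C' := Num.max C (2 * enorm nu / Num.min r r1).
have rr : 0 < Num.min r r1 by rewrite lt_min r0.
have C'0 : 0 < C' by rewrite lt_max C0.
have C'1 : enorm nu / C' < Num.min r r1.
  rewrite ltr_pdivrMr//; apply: (@lt_le_trans _ _ (Num.min r r1 * (2 * enorm nu / Num.min r r1))).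
    by rewrite mulrC divfK ?gt_eqF// ltr_pMl// ltr1n.
  by rewrite ler_pM2l// le_max lexx orbT.
pose rho := enorm nu / (2 * C'); have rho0 : 0 < rho by rewrite divr_gt0// mulr_gt0.
pose c := x0 + (2 * C')^-1 *: nu.
have xc : enorm (x0 - c) = rho.
  rewrite /c opprD addrA subrr sub0r enormN enormZ gtr0_norm ?invr_gt0 ?mulr_gt0//.
  by rewrite mulrC.
exists c, rho; split=> // y yc.
have [z yE] : exists z, y = x0 + z by exists (y - x0); rewrite addrC subrK.
have zn : enorm z < Num.min r r1.
  apply: le_lt_trans C'1; have -> : z = (y - c) - (x0 - c).
    by rewrite yE; move: (c) => c0; apply/rowP => k; rewrite !mxE; ring.
  apply: le_trans (enormD _ _) _; rewrite enormN xc.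
  rewrite (_ : enorm nu / C' = rho + rho); last by rewrite /rho; field; rewrite gt_eqF.
  by rewrite lerD2r ltW.
have znr : `|z| < Num.min r r1 by apply: le_lt_trans zn; exact: norm_le_enorm.
have quad : C' * dotp z z < dotp nu z.
  have : enorm (y - c) ^+ 2 < rho ^+ 2 by rewrite ltr_pXn2r ?nnegrE ?enorm_ge0 ?(ltW rho0).
  rewrite enorm_sqr (_ : y - c = z - (2 * C')^-1 *: nu); last first.
    by rewrite yE /c opprD addrA (addrC x0) addrK.
  rewrite !(dotpBl, dotpBr, dotpZl, dotpZr) (dotpC z nu).
  have -> : rho ^+ 2 = (2 * C')^-1 * ((2 * C')^-1 * dotp nu nu) by rewrite /rho -enorm_sqr; field; rewrite gt_eqF.
  set X := dotp z z; set Y := dotp nu z; set Z := _ * (_ * dotp nu nu) => h.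
  have {h}h : X < C'^-1 * Y.
    have : (2 * C')^-1 * Y + (2 * C')^-1 * Y = C'^-1 * Y by field; rewrite gt_eqF.
    by move: h; move: ((2 * C')^-1 * Y) => q h <-; lra.
  by rewrite -ltr_pdivlMl.
apply: (hr1 y _).2.
  by rewrite -ball_normE /= yE opprD addrA subrr sub0r normrN; apply: lt_le_trans znr _; rewrite ge_min lexx orbT.
rewrite -/sgn -/(hat y) yE hatD.
apply: le_lt_trans (Hl (hat z) _) _.
  by apply: le_lt_trans (hat_norm z) _; apply: lt_le_trans znr _; rewrite ge_min lexx.
have q1 : C * dotp (hat z) (hat z) <= C' * dotp z z.
  by apply: ler_pM => //; [exact: ltW|exact: dotp_ge0|rewrite le_max lexx].
by move: quad; rewrite nuE !mxE mulrDr; lra.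
Qed.

End interior_ball.

(** * Moving planes *)

Section density_points.
Context {R : realType} {N : nat}.
Implicit Types (x y z : 'rV[R]_N) (A Z D : set 'rV[R]_N).

Lemma msetI A Z : mset A -> mset Z -> mset (A `&` Z).
Proof. by move=> mA mZ; rewrite /mset preimage_setI; exact: measurableI. Qed.

Lemma indicR_setI A Z x : \1_(A `&` Z) x = \1_A x * \1_Z x :> R.
Proof. by rewrite !indicE in_setI -natrM mulnb. Qed.

Lemma le_Int_indic A Z : BM (\1_A : 'rV[R]_N -> R) -> BM (\1_Z : 'rV[R]_N -> R) -> A `<=` Z ->
  Int \1_A <= Int (\1_Z : 'rV[R]_N -> R).
Proof.
move=> bA bZ AZ; apply: le_Int => // x; rewrite !indicE.
case: (boolP (x \in A)); last by rewrite ler0n.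
by rewrite inE => /AZ h; rewrite mem_set.
Qed.

Lemma BM_sub A Z : BM (\1_Z : 'rV[R]_N -> R) -> mset A -> A `<=` Z -> BM (\1_A : 'rV[R]_N -> R).
Proof.
move=> [_ [M HM]] mA AZ; apply: BM_set => //; exists M => x /AZ Zx.
by apply: (HM x).2; rewrite indicE mem_set// oner_eq0.
Qed.

(* If the s-boxes around the points of E are all E-null then so is every s/2-box, and Fubini concludes. *)
Lemma null_of_null_boxes (s : R) Z : 0 < s -> BM (\1_Z : 'rV[R]_N -> R) ->
  (forall y, Z y -> Int \1_(Z `&` rbox y s) = 0) -> Int (\1_Z : 'rV[R]_N -> R) = 0.
Proof.
move=> s0 bZ H; have s2 : s / 2 <= s by rewrite ler_pdivrMr// ler_pMr// ler1n.
have s20 : 0 <= s / 2 by rewrite divr_ge0// ltW.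
have mZ : mset Z.
  have := mset_comp (D := [set 1]) (BM_mfun bZ) (measurable_set1 _).
  rewrite (_ : _ @^-1` _ = Z)//; apply/seteqP; split=> x /=; rewrite indicE.
    by case: (boolP (x \in Z)) => [|_ /eqP]; [rewrite inE|rewrite eq_sym oner_eq0].
  by move=> Zx; rewrite mem_set.
have mb y t : mset (rbox y t) by exact: closed_mset (@closed_rbox _ _ _ _).
have bI y t : BM (\1_(Z `&` rbox y t) : 'rV[R]_N -> R).
  by apply: (BM_sub bZ); [exact: msetI|move=> x []].
have null y : Int \1_(Z `&` rbox y (s / 2)) = 0.
  have [[z [Zz zy]]|nz] := pselect (exists z, Z z /\ rbox y (s / 2) z); last first.
    rewrite -[RHS](@Int0 R N); apply: eq_Int => x; rewrite indicE memNset//.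
    by move=> [Zx xy]; apply: nz; exists x.
  apply/eqP; rewrite eq_le; apply/andP; split; last by apply: Int_ge0 => x; exact: indicR_ge0.
  rewrite -[leRHS](H z Zz); apply: le_Int_indic; [exact: bI|exact: bI|].
  move=> x [Zx xy]; split=> //; rewrite /rbox /box /= (_ : x - z = (x - y) - (z - y)).
    by apply: le_trans (ler_normB _ _) _; rewrite [s]splitr lerD.
  by rewrite opprB addrA subrK.
have [_ [M HM]] := bZ.
(* The last factor is 1 whenever the other two are nonzero; it is there to bound the support in y
   visibly. *)
pose F x y : R := \1_Z x * (\1_(box (s / 2)) (x - y) * \1_(box (M + s)) y).
have bF : BM2 F.
  split.
    apply: mfun2M; first exact: mfun2_fst (mfun_indic mZ).
    apply: mfun2M; first by apply: (@mfun2_sub _ _ (\1_(box (s / 2)))); exact: BM_mfun (BM_box _).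
    by apply: mfun2_snd; exact: BM_mfun (BM_box _).
  exists (Num.max 1 (`|M| + s)) => x y; split.
    rewrite /F !indicE le_max; apply/orP; left.
    by case: (_ \in _); case: (_ \in _); case: (_ \in _); rewrite !(mul0r, mulr0, mul1r) ?normr0 ?normr1.
  rewrite /F !mulf_eq0 !negb_or => /and3P[h1 _ h3]; split; rewrite le_max; apply/orP; right.
    by apply: le_trans ((HM x).2 h1) _; apply: le_trans (ler_norm _) _; rewrite lerDl ltW.
  move: h3; rewrite indicE; case: (boolP (y \in _)); last by rewrite eqxx.
  rewrite inE => yb _; apply: le_trans yb _; rewrite lerD2r; exact: ler_norm.
have sw := Int_fubini bF.
have r0 : Int (fun y => Int (F ^~ y)) = 0.
  rewrite -[RHS](@Int0 R N); apply: eq_Int => y.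
  rewrite (_ : F ^~ y = fun x => \1_(box (M + s)) y * \1_(Z `&` rbox y (s / 2)) x); last first.
    apply/funext => x; rewrite /F mulrA mulrC; congr (_ * _).
    by rewrite -indic_rbox indicR_setI.
  by rewrite IntZ ?null ?mulr0//; exact: bI.
clear H null.
have l0 : Int (fun x => Int (F x)) = s ^+ N * Int \1_Z.
  rewrite -(IntZ (s ^+ N) bZ); apply: eq_Int => x.
  have [Zx|nZ] := pselect (Z x); last first.
    have zx : \1_Z x = 0 :> R by rewrite indicE memNset.
    have -> : F x = fun=> 0 by apply/funext => y; rewrite /F zx mul0r.
    by rewrite Int0 zx mulr0.
  rewrite (_ : F x = \1_(rbox x (s / 2))); last first.
    apply/funext => y; rewrite /F [\1_Z x]indicE (mem_set Zx) mul1r indic_rbox.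
    rewrite [X in X * _]indicE [RHS]indicE (_ : (x - y \in _) = (y - x \in box (s / 2))); last first.
      by apply/idP/idP; rewrite !inE /box /= -normrN opprB.
    case: (boolP (_ \in _)); last by rewrite mul0r.
    rewrite inE => yx; rewrite mul1r; suff yb : box (M + s) y by rewrite indicE (mem_set yb).
    rewrite /box /= -[y](subrK x); apply: le_trans (ler_normD _ _) _; rewrite addrC; apply: lerD.
      by apply: (HM x).2; rewrite indicE (mem_set Zx) oner_eq0.
    exact: le_trans yx s2.
  rewrite (Int_rbox x s20).
  by rewrite [\1_Z x]indicE (mem_set Zx) mulr1 mulrC divfK.
move: sw; rewrite r0 l0 => /eqP; rewrite mulf_eq0 => /orP[|/eqP//].
by rewrite gt_eqF// exprn_gt0.
Qed.

(** Density is needed only in the weak form of positive measure in every box. If each point of [Z]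
    had a null box, [Z] would be the union of the sets [E k] of points whose box of radius 1/(k+1)
    is null; these are null by [null_of_null_boxes], and dominated convergence makes [Z] null. *)
Lemma density_point Z : mset Z -> BM (\1_Z : 'rV[R]_N -> R) -> 0 < Int (\1_Z : 'rV[R]_N -> R) ->
  exists2 x, Z x & forall r : R, 0 < r -> 0 < Int \1_(Z `&` rbox x r).
Proof.
move=> mZ bZ IZ; apply: contrapT => nx.
have mb y t : mset (rbox y t) by exact: closed_mset (@closed_rbox _ _ _ _).
have bI y t : BM (\1_(Z `&` rbox y t) : 'rV[R]_N -> R).
  by apply: (BM_sub bZ); [exact: msetI|move=> x []].
have bad x : Z x -> exists2 r : R, 0 < r & Int \1_(Z `&` rbox x r) = 0.
  move=> Zx; apply: contrapT => nr; apply: nx; exists x => // r r0.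
  rewrite lt_neqAle eq_sym; apply/andP; split; last by apply: Int_ge0 => y; exact: indicR_ge0.
  by apply/eqP => h; apply: nr; exists r.
pose rad (k : nat) : R := k.+1%:R^-1.
have rad0 k : 0 < rad k by rewrite invr_gt0.
pose E k := [set y | Z y /\ Int \1_(Z `&` rbox y (rad k)) = 0].
have mE k : mset (E k).
  apply: msetI => //.
  have [_ [M HM]] := bZ.
  pose F y x : R := \1_(box (rad k)) (x - y) * \1_Z x.
  have bF : BM2 F.
    split.
      apply: mfun2M; last exact: mfun2_snd (mfun_indic mZ).
      apply: (@mfun2_comp _ _ (\1_(box (rad k))) (fun y x => x - y)); first exact: BM_mfun (BM_box _).
      move=> i; rewrite (_ : (fun x y => _) = fun x y => y 0 i + - x 0 i); last first.
        by apply/funext => x; apply/funext => y; rewrite !mxE.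
      apply: mfun2D; first exact: (@mfun2_snd _ _ (fun y => y 0 i) (@mfun_coord _ _ i)).
      apply: (@mfun2_fst _ _ (fun y => - y 0 i)).
      rewrite (_ : (fun y : 'rV[R]_N => - y 0 i) = fun y => -1 * y 0 i); last by apply/funext => y; rewrite mulN1r.
      by apply: (@mfunM _ _ (fun=> -1) (fun y => y 0 i)); [exact: mfun_cst|exact: mfun_coord].
    exists (Num.max 1 (`|M| + rad k)) => y x; split.
      rewrite /F !indicE le_max; apply/orP; left.
      by case: (_ \in _); case: (_ \in _); rewrite !(mul0r, mulr0, mul1r) ?normr0 ?normr1.
    rewrite /F mulf_eq0 negb_or => /andP[h1 h2].
    have xM : `|x| <= `|M| by apply: le_trans ((HM x).2 h2) _; exact: ler_norm.
    split; rewrite le_max; apply/orP; right; last by apply: le_trans xM _; rewrite lerDl ltW.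
    move: h1; rewrite indicE; case: (boolP (x - y \in _)); last by rewrite eqxx.
    rewrite inE => xy _; rewrite -[y](subKr x); apply: le_trans (ler_normB _ _) _.
    exact: lerD.
  have := mset_comp (D := [set 0]) (BM_mfun (BM_Int bF)) (measurable_set1 _).
  congr mset; apply/funext => y; congr (_ = _); apply: eq_Int => x.
  by rewrite /F -indic_rbox mulrC indicR_setI.
have EZ k : E k `<=` Z by move=> x [].
have nE k : Int (\1_(E k) : 'rV[R]_N -> R) = 0.
  have bE : BM (\1_(E k) : 'rV[R]_N -> R) by exact: BM_sub bZ (mE k) (EZ k).
  apply: (null_of_null_boxes (rad0 k) bE) => y [Zy Iy].
  apply/eqP; rewrite eq_le; apply/andP; split; last by apply: Int_ge0 => x; exact: indicR_ge0.
  rewrite -[leRHS]Iy; apply: le_Int_indic => //.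
    by apply: (BM_sub bE); [exact: msetI|move=> x []].
  by move=> x [[Zx _] xy].
have [_ [M HM]] := bZ.
have := @Int_dct R N (fun k => \1_(E k)) \1_Z (Num.max 1 M) (fun k => mfun_indic (mE k)) (mfun_indic mZ).
move=> /(_ _ _ _)-h.
have {h} : Int \o (fun k => \1_(E k) : 'rV[R]_N -> R) @ \oo --> Int (\1_Z : 'rV[R]_N -> R).
  apply: h.
  - by move=> k x; rewrite indicE ger0_norm// le_max lern1 leq_b1.
  - move=> k x; rewrite indicE; case: (boolP (x \in _)); last by rewrite eqxx.
    rewrite inE => /EZ Zx _; rewrite le_max; apply/orP; right; apply: (HM x).2.
    by rewrite indicE mem_set// oner_eq0.
  move=> x; have [Zx|nZ] := pselect (Z x); last first.
    rewrite (_ : (fun k => _) = fun=> 0); last by apply/funext => k; rewrite indicE memNset// => /EZ.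
    by rewrite indicE memNset//; exact: cvg_cst.
  have [r r0 Ir] := bad x Zx; rewrite indicE mem_set//.
  suff h : \forall k \near \oo, cst (1 : R) k = \1_(E k) x by exact: cvg_trans (near_eq_cvg h) (cvg_cst _).
  have [K _ HK] := near_infty_natSinv_lt (PosNum r0).
  exists K => // k /= /HK /= kr; rewrite indicE mem_set//; split=> //.
  apply/eqP; rewrite eq_le; apply/andP; split; last by apply: Int_ge0 => y; exact: indicR_ge0.
  rewrite -[leRHS]Ir; apply: le_Int_indic => // y [Zy yx]; split=> //.
  by apply: le_trans yx _; exact: ltW.
rewrite (_ : Int \o _ = fun=> 0); last by apply/funext => k /=; exact: nE.
move=> /(cvg_unique _ (cvg_cst (0 : R))) h.
by move: IZ; rewrite -h// ltxx.
Qed.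

(** [Z] is bounded, hence lies in a product of intervals one of which is reduced to a point. *)
Lemma null_hyperplane (i : 'I_N) (l : R) Z : BM (\1_Z : 'rV[R]_N -> R) -> (forall x, Z x -> x 0 i = l) ->
  Int (\1_Z : 'rV[R]_N -> R) = 0.
Proof.
move=> bZ Zl; have [_ [M HM]] := bZ.
pose A (j : 'I_N) : set R := if j == i then [set l] else `[- `|M|, `|M|]%classic.
have mA j : measurable (A j) by rewrite /A; case: ifP => _; [exact: measurable_set1|exact: measurable_itv].
pose P : set 'rV[R]_N := [set x | forall j, A j (x 0 j)].
have ZP : Z `<=` P.
  move=> x Zx j; rewrite /A; case: eqP => [->|_] /=; first exact: Zl.
  rewrite in_itv /= -ler_norml; apply: le_trans (rV_coord_le _ _) _.
  by apply: le_trans ((HM x).2 _) (ler_norm _); rewrite indicE mem_set// oner_eq0.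
have preP : @rV_of_tuple R N @^-1` P = [set t | forall j, A j (tnth t j)].
  by apply/seteqP; split=> t /= h j; have := h j; rewrite mxE.
have mP : mset P.
  rewrite /mset preP (_ : [set t | _] = \bigcap_(j in setT) ((@tnth _ R ^~ j) @^-1` A j)).
    apply: fin_bigcap_measurable; first exact: finite_finset.
    by move=> j _; rewrite -[X in measurable X]setTI; exact: measurable_tnth.
  by apply/seteqP; split=> t /= h j => [_|]; exact: h.
have bP : BM (\1_P : 'rV[R]_N -> R).
  apply: BM_set => //; exists (`|l| + `|M|) => x Px; apply/rV_normP; first exact: addr_ge0.
  move=> j; have := Px j; rewrite /A; case: ifP => _ /=; first by move=> ->; rewrite lerDl.
  by rewrite in_itv /= -ler_norml => /le_trans; apply; rewrite lerDr.
apply/eqP; rewrite eq_le; apply/andP; split; last by apply: Int_ge0 => x; exact: indicR_ge0.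
apply: le_trans (le_Int_indic bZ bP ZP) _.
rewrite /Int /Rintegral (_ : (fun t => _) = fun t => (\1_(@rV_of_tuple R N @^-1` P) t)%:E); last first.
  by apply/funext => t; rewrite !indicE; congr (((_ : bool)%:R)%:E).
have Z0 : lebesgue_Rn N (@rV_of_tuple R N @^-1` P) = 0%E.
  rewrite preP; transitivity (\prod_(j < N) lebesgue_measure (A j))%E; first exact: lebesgue_Rn_box.
  by rewrite (bigD1 i)//= /A eqxx lebesgue_measure_set1 mul0e.
rewrite integral_indic// setIT (_ : fine _ = 0)//.
by transitivity (fine (0 : \bar R)); first by congr fine; exact: Z0.
Qed.

Lemma open_closed_along_segment A (a b : 'rV[R]_N) : open A -> A a ->
  (forall t : R, 0 <= t <= 1 -> closure A (a + t *: b) -> A (a + t *: b)) -> A (a + b).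
Proof.
move=> oA Aa H.
pose g (t : R) := a + t *: b.
have cg : continuous g by move=> t; exact: line_continuous.
have E : `[0, 1]%classic `&` g @^-1` A = `[(0 : R), 1]%classic.
  apply: segment_connected.
  - by exists 0; split; rewrite /= ?in_itv /= ?lexx ?ler01// /g scale0r addr0.
  - by exists (g @^-1` A) => //; apply: open_comp => // t _; exact: cg.
  - exists (g @^-1` closure A); first by apply: closed_comp => [t _|]; [exact: cg|exact: closed_closure].
    apply/seteqP; split=> t /= [t01 At]; split=> //; first exact: subset_closure.
    by apply: H => //; move: t01; rewrite in_itv.
have [_] : (`[0, 1]%classic `&` g @^-1` A) 1 by rewrite E /= in_itv /= ler01 lexx.
by rewrite /g /= scale1r.
Qed.

Lemma closure_zero A (h : 'rV[R]_N -> R) x : closure A x -> continuous_at x h ->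
  (forall y, A y -> h y = 0) -> h x = 0.
Proof.
move=> clx ch h0; apply/eqP; apply: contrapT => /negP hx.
have e0 : 0 < `|h x| by rewrite normr_gt0.
have /cvgrPdist_lt/(_ _ e0) := ch.
move=> /clx [y [Ay /=]]; rewrite (h0 y Ay) subr0 ltxx//.
Qed.

Lemma min_grad0 (w : 'rV[R]_N -> R) (dw : 'rV[R]_N -> 'rV[R]_N) x :
  (\forall y \near x, is_grad w y (dw y)) -> continuous_at x dw ->
  (\forall y \near x, w x <= w y) -> dw x = 0.
Proof.
move=> g c m; apply/eqP; apply: contrapT => /negP d0.
have q0 : 0 < dotp (dw x) (dw x) by rewrite lt_neqAle eq_sym dotp_eq0 d0 dotp_ge0.
have cd : continuous_at x (fun y => dotp (dw y) (dw x)).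
  by apply: continuous_dotp => //; exact: for_cst.
have /cvgrPdist_lt/(_ _ q0) n1 := cd.
have : \forall y \near x, [/\ is_grad w y (dw y), w x <= w y & `|dotp (dw x) (dw x) - dotp (dw y) (dw x)| < dotp (dw x) (dw x)].
  by apply: filterS3 g m n1 => y *; split.
move=> /nbhs_ballP[r /= r0 hr].
have n0 : 0 < `|dw x| by rewrite normr_gt0.
pose t := r / 2 / `|dw x|; have t0 : 0 < t by rewrite !divr_gt0.
have inb s : 0 <= s <= 1 -> ball x r (x + s *: (- t *: dw x)).
  move=> /andP[s0 s1]; rewrite -ball_normE /= opprD addrA subrr sub0r normrN !normrZ normrN.
  rewrite (ger0_norm s0) (gtr0_norm t0) /t divfK ?gt_eqF//.
  apply: (@le_lt_trans _ _ (r / 2)); first by rewrite ler_piMl// divr_ge0// ltW.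
  by rewrite ltr_pdivrMr// ltr_pMr// ltr1n.
have [||s] := @mvt_line _ _ w dw x (- t *: dw x).
- by move=> s; rewrite in_itv /= => /andP[s0 s1]; have [|//] := hr _ (inb s _); rewrite !ltW.
- move=> s; rewrite in_itv /= => s01; have [h _ _] := hr _ (inb s s01); exact: is_grad_continuous h.
rewrite in_itv /= => /andP[s0 s1]; rewrite dotpZr mulNr => E.
have i1 : 0 <= (1 : R) <= 1 by rewrite ler01 lexx.
have [_ + _] := hr _ (inb 1 i1); rewrite scale1r -subr_ge0 E oppr_ge0.
have s01 : 0 <= s <= 1 by rewrite !ltW.
have [_ _] := hr _ (inb s s01); rewrite ltr_norml => /andP[_]; set X := dotp _ _; set Y := dotp _ _ => h.
by apply/negP; rewrite -ltNge mulr_gt0//; lra.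
Qed.

End density_points.

(** * The moving plane argument *)

Section moving_planes.
Context {R : realType} {n : nat}.
Implicit Types (x y z : 'rV[R]_n.+1) (mu nu : R).
Variables (Omega : set 'rV[R]_n.+1) (p : R) (v H : 'rV[R]_n.+1 -> R)
  (G : 'rV[R]_n.+1 -> 'rV[R]_n.+1).
Hypotheses (p1 : 1 < p) (S : psys Omega p v G H).
Hypotheses (sO : symmetric_x1 Omega) (cO : strictly_convex_x1 Omega).

Let P mu := forall x, x 0 ord0 <= mu -> v x <= v (refl mu x).

Let oO : open Omega. Proof. exact: psol_open (sys_sol S). Qed.
Let cv : continuous v. Proof. exact: sys_cont S. Qed.
Let vge0 x : 0 <= v x. Proof. exact: sys_ge0 S x. Qed.
Let cG x : Omega x -> continuous_at x G. Proof. exact: psol_G (sys_sol S) x. Qed.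

Let P_left : exists nu, forall mu, mu <= nu -> P mu.
Proof.
have [M M0 HM] := compact_bound (sys_compact S).
exists (- M - 1) => mu mM x xm; rewrite (sys_out S) => [|Ox]; first exact: vge0.
have := HM x (subset_closure Ox); have := rV_coord_le x ord0.
by rewrite ler_norml => /andP[a _] b; lra.
Qed.

Let P_closed l : (forall mu, mu < l -> P mu) -> P l.
Proof.
move=> Pl x; rewrite le_eqVlt => /predU1P[E|xl]; first by rewrite refl_fix.
rewrite leNgt; apply/negP => h.
have cr : continuous_at l (fun mu => v (refl mu x)).
  apply: (@continuous_comp _ _ _ (fun mu => refl mu x) v); last exact: cv.
  apply: continuous_rvD; first exact: for_cst.
  by apply: continuous_rvZ; [apply: continuous_rZ; exact: for_id|exact: for_cst].
have d0 : 0 < v x - v (refl l x) by rewrite subr_gt0.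
have /cvgrPdist_lt/(_ _ d0)/nbhs_ballP[r /= r0 hr] := cr.
(* Close to [l] from below, but not left of x, since [P mu] speaks only of points with x_1 <= mu. *)
pose mu := Num.max (x 0 ord0) (l - r / 2).
have ml : mu < l by rewrite gt_max xl/= ltrBlDr ltrDl divr_gt0.
have := hr mu; rewrite -ball_normE /= => /(_ _)/wrap[].
  rewrite ger0_norm ?subr_ge0 ?(ltW ml)// ltrBlDr -ltrBlDl.
  by rewrite lt_max; apply/orP; right; rewrite ltrD2l ltrN2 ltr_pdivrMr// ltr_pMr// ltr1n.
have := Pl mu ml x; rewrite le_max lexx => /(_ isT) => a; rewrite ltr_norml => /andP[b _]; lra.
Qed.

Section fixed_plane.
Variable l : R.
Hypotheses (l0 : l < 0) (Pl : P l).
Let vl x := v (refl l x).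
Let Gl x := reflect1 (G (refl l x)).
Let sol2 := psys_refl S l p1.
Let cvl : continuous vl. Proof. exact: (sys_refl_cont S). Qed.

Let Pr x : l <= x 0 ord0 -> vl x <= v x.
Proof. by move=> h; have := Pl (x := refl l x); rewrite reflK refl0; apply; lra. Qed.

Let Gl_enorm x : enorm (Gl x) = enorm (G (refl l x)).
Proof. by rewrite /Gl -mul_refl_mx enorm_orth//; exact: refl_mx_orth. Qed.

Let oOl : open (refl l @^-1` Omega). Proof. exact: psol_open sol2. Qed.

(** Equal nonzero gradients at x0 confine both moduli to one interval [m, M] nearby, where the
    equation is uniformly elliptic. Either sign of v - v_l will do, the two functions being
    exchanged. *)
Let local_smp x0 : Omega x0 -> Omega (refl l x0) -> G x0 != 0 -> Gl x0 = G x0 ->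
  (\forall y \near x0, v y <= vl y) \/ (\forall y \near x0, vl y <= v y) ->
  (forall r : R, 0 < r -> 0 < Int \1_([set y | rbox x0 r y /\ v y = vl y])) ->
  \forall y \near x0, v y = vl y.
Proof.
move=> O1 O2 G0 GG sgn dens.
have g0 : 0 < enorm (G x0) by rewrite enorm_gt0.
pose m := enorm (G x0) / 2; pose M := 2 * enorm (G x0).
have m0 : 0 < m by rewrite divr_gt0.
have near1 (F : 'rV[R]_n.+1 -> 'rV[R]_n.+1) : F x0 = G x0 -> continuous_at x0 F ->
    \forall y \near x0, m <= enorm (F y) <= M.
  move=> E cF; have := continuous_enorm cF => /cvgrPdist_lt/(_ _ m0).
  apply: filterS => y; rewrite E ltr_norml => /andP[a b].
  by rewrite /m /M in a b *; apply/andP; split; lra.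
have [U [oU Ux0 U1 sgnU]] : exists U, [/\ open U, U x0,
    forall y, U y -> [/\ Omega y, Omega (refl l y), m <= enorm (G y) <= M & m <= enorm (Gl y) <= M] &
    (forall y, U y -> v y <= vl y) \/ (forall y, U y -> vl y <= v y)].
  have nO1 : nbhs x0 Omega by apply: open_nbhs_nbhs.
  have nO2 : nbhs x0 (refl l @^-1` Omega) by apply: open_nbhs_nbhs.
  have n1 := near1 G erefl (cG O1).
  have n2 := near1 Gl GG (psol_G sol2 O2).
  have : \forall y \near x0, [/\ Omega y, Omega (refl l y), m <= enorm (G y) <= M & m <= enorm (Gl y) <= M].
    by near=> y; split; near: y.
  case: sgn => sgn nn.
    exists (interior [set y | [/\ Omega y, Omega (refl l y), m <= enorm (G y) <= M & m <= enorm (Gl y) <= M] /\ v y <= vl y]); split.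
    - exact: open_interior.
    - by apply: filterS2 nn sgn => y a b; split.
    - by move=> y /interior_subset[].
    - by left=> y /interior_subset[].
  exists (interior [set y | [/\ Omega y, Omega (refl l y), m <= enorm (G y) <= M & m <= enorm (Gl y) <= M] /\ vl y <= v y]); split.
  - exact: open_interior.
  - by apply: filterS2 nn sgn => y a b; split.
  - by move=> y /interior_subset[].
  - by right=> y /interior_subset[].
have s1 : psol U p v G H by apply: (psol_sub oU _ (sys_sol S)) => y /U1[].
have s2 := psol_sub oU (fun y Uy => let: And4 _ h _ _ := U1 y Uy in h) sol2.
have [L L0 HL] := sys_lip S.
have weakd (va vb Ha Hb : 'rV[R]_n.+1 -> R) (Ga Gb : 'rV[R]_n.+1 -> 'rV[R]_n.+1) phi dphi :
    psol U p va Ga Ha -> psol U p vb Gb Hb -> tst U phi dphi ->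
    Int (fun x => dotp (Vf p (Ga x) - Vf p (Gb x)) (dphi x)) = Int (fun x => (Ha x - Hb x) * phi x).
  move=> sa sb t.
  have b1 : BM (fun x => dotp (Vf p (Ga x)) (dphi x)).
    by apply: CC_BM; apply: (tst_CC_dot oU t) => y Uy; apply: continuous_Vf => //; exact: psol_G sa _ Uy.
  have b2 : BM (fun x => dotp (Vf p (Gb x)) (dphi x)).
    by apply: CC_BM; apply: (tst_CC_dot oU t) => y Uy; apply: continuous_Vf => //; exact: psol_G sb _ Uy.
  have h1 := CC_BM (tst_CC_mul oU t (psol_H sa)); have h2 := CC_BM (tst_CC_mul oU t (psol_H sb)).
  under eq_Int do rewrite dotpBl; rewrite IntB// (psol_weak sa t) (psol_weak sb t) -IntB//.
  by apply: eq_Int => y; rewrite mulrBl.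
case: sgnU => sgnU.
  have HLU y : U y -> `|H (refl l y) - H y| <= L * (vl y - v y).
    by move=> /sgnU h; apply: le_trans (HL _ _) _; rewrite ger0_norm// subr_ge0.
  have [r r0 Hr] := strong_comparison p1 oU cvl cv (psol_grad s2) (psol_grad s1) (psol_G s2) (psol_G s1)
    (psol_H s2) (psol_H s1) m0 (fun y Uy => let: And4 _ _ _ h := U1 y Uy in h)
    (fun y Uy => let: And4 _ _ h _ := U1 y Uy in h) L0 sgnU HLU (fun phi dphi t => weakd _ _ _ _ _ _ _ _ s2 s1 t) Ux0.
  apply/nbhs_ballP; exists r => //= y; rewrite -ball_normE /= -normrN opprB => yr.
  apply/esym/Hr => //; have := dens r r0; congr (0 < _); apply: eq_Int => z.
  by congr (\1_ _ z); apply/seteqP; split=> t /= [a b].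
have HLU y : U y -> `|H y - H (refl l y)| <= L * (v y - vl y).
  by move=> /sgnU h; apply: le_trans (HL _ _) _; rewrite ger0_norm// subr_ge0.
have [r r0 Hr] := strong_comparison p1 oU cv cvl (psol_grad s1) (psol_grad s2) (psol_G s1) (psol_G s2)
  (psol_H s1) (psol_H s2) m0 (fun y Uy => let: And4 _ _ h _ := U1 y Uy in h)
  (fun y Uy => let: And4 _ _ _ h := U1 y Uy in h) L0 sgnU HLU (fun phi dphi t => weakd _ _ _ _ _ _ _ _ s1 s2 t) Ux0.
apply/nbhs_ballP; exists r => //= y; rewrite -ball_normE /= -normrN opprB => yr.
by apply: Hr => //; exact: dens.
Unshelve. all: by end_near.
Qed.

Let D : set 'rV[R]_n.+1 := [set x | [/\ Omega x, G x != 0 & \forall y \near x, v y = vl y]].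

Let oD : open D.
Proof.
rewrite openE => x [Ox Gx nx].
have n1 : nbhs x Omega by apply: open_nbhs_nbhs.
have n2 : \forall y \near x, G y != 0.
  have e0 : 0 < enorm (G x) by rewrite enorm_gt0.
  have := continuous_enorm (cG Ox) => /cvgrPdist_lt/(_ _ e0); apply: filterS => y.
  apply: contraTneq => ->; rewrite enorm0 subr0 -leNgt; exact: ler_norm.
have n3 : \forall y \near x, \forall z \near y, v z = vl z by exact: near_join.
by apply: filterS3 n1 n2 n3 => y *; split.
Qed.

Let D_eq x : D x -> v x = vl x. Proof. by move=> [_ _ /nbhs_singleton]. Qed.

Let D_refl_in x : D x -> Omega (refl l x).
Proof. by move=> Dx; apply: (sys_in S); rewrite -/(vl x) -D_eq//; apply: (sys_pos S); case: Dx. Qed.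

Let D_G x : D x -> Gl x = G x.
Proof.
move=> Dx; have [Ox _ nx] := Dx.
have g2 := psol_grad sol2 (D_refl_in Dx); have g1 := psol_grad (sys_sol S) Ox.
apply: is_grad_unique (is_grad_near _ g2) g1; by apply: filterS nx => y E; exact: esym E.
Qed.

Let D_refl x : D x -> D (refl l x).
Proof.
move=> Dx; have [Ox Gx nx] := Dx; split; first exact: D_refl_in.
  by rewrite -enorm_gt0 -Gl_enorm D_G// enorm_gt0.
have cr : continuous_at (refl l x) (refl l) by exact: aff_continuous.
have : nbhs (refl l (refl l x)) [set y | v y = vl y] by rewrite reflK.
move=> h; have {}h : \forall y \near refl l x, v (refl l y) = vl (refl l y) := cr _ h.
by apply: filterS h => y; rewrite /vl reflK => ->.
Qed.

Let cl_eq x : closure D x -> v x = vl x.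
Proof.
move=> clx; apply/eqP; rewrite -subr_eq0; apply/eqP.
apply: (closure_zero (h := fun y => v y - vl y) clx); first by apply: continuous_rB; [exact: cv|exact: cvl].
by move=> y /D_eq ->; rewrite subrr.
Qed.

Let cl_refl_in x : closure D x -> Omega x -> Omega (refl l x).
Proof. by move=> clx Ox; apply: (sys_in S); rewrite -/(vl x) -cl_eq//; exact: sys_pos S _ Ox. Qed.

Let cl_G x : closure D x -> Omega x -> Gl x = G x.
Proof.
move=> clx Ox; apply/eqP; rewrite -subr_eq0 -enorm_eq0; apply/eqP.
apply: (closure_zero (h := fun y => enorm (Gl y - G y)) clx).
  apply: continuous_enorm; apply: continuous_rvB; last exact: cG.
  exact: psol_G sol2 _ (cl_refl_in clx Ox).
by move=> y /D_G ->; rewrite subrr enorm0.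
Qed.

(** A point of [D] close to x brings a whole box on which v = v_l. *)
Let cl_dens x : closure D x -> forall r : R, 0 < r -> 0 < Int \1_([set y | rbox x r y /\ v y = vl y]).
Proof.
move=> clx r r0.
have /clx[y [[_ _ /nbhs_ballP[s /= s0 hs]] xy]] : nbhs x (ball x (r / 2)) by apply: nbhsx_ballx; rewrite divr_gt0.
pose t := Num.min (r / 2) (s / 2).
have t0 : 0 < t by rewrite lt_min !divr_gt0.
have b1 := @BM_rbox R n.+1 x r.
have mm := mset_rbox_eq x r cv cvl.
have b2 : BM (\1_[set y | rbox x r y /\ v y = vl y] : 'rV[R]_n.+1 -> R) by apply: (BM_sub b1 mm) => z [].
apply: (@lt_le_trans _ _ (Int (\1_(rbox y t) : 'rV[R]_n.+1 -> R))).
  by rewrite Int_rbox ?(ltW t0)// exprn_gt0// mulr_gt0.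
apply: le_Int_indic => //; first exact: BM_rbox.
move=> z zy; split.
  rewrite /rbox /box /= (_ : z - x = (z - y) - (x - y)); last by rewrite opprB addrA subrK.
  apply: le_trans (ler_normB _ _) _; rewrite [r]splitr; apply: lerD.
    by apply: le_trans zy _; rewrite ge_min lexx.
  by move: xy; rewrite -ball_normE /= => /ltW.
apply: hs; rewrite -ball_normE /= -normrN opprB; apply: le_lt_trans zy _.
by rewrite gt_min; apply/orP; right; rewrite ltr_pdivrMr// ltr_pMr// ltr1n.
Qed.

Let coord_near x (A : set R) : open A -> A (x 0 ord0) ->
  \forall y \near x, A ((y : 'rV[R]_n.+1) 0 ord0).
Proof.
move=> oA Ax; have : nbhs (x 0 ord0) A by apply: open_nbhs_nbhs.
by move=> h; exact: (@coord_continuous R 1 n.+1 0 ord0 x _ h).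
Qed.

Let D_side x : closure D x -> Omega x -> G x != 0 -> x 0 ord0 != l -> D x.
Proof.
move=> clx Ox Gx; rewrite neq_lt => xl; split=> //.
apply: local_smp => //; [exact: cl_refl_in|exact: cl_G| |exact: cl_dens].
case/orP: xl => xl; [left|right].
  have ol : open [set t : R | t < l] by exact: open_lt.
  by have := coord_near ol xl; apply: filterS => y /ltW; exact: Pl.
have ol : open [set t : R | l < t] by exact: open_gt.
by have := coord_near ol xl; apply: filterS => y /ltW; exact: Pr.
Qed.

Let off_plane x U : open U -> D x -> U x -> exists2 y, D y /\ U y & y 0 ord0 != l.
Proof.
move=> oU Dx Ux; have [E|] := eqVneq (x 0 ord0) l; last by exists x.
have /nbhs_ballP[r /= r0 hr] : nbhs x (D `&` U) by apply: open_nbhs_nbhs; split; [exact: openI|].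
exists (x + (r / 2) *: e1).
  apply: hr; rewrite -ball_normE /= opprD addrA subrr sub0r normrN.
  apply: le_lt_trans (norm_le_enorm _) _; rewrite enormZ /e1 enorm_delta mulr1 gtr0_norm ?divr_gt0//.
  by rewrite ltr_pdivrMr// ltr_pMr// ltr1n.
by rewrite !mxE eqxx /= mulr1 E gt_eqF// ltrDl divr_gt0.
Qed.

(** In a symmetric neighbourhood a point of [D] can be moved off the plane, as [D] is open, and then
    reflected to the left. *)
Let left_point x U : open U -> (forall y, U y -> U (refl l y)) -> closure D x -> U x ->
  exists2 y, D y & U y /\ y 0 ord0 < l.
Proof.
move=> oU sU clx Ux; have /clx[y [Dy Uy]] : nbhs x U by apply: open_nbhs_nbhs.
have [z [Dz Uz]] := off_plane oU Dy Uy; rewrite neq_lt => /orP[zl|zl]; first by exists z.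
by exists (refl l z); [exact: D_refl|split; [exact: sU|rewrite refl0; lra]].
Qed.

Let ball_refl x (r : R) y : x 0 ord0 = l -> ball x r y -> ball x r (refl l y).
Proof.
by move=> xl; rewrite -!ball_normE /= -{2}(refl_fix xl) norm_reflB.
Qed.

Let ball_conv x (r : R) y z t : 0 <= t <= 1 -> ball x r y -> ball x r (y + z) -> ball x r (y + t *: z).
Proof.
move=> /andP[t0 t1]; rewrite -!ball_normE /= => h1 h2.
have -> : x - (y + t *: z) = (1 - t) *: (x - y) + t *: (x - (y + z)).
  by apply/rowP => i; rewrite !mxE; ring.
apply: le_lt_trans (ler_normD _ _) _; rewrite !normrZ !ger0_norm ?subr_ge0//.
move: h1 h2; move: (`|x - y|) (`|x - (y + z)|) => a b ar br.
have : Num.max a b < r by rewrite gt_max ar.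
have am : a <= Num.max a b by rewrite le_max lexx.
have bm : b <= Num.max a b by rewrite le_max lexx orbT.
by move: am bm; move: (Num.max a b) => c am bm; apply: le_lt_trans; nra.
Qed.

(** On the plane v - v_l has no sign nearby and [local_smp] does not apply directly. But [D_side],
    followed along segments, shows that [D] fills the left half of a ball around x; the right half
    follows by reflection, and on the plane v = v_l trivially. *)
Let D_closed x : closure D x -> Omega x -> G x != 0 -> D x.
Proof.
move=> clx Ox Gx; have [xl|] := eqVneq (x 0 ord0) l; last exact: D_side.
split=> //.
have /nbhs_ballP[r /= r0 hr] : nbhs x [set y | Omega y /\ G y != 0].
  have e0 : 0 < enorm (G x) by rewrite enorm_gt0.
  have n1 : nbhs x Omega by apply: open_nbhs_nbhs.
  have := continuous_enorm (cG Ox) => /cvgrPdist_lt/(_ _ e0); apply: filterS2 n1 => y Oy h; split=> //.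
  by move: h; apply: contraTneq => ->; rewrite enorm0 subr0 -leNgt; exact: ler_norm.
have [a Da [Ba al]] : exists2 a, D a & ball x r a /\ a 0 ord0 < l.
  apply: left_point; [exact: ball_open|by move=> y; exact: ball_refl|exact: clx|exact: ballxx].
have DL b : ball x r b -> b 0 ord0 < l -> D b.
  move=> Bb bl; rewrite -[b](subrK a) addrC; apply: (open_closed_along_segment oD Da) => t t01 clt.
  have Bt : ball x r (a + t *: (b - a)).
    by apply: ball_conv => //; rewrite addrC subrK.
  have [Ot Gt] := hr _ Bt; apply: D_side => //.
  rewrite !mxE lt_eqF//; move: t01 => /andP[t0 t1]; move: al bl; move: (a 0 ord0) (b 0 ord0) => a0 b0 al bl.
  by have [ab|ab] := lerP a0 b0; nra.
apply/nbhs_ballP; exists r => //= b Bb.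
have [bl|bl|bl] := ltgtP (b 0 ord0) l.
- exact: D_eq (DL b Bb bl).
- have := D_eq (DL _ (ball_refl xl Bb) _); rewrite /vl reflK => -> //.
  by rewrite refl0; lra.
- by rewrite /vl refl_fix.
Qed.

Let cl_in x : closure D x -> closure Omega x.
Proof. by move=> clx B nB; have [y [[Oy _ _] By]] := clx _ nB; exists y. Qed.

Let cl_refl x : closure D x -> closure D (refl l x).
Proof.
move=> clx B nB; have nB' : nbhs x (refl l @^-1` B) by exact: aff_continuous.
by have [y [Dy By]] := clx _ nB'; exists (refl l y); split=> //; exact: D_refl.
Qed.

Let cl_side x : closure D x -> x 0 ord0 < l -> Omega x.
Proof.
move=> clx xl; apply: (sys_in S); rewrite cl_eq// /vl; apply: (sys_pos S).
by apply: refl_closure_in => //; exact: cl_in.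
Qed.

(** Off the plane, v = v_l and the reflection of the left side into [Omega] give v > 0. At a
    boundary point on the plane Hopf's lemma excludes critical points nearby, so [D] propagates to
    the left along segments; but by strict convexity the points slightly to the left of x are
    outside the closure of [Omega]. *)
Let cl_Omega : closure D `<=` Omega.
Proof.
move=> x clx; have [xl|xl|xl] := ltgtP (x 0 ord0) l; first exact: cl_side.
  have Or : Omega (refl l x) by apply: cl_side; [exact: cl_refl|rewrite refl0; lra].
  apply: (sys_in S); rewrite cl_eq//; exact: sys_pos S _ Or.
apply: contrapT => nO; have cx := cl_in clx.
have Gx := sys_hopf S cx nO.
have e0 : 0 < enorm (G x) by rewrite enorm_gt0.
have [r r0 Hr] := sys_unif S e0.
have GB y : ball x r y -> Omega y -> G y != 0.
  rewrite -ball_normE /= => xy Oy; have := Hr _ _ cx (subset_closure Oy) xy.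
  by apply: contraTneq => ->; rewrite subr0 -leNgt.
pose t := Num.min (r / 2) (- l).
have t0 : 0 < t by rewrite lt_min divr_gt0//= oppr_gt0.
(* Otherwise x would lie strictly between this point and its own mirror image in {x_1 = 0}, hence in
   [Omega]. *)
have nx : ~ closure Omega (x - t *: e1).
  move=> c1; apply: nO.
  have := cO (x := x - t *: e1) (t := t - 2 * l) _ c1 _ (s := t / (t - 2 * l)) _.
  have -> : x - t *: e1 + (t - 2 * l) *: e1 = reflect1 x.
    by rewrite -refl_reflect1 refl_shift xl -addrA; congr (_ + _); rewrite -scaleNr -scalerDl; congr (_ *: _); ring.
  have tl : 0 < t - 2 * l by have := l0; move: t0; move: (t) => q; lra.
  move=> /(_ _ (closure_reflect1 sO cx) _); rewrite divfK ?gt_eqF// subrK; apply.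
    by [].
  by rewrite divr_gt0//= ltr_pdivrMr// mul1r; have := l0; move: (t) => q; lra.
have csh (s : R) y : continuous_at y (fun y : 'rV[R]_n.+1 => y - s *: e1).
  by apply: continuous_rvB; [exact: for_id|exact: for_cst].
have oU2 : open ((fun y : 'rV[R]_n.+1 => y - t *: e1) @^-1` (~` closure Omega)).
  by apply: open_comp => [y _|]; [exact: csh|exact: closed_openC (@closed_closure _ _)].
have [y [Dy [By yt]] yl] : exists2 y, D y /\ (ball x (r / 2) y /\ ~ closure Omega (y - t *: e1)) & y 0 ord0 < l.
  have /nbhs_ballP[s /= s0 hs] : nbhs x ((fun y : 'rV[R]_n.+1 => y - t *: e1) @^-1` (~` closure Omega)).
    by apply: open_nbhs_nbhs.
  pose s' := Num.min s (r / 2); have s'0 : 0 < s' by rewrite lt_min s0 divr_gt0.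
  have [y Dy [By yl]] : exists2 y, D y & ball x s' y /\ y 0 ord0 < l.
    apply: left_point; [exact: ball_open|by move=> y; exact: ball_refl|exact: clx|exact: ballxx].
  exists y; last exact: yl.
  split; first exact: Dy.
  split.
    by move: By; rewrite -!ball_normE /= lt_min => /andP[].
  by apply: hs; move: By; rewrite -!ball_normE /= lt_min => /andP[].
apply: yt; suff [Oy _ _] : D (y - t *: e1) by exact: subset_closure.
rewrite -[_ - _]/(y + - (t *: e1)); apply: (open_closed_along_segment oD Dy) => s /andP[s01 s11] cls.
have zl : (y + s *: - (t *: e1)) 0 ord0 < l.
  rewrite !mxE /= mulr1; apply: le_lt_trans yl; by rewrite gerDl mulrN oppr_le0; apply: mulr_ge0; [exact: s01|exact: (ltW t0)].
have Os := cl_side cls zl.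
apply: D_side; [exact: cls|exact: Os| |by rewrite (lt_eqF zl)].
apply: GB; last exact: Os.
rewrite -ball_normE /= opprD addrA; apply: le_lt_trans (ler_normB _ _) _.
rewrite [r]splitr; apply: ltr_leD; first by move: By; rewrite -ball_normE.
apply: le_trans (norm_le_enorm _) _; rewrite enormZ enormN enormZ /e1 enorm_delta mulr1 (ger0_norm s01) (gtr0_norm t0).
by apply: (@le_trans _ _ t); [exact: (ler_piMl (ltW t0) s11)|rewrite ge_min lexx].
Qed.

Lemma no_local_symmetry x : D x -> False.
Proof.
move=> Dx; have [L L0 HL] := sys_lip S.
have cD : compact (closure D).
  by apply: (subclosed_compact (@closed_closure _ D) (sys_compact S)) => y; exact: cl_in.
apply: (no_critical_island p1 (sys_sol S) cv L0 HL (sys_Hpos S) oD cD cl_Omega _ _ Dx).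
- by move=> y [].
- move=> y cly nD; apply/eqP; apply: contrapT => /negP Gy; apply: nD.
  by apply: D_closed => //; exact: cl_Omega.
Qed.

Lemma no_dense_coincidence x0 : Omega x0 -> x0 0 ord0 < l -> G x0 != 0 -> v x0 = v (refl l x0) ->
  (forall r : R, 0 < r -> 0 < Int \1_([set y | rbox x0 r y /\ v y = v (refl l y)])) -> False.
Proof.
move=> Ox xl Gx E dens; have O2 : Omega (refl l x0) by apply: refl_in => //; exact: ltW.
have ol : open [set t : R | t < l] by exact: open_lt.
have nl : \forall y \near x0, v y <= vl y.
  by have := coord_near ol xl; apply: filterS => y /ltW; exact: Pl.
have n1 : nbhs x0 Omega by apply: open_nbhs_nbhs.
have n2 : nbhs x0 (refl l @^-1` Omega) by apply: open_nbhs_nbhs.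
(* v_l - v has a local minimum, with value 0, at x0. *)
have Z : Gl x0 - G x0 = 0.
  apply: (@min_grad0 _ _ (fun y => vl y - v y) (fun y => Gl y - G y)).
  - apply: filterS2 n1 n2 => y O1y O2y; apply: is_gradB; first exact: psol_grad sol2 _ O2y.
    exact: psol_grad (sys_sol S) _ O1y.
  - by apply: continuous_rvB; [exact: psol_G sol2 _ O2|exact: cG].
  - by apply: filterS nl => y h; rewrite /vl -E subrr subr_ge0.
apply: (@no_local_symmetry x0); split; [exact: Ox|exact: Gx|].
apply: local_smp; [exact: Ox|exact: O2|exact: Gx| |by left|exact: dens].
by apply/eqP; rewrite -subr_eq0 Z.
Qed.

End fixed_plane.

Let bounded_Omega : exists2 M : R, 0 < M & forall x, Omega x -> `|x| <= M.
Proof.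
have [M M0 HM] := compact_bound (sys_compact S).
by exists M => // x /subset_closure; exact: HM.
Qed.

Let A d : set 'rV[R]_n.+1 := [set x | Omega x /\ d <= enorm (G x)].

Let BM_A d : BM (\1_(A d) : 'rV[R]_n.+1 -> R).
Proof.
have [M M0 HM] := bounded_Omega; apply: BM_set; first exact: mset_G S d.
by exists M => x [/HM].
Qed.

Let coincidence mu : set 'rV[R]_n.+1 := [set x : 'rV[R]_n.+1 | x 0 ord0 <= mu /\ v x = v (refl mu x)].

Let closed_coincidence mu : closed (coincidence mu).
Proof.
have -> : coincidence mu = [set x : 'rV[R]_n.+1 | x 0 ord0 <= mu] `&` [set x | v x - v (refl mu x) = 0].
  apply/seteqP; split=> x /= [a b]; split=> //; first by rewrite b subrr.
  by apply/eqP; rewrite -subr_eq0 b.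
apply: closedI.
  apply: (@closed_comp _ _ (fun x : 'rV[R]_n.+1 => x 0 ord0) [set t | t <= mu]) => [x _|].
    exact: coord_continuous.
  exact: closed_le.
apply: (@closed_comp _ _ (fun x => v x - v (refl mu x)) [set 0]) => [x _|]; last exact: closed_eq.
by apply: continuous_rB; [exact: cv|exact: (sys_refl_cont S)].
Qed.

Let mset_bad mu : mset (bad_set Omega v mu).
Proof.
have -> : bad_set Omega v mu = Omega `&` ([set x : 'rV[R]_n.+1 | x 0 ord0 < mu] `&` [set x | 0 < v x - v (refl mu x)]).
  by apply/seteqP; split=> x /=; rewrite subr_gt0; [move=> []|move=> [a []]].
apply: open_mset; apply: openI; first exact: oO.
apply: openI.
  apply: (@open_comp _ _ (fun x : 'rV[R]_n.+1 => x 0 ord0) [set t | t < mu]) => [x _|].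
    exact: coord_continuous.
  exact: open_lt.
apply: (@open_comp _ _ (fun x => v x - v (refl mu x)) [set t | 0 < t]) => [x _|]; last exact: open_gt.
by apply: continuous_rB; [exact: cv|exact: (sys_refl_cont S)].
Qed.

(* The characteristic functions of bad_set mu off the coincidence set tend to 0 pointwise as mu decreases to l. *)
Let bad_limit l d theta (m : nat -> R) : (forall k, l < m k < l + k.+1%:R^-1) ->
  (forall k, theta < Int \1_(bad_set Omega v (m k) `&` A d)) -> P l ->
  theta <= Int \1_(A d `&` coincidence l).
Proof.
move=> ml mth Pl; have [M M0 HM] := bounded_Omega.
have mC := closed_mset (@closed_coincidence l).
pose F k x : R := \1_(bad_set Omega v (m k) `&` A d) x * (1 - \1_(coincidence l) x).
have bB k : BM (\1_(bad_set Omega v (m k) `&` A d) : 'rV[R]_n.+1 -> R).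
  by apply: (BM_sub (BM_A d)) => [|x []//]; apply: msetI; [exact: mset_bad|exact: mset_G S d].
have bT : BM (\1_(A d `&` coincidence l) : 'rV[R]_n.+1 -> R).
  by apply: (BM_sub (BM_A d)) => [|x []//]; apply: msetI; [exact: mset_G S d|exact: mC].
have bBC k : BM (fun x => \1_(coincidence l) x * \1_(bad_set Omega v (m k) `&` A d) x : R) by exact: BM_indic.
have FE k x : F k x = \1_(bad_set Omega v (m k) `&` A d) x - \1_(coincidence l) x * \1_(bad_set Omega v (m k) `&` A d) x.
  by rewrite /F; ring.
have bF k : BM (F k).
  by rewrite (_ : F k = fun x => \1_(bad_set Omega v (m k) `&` A d) x - \1_(coincidence l) x * \1_(bad_set Omega v (m k) `&` A d) x); [exact: BMB|apply/funext => x; exact: FE].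
have F01 k x : 0 <= F k x <= 1.
  by rewrite /F !indicE; case: (x \in coincidence l); case: (x \in _); rewrite ?subrr ?subr0 ?mulr0 ?mulr1 ?ler01 ?lexx.
(* The part of the bad set on the coincidence set of [l] is contained in [A d] and the coincidence
   set, so the part off it keeps at least the remaining measure. *)
have Flow k : theta - Int \1_(A d `&` coincidence l) <= Int (F k).
  have -> : Int (F k) = Int \1_(bad_set Omega v (m k) `&` A d) - Int (fun x => \1_(coincidence l) x * \1_(bad_set Omega v (m k) `&` A d) x).
    by rewrite -IntB//; apply: eq_Int => x; exact: FE.
  apply: lerB; first exact: ltW.
  apply: le_Int => // x; rewrite (indicR_setI (bad_set Omega v (m k)) (A d)) (indicR_setI (A d) (coincidence l)) !indicE.
  by case: (x \in coincidence l); case: (x \in A d); case: (x \in bad_set _ _ _); rewrite /= ?(mulr0, mulr1, mul0r) ?ler01 ?lexx.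
have Flim : Int \o F @ \oo --> Int (fun _ : 'rV[R]_n.+1 => 0 : R).
  have h := @Int_dct R n.+1 F (fun=> 0) (Num.max 1 M).
  apply: h.
  - by move=> k; exact: BM_mfun.
  - exact: BM_mfun (@BM0 _ _).
  - move=> k x; have /andP[a b] := F01 k x; rewrite ger0_norm// le_max b//.
  - move=> k x; rewrite /F indicE; case: (boolP (x \in _)); last by rewrite mul0r eqxx.
    by rewrite inE => -[_ [/HM h _]] _; rewrite le_max h orbT.
  move=> x; apply: cvg_near_cst.
  suff : \forall k \near \oo, F k x = 0 by [].
  (* Pointwise there are three cases: on the coincidence set F is 0 by definition, points right of
     [l] are eventually right of the planes, and where v < v_l on the left the inequality persists
     by continuity. *)
  have [Cx|nC] := pselect (coincidence l x).
    by near=> k; rewrite /F [X in 1 - X]indicE mem_set// subrr mulr0.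
  have [xl|xl] := lerP (x 0 ord0) l; last first.
    have d0 : 0 < x 0 ord0 - l by rewrite subr_gt0.
    near=> k; rewrite /F indicE memNset ?mul0r// => -[[_ xm _] _].
    have /andP[_ b] := ml k; have c := lt_trans xm b.
    suff : k.+1%:R^-1 < x 0 ord0 - l by rewrite ltrBrDl => /(lt_trans c); rewrite ltxx.
    by near: k; exact: near_infty_natSinv_lt (PosNum d0).
  have w0 : 0 < v (refl l x) - v x.
    by rewrite subr_gt0 lt_neqAle Pl// andbT; apply/eqP => E; apply: nC.
  have cr : continuous_at l (fun mu => v (refl mu x)).
    apply: (@continuous_comp _ _ _ (fun mu => refl mu x) v); last exact: cv.
    apply: continuous_rvD; first exact: for_cst.
    by apply: continuous_rvZ; [apply: continuous_rZ; exact: for_id|exact: for_cst].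
  have /cvgrPdist_lt/(_ _ w0)/nbhs_ballP[r /= r0 hr] := cr.
  near=> k; rewrite /F indicE memNset ?mul0r// => -[[_ _ vm] _].
  have /andP[a b] := ml k.
  have : ball l r (m k).
    rewrite -ball_normE /= -normrN opprB gtr0_norm ?subr_gt0// ltrBlDl.
    apply: lt_trans b _; rewrite ltrD2l; near: k; exact: near_infty_natSinv_lt (PosNum r0).
  by move=> /hr /=; rewrite ltr_norml => /andP[_]; lra.
have : theta - Int \1_(A d `&` coincidence l) <= Int (fun _ : 'rV[R]_n.+1 => 0 : R).
  rewrite -(cvg_lim (@Rhausdorff R) Flim); apply: limr_ge; first by apply/cvg_ex; exists (Int (fun _ : 'rV[R]_n.+1 => 0 : R)).
  by apply: nearW => k; exact: Flow.
by rewrite Int0 subr_le0.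
Unshelve. all: by end_near.
Qed.

(** If the planes could not advance, [weak_comparison] would fail along planes decreasing to [l],
    each with bad noncritical points of measure above theta. In the limit these leave noncritical
    coincidence points of positive measure, and a density point contradicts
    [no_dense_coincidence]. *)
Let step_past l : l < 0 -> P l -> exists2 e : R, 0 < e & forall mu, l <= mu -> mu < l + e -> mu <= 0 -> P mu.
Proof.
move=> l0 Pl; have [d d0 [theta th0 WC]] := weak_comparison p1 S sO cO.
apply: contrapT => nE.
have pick k : exists mu, [/\ l < mu < l + k.+1%:R^-1, mu <= 0 & theta < Int \1_(bad_set Omega v mu `&` A d)].
  apply: contrapT => nk; apply: nE; exists (k.+1%:R^-1); first by rewrite invr_gt0.
  move=> mu; rewrite le_eqVlt => /predU1P[<- _ _//|lm] mk m0.
  apply: WC => //; rewrite leNgt; apply/negP => h; apply: nk; exists mu; split; [by rewrite lm|exact: m0|exact: h].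
have [m Hm] := choice pick.
have T0 : theta <= Int \1_(A d `&` coincidence l).
  by apply: (@bad_limit _ _ _ m) => [k|k|]; [have [] := Hm k|have [] := Hm k|exact: Pl].
(* The points on the plane itself, where coincidence is trivial, are split off as [W]; they form a
   null set. *)
pose Z : set 'rV[R]_n.+1 := A d `&` coincidence l `&` [set x : 'rV[R]_n.+1 | x 0 ord0 < l].
pose W : set 'rV[R]_n.+1 := A d `&` coincidence l `&` [set x : 'rV[R]_n.+1 | x 0 ord0 = l].
have mT : mset (A d `&` coincidence l).
  by apply: msetI; [exact: mset_G S d|exact: closed_mset (@closed_coincidence l)].
have mZ : mset Z.
  apply: msetI => //; apply: open_mset.
  apply: (@open_comp _ _ (fun x : 'rV[R]_n.+1 => x 0 ord0) [set t | t < l]) => [x _|].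
    exact: coord_continuous.
  exact: open_lt.
have mW : mset W.
  apply: msetI => //; apply: closed_mset.
  apply: (@closed_comp _ _ (fun x : 'rV[R]_n.+1 => x 0 ord0) [set l]) => [x _|].
    exact: coord_continuous.
  exact: closed_eq.
have bZ : BM (\1_Z : 'rV[R]_n.+1 -> R) by apply: (BM_sub (BM_A d)) => // x [[]].
have bW : BM (\1_W : 'rV[R]_n.+1 -> R) by apply: (BM_sub (BM_A d)) => // x [[]].
have IZ : 0 < Int (\1_Z : 'rV[R]_n.+1 -> R).
  apply: lt_le_trans th0 _; apply: le_trans T0 _.
  rewrite -[leRHS]addr0 -(@null_hyperplane _ _ ord0 l W bW); last by move=> x [].
  rewrite -IntD//; apply: le_Int; [by apply: (BM_sub (BM_A d)) => // x []|exact: BMD|].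
  move=> x; rewrite indicE; case: (boolP (x \in _)); last by rewrite addr_ge0// indicE ler0n.
  rewrite inE => h; have [_ [xl _]] := h.
  move: xl; rewrite le_eqVlt => /predU1P[E|E].
    by rewrite (_ : \1_W x = 1); [rewrite lerDr indicE ler0n|rewrite indicE mem_set].
  by rewrite (_ : \1_Z x = 1); [rewrite lerDl indicE ler0n|rewrite indicE mem_set].
have [x0 [[[Ox Gx] [_ E]] xl] dens] := density_point mZ bZ IZ.
apply: (no_dense_coincidence l0 Pl Ox xl _ E).
  by rewrite -enorm_gt0; exact: lt_le_trans Gx.
move=> r r0; apply: lt_le_trans (dens r r0) _.
have mb : mset (rbox x0 r) by exact: closed_mset (@closed_rbox _ _ _ _).
apply: le_Int_indic; first by apply: (BM_sub bZ) => [|x []//]; exact: msetI.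
- apply: (BM_sub (@BM_rbox R n.+1 x0 r)) => [|x []//].
  by apply: mset_rbox_eq; [exact: cv|exact: (sys_refl_cont S)].
- by move=> y [[[_ [_ Ey]] _] yr]; split.
Qed.

Theorem moving_planes mu x : mu <= 0 -> x 0 ord0 <= mu -> v x <= v (refl mu x).
Proof.
move=> mu0; suff : P mu by apply.
(* All positions to the left are required, so that the admissible planes form an interval and every
   plane strictly left of the supremum is admissible. *)
pose E : set R := [set l | l <= 0 /\ forall nu, nu <= l -> P nu].
have [nu0 Hnu0] := P_left.
have E0 : E (Num.min nu0 0).
  by split=> [|nu h]; [rewrite ge_min lexx orbT|apply: Hnu0; apply: le_trans h _; rewrite ge_min lexx].
have ubE : ubound E 0 by move=> y [].
have hsE : has_sup E by split; [exists (Num.min nu0 0)|exists 0].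
pose l := sup E.
have Plt nu : nu < l -> P nu.
  move=> /(sup_gt (ex_intro _ _ E0)) h; have [t [_ Ht] nt] := h; exact: Ht (ltW nt).
have Pl : P l by exact: P_closed.
have l0 : l <= 0 by apply: ge_sup; [exists (Num.min nu0 0)|].
have Ple nu : nu <= l -> P nu by rewrite le_eqVlt => /predU1P[->|/Plt].
move: l0; rewrite le_eqVlt => /predU1P[E1|l0]; first by apply: Ple; rewrite E1.
have [e e0 He] := step_past l0 Pl.
exfalso; pose l' := Num.min (l + e / 2) 0.
have ll' : l < l' by rewrite lt_min l0 andbT ltrDl divr_gt0.
have El' : E l'.
  split=> [|nu nl]; first by rewrite ge_min lexx orbT.
  have [h|h] := lerP nu l; first exact: Ple.
  apply: He; [exact: ltW| |by apply: le_trans nl _; rewrite ge_min lexx orbT].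
  apply: le_lt_trans nl _; rewrite gt_min; apply/orP; left.
  by rewrite ltrD2l ltr_pdivrMr// ltr_pMr// ltr1n.
by have := ub_le_sup hsE.2 El'; rewrite leNgt ll'.
Qed.

End moving_planes.

(** * Symmetry, monotonicity and the ball *)

Section symmetry.
Context {R : realType} {n : nat}.
Implicit Types (x y z c q : 'rV[R]_n.+1) (mu t : R).
Variables (Omega : set 'rV[R]_n.+1) (p : R).
Hypotheses (p1 : 1 < p).

Lemma aff_enormB (Q : 'M[R]_n.+1) b x y : Q *m Q^T = 1%:M -> enorm (aff Q b x - aff Q b y) = enorm (x - y).
Proof. by move=> QQ; rewrite /aff opprD addrACA subrr addr0 -mulmxBl enorm_orth. Qed.

Lemma psys_isometry v H (G : 'rV[R]_n.+1 -> 'rV[R]_n.+1) (Q : 'M[R]_n.+1) b :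
  psys Omega p v G H -> Q *m Q^T = 1%:M -> (forall x, Omega (aff Q b x) <-> Omega x) ->
  psys Omega p (fun x => v (aff Q b x)) (fun x => G (aff Q b x) *m Q^T) (fun x => H (aff Q b x)).
Proof.
move=> S QQ OT; have QQ' : Q^T *m Q^T^T = 1%:M by rewrite trmxK; exact: orth_tr.
have OE : aff Q b @^-1` Omega = Omega by apply/seteqP; split=> x /= /OT.
have clT x : closure Omega x -> closure Omega (aff Q b x).
  move=> clx B nB; have nB' : nbhs x (aff Q b @^-1` B) by exact: aff_continuous.
  by have [y [/OT Oy By]] := clx _ nB'; exists (aff Q b y).
have cT (g : 'rV[R]_n.+1 -> R) : continuous g -> continuous (fun x => g (aff Q b x)).
  by move=> cg x; apply: (continuous_comp (@aff_continuous _ _ Q b x)); exact: cg.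
split.
- by rewrite -[X in psol X]OE; apply: psol_aff => //; exact: sys_sol S.
- exact: sys_compact S.
- exact: cT (sys_cont S).
- by move=> x /OT; exact: sys_pos S _.
- by move=> x nO; apply: (sys_out S) => /OT.
(* An orthogonal map preserves the Euclidean norm but not the sup norm of the modulus of continuity;
   passing between the two costs the factor n + 1. *)
- move=> e e0; have [r r0 Hr] := sys_unif S e0; exists (r / n.+1%:R); first by rewrite divr_gt0.
  move=> x y cx cy xy; rewrite -mulmxBl enorm_orth//; apply: Hr; [exact: clT|exact: clT|].
  apply: le_lt_trans (norm_le_enorm _) _; rewrite aff_enormB//.
  by apply: le_lt_trans (enorm_le_norm _) _; rewrite mulrC -ltr_pdivlMr.
- exact: cT (sys_Hcont S).
- by move=> x /OT; exact: sys_Hpos S _.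
- by have [L L0 HL] := sys_lip S; exists L.
- move=> x cx nO; rewrite -enorm_gt0 enorm_orth// enorm_gt0; apply: (sys_hopf S); first exact: clT.
  by move=> /OT.
Qed.

Hypotheses (sO : symmetric_x1 Omega) (cO : strictly_convex_x1 Omega).

(** The points x and x + t e1 are mirror images in the plane through their midpoint. *)
Lemma psys_monotone_x1 v H G x t : psys Omega p v G H -> 0 <= t -> x 0 ord0 + t / 2 <= 0 ->
  v x <= v (x + t *: e1).
Proof.
move=> S t0 xt; have := @moving_planes _ _ _ _ _ _ _ p1 S sO cO (x 0 ord0 + t / 2) x xt.
rewrite refl_shift (_ : 2 * _ = t); last by field.
by apply; rewrite lerDl divr_ge0.
Qed.

(** Planes are moved up to mu = 0 for [v] and for its mirror image, which solves the same problem;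
    the two inequalities are opposite. *)
Lemma psys_symmetric_x1 v H G x : psys Omega p v G H -> v (reflect1 x) = v x.
Proof.
move=> S; have OT y : Omega (refl 0 y) <-> Omega y by rewrite refl_reflect1; exact: iff_sym (sO y).
have S' := psys_isometry S (@refl_mx_orth R n) OT.
have le0 y : y 0 ord0 <= 0 -> v (reflect1 y) = v y.
  move=> y0; rewrite -refl_reflect1; apply/eqP; rewrite eq_le; apply/andP; split.
    have := @moving_planes _ _ _ _ _ _ _ p1 S' sO cO 0 y (lexx _) y0.
    by rewrite -/(refl 0 y) -/(refl 0 (refl 0 y)) reflK.
  exact: (@moving_planes _ _ _ _ _ _ _ p1 S sO cO 0 y).
have [|x0] := lerP (x 0 ord0) 0; first exact: le0.
have := le0 (refl 0 x); rewrite -refl_reflect1 reflK refl_reflect1 => ->//.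
by rewrite -refl_reflect1 refl0; lra.
Qed.

(** Where v is constant the flux vanishes, while a cut-off function tests the positive source to a
    positive value. *)
Lemma psol_not_flat (U : set 'rV[R]_n.+1) v H G (k : R) x : psol U p v G H -> U x ->
  (forall y, U y -> 0 < H y) -> (forall y, U y -> v y = k) -> False.
Proof.
move=> S Ux Hp vk; have /nbhs_ballP[r /= r0 hr] : nbhs x U by apply: open_nbhs_nbhs; split=> //; exact: psol_open S.
have r20 : 0 < r / 2 by rewrite divr_gt0.
have [chi [dchi [tc c01 c1]]] := @cutoff R n.+1 x _ r20.
have tU : tst U chi dchi.
  apply: tst_sub tc => y /=; rewrite mulrC divfK// => yr; apply: hr; rewrite -ball_normE /= -normrN opprB.
  exact: le_lt_trans (norm_le_enorm _) yr.
have G0 y : U y -> G y = 0.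
  move=> Uy; apply: (is_grad_unique (psol_grad S Uy)); apply: (is_grad_near (g := fun=> k)); last exact: is_grad_cst.
  have nU : nbhs y U by apply: open_nbhs_nbhs; split=> //; exact: psol_open S.
  by apply: filterS nU => z /vk.
have [_ _ [K _ [KU out]]] := tU.
have := psol_weak S tU; rewrite (_ : Int _ = 0); last first.
  rewrite -(@Int0 R n.+1); apply: eq_Int => y.
  have [/KU/G0 ->|/out[_ ->]] := pselect (K y); first by rewrite Vf0 dotp0l.
  by rewrite dotp0r.
have bH : CC (fun y => H y * chi y) by apply: (tst_CC_mul (psol_open S) tU); exact: psol_H S.
move=> /esym E; have h : 0 < Int (fun y => H y * chi y).
  apply: (@Int_gt0 _ _ _ x); [exact: CC_BM|exact: bH.1| |].
    move=> y; have [/KU/Hp/ltW h|/out[-> _]] := pselect (K y); last by rewrite mulr0.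
    by apply: mulr_ge0 => //; have /andP[] := c01 y.
  by rewrite (c1 x _).1 ?mulr1 ?subrr ?enorm0 ?divr_ge0 ?(ltW r0)//; exact: Hp.
by rewrite E ltxx in h.
Qed.

Section ball.
Variables (c : 'rV[R]_n.+1) (rho : R) (v H : 'rV[R]_n.+1 -> R) (G : 'rV[R]_n.+1 -> 'rV[R]_n.+1).
Hypotheses (rho0 : 0 < rho) (OE : Omega = eball c rho) (S : psys Omega p v G H).

(** The symmetry of [Omega] is what ties the centre to the plane: otherwise some point c + t e1 of
    the ball would be reflected out of it. *)
Let c0 : c 0 ord0 = 0.
Proof.
have Oc t : `|t| < rho -> Omega (c + t *: e1).
  by move=> tr; rewrite OE /eball /= addrAC subrr add0r enormZ /e1 enorm_delta mulr1.
have h t : `|t| < rho -> `|2 * c 0 ord0 + t| < rho.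
  move=> /Oc /sO; rewrite OE /eball /= => h; apply: le_lt_trans h.
  apply: le_trans (coord_le_enorm _ ord0).
  by rewrite !mxE eqxx /= mulr1 -[leRHS]normrN le_eqVlt; apply/orP; left; apply/eqP; congr (`|_|); ring.
apply/eqP; apply: contrapT => /negP cn.
have cpos : 0 < `|c 0 ord0| by rewrite normr_gt0.
(* Away from the plane by max(0, rho - |c_1|): the point stays in the ball, and its mirror image is
   at distance at least rho + |c_1| from the centre. *)
pose t := Num.sg (c 0 ord0) * Num.max 0 (rho - `|c 0 ord0|).
have t1 : `|t| < rho.
  rewrite normrM normr_sg cn mul1r ger0_norm ?le_max ?lexx// gt_max rho0/= ltrBlDr ltrDl//.
have cE : 2 * c 0 ord0 + t = Num.sg (c 0 ord0) * (2 * `|c 0 ord0| + Num.max 0 (rho - `|c 0 ord0|)).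
  by rewrite /t mulrDr; congr (_ + _); rewrite mulrCA -numEsg.
have := h t t1; rewrite cE normrM normr_sg cn mul1r.
rewrite ger0_norm; last by rewrite addr_ge0 ?mulr_ge0// le_max lexx.
rewrite ltNge => /negP; apply.
have : rho - `|c 0 ord0| <= Num.max 0 (rho - `|c 0 ord0|) by rewrite le_max lexx orbT.
by move: (Num.max _ _) => m; lra.
Qed.

(** The Householder reflection along e1 - q, which exchanges e1 and q. It transports the result for
    the x_1-direction to any direction. *)
Let householder q : enorm q = 1 -> exists2 Q : 'M[R]_n.+1, Q *m Q^T = 1%:M & e1 *m Q = q.
Proof.
move=> q1; have [->|qe] := eqVneq q e1; first by exists 1%:M; rewrite ?trmx1 mulmx1.
pose w : 'rV[R]_n.+1 := e1 - q; have w0 : dotp w w != 0 by rewrite dotp_eq0 subr_eq0 eq_sym.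
have qq : dotp q q = 1 by rewrite -enorm_sqr q1 expr1n.
have ee : dotp (e1 : 'rV[R]_n.+1) e1 = 1 by rewrite -enorm_sqr /e1 enorm_delta expr1n.
have ww : dotp w w = 2 * dotp e1 w.
  by rewrite /w !(dotpBl, dotpBr) qq ee (dotpC q); ring.
pose Q : 'M[R]_n.+1 := 1%:M - (2 / dotp w w) *: (w^T *m w).
have QT : Q^T = Q by rewrite /Q linearB/= linearZ/= trmx1 trmx_mul trmxK.
have xQ x : x *m Q = x - (2 * dotp x w / dotp w w) *: w.
  rewrite /Q mulmxBr mulmx1 -scalemxAr mulmxA; congr (_ - _).
  have -> : x *m w^T = (dotp x w)%:M by apply/matrixP => i j; rewrite !ord1 -dotpE mxE eqxx.
  by rewrite mul_scalar_mx scalerA mulrAC.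
exists Q.
  rewrite QT; apply/row_matrixP => i; rewrite !rowE mulmxA !xQ mulmx1 (dotpBl (delta_mx 0 i)) dotpZl.
  rewrite -addrA -opprD -scalerDl.
  move: w0; move: (dotp w w) (dotp (delta_mx 0 i) w) => ww' d ww0.
  by rewrite (_ : 2 * d / ww' + _ = 0) ?scale0r ?subr0//; field.
rewrite xQ ww mulfV ?scale1r; first by rewrite /w opprB addrC subrK.
by rewrite -ww.
Qed.

Let directional q x t : enorm q = 1 -> 0 <= t -> dotp (x - c) q + t / 2 <= 0 -> v x <= v (x + t *: q).
Proof.
move=> q1 t0 xt; have [Q QQ eQ] := householder q1.
pose b := c - c *m Q.
have TE y : aff Q b y - c = (y - c) *m Q by rewrite /aff /b mulmxBl addrA addrAC addrK.
have OT y : Omega (aff Q b y) <-> Omega y by rewrite OE /eball /= TE enorm_orth.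
have S' := psys_isometry S QQ OT; have QQ' := orth_tr QQ.
pose y := (x - c) *m Q^T + c.
have Ty s : aff Q b (y + s *: e1) = x + s *: q.
  apply: (addIr (- c)); rewrite TE addrAC /y addrK mulmxDl -mulmxA QQ' mulmx1 -scalemxAl eQ.
  by rewrite addrAC.
have := psys_monotone_x1 S' t0 (x := y); rewrite Ty; have := Ty 0; rewrite !scale0r !addr0 => ->; apply.
suff -> : y 0 ord0 = dotp (x - c) q by [].
rewrite /y mxE c0 addr0 -(dotp_delta _ ord0) -(dotp_orth QQ) -mulmxA QQ' mulmx1.
by rewrite -/e1 eQ.
Qed.

(** In the direction from x to y, with t = |y - x|, the hypothesis of [directional] says that the
    midpoint is on the near side of the hyperplane through c, and this amounts to |y - c| <= |x -
    c|. *)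
Lemma psys_radial x y : enorm (y - c) <= enorm (x - c) -> v x <= v y.
Proof.
move=> yx; have [->//|xy] := eqVneq x y.
pose t := enorm (y - x); have t0 : 0 < t by rewrite enorm_gt0 subr_eq0 eq_sym.
have E : x + t *: (t^-1 *: (y - x)) = y by rewrite scalerA mulfV ?gt_eqF// scale1r addrC subrK.
rewrite -E; apply: directional; last first.
- rewrite dotpZr; have tt : t * t = dotp (y - x) (y - x) by rewrite -expr2 enorm_sqr.
  have : enorm (y - c) ^+ 2 <= enorm (x - c) ^+ 2 by rewrite ler_pXn2r ?nnegrE ?enorm_ge0.
  rewrite !enorm_sqr; have -> : y - c = (x - c) + (y - x) by rewrite [RHS]addrC addrA subrK.
  rewrite !(dotpDl (x - c), dotpDr (x - c)) (dotpC (y - x) (x - c)) -tt => h.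
  have -> : t^-1 * dotp (x - c) (y - x) + t / 2 = (2 * dotp (x - c) (y - x) + t * t) / (2 * t).
    by field; rewrite gt_eqF.
  by rewrite ler_pdivrMr ?mulr_gt0// mul0r; lra.
- exact: ltW.
- by rewrite enormZ gtr0_norm ?invr_gt0// mulVf// gt_eqF.
Qed.

Lemma psys_radial_strict x y : enorm (y - c) < enorm (x - c) -> enorm (x - c) <= rho -> v x < v y.
Proof.
move=> yx xr; rewrite lt_neqAle psys_radial ?ltW// andbT; apply/eqP => E.
have x0 : 0 < enorm (x - c) by apply: le_lt_trans yx; exact: enorm_ge0.
pose U : set 'rV[R]_n.+1 := [set z | enorm (y - c) < enorm (z - c) < enorm (x - c)].
have oU : open U.
  apply: (@open_comp _ _ (fun z : 'rV[R]_n.+1 => enorm (z - c)) [set t | enorm (y - c) < t < enorm (x - c)]).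
    by move=> z _; apply: continuous_enorm; apply: continuous_rvB; [exact: for_id|exact: for_cst].
  rewrite (_ : [set t | _] = [set t | enorm (y - c) < t] `&` [set t | t < enorm (x - c)]).
    by apply: openI; [exact: open_gt|exact: open_lt].
  by apply/seteqP; split=> s /= => [/andP[]|[-> ->]].
have UO : U `<=` Omega by move=> z /andP[_ zx]; rewrite OE /eball /=; exact: lt_le_trans xr.
pose s := (enorm (y - c) + enorm (x - c)) / (2 * enorm (x - c)).
have s0 : 0 <= s by rewrite divr_ge0 ?addr_ge0 ?mulr_ge0 ?enorm_ge0.
apply: (@psol_not_flat U v H G (v x) (c + s *: (x - c)) (psol_sub oU UO (sys_sol S))).
- rewrite /U /= addrAC subrr add0r enormZ ger0_norm//.
  rewrite (_ : s * _ = (enorm (y - c) + enorm (x - c)) / 2); last by rewrite /s; field; rewrite gt_eqF.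
  by move: yx; move: (enorm (y - c)) (enorm (x - c)) => a b ab; apply/andP; split; lra.
- by move=> z /UO; exact: sys_Hpos S _.
- move=> z /andP[yz zx]; apply/eqP; rewrite eq_le {1}E; apply/andP; split.
    by apply: psys_radial; exact: ltW.
  by apply: psys_radial; exact: ltW.
Qed.

End ball.

End symmetry.

(** * Reduction to the p-Laplace equation *)

Section real_functions.
Context {R : realType}.
Implicit Types (a f : R -> R) (s t M p eta : R).

(** Local Lipschitz continuity provides a constant around each pair of points; the square of pairs
    in [0, M] is compact, and larger constants remain valid. *)
Lemma lipschitz_segment f M : [locally [lipschitz f x | x in [set s : R | 0 <= s]]] ->
  exists2 L : R, 0 <= L & forall s t, 0 <= s <= M -> 0 <= t <= M -> `|f s - f t| <= L * `|s - t|.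
Proof.
move=> lf; pose K : set (R * R) := `[0, M]%classic `*` `[0, M]%classic.
have cK : compact K by apply: compact_setX; exact: segment_compact.
pose P (L : R) (z : R * R) := 0 <= z.1 -> 0 <= z.2 -> `|f z.1 - f z.2| <= L * `|z.1 - z.2|.
have h : \forall L \near +oo, K `<=` P L.
  move/compact_near_coveringP : cK => cK.
  apply: (cK R (+oo)%R P) => z [/= z1 z2].
  have Az : ([set s : R | 0 <= s] `*` [set s : R | 0 <= s]) z.
    by move: z1 z2; rewrite !in_itv/= => /andP[z1 _] /andP[z2 _].
  have [L0 [_ HL]] := lf z Az.
  have l1 : L0 < L0 + 1 by rewrite ltrDl.
  have {}HL := HL _ l1.
  have n1 : \forall y \near z, 0 <= y.1 -> 0 <= y.2 -> `|f y.1 - f y.2| <= (L0 + 1) * `|y.1 - y.2|.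
    have h1 : nbhs z [set y : R * R | ([set s : R | 0 <= s] `*` [set s : R | 0 <= s]) y ->
        `|f y.1 - f y.2| <= (L0 + 1) * `|y.1 - y.2|] by exact: HL.
    by apply: filterS h1 => y hy y1 y2; exact: (hy (conj y1 y2)).
  have n2 : \forall L \near +oo, L0 + 1 <= L by apply: nbhs_pinfty_ge; exact: num_real.
  exists ([set y | 0 <= y.1 -> 0 <= y.2 -> `|f y.1 - f y.2| <= (L0 + 1) * `|y.1 - y.2|], [set L | L0 + 1 <= L]) => //.
  move=> [y L] /= [hy hL] y1 y2; apply: le_trans (hy y1 y2) _; exact: ler_wpM2r.
have [L [L0 HL]] : exists L : R, 0 <= L /\ K `<=` P L.
  by near (+oo : set_system R) => L; exists L; split; near: L => //; apply: nbhs_pinfty_ge; exact: num_real.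
exists L => // s t /andP[s0 sM] /andP[t0 tM]; apply: (HL (s, t)) => //.
by split; rewrite /= in_itv /= ?s0 ?t0.
Unshelve. all: by end_near.
Qed.

Lemma lipschitz_C1 a M : (forall s, derivable a s 1) -> continuous (derive1 a) ->
  exists2 L : R, 0 <= L & forall s t, 0 <= s <= M -> 0 <= t <= M -> `|a s - a t| <= L * `|s - t|.
Proof.
move=> da ca; have /compact_bounded[K [_ HK]] := continuous_compact (continuous_subspaceT ca) (@segment_compact R 0 M).
pose L := `|K| + 1; have L0 : 0 <= L by rewrite addr_ge0.
have HL s : 0 <= s <= M -> `|derive1 a s| <= L.
  by move=> h; apply: (HK L); [rewrite ltr_pwDr// ler_norm|exists s => //=; rewrite in_itv].
have ac : continuous a by move=> s; apply: differentiable_continuous; apply/derivable1_diffP.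
exists L => //; suff H s t : s <= t -> 0 <= s <= M -> 0 <= t <= M -> `|a t - a s| <= L * `|t - s|.
  move=> s t hs ht; have [st|/ltW st] := leP s t; last exact: H.
  by rewrite distrC (distrC s); exact: H.
move=> st /andP[s0 sM] /andP[t0 tM].
have [||c + ->] := @MVT_segment R a (derive1 a) s t st.
- by move=> x _; apply: DeriveDef => //; rewrite derive1E.
- exact: continuous_subspaceT.
rewrite in_itv /= => /andP[sc ct]; rewrite normrM; apply: ler_wpM2r => //; apply: HL.
by rewrite (le_trans s0 sc) (le_trans ct tM).
Qed.

Section change_of_variable.
Variables (a : R -> R) (eta p : R).
Hypotheses (Ca : class_C2 a) (eta0 : 0 < eta) (ha : forall s, 0 <= s -> eta <= a s) (p1 : 1 < p).

Let a_gt0 s : 0 <= s -> 0 < a s. Proof. by move=> /ha; exact: lt_le_trans. Qed.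

Lemma class_C2_continuous : continuous a.
Proof.
by case: Ca => da _ _ s; apply: differentiable_continuous; apply/derivable1_diffP; exact: da.
Qed.

Lemma class_C2_continuous_derive1 : continuous (derive1 a).
Proof.
by case: Ca => _ da _ s; apply: differentiable_continuous; apply/derivable1_diffP; exact: da.
Qed.

(** The p-th root of [a]. The lower bound on [a] is available for s >= 0 only, and the truncation
    keeps the root positive and continuous on the whole line. *)
Definition proot s := a (Num.max s 0) `^ p^-1.

Lemma continuous_proot : continuous proot.
Proof.
move=> s; apply: continuous_powR_at; first by apply: a_gt0; rewrite le_max lexx orbT.
apply: (@continuous_comp _ _ _ (fun s : R => Num.max s 0) a); last exact: class_C2_continuous.
by apply: continuous_max; [exact: for_id|exact: for_cst].
Qed.

Lemma proot_pos s : 0 <= s -> proot s = a s `^ p^-1.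
Proof. by move=> s0; rewrite /proot max_l. Qed.

Lemma proot_ge s : eta `^ p^-1 <= proot s.
Proof.
have s0 : 0 <= Num.max s 0 by rewrite le_max lexx orbT.
apply: ge0_ler_powR; rewrite ?nnegrE ?invr_ge0 ?(ltW eta0) ?(ltW (a_gt0 s0))//; last exact: ha.
by apply: ltW; exact: lt_trans p1.
Qed.

Lemma proot_gt0 s : 0 < proot s.
Proof. by apply: lt_le_trans (proot_ge s); exact: powR_gt0. Qed.

(* The primitive is based at -1 so that it is differentiable at 0. *)
Definition primitive s : R := (\int[lebesgue_measure]_(t in `[(-1), s]) proot t)%R -
  (\int[lebesgue_measure]_(t in `[(-1), 0%R]) proot t)%R.

Lemma primitive0 : primitive 0 = 0. Proof. exact: subrr. Qed.

Lemma is_derive_primitive s : 0 <= s -> is_derive s (1 : R) primitive (proot s).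
Proof.
move=> s0; have s1 : s < s + 1 by rewrite ltrDl.
have I : lebesgue_measure.-integrable `[(-1), (s + 1)] (EFin \o proot).
  apply: continuous_compact_integrable; first exact: segment_compact.
  by apply: continuous_subspaceT; exact: continuous_proot.
have m1s : -1 < s by lra.
have [d E] := continuous_FTC1_closed s1 I m1s (@continuous_proot s).
rewrite -[proot s]subr0; apply: is_deriveB.
by apply: DeriveDef; [exact: d|rewrite -derive1E; exact: E].
Qed.

Lemma primitive_ge s t : 0 <= s -> s <= t -> eta `^ p^-1 * (t - s) <= primitive t - primitive s.
Proof.
move=> s0 st; have [||c + ->] := @MVT_segment R primitive proot s t st.
- by move=> x; rewrite in_itv /= => /andP[sx _]; apply: is_derive_primitive; exact: le_trans (ltW sx).
- apply: continuous_in_subspaceT => x; rewrite inE /= in_itv /= => /andP[sx _].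
  have [d _] := is_derive_primitive (le_trans s0 sx).
  by apply: differentiable_continuous; apply/derivable1_diffP.
by move=> _; apply: ler_wpM2r; [rewrite subr_ge0|exact: proot_ge].
Qed.

Lemma primitive_lt s t : 0 <= s -> s < t -> primitive s < primitive t.
Proof.
move=> s0 st; rewrite -subr_gt0; apply: lt_le_trans (primitive_ge s0 (ltW st)).
by rewrite mulr_gt0 ?powR_gt0// subr_gt0.
Qed.

Lemma primitive_dist s t : 0 <= s -> 0 <= t -> `|s - t| <= (eta `^ p^-1)^-1 * `|primitive s - primitive t|.
Proof.
have q0 : 0 < eta `^ p^-1 by exact: powR_gt0.
move=> s0 t0; rewrite mulrC ler_pdivlMr//; have [st|/ltW st] := lerP s t.
  rewrite mulrC; apply: le_trans (primitive_ge s0 st) _.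
  by rewrite distrC; exact: ler_norm.
rewrite mulrC; apply: le_trans (primitive_ge t0 st) _.
exact: ler_norm.
Qed.

Lemma lipschitz_quotient f M : [locally [lipschitz f x | x in [set s : R | 0 <= s]]] -> 0 <= M ->
  exists2 L : R, 0 <= L & forall s t, 0 <= s <= M -> 0 <= t <= M ->
    `|f s / proot s - f t / proot t| <= L * `|s - t|.
Proof.
move=> lf M0; have [L1 L10 H1] := lipschitz_segment M lf.
have [da _ _] := Ca; have [L2 L20 H2] := @lipschitz_C1 a M da class_C2_continuous_derive1.
have p0 : 0 < p by exact: lt_trans p1.
pose am := a 0 + L2 * M.
have Ha s : 0 <= s <= M -> eta <= a s <= am.
  move=> hs; have /andP[s0 sM] := hs; rewrite ha//=.
  have z0 : 0 <= (0 : R) <= M by rewrite lexx.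
  have := H2 s 0 hs z0; rewrite subr0 (ger0_norm s0) => /(le_trans (ler_norm _)).
  have : L2 * s <= L2 * M by apply: ler_wpM2l.
  rewrite /am; lra.
pose L3 := `|p^-1| * (eta `^ (p^-1 - 1) + am `^ (p^-1 - 1)) * L2.
have H3 s t : 0 <= s <= M -> 0 <= t <= M -> `|proot s - proot t| <= L3 * `|s - t|.
  move=> hs ht; have [/andP[s0 _] /andP[t0 _]] := (hs, ht); rewrite !proot_pos//.
  apply: le_trans (powR_lipschitz _ eta0 (Ha _ hs) (Ha _ ht)) _.
  by rewrite /L3 -!mulrA; do 2 (apply: ler_wpM2l; first by rewrite ?addr_ge0 ?powR_ge0); exact: H2.
have L30 : 0 <= L3 by rewrite /L3 !mulr_ge0// addr_ge0// powR_ge0.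
pose b := eta `^ p^-1; have b0 : 0 < b by exact: powR_gt0.
pose F := `|f 0| + L1 * M.
have HF t : 0 <= t <= M -> `|f t| <= F.
  move=> ht; have /andP[t0 tM] := ht; have z0 : 0 <= (0 : R) <= M by rewrite lexx.
  have := H1 t 0 ht z0; rewrite subr0 (ger0_norm t0) => h.
  rewrite -[f t](subrK (f 0)) addrC; apply: le_trans (ler_normD _ _) _; rewrite /F lerD2l.
  by apply: le_trans h _; exact: ler_wpM2l.
exists (L1 / b + F * L3 / (b * b)).
  have F0 : 0 <= F by rewrite addr_ge0// mulr_ge0.
  have bb : 0 <= b * b by rewrite mulr_ge0 ?(ltW b0).
  by apply: addr_ge0; apply: divr_ge0; rewrite ?(ltW b0) ?(mulr_ge0 F0).
move=> s t hs ht; have bs := proot_ge s; have bt := proot_ge t.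
have ps := proot_gt0 s; have pt := proot_gt0 t.
have -> : f s / proot s - f t / proot t = (f s - f t) / proot s + f t * (proot t - proot s) / (proot s * proot t).
  by field; rewrite !gt_eqF.
apply: le_trans (ler_normD _ _) _; rewrite [leRHS]mulrDl; apply: lerD.
  rewrite normrM mulrAC [X in _ * X]ger0_norm ?invr_ge0 ?(ltW ps)//.
  apply: ler_pM => //; [by rewrite invr_ge0 ltW|exact: H1|by rewrite lef_pV2 ?posrE].
have pp : 0 < proot s * proot t by rewrite mulr_gt0.
rewrite normrM [X in _ * X]ger0_norm ?invr_ge0 ?(ltW pp)// mulrAC.
apply: ler_pM => //; first by rewrite invr_ge0 ltW.
  rewrite normrM -mulrA; apply: ler_pM => //; first exact: HF.
  by rewrite distrC; exact: H3.
rewrite lef_pV2 ?posrE ?mulr_gt0//; apply: ler_pM => //; exact: ltW.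
Qed.

Lemma is_derive_proot_inv s : 0 < s ->
  is_derive s (1 : R) (fun t => (proot t)^-1) (- p^-1 * (proot s)^-1 / a s * derive1 a s).
Proof.
move=> s0; have a0 := a_gt0 (ltW s0); have [da _ _] := Ca.
have d1 : is_derive s (1 : R) a (derive1 a s) by apply: DeriveDef => //; rewrite derive1E.
have d2 := is_derive1_powR (- p^-1) a0.
have d3 : is_derive s (1 : R) ((fun t => t `^ (- p^-1)) \o a) (- p^-1 * a s `^ (- p^-1 - 1) * derive1 a s).
  exact: is_derive1_comp.
have E : \near s, (((fun t => t `^ (- p^-1)) \o a) s = (proot s)^-1).
  have n0 : \forall t \near s, 0 < t by apply: lt_nbhsr.
  by apply: filterS n0 => t t0 /=; rewrite proot_pos ?(ltW t0)// powRN.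
have -> : - p^-1 * (proot s)^-1 / a s * derive1 a s = - p^-1 * a s `^ (- p^-1 - 1) * derive1 a s.
  rewrite proot_pos ?(ltW s0)// powRB ?(gt_eqF a0)// ?implybT// powRr1 ?(ltW a0)// powRN.
  by ring.
by apply: near_eq_is_derive E d3.
Qed.

End change_of_variable.

End real_functions.

(** * From the quasilinear equation to the p-Laplace equation *)

Section transformation.
Context {R : realType} {n : nat}.
Implicit Types (x y z : 'rV[R]_n.+1) (g h phi psi : 'rV[R]_n.+1 -> R).

Lemma near_continuous_at (T : topologicalType) (V : normedModType R) (t : T) (F : T -> V) :
  (forall e : R, 0 < e -> \forall s \near t, `|F t - F s| < e) -> continuous_at t F.
Proof. by move=> h; apply/cvgrPdist_lt. Qed.

Lemma continuous_at_near (T : topologicalType) (V : normedModType R) (t : T) (F : T -> V) (e : R) :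
  continuous_at t F -> 0 < e -> \forall s \near t, `|F t - F s| < e.
Proof. by move=> /cvgrPdist_lt; exact. Qed.

Lemma integral_Rn_Int (D : set 'rV[R]_n.+1) g h : (forall x, D x -> g x = h x) ->
  (forall x, ~ D x -> h x = 0) -> integral_Rn D g = Int h.
Proof.
move=> gh h0; rewrite /integral_Rn Rintegral_mkcond; apply: eq_Rintegral => t _.
rewrite patchE; case: ifPn => [|/negP nD]; first by rewrite inE => /gh.
by rewrite h0// => Dt; apply: nD; rewrite inE.
Qed.

Lemma tst_test_function (D : set 'rV[R]_n.+1) phi dphi : tst D phi dphi -> smooth setT phi ->
  test_function D phi.
Proof.
move=> [_ _ [K cK [KD out]]] sphi.
have clK : closure [set x | phi x != 0] `<=` K.
  have cl := compact_closed_rV cK.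
  move=> x clx; apply: cl => W nW; have [y [/= py Wy]] := clx _ nW; exists y; split=> //.
  by apply: contrapT => /out[E _]; rewrite E eqxx in py.
split=> //; last by move=> x /clK /KD.
exact: (subclosed_compact (@closed_closure _ _) cK clK).
Qed.

Variables (Omega : set 'rV[R]_n.+1) (p : R) (a f : R -> R) (eta : R) (u : 'rV[R]_n.+1 -> R)
  (G0 : 'rV[R]_n.+1 -> 'rV[R]_n.+1).
Hypotheses (oO : open Omega) (cmp : compact (closure Omega)) (sb : smooth_boundary Omega).
Hypotheses (p1 : 1 < p) (Ca : class_C2 a) (eta0 : 0 < eta) (ha : forall s, 0 <= s -> eta <= a s).
Hypotheses (lf : [locally [lipschitz f x | x in [set s : R | 0 <= s]]]) (fpos : forall s, 0 < s -> 0 < f s).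
Hypotheses (cu : {within closure Omega, continuous u}) (Cu : class_C 1 Omega u)
  (cG0 : {within closure Omega, continuous G0}) (G0E : forall x, Omega x -> G0 x = grad u x)
  (upos : forall x, Omega x -> 0 < u x) (ubd : forall x, boundary Omega x -> u x = 0).
Hypothesis wk : forall phi, test_function Omega phi ->
  integral_Rn Omega (fun x =>
    a (u x) * enorm (grad u x) `^ (p - 2) * dotp (grad u x) (grad phi x))
  + p^-1 * integral_Rn Omega (fun x => derive1 a (u x) * enorm (grad u x) `^ p * phi x)
  = integral_Rn Omega (fun x => f (u x) * phi x).

(** The values of u outside the closure of [Omega] are arbitrary; extended by zero it is continuous
    everywhere. *)
Let ub : 'rV[R]_n.+1 -> R := cut (closure Omega) u.

Let ub_in x : Omega x -> ub x = u x.
Proof. by move=> Ox; rewrite /ub cut_in//; exact: subset_closure. Qed.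

Let ub_out x : ~ Omega x -> ub x = 0.
Proof.
move=> nO; have [cx|ncx] := pselect (closure Omega x); last by rewrite /ub cut_out.
by rewrite /ub cut_in// ubd//; split=> // /interior_subset.
Qed.

Let ub_ge0 x : 0 <= ub x.
Proof.
by have [Ox|/ub_out ->//] := pselect (Omega x); rewrite ub_in// ltW// upos.
Qed.

Let within_dist (V : normedModType R) (F : 'rV[R]_n.+1 -> V) x (e : R) : {within closure Omega, continuous F} ->
  closure Omega x -> 0 < e -> exists2 r : R, 0 < r & forall y, `|x - y| < r -> closure Omega y -> `|F x - F y| < e.
Proof.
move=> /subspace_continuousP cF cx e0; have := cF x cx => /cvgrPdist_lt/(_ _ e0) h.
have {}h : nbhs x [set y | closure Omega y -> `|F x - F y| < e] by exact: h.
have /nbhs_ballP[r /= r0 hr] := h; exists r => // y xy; apply: hr.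
by rewrite -ball_normE.
Qed.

Let near_ub x : Omega x -> \forall y \near x, ub y = u y.
Proof.
move=> Ox; have nx : nbhs x Omega by apply: open_nbhs_nbhs.
by apply: filterS nx => y; exact: ub_in.
Qed.

Let gu x : Omega x -> is_grad ub x (G0 x).
Proof.
move=> Ox; have [gx _] := class_C1_grad oO Cu; rewrite G0E//.
by apply: is_grad_near (gx x Ox); apply: filterS (near_ub Ox) => y ->.
Qed.

Let cub : continuous ub.
Proof.
move=> x; have [Ox|nO] := pselect (Omega x); first exact: is_grad_continuous (gu Ox).
apply: near_continuous_at => e e0; have [cx|ncx] := pselect (closure Omega x); last first.
  have o : open (~` closure Omega) by apply: closed_openC; exact: closed_closure.
  have nx : nbhs x (~` closure Omega) by apply: open_nbhs_nbhs.
  by apply: filterS nx => y ncy; rewrite /ub !cut_out// subrr normr0.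
have [r r0 hr] := within_dist cu cx e0; apply/nbhs_ballP; exists r => //= y.
rewrite -ball_normE /= => xy; have [cy|ncy] := pselect (closure Omega y).
  by rewrite /ub !cut_in//; exact: hr.
by rewrite ub_out// /ub cut_out// subrr normr0.
Qed.

Let cG x : Omega x -> continuous_at x G0.
Proof.
move=> Ox; have [_ cx] := class_C1_grad oO Cu.
have nx : nbhs x Omega by apply: open_nbhs_nbhs.
have := cx x Ox; rewrite /continuous_at G0E// => h.
move/cvgrPdist_lt : h => h; rewrite -G0E//; apply: near_continuous_at => e e0.
rewrite G0E//; have := h e e0.
by apply: filterS2 nx => y Oy; rewrite G0E.
Qed.

Let bounded_ub : exists2 M : R, 0 <= M & forall x, 0 <= ub x <= M.
Proof.
have [M M0 HM] := continuous_bounded cmp (continuous_subspaceT cub).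
exists M => [|x]; first exact: ltW.
rewrite ub_ge0 /=; have [/subset_closure cx|/ub_out ->] := pselect (Omega x); last exact: ltW.
exact: le_trans (ler_norm _) (HM x cx).
Qed.

Let b := proot a p.
Let v x := primitive a p (ub x).
(** Built from [G0], the continuous extension of the gradient of u, so that it is meaningful on the
    boundary, where Hopf's lemma is applied. *)
Let G x := b (ub x) *: G0 x.
Let H x := f (ub x) / b (ub x).
Let a_gt0 x : 0 < a (ub x). Proof. by apply: lt_le_trans (ha (ub_ge0 x)). Qed.
Let b_gt0 s : 0 < b s. Proof. exact: (proot_gt0 eta0 ha p1). Qed.

Let cb : continuous (fun x => b (ub x)).
Proof. by move=> x; apply: continuous_rcomp; [exact: cub|exact: (@continuous_proot _ a eta p Ca eta0 ha)]. Qed.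

Let cbV : continuous (fun x => (b (ub x))^-1).
Proof. by move=> x; apply: continuous_rV; [rewrite gt_eqF|exact: cb]. Qed.

Let ca' : continuous (fun x => derive1 a (ub x)).
Proof. by move=> x; apply: continuous_rcomp; [exact: cub|exact: class_C2_continuous_derive1]. Qed.

Let ca : continuous (fun x => a (ub x)).
Proof. by move=> x; apply: continuous_rcomp; [exact: cub|exact: class_C2_continuous]. Qed.

Let lipschitz_continuous (k : 'rV[R]_n.+1 -> R) (L : R) : 0 <= L ->
  (forall x y, `|k x - k y| <= L * `|ub x - ub y|) -> continuous k.
Proof.
move=> L0 HL x; apply: near_continuous_at => e e0.
have q0 : 0 < e / (L + 1) by rewrite divr_gt0// ltr_wpDl.
have := continuous_at_near (@cub x) q0; apply: filterS => y h; apply: le_lt_trans (HL x y) _.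
apply: (@le_lt_trans _ _ ((L + 1) * `|ub x - ub y|)).
  by apply: ler_wpM2r => //; rewrite lerDl.
by rewrite mulrC -ltr_pdivlMr// ltr_wpDl.
Qed.

Let cf : continuous (fun x => f (ub x)).
Proof.
have [M M0 HM] := bounded_ub; have [L L0 HL] := lipschitz_segment M lf.
by apply: (lipschitz_continuous L0) => x y; exact: HL.
Qed.

Let H_lip : exists2 L : R, 0 <= L & forall x y, `|H x - H y| <= L * `|ub x - ub y|.
Proof.
have [M M0 HM] := bounded_ub; have [L L0 HL] := lipschitz_quotient Ca eta0 ha p1 lf M0.
by exists L => // x y; exact: HL.
Qed.

Let cH : continuous H.
Proof. by have [L L0 HL] := H_lip; exact: lipschitz_continuous L0 HL. Qed.

Let E x := enorm (G0 x) `^ p.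
Let cE x : Omega x -> continuous_at x E.
Proof. by move=> Ox; apply: continuous_enorm_powR; [apply: ltW; exact: lt_trans p1|exact: cG]. Qed.

Let A x := a (ub x) *: Vf p (G0 x).
Let B x := f (ub x) - p^-1 * (derive1 a (ub x) * E x).

Let cA x : Omega x -> continuous_at x A.
Proof. by move=> Ox; apply: continuous_rvZ; [exact: ca|apply: continuous_Vf => //; exact: cG]. Qed.

Let cB x : Omega x -> continuous_at x B.
Proof.
move=> Ox; apply: continuous_rB; first exact: cf.
by apply: continuous_rZ; apply: continuous_rM; [exact: ca'|exact: cE].
Qed.

Let weakAB phi dphi : tst Omega phi dphi -> smooth setT phi ->
  Int (fun x => dotp (A x) (dphi x)) = Int (fun x => B x * phi x).
Proof.
move=> t sphi; have [gphi _ [K cK [KO out]]] := t.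
have out0 x : ~ Omega x -> phi x = 0 /\ dphi x = 0 by move=> nO; apply: out => /KO.
have := wk (tst_test_function t sphi).
rewrite (@integral_Rn_Int _ _ (fun x => dotp (A x) (dphi x))); first last.
- by move=> x /out0[_ ->]; rewrite dotp0r.
- by move=> x Ox; rewrite /A /Vf !dotpZl ub_in// G0E// (is_grad_grad (gphi x)) mulrA.
rewrite (@integral_Rn_Int _ _ (fun x => (derive1 a (ub x) * E x) * phi x)); first last.
- by move=> x /out0[-> _]; rewrite mulr0.
- by move=> x Ox; rewrite /E (ub_in Ox) (G0E Ox).
rewrite (@integral_Rn_Int _ _ (fun x => f (ub x) * phi x)); first last.
- by move=> x /out0[-> _]; rewrite mulr0.
- by move=> x Ox; rewrite ub_in.
have b1 : BM (fun x => (derive1 a (ub x) * E x) * phi x).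
  by apply: CC_BM; apply: (tst_CC_mul oO t) => x Ox; apply: continuous_rM; [exact: ca'|exact: cE].
have b2 : BM (fun x => f (ub x) * phi x).
  by apply: CC_BM; apply: (tst_CC_mul oO t) => x Ox; exact: cf.
have -> : Int (fun x => B x * phi x) = Int (fun x => f (ub x) * phi x) - p^-1 * Int (fun x => (derive1 a (ub x) * E x) * phi x).
  rewrite -(IntZ p^-1 b1) -IntB//; last exact: BM_scale.
  by apply: eq_Int => x; rewrite /B mulrBl -!mulrA.
by move=> <-; rewrite addrK.
Qed.

Let Vf_G x : Vf p (G x) = (a (ub x) / b (ub x)) *: Vf p (G0 x).
Proof.
have b0 := b_gt0 (ub x); have p0 : 0 < p by exact: lt_trans p1.
have -> : a (ub x) = b (ub x) `^ p.
  by rewrite /b proot_pos// -powRrM mulVf ?gt_eqF// powRr1// ltW.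
rewrite /Vf /G enormZ gtr0_norm// powRM ?enorm_ge0 ?(ltW b0)// !scalerA; congr (_ *: _).
have -> : b (ub x) `^ p = b (ub x) `^ (p - 2) * b (ub x) * b (ub x).
  by rewrite powR_sub2 ?(ltW b0)// powR_sub1 ?(ltW b0).
by field; rewrite gt_eqF.
Qed.

(* Test functions of the form psi / a(u)^(1/p) absorb the term in a'(u). *)
Let weak_v psi dpsi : tst Omega psi dpsi ->
  Int (fun x => dotp (Vf p (G x)) (dpsi x)) = Int (fun x => H x * psi x).
Proof.
move=> t.
pose h x := (b (ub x))^-1.
pose dh x := (- p^-1 * (b (ub x))^-1 / a (ub x) * derive1 a (ub x)) *: G0 x.
have gh x : Omega x -> is_grad h x (dh x).
  move=> Ox; apply: (@is_grad_comp _ _ (fun s => (b s)^-1) ub); first exact: gu.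
  by apply: (@is_derive_proot_inv _ a eta p Ca eta0 ha); rewrite ub_in//; exact: upos.
have ch x : Omega x -> continuous_at x dh.
  move=> Ox; apply: continuous_rvZ; last exact: cG.
  apply: continuous_rM; last exact: ca'.
  apply: continuous_rM; first by apply: continuous_rZ; exact: cbV.
  by apply: continuous_rV; [rewrite gt_eqF|exact: ca].
have th := tst_mul oO t gh ch.
have := weak_form_C1 oO cA cB weakAB th.
(* The contribution of a'(u): on the left it comes from differentiating the factor 1/b, on the right
   from the lower-order term of [B]. The two are equal and cancel. *)
pose k x := - p^-1 * (b (ub x))^-1 * (derive1 a (ub x) * E x).
have bk : BM (fun x => k x * psi x).
  apply: CC_BM; apply: (tst_CC_mul oO t) => x Ox; apply: continuous_rM.
    by apply: continuous_rZ; exact: cbV.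
  by apply: continuous_rM; [exact: ca'|exact: cE].
have b1 : BM (fun x => dotp (Vf p (G x)) (dpsi x)).
  apply: CC_BM; apply: (tst_CC_dot oO t) => x Ox; apply: continuous_Vf => //.
  by apply: continuous_rvZ; [exact: cb|exact: cG].
have b2 : BM (fun x => H x * psi x) by apply: CC_BM; apply: (tst_CC_mul oO t) => x _; exact: cH.
have -> : Int (fun x => dotp (A x) (h x *: dpsi x + psi x *: dh x)) =
    Int (fun x => dotp (Vf p (G x)) (dpsi x) + k x * psi x).
  apply: eq_Int => x; rewrite dotpDr Vf_G /A /dh /k /h.
  have : dotp (Vf p (G0 x)) (G0 x) = E x by exact: dotp_Vf.
  move: (Vf p (G0 x)) => w wE; rewrite !(dotpZl, dotpZr) wE; move: (dotp w (dpsi x)) => q; have a0 := a_gt0 x; have b0 := b_gt0 (ub x).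
  by field; rewrite !gt_eqF// (lt_trans _ p1).
have -> : Int (fun x => B x * (h x * psi x)) = Int (fun x => H x * psi x + k x * psi x).
  by apply: eq_Int => x; rewrite /B /H /k /h; ring.
by rewrite !IntD// => /addIr.
Qed.

Let unif_G e : 0 < e -> exists2 r : R, 0 < r & forall x y,
  closure Omega x -> closure Omega y -> `|x - y| < r -> enorm (G x - G y) < e.
Proof.
move=> e0; pose P (s : R) y := forall z, closure Omega z -> `|y - z| < s -> closure Omega y -> enorm (G y - G z) < e.
have cGw : {within closure Omega, continuous G}.
  apply/subspace_continuousP => x cx; apply: cvgZ; last by move/subspace_continuousP : cG0; exact.
  by apply: cvg_within_filter; exact: cb.
have q0 : 0 < e / (2 * n.+1%:R) by rewrite divr_gt0// mulr_gt0.
have [|r r0 Hr] := compact_unif (P := P) cmp.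
  move=> x cx; have [r r0 Hr] := within_dist cGw cx q0.
  exists (r / 2) => [|y xy s /andP[_ sr] z cz yz cy]; first by rewrite divr_gt0.
  have xy' : `|x - y| < r by apply: lt_trans xy _; rewrite ltr_pdivrMr// ltr_pMr// ltr1n.
  have xz : `|x - z| < r.
    rewrite -(subrKA y x (-z)); apply: le_lt_trans (ler_normD _ _) _.
    by rewrite [r]splitr; apply: ltrD => //; exact: lt_trans sr.
  apply: le_lt_trans (enorm_le_norm _) _; rewrite mulrC -ltr_pdivlMr//.
  have -> : G y - G z = (G x - G z) - (G x - G y) by rewrite opprB [RHS]addrC subrKA.
  apply: le_lt_trans (ler_normB _ _) _.
  have -> : e / n.+1%:R = e / (2 * n.+1%:R) + e / (2 * n.+1%:R) by move: (pnatr_eq0 R n.+1); move: (n.+1%:R) => N /negbT N0; field.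
  by apply: ltrD; exact: Hr.
exists (r / 2); first by rewrite divr_gt0.
move=> x y cx cy xy; apply: (Hr (r / 2)) => //.
by rewrite divr_gt0//= ltr_pdivrMr// ltr_pMr// ltr1n.
Qed.

Let cv : continuous v.
Proof.
move=> x; apply: (@continuous_comp _ _ _ ub (primitive a p)); first exact: cub.
have [d _] := is_derive_primitive p Ca eta0 ha (ub_ge0 x).
by apply: differentiable_continuous; apply/derivable1_diffP.
Qed.

Let sol : psol Omega p v G H.
Proof.
split; first exact: oO.
- move=> x Ox; apply: (is_grad_comp (gu Ox)).
  exact: (is_derive_primitive p Ca eta0 ha (ub_ge0 x)).
- by move=> x Ox; apply: continuous_rvZ; [exact: cb|exact: cG].
- by move=> x _; exact: cH.
- exact: weak_v.
Qed.

Let v_pos x : Omega x -> 0 < v x.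
Proof.
by move=> Ox; rewrite -(primitive0 a p); apply: (primitive_lt Ca eta0 ha p1) => //; rewrite ub_in// upos.
Qed.

Let v_out x : ~ Omega x -> v x = 0.
Proof. by move=> nO; rewrite /v ub_out// primitive0. Qed.

Let H_pos x : Omega x -> 0 < H x.
Proof. by move=> Ox; rewrite divr_gt0// fpos// ub_in// upos. Qed.

Lemma psys_transformation : exists v H G, psys Omega p v G H /\
  forall x, closure Omega x -> 0 <= u x /\ v x = primitive a p (u x).
Proof.
exists v, H, G; split; last first.
  by move=> x cx; have := ub_ge0 x; rewrite /v /ub cut_in.
split; [exact: sol|exact: cmp|exact: cv|exact: v_pos|exact: v_out|exact: unif_G|exact: cH|exact: H_pos| |].
  have [L L0 HL] := H_lip; exists (L * (eta `^ p^-1)^-1); first by rewrite mulr_ge0// invr_ge0 powR_ge0.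
  move=> x y; apply: le_trans (HL x y) _; rewrite -mulrA; apply: ler_wpM2l => //.
  exact: (primitive_dist Ca eta0 ha p1).
move=> x cx nO; have [c [rho [rho0 xc bi]]] := interior_ball oO sb cx nO.
(* Chosen so that m > 1 and m (p - 1) = 2 (p - 1) + n + 1 + |p - 2|, which makes 2a at least the
   dimension n + 1 for every p > 1. *)
pose m := 2 + (n.+1%:R + `|p - 2|) / (p - 1).
have p10 : 0 < p - 1 by rewrite subr_gt0.
apply: (@hopf _ _ Omega p v H G _ p1 sol cv v_pos v_out unif_G H_pos c rho m _ rho0 bi _ erefl _ x xc nO) => //.
  have q0 : 0 <= (n.+1%:R + `|p - 2|) / (p - 1) by apply: divr_ge0; [apply: addr_ge0; [exact: ler0n|exact: normr_ge0]|exact: ltW].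
  by rewrite /m; move: (_ / _) q0 => q; lra.
have mE : m * (p - 1) = 2 * (p - 1) + (n.+1%:R + `|p - 2|).
  by rewrite /m; move: (n.+1%:R + _) => q; field; rewrite gt_eqF.
rewrite mE.
have := ler_norm (p - 2); have : 0 <= (n.+1%:R : R) by exact: ler0n.
by move: (`|p - 2|) (normr_ge0 (p - 2)) (n.+1%:R : R) p10 => q q0 N; lra.
Qed.

End transformation.

Theorem theorem1p2 (R : realType) (n : nat) (Omega : set 'rV[R]_n.+1)
    (p : R) (a f : R -> R) (eta : R) (u : 'rV[R]_n.+1 -> R) :
  smooth_bounded_domain Omega ->
  1 < p ->
  class_C2 a ->
  0 < eta -> (forall s, 0 <= s -> eta <= a s) ->
  [locally [lipschitz f x | x in [set s : R | 0 <= s]]] ->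
  (forall s, 0 < s -> 0 < f s) ->
  strictly_convex_x1 Omega ->
  symmetric_x1 Omega ->
  weak_solution Omega p a f u ->
  solutions_x1 Omega p a f u /\
  (forall (c : 'rV[R]_n.+1) (r : R), 0 < r -> Omega = eball c r ->
    solutions_radial Omega p a f c u).
Proof.
move=> [oO _ neO bO sb] p1 Ca eta0 ha lf fpos cO sO W.
have [[alpha [_ [cu Cu [G0 [cG0 G0E _]]]]] upos ubd wk] := W.
have cmp : compact (closure Omega).
  have [M [_ HM]] := bO; have {}HM := HM (M + 1) (ltr_pwDr ltr01 (lexx M)).
  apply: (@compact_closed_bounded _ _ _ (M + 1)); first exact: closed_closure.
  move=> x clx; apply: (@closed_box R n.+1 (M + 1)) => B nB.
  by have [y [Oy By]] := clx _ nB; exists y; split=> //; exact: HM.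
have [v [H [G [S vE]]]] := psys_transformation oO cmp sb p1 Ca eta0 ha lf fpos cu Cu cG0 G0E upos ubd wk.
(* The primitive is strictly increasing on [0, +oo[, so u and v order the points of the closure in
   the same way. *)
have u_le x y : closure Omega x -> closure Omega y -> v x <= v y -> u x <= u y.
  move=> /vE[ux Ex] /vE[uy Ey]; rewrite Ex Ey; apply: contraTT; rewrite -!ltNge.
  exact: (primitive_lt Ca eta0 ha p1).
have u_eq x y : closure Omega x -> closure Omega y -> v x = v y -> u x = u y.
  by move=> cx cy E; apply/eqP; rewrite eq_le !u_le// E.
have u_lt x y : closure Omega x -> closure Omega y -> v x < v y -> u x < u y.
  move=> cx cy h; rewrite lt_neqAle u_le ?(ltW h)// andbT; apply/eqP => E.
  by have [_ Ex] := vE x cx; have [_ Ey] := vE y cy; move: h; rewrite Ex Ey E ltxx.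
have nt : nontrivial Omega u by have [x Ox] := neO; exists x => //; rewrite gt_eqF// upos.
split.
  split=> //.
  - move=> x cx; apply: u_eq => //; first exact: closure_reflect1.
    exact: psys_symmetric_x1 S.
  - move=> x t t0 cx cxt; rewrite !mxE /= mulr1 => xt0; apply: u_le => //.
    by apply: (psys_monotone_x1 p1 sO cO S t0); lra.
  - move=> x t t0 cx cxt x0; apply: u_le => //.
    (* The right half is reduced to the left one: the mirror image of x + t e1 is moved by t e1 to
       that of x. *)
    rewrite -(psys_symmetric_x1 p1 sO cO (x + t *: e1) S) -(psys_symmetric_x1 p1 sO cO x S).
    have -> : reflect1 x = reflect1 (x + t *: e1) + t *: e1.
      by apply/rowP => i; rewrite !mxE /=; case: (i == ord0); rewrite ?mulr1 ?mulr0 ?addr0//=; ring.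
    apply: (psys_monotone_x1 p1 sO cO S t0); rewrite !mxE /= mulr1; lra.
move=> c r r0 OE.
have cball x : closure Omega x -> enorm (x - c) <= r.
  move=> clx; have cl : closed [set y : 'rV[R]_n.+1 | enorm (y - c) <= r].
    by apply: compact_closed_rV; exact: compact_edisk.
  apply: cl => B nB; have [y [Oy By]] := clx _ nB; exists y; split=> //.
  by move: Oy; rewrite OE => /ltW.
split=> //.
- move=> x y cx cy E; apply: u_eq => //; apply/eqP; rewrite eq_le.
  by rewrite !(psys_radial p1 sO cO r0 OE S)// E.
- move=> x y cx cy xy; apply: u_lt => //.
  by apply: (psys_radial_strict p1 sO cO r0 OE S) => //; exact: cball.
Qed.
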